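(* Assume that $X$ is $\mathbb F$-quasi-left continuous and that the random time $\tau$ satisfies either (a) $\mathbb P[\tau=\sigma<+\infty]=0$ for every $\mathbb F$-stopping time $\sigma$, and every $\mathbb F$-martingale is a $\mathbb G$-martingale; or (b) the law $\eta$ of $\tau$ is a diffuse probability measure and for every $t\ge0$ the regular conditional law of $\tau$ given $\mathcal F_t$ is absolutely continuous with respect to $\eta$. Let $(U,\mathcal U)$ be a measurable space and let $r,l:\Omega\times[0,T]\times\mathbb R^d\times U\to\mathbb R$ be $\mathcal P(\mathbb G)\otimes\mathcal B(\mathbb R^d)\otimes\mathcal U$-measurable functions for which there are constants $M_r>1$, $M_l>0$ such that, $\mathbb P$-a.s., $0\le r_t(x_1,u)\le M_r$ and $|l_t(x_1,u)|\le M_l$ for all $t\in[0,T]$, $x_1\in\mathbb R^d$, $u\in U$. Assume $$\mathbb E[e^{(3+M_r^4)C_T}]<+\infty .$$ Set $L:=\operatorname{ess\,sup}_\omega(\sup\{|r_t(x_1,u)-1|: t\in[0,T],x_1\in\mathbb R^d,u\in U\})$. Let $g:\Omega\times\mathbb R^d\to\mathbb R$ be $\mathcal G_T\otimes\mathcal B(\mathbb R^d)$-measurable and suppose there is $\beta>L^2$ with $\mathbb E[e^{\beta C_T}]<+\infty$ and $\mathbb E[|g(X_T)|^2e^{\beta C_T}]<+\infty$. Define $$f(\omega,t,y_1,\theta(\cdot)):=\inf_{u\in U}\Big\{l_t(\omega,y_1,u)+\int_{\mathbb R^d}\theta(x_1,0)\,(r_t(\omega,x_1,u)-1)\,\phi^{\mathbb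 G,X}_t(\omega,dx_1)\Big\}$$ for $\omega\in\Omega$, $t\in[0,T]$, $y_1\in\mathbb R^d$, $\theta\in\mathcal L^1(\mathbb R^{d+1},\mathcal B(\mathbb R^{d+1}),\phi_t(\omega,dx_1,dx_2))$, and assume that for every $\Theta\in L^{1,0}(\mu^Z,\mathbb G)$ there exists $\underline u^\Theta\in\mathcal C$ such that, for $d_1(\omega,t)\,dC_t(\omega)\,\mathbb P(d\omega)$-almost all $(\omega,t)$, $$f(\omega,t,X_{t-}(\omega),\Theta_t(\omega,\cdot))=l_t(\omega,X_{t-}(\omega),\underline u^\Theta(\omega,t))+\int_{\mathbb R^d}\Theta_t(\omega,x_1,0)\,(r_t(\omega,x_1,\underline u^\Theta(\omega,t))-1)\,\phi^{\mathbb G,X}_t(\omega,dx_1).\qquad(\ast)$$ Let $(Y,\Theta)\in L^{2,\beta}_{\mathrm{Prog}}(\Omega\times[0,T],\mathbb G)\times L^{2,\beta}(\mu^Z,\mathbb G)$ denote the unique solution to the BSDE: $\mathbb P$-a.s., for all $t\in[0,T]$, $$Y_t+\int_t^T\int_{\mathbb R^{d+1}}\Theta_s(x_1,x_2)\,(\mu^Z-\nu^Z)(ds,dx_1,dx_2)=g(X_T)+\int_t^Tf(s,X_s,\Theta_s(\cdot))\,dC^{\mathbb G,X}_s,$$ with corresponding admissible control $\underline u^\Theta\in\mathcal C$ satisfying $(\ast)$. Then $\underline u^\Theta$ is optimal and $Y_0$ is the optimal cost for the problem of minimizing $J(u)=\mathbb E_u\big[\int_0^Tl_t(X_t,u_t)\,dC^{\mathbb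 G,X}_t+g(X_T)\big]$ over $u\in\mathcal C$, i.e. $$Y_0=J(\underline u^\Theta)=\inf_{u\in\mathcal C}J(u).$$
   Context: Setting: $(\Omega,\mathcal F,\mathbb P)$ is a probability space, $T>0$ is fixed, $X$ is an $\mathbb R^d$-valued step process and $\mathbb F=(\mathcal F_t)_{t\ge0}$, $\mathcal F_t=\mathcal F^X_t$, is the smallest right-continuous filtration to which $X$ is adapted. (Step process: a semimartingale $X=\sum_{n\ge1}\xi_n1_{[\tau_n,+\infty)}$ with stopping times $\tau_n\uparrow+\infty$, $\tau_n<\tau_{n+1}$ on $\{\tau_n<\infty\}$, and $\mathcal F_{\tau_n}$-measurable $\xi_n$, $\xi_n\ne0$ iff $\tau_n<\infty$.) $\tau:\Omega\to(0,+\infty]$ is a random time, $H=1_{[\tau,+\infty)}$, $\mathbb G=(\mathcal G_t)$ is the smallest right-continuous filtration containing $\mathbb F$ and making $\tau$ a stopping time, and $Z=(X,H)$. Quasi-left continuity of $X$ w.r.t. $\mathbb F$: $\Delta X_\sigma=0$ a.s. for every finite-valued $\mathbb F$-predictable stopping time $\sigma$. $\mathcal P(\mathbb G)$ is the $\mathbb G$-predictable $\sigma$-algebra. $\mu^X,\mu^Z$ are the jump measures of $X,Z$ ($\mu^Y(dt,dy)=\sum_{s>0}1_{\{\Delta Y_s\ne0\}}\delta_{(s,\Delta Y_s)}(dt,dy)$); $\nu^{\mathbb G,X}$ and $\nu^Z$ are their $\mathbb G$-compensators, and $\Lambda^{\mathbb G}$ is the $\mathbb G$-dual predictable projection of $H$.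 Write $\nu^{\mathbb G,X}(dt,dx_1)=\phi^{\mathbb G,X}_t(dx_1)\,dC^{\mathbb G,X}_t$ with $\phi^{\mathbb G,X}$ a transition probability from $(\Omega\times[0,T],\mathcal P(\mathbb G))$ to $(\mathbb R^d,\mathcal B(\mathbb R^d))$ and $C^{\mathbb G,X}$ an increasing process. Under (a) or (b) with $X$ quasi-left continuous, $C^{\mathbb G,X}$ and $\Lambda^{\mathbb G}$ are continuous and $\nu^Z(dt,dx_1,dx_2)=\delta_0(dx_2)\phi^{\mathbb G,X}_t(dx_1)\,dC^{\mathbb G,X}_t+\delta_0(dx_1)\delta_1(dx_2)\,d\Lambda^{\mathbb G}_t$. Set $C:=C^{\mathbb G,X}+\Lambda^{\mathbb G}$ and write $\nu^Z(dt,dx_1,dx_2)=\phi_t(dx_1,dx_2)\,dC_t$ with $\phi$ a transition probability from $(\Omega\times[0,T],\mathcal P(\mathbb G))$ to $(\mathbb R^{d+1},\mathcal B(\mathbb R^{d+1}))$. Set $d_1(\omega,t):=\int_{\mathbb R^{d+1}}1_{\{x_2=0\}}\phi_t(\omega,dx_1,dx_2)$, so $d_1\,dC=dC^{\mathbb G,X}$. Spaces: $L^{2,\beta}_{\mathrm{Prog}}(\Omega\times[0,T],\mathbb G)$ is the set of real $\mathbb G$-progressively measurable $Y$ with $\mathbb E[\int_0^Te^{\beta C_t}|Y_t|^2dC_t]<\infty$; $L^{2,\beta}(\mu^Z,\mathbb G)$ is the set of $\mathcal P(\mathbb G)\otimes\mathcal B(\mathbb R^{d+1})$-measurable $\Theta$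 with $\mathbb E[\int_0^T\int e^{\beta C_t}|\Theta_t(x_1,x_2)|^2\phi_t(dx_1,dx_2)dC_t]<\infty$; $L^{1,0}(\mu^Z,\mathbb G)$ is the set of $\mathcal P(\mathbb G)\otimes\mathcal B(\mathbb R^{d+1})$-measurable $\Theta$ with $\mathbb E[\int_0^T\int|\Theta_t(x_1,x_2)|\phi_t(dx_1,dx_2)dC_t]<\infty$. Control problem: the set $\mathcal C$ of admissible controls consists of all $U$-valued $\mathbb G$-predictable processes $u=(u_t)_{t\in[0,T]}$. Put $R_t(x_1,x_2,u):=r_t(x_1,u)1_{\{x_2=0\}}+1_{\{x_2\neq0\}}$. For $u\in\mathcal C$, $L^u$ is the Doléans-Dade exponential solving $$L^u_t=1+\int_0^t\int_{\mathbb R^{d+1}}L^u_{s-}\,(R_s(x_1,x_2,u_s)-1)\,(\mu^Z-\nu^Z)(ds,dx_1,dx_2),\quad t\in[0,T].$$ Under $\mathbb E[e^{(3+M_r^4)C_T}]<\infty$ it is a nonnegative square integrable $\mathbb G$-martingale with $\mathbb E[L^u_T]=1$, so $\mathbb P_u(d\omega):=L^u_T(\omega)\,\mathbb P(d\omega)$ is a probability measure; $\mathbb E_u$ denotes expectation under $\mathbb P_u$. *)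

(* Defs.v *)
From HB Require Import structures.
From mathcomp Require Import all_boot all_order all_algebra.
From mathcomp Require Import all_classical all_reals all_analysis.
From mathcomp Require Import measurable_realfun ess_sup_inf.

Set Implicit Arguments.
Unset Strict Implicit.
Unset Printing Implicit Defensive.

Import Order.TTheory GRing.Theory Num.Theory.
Import numFieldNormedType.Exports.

Local Open Scope classical_set_scope.
Local Open Scope ring_scope.

(* Conventions.
   - A process is a function Omega -> R -> V; only its values at times t >= 0
     (or t in [0, T]) matter, except that a step process is 0 at times t < 0,
     see step_process.
   - A filtration is a family of sigma-algebras on Omega, each given by the set
     of its members; it is indexed by R and used at times t >= 0 only. No
     completeness is assumed.
   - An integral over a time interval from s to t is over `]s, t]. *)

Section sigma_algebras.

(* S-measurability, for a sigma-algebra S on A, of the restriction of f to a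
   member D of S. *)
Definition measurable_wrt (A : Type) (S : set_system A) (D : set A)
    (d : measure_display) (V : measurableType d) (f : A -> V) : Prop :=
  forall B, measurable B -> S (D `&` f @^-1` B).

Definition prod_salgebra (A B : Type) (S1 : set_system A) (S2 : set_system B) :
    set_system (A * B) :=
  <<s [set E | exists A1 B1, [/\ S1 A1, S2 B1 & E = A1 `*` B1]] >>.

End sigma_algebras.

HB.instance Definition _ (R : realType) (d : nat) :=
  @isMeasurable.Build (sigma_display (@open 'rV[R]_d)) 'rV[R]_d
    <<s @open 'rV[R]_d >> (@sigma_algebra0 _ setT _) (@sigma_algebraC _ _)
    (@sigma_algebra_bigcup _ setT _).

Section path_measure.
Context (R : realType).

Definition nonneg_time (A : R -> R) (t : R) : R := A (Num.max 0 t).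

Definition increasing_path (A : R -> R) : Prop :=
  nondecreasing (nonneg_time A) /\ right_continuous (nonneg_time A).

Definition path_cumulative (A : R -> R) (h : increasing_path A) : R -> R :=
  nonneg_time A.

HB.instance Definition _ (A : R -> R) (h : increasing_path A) :=
  isCumulative.Build R _ R (path_cumulative h) (proj1 h) (proj2 h).

(* The Stieltjes measure dA_t of a right-continuous nondecreasing path
   A : [0, +oo[ -> R. It is carried by ]0, +oo[; it is the zero measure for a
   path that is not right-continuous and nondecreasing. *)
Definition dS (A : R -> R) : {measure set (measurableTypeR R) -> \bar R} :=
  match pselect (increasing_path A) with
  | left h => lebesgue_stieltjes_measure (path_cumulative h)
  | right _ => mzero
  end.

End path_measure.

Section point_measure.
Local Open Scope ereal_scope.
Context (R : realType) (d : measure_display) (E : measurableType d).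

Definition point_measure (J : set R) (y : R -> E) (B : set (R * E)) : \bar R :=
  \esum_(s in J) (\d_(s, y s) B : \bar R).

Variables (J : set R) (y : R -> E).

Let point_measure0 : point_measure J y set0 = 0.
Proof. by rewrite /point_measure esum1// => s _; rewrite measure0. Qed.

Let point_measure_ge0 B : 0 <= point_measure J y B.
Proof. exact: esum_ge0. Qed.

Let point_measure_sigma_additive : semi_sigma_additive (point_measure J y).
Proof.
pose pre (B : set (R * E)) := J `&` [set s | B (s, y s)].
have preE B : point_measure J y B = \esum_(s in pre B) 1.
  rewrite /point_measure esum_mkcond [RHS]esum_mkcond; apply: eq_esum => s _.
  rewrite diracE; case: ifPn; case: ifPn; rewrite ?(inE, notin_setE)//=.
  - by move=> [_ Bs] _; rewrite mem_set.
  - by move=> nB Js; rewrite memNset// => Bs; exact: nB.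
  - by move=> [Js _] nJ.
move=> F mF tF mUF.
have tpre : trivIset setT (fun n => pre (F n)).
  apply/trivIsetP => i j _ _ ij; apply/seteqP; split => // s [[_ Fi] [_ Fj]].
  move/trivIsetP : tF => /(_ i j Logic.I Logic.I ij) /seteqP[+ _].
  by move=> /(_ (s, y s)); apply.
have -> : point_measure J y (\bigcup_n F n) =
    \sum_(0 <= n <oo) point_measure J y (F n).
  rewrite preE (_ : pre _ = \bigcup_n pre (F n)); last first.
    by rewrite /pre -setI_bigcupr.
  rewrite nneseries_sum_bigcup//.
  by apply: eq_eseriesr => n _; rewrite preE.
exact: is_cvg_nneseries.
Qed.

HB.instance Definition _ := isMeasure.Build _ _ _ (point_measure J y)
  point_measure0 point_measure_ge0 point_measure_sigma_additive.

End point_measure.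

Section jumps.
Context (R : realType) (V : normedModType R).

Definition left_limit (y : R -> V) (t : R) : V := lim (y s @[s --> t^'-]).

Definition jump (y : R -> V) (t : R) : V := y t - left_limit y t.

Definition jump_times (y : R -> V) : set R := [set s | 0 < s /\ jump y s != 0].

Definition cadlag_on (T : R) (y : R -> V) : Prop :=
  (forall t, 0 <= t < T -> y s @[s --> t^'+] --> y t) /\
  (forall t, 0 < t <= T -> cvg (y s @[s --> t^'-])).

End jumps.

Definition is_measure (R : realType) (d : measure_display)
    (A : measurableType d) (m : set A -> \bar R) : Prop :=
  [/\ m set0 = 0%E, (forall B, 0 <= m B)%E & semi_sigma_additive m].

Section density.
Context (R : realType) (d : measure_display) (A : measurableType d).
Variable m : set A -> \bar R.

Definition set_function_measure (h : is_measure m) : set A -> \bar R := m.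

Let m0 (h : is_measure m) : set_function_measure h set0 = 0%E.
Proof. by case: h. Qed.

Let mge0 (h : is_measure m) B : (0 <= set_function_measure h B)%E.
Proof. by case: h. Qed.

Let madd (h : is_measure m) : semi_sigma_additive (set_function_measure h).
Proof. by case: h. Qed.

HB.instance Definition _ (h : is_measure m) := isMeasure.Build _ _ _
  (set_function_measure h) (@m0 h) (@mge0 h) (@madd h).

End density.

(* The measure f(w) P(dw), that is B |-> \int[P]_(w in B) f w; the zero measure
   if that set function is not a measure. *)
Definition density_measure (R : realType) (d : measure_display)
    (A : measurableType d) (P : {measure set A -> \bar R}) (f : A -> R) :
    {measure set A -> \bar R} :=
  match pselect (is_measure (fun B => \int[P]_(w in B) (f w)%:E)%E) with
  | left h => set_function_measure h
  | right _ => mzero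
  end.

Section general_theory.
Context (R : realType) (d0 : measure_display) (Omega : measurableType d0).
Variable P : probability Omega R.

Implicit Types (K F G : R -> set_system Omega) (T : R).

Definition horizon T : set (Omega * R) := setT `*` `[0, T].

Definition all_times : set (Omega * R) := setT `*` `[0, +oo[.

Definition filtration K : Prop :=
  [/\ forall t, 0 <= t -> sigma_algebra setT (K t),
      forall t, 0 <= t -> K t `<=` measurable &
      forall s t, 0 <= s -> s <= t -> K s `<=` K t].

Definition rc_filtration K : Prop :=
  filtration K /\
  forall t, 0 <= t -> \bigcap_(s in [set s | t < s]) K s `<=` K t.

Definition adapted K (d : measure_display) (V : measurableType d)
    (X : Omega -> R -> V) : Prop :=
  forall t, 0 <= t -> measurable_wrt (K t) setT (X ^~ t).

Definition stopping_time K (sigma : Omega -> \bar R) : Prop :=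
  (forall w, 0 <= sigma w)%E /\
  forall t, 0 <= t -> K t [set w | (sigma w <= t%:E)%E].

(* the sigma-algebra of events prior to the stopping time sigma *)
Definition stopped_salgebra K (sigma : Omega -> \bar R) : set_system Omega :=
  [set A | measurable A /\
     forall t, 0 <= t -> K t (A `&` [set w | (sigma w <= t%:E)%E])].

Definition natural_filtration (d : measure_display) (V : measurableType d)
    (X : Omega -> R -> V) : R -> set_system Omega :=
  fun t => [set A | forall K, rc_filtration K -> adapted K X -> K t A].

(* smallest right-continuous filtration containing F and making tau a stopping
   time *)
Definition enlarged_filtration F (tau : Omega -> \bar R) :
    R -> set_system Omega :=
  fun t => [set A | forall K, rc_filtration K ->
    (forall s, 0 <= s -> F s `<=` K s) -> stopping_time K tau -> K t A].

(* The predictable sigma-algebra on Omega * [0, +oo[. As a sigma-algebra on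
   Omega * R it has Omega * ]-oo, 0[ as an atom; processes are only tested on
   all_times or on horizon T, which are members of it. *)
Definition predictable K : set_system (Omega * R) :=
  <<s [set S | (exists2 A, K 0 A & S = A `*` [set 0]) \/
               (exists A s t, [/\ 0 <= s, s < t, K s A & S = A `*` `]s, t]])] >>.

Definition predictable_on K (D : set (Omega * R))
    (d : measure_display) (V : measurableType d) (Y : Omega -> R -> V) : Prop :=
  measurable_wrt (predictable K) D (fun p => Y p.1 p.2).

(* measurability with respect to predictable K (x) sigma-algebra of E *)
Definition predictable_field_on K (D : set (Omega * R))
    (d1 : measure_display) (E : measurableType d1)
    (d2 : measure_display) (V : measurableType d2)
    (W : Omega -> R -> E -> V) : Prop :=
  measurable_wrt (prod_salgebra (predictable K) (@measurable _ E))
    (D `*` setT) (fun q => W q.1.1 q.1.2 q.2).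

Definition progressive K T (Y : Omega -> R -> R) : Prop :=
  forall t, 0 <= t <= T ->
    measurable_wrt (prod_salgebra (K t) (@measurable _ R)) (horizon t)
      (fun p => Y p.1 p.2).

Definition increasing_process K (A : Omega -> R -> R) : Prop :=
  adapted K A /\ {ae P, forall w, A w 0 = 0 /\ increasing_path (A w)}.

Definition martingale K (M : Omega -> R -> R) : Prop :=
  [/\ adapted K M,
      forall t, 0 <= t -> P.-integrable setT (fun w => (M w t)%:E) &
      forall s t, 0 <= s -> s <= t -> forall A, K s A ->
        (\int[P]_(w in A) (M w t)%:E = \int[P]_(w in A) (M w s)%:E)%E].

(* X = sum_n xi_n 1_[tau_n, +oo[. The formula is required at every t : R, so
   that X w t = 0 for t < 0: thus jump (X w) 0 = X w 0, as in the convention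
   X_{0-} = 0. *)
Definition step_process K (d : nat) (X : Omega -> R -> 'rV[R]_d) : Prop :=
  (forall t, measurable_fun setT (X ^~ t)) /\
  exists (tau_ : nat -> Omega -> \bar R) (xi : nat -> Omega -> 'rV[R]_d),
    [/\ forall n, stopping_time K (tau_ n),
        forall n w, (tau_ n w < +oo -> tau_ n w < tau_ n.+1 w)%E,
        forall w, {homo tau_ ^~ w : m n / (m <= n)%N >-> (m <= n)%E} /\
          tau_ ^~ w @ \oo --> +oo%E,
        forall n, measurable_wrt (stopped_salgebra K (tau_ n)) setT (xi n) /\
          (forall w, xi n w != 0 <-> (tau_ n w < +oo)%E) &
        forall w t,
          X w t = \sum_(n \in [set n | (tau_ n w <= t%:E)%E]) xi n w].

Definition quasi_left_continuous K (d : nat) (X : Omega -> R -> 'rV[R]_d) :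
    Prop :=
  forall sigma : Omega -> R, (forall w, 0 <= sigma w) ->
    predictable K [set p | sigma p.1 <= p.2] ->
    {ae P, forall w, jump (X w) (sigma w) = 0}.

End general_theory.

Section random_measures.
Context (R : realType) (d0 : measure_display) (Omega : measurableType d0).
Variable P : probability Omega R.
Context (d1 : measure_display) (E : measurableType d1).

Implicit Types (K : R -> set_system Omega) (T : R).
Implicit Types mu nu : Omega -> {measure set (R * E) -> \bar R}.

(* nu is carried by ]0, +oo[ * E, and the integral process of every nonnegative
   predictable W is predictable *)
Definition predictable_random_measure K nu : Prop :=
  (forall w, nu w (`]-oo, 0] `*` setT) = 0%E) /\
  forall W : Omega -> R -> E -> R,
    predictable_field_on K (@all_times R _ Omega) W ->
    (forall w t x, 0 <= W w t x) ->
    predictable_on K (@all_times R _ Omega)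
      (fun w t =>
        (\int[nu w]_(p in `]0%R, t] `*` setT) (W w p.1 p.2)%:E)%E : \bar R).

Definition compensator K mu nu : Prop :=
  predictable_random_measure K nu /\
  forall W : Omega -> R -> E -> R,
    predictable_field_on K (@all_times R _ Omega) W ->
    (forall w t x, 0 <= W w t x) ->
    (\int[P]_w \int[mu w]_(p in `]0%R, +oo[ `*` setT) (W w p.1 p.2)%:E =
     \int[P]_w \int[nu w]_(p in `]0%R, +oo[ `*` setT) (W w p.1 p.2)%:E)%E.

Definition dual_predictable_projection K (H A : Omega -> R -> R) : Prop :=
  [/\ increasing_process P K A,
      predictable_on K (@all_times R _ Omega) A &
      forall W : Omega -> R -> R,
        predictable_on K (@all_times R _ Omega) W ->
        (forall w t, 0 <= W w t) ->
        (\int[P]_w \int[dS (H w)]_(t in `]0%R, +oo[) (W w t)%:E =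
         \int[P]_w \int[dS (A w)]_(t in `]0%R, +oo[) (W w t)%:E)%E].

Definition transition_probability K T (phi : Omega -> R -> probability E R) :
    Prop :=
  forall B, measurable B ->
    predictable_on K (@horizon R _ Omega T) (fun w t => phi w t B : \bar R).

(* nu(dt, dx) = phi_t(dx) dC_t on ]0, T] * E, P-a.s. *)
Definition disintegration T nu (phi : Omega -> R -> probability E R)
    (C : Omega -> R -> R) : Prop :=
  {ae P, forall w, forall B : set (R * E), measurable B ->
    (nu w (B `&` (`]0%R, T] `*` setT)) =
     \int[dS (C w)]_(t in `]0%R, T]) phi w t [set x | B (t, x)])%E}.

(* Pathwise integral with respect to mu - nu. Both integrals are finite for the
   integrands of interest. *)
Definition compensated_integral (mu nu : {measure set (R * E) -> \bar R})
    (D : set R) (W : R -> E -> R) : R :=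
  (\int[mu]_(p in D `*` setT) W p.1 p.2) -
  (\int[nu]_(p in D `*` setT) W p.1 p.2).

(* the space L^{2,beta}(mu, K) of integrands, where nu = phi dC *)
Definition L2_field K T (C : Omega -> R -> R)
    (phi : Omega -> R -> probability E R) (beta : R)
    (Theta : Omega -> R -> E -> R) : Prop :=
  predictable_field_on K (@horizon R _ Omega T) Theta /\
  (\int[P]_w \int[dS (C w)]_(t in `]0%R, T]) \int[phi w t]_x
     (expR (beta * C w t) * `|Theta w t x| ^+ 2)%:E < +oo)%E.

(* the space L^{1,0}(mu, K) *)
Definition L1_field K T (C : Omega -> R -> R)
    (phi : Omega -> R -> probability E R)
    (Theta : Omega -> R -> E -> R) : Prop :=
  predictable_field_on K (@horizon R _ Omega T) Theta /\
  (\int[P]_w \int[dS (C w)]_(t in `]0%R, T]) \int[phi w t]_x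
     (`|Theta w t x|)%:E < +oo)%E.

Definition L2_prog K T (C : Omega -> R -> R) (beta : R)
    (Y : Omega -> R -> R) : Prop :=
  progressive K T Y /\
  (\int[P]_w \int[dS (C w)]_(t in `]0%R, T])
     (expR (beta * C w t) * `|Y w t| ^+ 2)%:E < +oo)%E.

(* Q holds for delta_t(w) dC_t(w) P(dw)-almost all (w, t) in Omega * [0, T] *)
Definition ae_dCdP T (C : Omega -> R -> R) (delta : Omega -> R -> \bar R)
    (Q : Omega -> R -> Prop) : Prop :=
  exists N : set (Omega * R), [/\ measurable N,
    (\int[P]_w \int[dS (C w)]_(t in `]0%R, T])
       (delta w t * (\1_N (w, t))%:E) = 0)%E &
    forall w t, 0 <= t <= T -> ~ N (w, t) -> Q w t].

End random_measures.

Section random_time.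
Context (R : realType) (d0 : measure_display) (Omega : measurableType d0).
Variable P : probability Omega R.
Implicit Types (F G : R -> set_system Omega) (tau : Omega -> \bar R).

Definition avoids_stopping_times F tau : Prop :=
  forall sigma, stopping_time F sigma ->
    P [set w | tau w = sigma w /\ (sigma w < +oo)%E] = 0%E.

Definition martingales_preserved F G : Prop :=
  forall M, martingale P F M -> martingale P G M.

Definition diffuse_law tau : Prop :=
  forall x : \bar R, pushforward P tau [set x] = 0%E.

(* kappa is a regular version of the conditional law of tau given K *)
Definition regular_conditional_law (K : set_system Omega) tau
    (kappa : Omega -> probability (\bar R) R) : Prop :=
  (forall B : set (\bar R), measurable B ->
     measurable_wrt K setT (fun w => kappa w B : \bar R)) /\
  forall A (B : set (\bar R)), K A -> measurable B ->
    P (A `&` tau @^-1` B) = (\int[P]_(w in A) kappa w B)%E.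

Definition absolutely_continuous_conditional_laws F tau : Prop :=
  forall t, 0 <= t -> exists kappa, regular_conditional_law (F t) tau kappa /\
    {ae P, forall w, kappa w `<< pushforward P tau}.

Definition default_process tau (w : Omega) (t : R) : R :=
  (tau w <= t%:E)%E%:R.

End random_time.

Section control_problem.
Context (R : realType) (d0 : measure_display) (Omega : measurableType d0).
Variable P : probability Omega R.
Context (d : nat) (dU : measure_display) (U : measurableType dU).

Implicit Types (G : R -> set_system Omega) (T : R) (u : Omega -> R -> U).
Implicit Types (CX : Omega -> R -> R) (X : Omega -> R -> 'rV[R]_d).
Implicit Types (r l : Omega -> R -> 'rV[R]_d -> U -> R).
Implicit Types mu nu : Omega -> {measure set (R * ('rV[R]_d * R)) -> \bar R}.
Implicit Types phiX : Omega -> R -> probability 'rV[R]_d R.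

Definition admissible G T u : Prop := predictable_on G (@horizon R _ Omega T) u.

(* R_t(x1, x2, u) = r_t(x1, u) 1_{x2 = 0} + 1_{x2 <> 0} *)
Definition jump_density r w t (x : 'rV[R]_d * R) (v : U) : R :=
  r w t x.1 v * (x.2 == 0)%:R + (x.2 != 0)%:R.

(* L = 1 + int_0^. int L_{s-} (R_s(x, u_s) - 1) (mu - nu)(ds, dx) on [0, T] *)
Definition doleans_dade G T mu nu r u (L : Omega -> R -> R) : Prop :=
  adapted G L /\
  {ae P, forall w, cadlag_on T (L w) /\ forall t, 0 <= t <= T ->
    L w t = 1 + compensated_integral (mu w) (nu w) `]0, t]
      (fun s x => left_limit (L w) s * (jump_density r w s x (u w s) - 1))}.

(* ess sup_w sup_{t, x, v} |r_t(w, x, v) - 1| *)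
Definition density_deviation T r : \bar R :=
  ess_sup P (fun w => ereal_sup
    [set z | exists t x v, 0 <= t <= T /\ z = (`|r w t x v - 1|)%:E]).

(* P_u(dw) = L^u_T(w) P(dw) *)
Definition controlled_measure T (L : Omega -> R -> R) :
    {measure set Omega -> \bar R} :=
  density_measure P (fun w => L w T).

(* J(u) = E_u[int_0^T l_t(X_t, u_t) dC^X_t + g(X_T)]; Lu is L^u *)
Definition cost T CX X l (g : Omega -> 'rV[R]_d -> R) (Lu : Omega -> R -> R) u :
    \bar R :=
  (\int[controlled_measure T Lu]_w
     ((\int[dS (CX w)]_(t in `]0%R, T]) l w t (X w t) (u w t)) +
      g w (X w T))%:E)%E.

(* l_t(y, v) + int theta(x, 0) (r_t(x, v) - 1) phi^X_t(dx) *)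
Definition hamiltonian phiX l r w t (y : 'rV[R]_d)
    (theta : 'rV[R]_d * R -> R) (v : U) : \bar R :=
  ((l w t y v)%:E +
   \int[phiX w t]_x (theta (x, 0%R) * (r w t x v - 1))%:E)%E.

Definition driver phiX l r w t (y : 'rV[R]_d) (theta : 'rV[R]_d * R -> R) :
    \bar R :=
  ereal_inf [set hamiltonian phiX l r w t y theta v | v in [set: U]].

(* the control u attains the infimum in the driver along (X_-, Theta) *)
Definition minimizing_control T C (phi : Omega -> R -> probability _ R) phiX l r
    X (Theta : Omega -> R -> 'rV[R]_d * R -> R) u : Prop :=
  ae_dCdP P T C
    (fun w t => \int[phi w t]_x (\1_[set x : 'rV[R]_d * R | x.2 = 0] x)%:E)%E
    (fun w t => driver phiX l r w t (left_limit (X w) t) (Theta w t) =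
      hamiltonian phiX l r w t (left_limit (X w) t) (Theta w t) (u w t)).

Definition bsde T mu nu CX X (g : Omega -> 'rV[R]_d -> R)
    (f : Omega -> R -> 'rV[R]_d -> ('rV[R]_d * R -> R) -> \bar R)
    (Y : Omega -> R -> R) (Theta : Omega -> R -> 'rV[R]_d * R -> R) : Prop :=
  {ae P, forall w, forall t, 0 <= t <= T ->
    ((Y w t + compensated_integral (mu w) (nu w) `]t, T] (Theta w))%:E =
     (g w (X w T))%:E +
     \int[dS (CX w)]_(s in `]t, T]) f w s (X w s) (Theta w s))%E}.

End control_problem.

(* Main.v *)
Require Import Defs.
From HB Require Import structures.
From mathcomp Require Import all_boot all_order all_algebra.
From mathcomp Require Import all_classical all_reals all_analysis.
From mathcomp Require Import measurable_realfun ess_sup_inf.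
From mathcomp Require Import ring lra.

(** Verification by a change of measure.

    Write [H u = r u - 1] on the marks [(x, 0)] and [0] on the others, so that
    [L^u] is the Doleans-Dade exponential of the integral of [H u] against
    [mu^Z - nu^Z]. Substituting the BSDE into the cost, the gain of a control [u]
    is almost surely
    [[
      \int_0^T l(u) dC^X + g (X_T)
        = Y_0 + (\int Theta dmu^Z - \int Theta (1 + H u) dnu^Z) + Delta u,
      Delta u = \int_0^T (ham(u) - ham(u_star)) dC^X,
    ]]
    where [ham(u)] is the expression minimised in the definition of [f]. Hence
    [Delta u >= 0], with equality when [u] is the selected control. Under [P_u]
    the compensator of [mu^Z] is [(1 + H u) nu^Z] ([girsanov_mean]), so the
    bracket has mean zero, and [L^u_T] is a probability density
    ([doleans_mean]). Since [G 0] is trivial ([initial_trivial]), [Y_0] is a.s.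
    constant; integrating gives [J u >= Y_0], with equality for the selected
    control.

    Everything is done path by path. On almost every path the jumps up to [T] are
    a finite list, and [nu^Z] is a finite measure without time atoms. The paths
    of [L^u] and of the compensated integral of [Theta] are then explicit, and
    integration by parts ([girsanov_path]) writes their product as a sum of
    compensated integrals of predictable fields. Such integrals have mean zero
    once they are integrable ([compensated_mean0]). Integrability comes from
    [0 <= L <= M^N exp A], where [A] is the mass of [nu^Z] and [N] is the
    number of jumps, together with the exponential moment of [N]
    ([exponential_moment]), the moment assumed on [C_T], and the weighted square
    integrability of [Theta] ([weighted_integrable]). The power of [M_r] in the
    assumption on [C_T] is the one that square integrability of [L] calls for.

    Absence of time atoms is where quasi-left-continuity and the hypotheses on
    [tau] enter. It suffices that jump times are not hit by predictable sets with
    thin sections ([compensator_atomless], [no_predictable_hit]), and this follows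
    if a jump after a fixed time [q] a.s. avoids every [G q]-measurable time after
    [q]. For [tau], this holds because its conditional laws are atomless. For the
    jump times of [X], immersion makes their conditional laws given [F q] and
    [G q] the same ([jump_inaccessible_immersion]), while under a conditional
    density a [G q]-measurable time becomes, once [tau] is frozen, an
    [F q]-measurable one ([jump_inaccessible_density]).

    The two dynamics are matched by [compensator_unique]: on the marks [(x, 0)]
    the compensator of [Z] is that of [X]. This turns the integrals against
    [phi] and [dC] into integrals against [phi^X] and [dC^X], and yields
    [d_1 dC = dC^X]. *)

Set Implicit Arguments.
Unset Strict Implicit.
Unset Printing Implicit Defensive.

Import Order.TTheory GRing.Theory Num.Theory.
Import numFieldNormedType.Exports.

Local Open Scope classical_set_scope.
Local Open Scope ring_scope.

(** * Measures and integrals *)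

Section ge0_induction.
Local Open Scope ereal_scope.
Context d (T : measurableType d) (R : realType).
Import HBNNSimple.

Lemma ge0_measurable_ind (Q : (T -> \bar R) -> Prop) :
  (forall A, measurable A -> Q (fun x => (\1_A x)%:E)) ->
  (forall (k : R) f, (0 <= k)%R -> measurable_fun setT f -> (forall x, 0 <= f x) ->
     Q f -> Q (fun x => k%:E * f x)) ->
  (forall f g, measurable_fun setT f -> (forall x, 0 <= f x) ->
     measurable_fun setT g -> (forall x, 0 <= g x) -> Q f -> Q g ->
     Q (fun x => f x + g x)) ->
  (forall F : (T -> \bar R)^nat, (forall n, measurable_fun setT (F n)) ->
     (forall n x, 0 <= F n x) -> (forall x, nondecreasing_seq (F ^~ x)) ->
     (forall n, Q (F n)) -> Q (fun x => limn (F ^~ x))) ->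
  forall f, measurable_fun setT f -> (forall x, 0 <= f x) -> Q f.
Proof.
move=> Q1 QZ QD Ql f mf f0.
have Q0 : Q (fun=> 0).
  have := Q1 set0 measurable0; congr Q.
  by apply/funext => x; rewrite indic0.
have Qs (h : {nnsfun T >-> R}) : Q (EFin \o h).
  have -> : EFin \o h = fun x => \sum_(y <- finmap.enum_fset (fset_set (range h)))
      (y * \1_(h @^-1` [set y]) x)%:E.
    by apply/funext => x /=; rewrite {1}fimfunE fsbig_finite//= -sumEFin.
  have : forall s : seq R, (forall y, y \in s -> (0 <= y)%R) ->
      [/\ Q (fun x => \sum_(y <- s) (y * \1_(h @^-1` [set y]) x)%:E),
      measurable_fun setT (fun x => \sum_(y <- s) (y * \1_(h @^-1` [set y]) x)%:E) &
      (forall x, 0 <= \sum_(y <- s) (y * \1_(h @^-1` [set y]) x)%:E)].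
    elim=> [_|y s ih ys].
      have -> : (fun x => \sum_(y <- [::]) (y * \1_(h @^-1` [set y]) x)%:E) =
          cst (0 : \bar R) by apply/funext => x; rewrite big_nil.
      by split; [| |move=> x; rewrite big_nil].
    have [ih1 ih2 ih3] : _ := ih (fun z zs => ys z (@mem_behead _ (y :: s) z zs)).
    have y0 : (0 <= y)%R by apply: ys; rewrite mem_head.
    have m1 : measurable_fun setT (fun x => (\1_(h @^-1` [set y]) x)%:E : \bar R).
      by apply/measurable_EFinP; exact: measurable_indic.
    have e : (fun x => \sum_(y0 <- y :: s) (y0 * \1_(h @^-1` [set y0]) x)%:E) =
        (fun x => y%:E * (\1_(h @^-1` [set y]) x)%:E +
                  \sum_(y <- s) (y * \1_(h @^-1` [set y]) x)%:E).
      by apply/funext => x; rewrite big_cons EFinM.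
    rewrite e; split.
    - apply: QD => //.
      + exact: emeasurable_funM.
      + by move=> x; rewrite mule_ge0// lee_fin.
      + apply: QZ => //.
        by apply: Q1; rewrite -[X in measurable X]setTI; exact: measurable_funP.
    - apply: emeasurable_funD => //; exact: emeasurable_funM.
    - by move=> x; rewrite big_cons adde_ge0// lee_fin mulr_ge0.
  move=> /(_ (finmap.enum_fset (fset_set (range h)))) [] //.
  move=> y; rewrite in_fset_set// inE => -[x _ <-]; exact: fun_ge0.
pose g := nnsfun_approx measurableT mf.
have -> : f = fun x => limn (fun n => (EFin \o g n) x).
  apply/funext => x; apply/esym/cvg_lim => //.
  exact: (@cvg_nnsfun_approx _ _ _ _ measurableT _ mf).
apply: (Ql (fun n => EFin \o g n)) => //.
- by move=> n; apply/measurable_EFinP.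
- by move=> n x; rewrite lee_fin.
- by move=> x m n mn; rewrite lee_fin; exact/lefP/nd_nnsfun_approx.
Qed.

End ge0_induction.

Section ae_eq_integral_nonmeasurable.
Local Open Scope ereal_scope.
Context d (T : measurableType d) (R : realType).
Variable mu : {measure set T -> \bar R}.
Import HBNNSimple.

Let le_nn (N : set T) (f g : T -> \bar R) : measurable N -> mu N = 0 ->
  (forall x, 0 <= f x) -> (forall x, 0 <= g x) ->
  (forall x, ~ N x -> f x = g x) -> \int[mu]_x f x <= \int[mu]_x g x.
Proof.
move=> mN N0 f0 g0 fg; rewrite !ge0_integralTE//.
apply: ge_ereal_sup => _ [h /= hf <-].
have mNC := measurableC mN.
pose h' : {nnsfun T >-> R} := mul_nnsfun h (indic_nnsfun R mNC).
have h'E x : h' x = (h x * \1_(~` N) x)%R by [].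
apply: ereal_sup_ubound; clearbody h'; exists h' => /=.
  move=> x; rewrite h'E indicE.
  have [xN|xN] := boolP (x \in ~` N); last by rewrite mulr0.
  by rewrite mulr1 -fg//; exact: set_mem.
rewrite -!integralT_nnsfun; apply: ae_eq_integral => //.
- by apply/measurable_EFinP.
- by apply/measurable_EFinP.
- exists N; split => // x /=; apply: contra_notP => Nx _ /=.
  by rewrite h'E indicE mem_set// mulr1.
Qed.

(** No measurability is asked of [f] and [g]: the integral is a supremum over
    simple functions, and a simple function below [f] can be set to [0] on the
    null set without changing its integral. *)
Lemma ae_eq_integral_nomeas (D : set T) (f g : T -> \bar R) :
  {ae mu, forall x, D x -> f x = g x} ->
  \int[mu]_(x in D) f x = \int[mu]_(x in D) g x.
Proof.
move=> [N [mN N0 fgN]]; rewrite integral_mkcond [RHS]integral_mkcond.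
have fg x : ~ N x -> (f \_ D) x = (g \_ D) x.
  move=> Nx; rewrite !patchE; case: ifPn => // /set_mem Dx.
  by apply: contrapT => /= fgx; apply: Nx; apply: fgN => /= /(_ Dx).
rewrite integralE [RHS]integralE; congr (_ - _); apply/eqP; rewrite eq_le;
  apply/andP; split; apply: (@le_nn N) => // x; rewrite ?funepos_ge0 ?funeneg_ge0//;
  by move=> Nx; rewrite ?funeposE ?funenegE fg.
Qed.

Lemma ae_ge0_integral0_nomeas (f : T -> \bar R) :
  {ae mu, forall x, f x = 0} -> \int[mu]_x f x = 0.
Proof.
move=> f0; rewrite (@ae_eq_integral_nomeas setT _ (cst 0)) ?integral0//.
by apply: filterS f0 => x ->.
Qed.

End ae_eq_integral_nonmeasurable.

Section measurable_kernel_integral.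
Import HBNNSimple.
Local Open Scope ereal_scope.
Context d d' (X : measurableType d) (Y : measurableType d') (R : realType).

(** By the monotone class argument, starting from the measurability on sets. *)
Lemma measurable_fun_integral_fam (l : X -> {measure set Y -> \bar R}) :
  (forall x, l x setT < +oo) ->
  (forall B, measurable B -> measurable_fun setT (l ^~ B)) ->
  forall f : X * Y -> \bar R, measurable_fun setT f -> (forall p, 0 <= f p) ->
  measurable_fun setT (fun x => \int[l x]_y f (x, y)).
Proof.
move=> lfin lm f mf f0.
have lfinB x B : measurable B -> l x B < +oo.
  by move=> mB; apply: le_lt_trans (lfin x); apply: le_measure; rewrite ?inE.
have key (A : set (X * Y)) : measurable A ->
    measurable_fun setT (fun x => l x (xsection A x)).
  move=> mA; have : <<s [set A `*` B | A in @measurable _ X & B in @measurable _ Y] >> A.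
    by rewrite -measurable_prod_measurableType.
  move: A {mA}; apply: dynkin_induction => /=.
  - exact: measurable_prod_measurableType.
  - move=> _ _ [X1 mX1 [X2 mX2 <-]] [Y1 mY1 [Y2 mY2 <-]].
    exists (X1 `&` Y1); first exact: measurableI.
    by exists (X2 `&` Y2); [exact: measurableI|rewrite setXI].
  - under eq_fun do rewrite xsectionE/=.
    by rewrite (_ : (fun _ => _) = l ^~ setT); [exact: lm|apply/funext].
  - move=> _ [A mA [B mB <-]].
    rewrite (_ : (fun _ => _) = (fun x => l x B * (\1_A x)%:E)).
      apply: emeasurable_funM; first exact: lm.
      by apply/measurable_EFinP; exact: measurable_indic.
    apply/funext => x; rewrite indicE.
    have [xA|xA] := boolP (x \in A); first by rewrite mule1 in_xsectionX.
    by rewrite mule0 notin_xsectionX// measure0.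
  - move=> S mS ih.
    rewrite (_ : (fun _ => _) = (fun x => l x setT - l x (xsection S x))).
      by apply: emeasurable_funB => //; exact: lm.
    apply/funext => x.
    rewrite (_ : xsection (~` S) x = setT `\` xsection S x); last first.
      by rewrite setTD; apply/seteqP; split => y; rewrite /xsection/= !inE.
    rewrite measureD// ?setTI//; last exact: lfin.
    exact: measurable_xsection.
  - move=> F mF tF ih.
    rewrite (_ : (fun _ => _) = (fun x => \sum_(n <oo) l x (xsection (F n) x))).
      by apply: ge0_emeasurable_sum => // n _.
    apply/funext => x; rewrite xsection_bigcup measure_bigcup//.
    + by apply: eq_eseriesl => n; rewrite in_setT.
    + by move=> n _; exact: measurable_xsection.
    + exact: trivIset_xsection.
pose k_ := nnsfun_approx measurableT mf.
apply: (@measurable_fun_xsection_integral _ _ _ _ _ f l k_).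
- by move=> a b ab; exact/nd_nnsfun_approx.
- by move=> z; exact/cvg_nnsfun_approx.
- by move=> n r; apply: key.
Qed.

End measurable_kernel_integral.

Section density.
Local Open Scope ereal_scope.
Context d (T : measurableType d) (R : realType).
Variables (m q : {measure set T -> \bar R}) (f : T -> R).
Hypothesis mf : measurable_fun setT f.
Hypothesis f0 : forall x, (0 <= f x)%R.
Hypothesis qE : forall A, measurable A -> q A = \int[m]_(x in A) (f x)%:E.

Lemma ge0_integral_density (h : T -> \bar R) :
  measurable_fun setT h -> (forall x, 0 <= h x) ->
  \int[q]_x h x = \int[m]_x ((f x)%:E * h x).
Proof.
have mfE : measurable_fun setT (fun x => (f x)%:E : \bar R) by exact/measurable_EFinP.
move: h; apply: ge0_measurable_ind.
- move=> A mA; rewrite integral_indic// setIT qE// integral_mkcond.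
  apply: eq_integral => x _; rewrite patchE indicE.
  by case: ifPn; rewrite ?mule1 ?mule0.
- move=> k h k0 mh h0 ih; rewrite ge0_integralZl// ih -ge0_integralZl//.
  + by apply: eq_integral => x _; rewrite muleCA.
  + exact: emeasurable_funM.
  + by move=> x _; rewrite mule_ge0// lee_fin.
- move=> h1 h2 mh1 h10 mh2 h20 ih1 ih2.
  rewrite ge0_integralD// ih1 ih2 -ge0_integralD//.
  + by apply: eq_integral => x _; rewrite ge0_muleDr.
  + by move=> x _; rewrite mule_ge0// lee_fin.
  + exact: emeasurable_funM.
  + by move=> x _; rewrite mule_ge0// lee_fin.
  + exact: emeasurable_funM.
- move=> F mF F0 ndF ih; rewrite monotone_convergence//.
  under eq_fun do rewrite ih.
  rewrite -monotone_convergence//.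
  + apply: eq_integral => x _; rewrite limeMl//.
    exact: ereal_nondecreasing_is_cvgn.
  + by move=> n; exact: emeasurable_funM.
  + by move=> n x _; rewrite mule_ge0// lee_fin.
  + by move=> x _ a b ab; apply: lee_wpmul2l; [rewrite lee_fin|exact: ndF].
Qed.

Lemma integral_density (h : T -> R) : measurable_fun setT h ->
  \int[q]_x (h x)%:E = \int[m]_x (f x * h x)%:E.
Proof.
move=> mh; rewrite integralE [RHS]integralE.
have mhE : measurable_fun setT (EFin \o h) by exact/measurable_EFinP.
rewrite !ge0_integral_density//; [|exact: measurable_funeneg|exact: measurable_funepos].
congr (_ - _); apply: eq_integral => x _.
- by rewrite !funeposE /= EFinM maxe_pMr ?mule0 ?lee_fin.
- by rewrite !funenegE /= -mulrN EFinM maxe_pMr ?mule0 ?lee_fin.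
Qed.

End density.

(** * Step paths and the progressive enlargement *)

Section min_le.
Context (R : realType).
Lemma minL (a b : R) : Num.min a b <= a. Proof. by rewrite ge_min lexx. Qed.
Lemma minR (a b : R) : Num.min a b <= b. Proof. by rewrite ge_min lexx orbT. Qed.
End min_le.

Section locally_finite_times.
Context (R : realType).
Variable tm : nat -> \bar R.

Definition locally_finite := forall t : R, exists N, forall n, (N <= n)%N -> (t%:E < tm n)%E.

Hypothesis tm_lf : locally_finite.

Lemma times_right (t : R) : exists2 e, 0 < e & forall n s, t <= s < t + e ->
  (tm n <= s%:E)%E = (tm n <= t%:E)%E.
Proof.
have [N hN] := tm_lf (t + 1).
suff [e /andP[e0 e1] he] : exists2 e, 0 < e <= 1 & forall n s, (n < N)%N -> t <= s < t + e ->
    (tm n <= s%:E)%E = (tm n <= t%:E)%E.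
  exists e => // n s ts; case: (ltnP n N) => [|Nn]; first by move=> nN; exact: he.
  have := hN _ Nn => tn.
  have sn : (s%:E < tm n)%E by apply: le_lt_trans tn; rewrite lee_fin; lra.
  have tn' : (t%:E < tm n)%E by apply: le_lt_trans tn; rewrite lee_fin; lra.
  by rewrite !leNgt sn tn'.
elim: N {hN} => [|N [e /andP[e0 e1] ih]]; first by exists 1 => //; rewrite ltr01 lexx.
have [tN|tN] := leP (tm N) t%:E.
  exists e; first by rewrite e0 e1.
  move=> n s; rewrite ltnS leq_eqVlt => /predU1P[->|nN] ts; last exact: ih.
  by rewrite tN (le_trans tN)// lee_fin; lra.
have [u tu uN] : exists2 u, t < u & (u%:E <= tm N)%E.
  case: (tm N) tN => [r| |]//=; first by rewrite lte_fin => tr; exists r.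
  by move=> _; exists (t + 1); [lra|rewrite leey].
exists (Num.min e (u - t)).
  by rewrite lt_min e0 subr_gt0 tu/= ge_min e1.
move=> n s; rewrite ltnS leq_eqVlt => /predU1P[->|nN] ts.
  rewrite (leNgt _ s%:E) (leNgt _ t%:E) tN/=; apply/negbTE; rewrite negbK.
  apply: lt_le_trans uN; rewrite lte_fin.
  by move: ts => /andP[_ ts]; have := minR e (u - t); lra.
by apply: ih => //; move: ts => /andP[-> ts]/=; have := minL e (u - t); lra.
Qed.

Lemma times_left (t : R) : exists2 e, 0 < e & forall n s, t - e <= s < t ->
  (tm n <= s%:E)%E = (tm n < t%:E)%E.
Proof.
have [N hN] := tm_lf t.
suff [e e0 he] : exists2 e, 0 < e & forall n s, (n < N)%N -> t - e <= s < t ->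
    (tm n <= s%:E)%E = (tm n < t%:E)%E.
  exists e => // n s ts; case: (ltnP n N) => [|Nn]; first by move=> nN; exact: he.
  have tn := hN _ Nn.
  have sn : (s%:E < tm n)%E by apply: lt_trans tn; rewrite lte_fin; lra.
  by rewrite leNgt sn ltNge (ltW tn).
elim: N {hN} => [|N [e e0 ih]]; first by exists 1.
have [tN|tN] := leP t%:E (tm N).
  exists e => // n s; rewrite ltnS leq_eqVlt => /predU1P[->|nN] ts; last exact: ih.
  rewrite [RHS]ltNge tN/=; apply/negbTE; rewrite -ltNge (lt_le_trans _ tN)// lte_fin; lra.
have [u ut uN] : exists2 u, u < t & (tm N <= u%:E)%E.
  case: (tm N) tN => [r| |]//=; first by rewrite lte_fin => tr; exists r.
  by move=> _; exists (t - 1); [lra|rewrite leNye].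
exists (Num.min e (t - u)); first by rewrite lt_min e0 subr_gt0.
move=> n s; rewrite ltnS leq_eqVlt => /predU1P[->|nN] ts.
  rewrite tN; apply: le_trans uN _; rewrite lee_fin.
  by move: ts => /andP[ts _]; have := minR e (t - u); lra.
by apply: ih => //; move: ts => /andP[ts ->]; have := minL e (t - u); lra.
Qed.

End locally_finite_times.

Section step_path.
Context (R : realType) (V : normedModType R).
Variables (tm : nat -> \bar R) (x_ : nat -> V) (y : R -> V).
Hypothesis tm_ge0 : forall n, (0 <= tm n)%E.
Hypothesis tm_lt : forall n, (tm n < +oo -> tm n < tm n.+1)%E.
Hypothesis tm_mono : {homo tm : m n / (m <= n)%N >-> (m <= n)%E}.
Hypothesis tm_cvg : tm @ \oo --> +oo%E.
Hypothesis yE : forall t, y t = \sum_(n \in [set n | (tm n <= t%:E)%E]) x_ n.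

Lemma step_locally_finite : locally_finite tm.
Proof.
move=> t; move/cvgeyPgt : tm_cvg => /(_ t) [N _ hN]; exists N => n Nn.
exact: hN.
Qed.

Lemma step_inj m n : (tm m < +oo)%E -> tm m = tm n -> m = n.
Proof.
wlog mn : m n / (m <= n)%N.
  move=> wl tmy tmn; case: (leqP m n) => [mn|/ltnW nm]; first exact: wl.
  by apply/esym; apply: wl => //; rewrite -tmn.
move=> tmy tmn; apply/eqP; rewrite eqn_leq mn/= leqNgt; apply/negP => mltn.
have := @tm_lt m tmy; rewrite tmn ltNge => /negP; apply.
exact: tm_mono.
Qed.

Lemma step_eq s t : (forall n, (tm n <= s%:E)%E = (tm n <= t%:E)%E) -> y s = y t.
Proof.
move=> st; rewrite !yE; congr (\sum_(n \in _) _).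
by apply/seteqP; split => n /=; rewrite st.
Qed.

Lemma step_neg s : s < 0 -> y s = 0.
Proof.
move=> s0; rewrite yE (_ : [set n | _] = set0) ?fsbig_set0//.
apply/seteqP; split => // n /= /(le_trans (tm_ge0 n)).
by rewrite lee_fin leNgt s0.
Qed.

Lemma left_limit_near (z : R -> V) (t : R) (c : V) (e : R) : 0 < e ->
  (forall s, t - e <= s < t -> z s = c) -> left_limit z t = c.
Proof.
move=> e0 zc; apply: cvg_lim => //; apply: cvg_near_cst.
near=> s; apply: zc; apply/andP; split; last by near: s; exact: nbhs_left_lt.
near: s; apply: nbhs_left_ge; lra.
Unshelve. all: by end_near. Qed.

Let fin_le t : finite_set [set n | (tm n <= t%:E)%E].
Proof.
have [N hN] := step_locally_finite t.
apply: (sub_finite_set _ (finite_II N)) => n /= nt.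
by rewrite ltnNge; apply/negP => /hN; rewrite ltNge nt.
Qed.

Lemma step_left t : left_limit y t = \sum_(n \in [set n | (tm n < t%:E)%E]) x_ n.
Proof.
have [e e0 he] := times_left step_locally_finite t.
apply: (left_limit_near e0) => s ts; rewrite yE; congr (\sum_(n \in _) _).
by apply/seteqP; split => n /=; rewrite (he n s ts).
Qed.

Lemma step_jump n t : tm n = t%:E -> jump y t = x_ n.
Proof.
move=> nt; rewrite /jump step_left yE.
have -> : [set k | (tm k <= t%:E)%E] = [set n] `|` [set k | (tm k < t%:E)%E].
  apply/seteqP; split => k /=.
    rewrite le_eqVlt => /predU1P[kt|]; [left|by right].
    by apply: step_inj; [rewrite kt ltry|rewrite kt nt].
  by move=> [->|/ltW//]; rewrite nt.
rewrite fsbigU0/=; [|exact: finite_set1| |].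
- by rewrite fsbig_set1 addrK.
- by apply: sub_finite_set (fin_le t) => k /= /ltW.
- by move=> k /= [->]; rewrite nt ltxx.
Qed.

Lemma step_nojump t : (forall n, tm n <> t%:E) -> jump y t = 0.
Proof.
move=> nt; rewrite /jump step_left yE; apply/eqP; rewrite subr_eq0; apply/eqP.
congr (\sum_(n \in _) _); apply/seteqP; split => k /=; last exact: ltW.
by rewrite le_eqVlt => /predU1P[/nt//|].
Qed.

End step_path.

Lemma salgI (T : Type) (S : set_system T) A B : sigma_algebra setT S ->
  S A -> S B -> S (A `&` B).
Proof.
move=> hS SA SB; have := sigma_algebra_id hS => <-.
pose D n := if n == 0%N then ~` A else ~` B.
have -> : A `&` B = setT `\` \bigcup_n D n.
  rewrite setTD setC_bigcup; apply/seteqP; split => x.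
    by move=> [Ax Bx] n _; rewrite /D; case: ifP => _ /=; exact.
  move=> h; split; apply: contrapT.
    exact: (h 0%N Logic.I).
  exact: (h 1%N Logic.I).
apply: sigma_algebraCD; apply: sigma_algebra_bigcup => n; rewrite /D.
by case: ifP => _; rewrite -setTD; apply: sigma_algebraCD; exact: sub_sigma_algebra.
Qed.

Lemma salgC (T : Type) (S : set_system T) A : sigma_algebra setT S -> S A -> S (~` A).
Proof. by move=> [_ SC _] SA; rewrite -setTD; exact: SC. Qed.

Lemma salgT (T : Type) (S : set_system T) : sigma_algebra setT S -> S setT.
Proof. by move=> hS; rewrite -setC0; apply: salgC => //; case: hS. Qed.

Lemma salg_bigcup (T : Type) (S : set_system T) (A : (set T)^nat) :
  sigma_algebra setT S -> (forall n, S (A n)) -> S (\bigcup_n A n).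
Proof. by move=> [_ _ SU] SA; exact: SU. Qed.

Lemma salg_bigcap (T : Type) (S : set_system T) (A : (set T)^nat) :
  sigma_algebra setT S -> (forall n, S (A n)) -> S (\bigcap_n A n).
Proof.
move=> hS SA; rewrite -(setCK (\bigcap_n A n)) setC_bigcap; apply: salgC => //.
by apply: salg_bigcup => // n; apply: salgC.
Qed.

Lemma salgU (T : Type) (S : set_system T) A B : sigma_algebra setT S ->
  S A -> S B -> S (A `|` B).
Proof.
move=> hS SA SB; rewrite -(setCK (A `|` B)) setCU; apply: salgC => //.
by apply: salgI => //; apply: salgC.
Qed.

Lemma salgD (T : Type) (S : set_system T) A B : sigma_algebra setT S ->
  S A -> S B -> S (A `\` B).
Proof. by move=> hS SA SB; rewrite setDE; apply: salgI => //; exact: salgC. Qed.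

Section filtrations.
Context (R : realType) (d0 : measure_display) (Omega : measurableType d0).

Implicit Types (K F G : R -> set_system Omega).

Lemma full_filtration : filtration (fun _ : R => @measurable _ Omega).
Proof.
split => [t t0|t t0 A|s t _ _ A] //; exact: (@sigma_algebra_measurable d0 Omega).
Qed.

Lemma natural_filtrationP (d : measure_display) (V : measurableType d)
    (X : Omega -> R -> V) : (forall t, measurable_fun setT (X ^~ t)) ->
  rc_filtration (natural_filtration X) /\ adapted (natural_filtration X) X.
Proof.
move=> mX; split; last by move=> t t0 B mB K rcK aK; exact: aK.
have Kt : rc_filtration (fun _ : R => @measurable _ Omega) /\
    adapted (fun _ : R => @measurable _ Omega) X.
  split; first split.
  - exact: full_filtration.
  - by move=> t _ A /(_ (t + 1)); apply; rewrite /= ltrDl.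
  - by move=> t _ B mB; exact: mX.
split; first split.
- move=> t t0; split => [K [[Ks _ _] _] _|A h K rcK aK|A h K rcK aK].
  + by case: (Ks t t0).
  + by have [[Ks _ _] _] := rcK; rewrite setTD; apply: salgC; [exact: Ks|exact: h].
  + have [[Ks _ _] _] := rcK; apply: salg_bigcup; first exact: Ks.
    by move=> n; exact: h.
- by move=> t t0 A /(_ _ Kt.1 Kt.2).
- by move=> s t s0 st A h K rcK aK; have [[_ _ Ki] _] := rcK; apply: (Ki s t) => //; exact: h.
move=> t t0 A h K rcK aK; have [_ Kr] := rcK; apply: Kr => // s ts; exact: h.
Qed.

Lemma enlarged_filtrationP F (tau : Omega -> \bar R) : filtration F ->
  measurable_fun setT tau -> (forall w, (0 <= tau w)%E) ->
  [/\ rc_filtration (enlarged_filtration F tau),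
      forall s, 0 <= s -> F s `<=` enlarged_filtration F tau s &
      stopping_time (enlarged_filtration F tau) tau].
Proof.
move=> fF mtau tau0; have [_ Fm _] := fF.
have mle t : measurable [set w | (tau w <= t%:E)%E].
  by rewrite -[X in measurable X]setTI; exact: emeasurable_fun_infty_c.
have Kt : [/\ rc_filtration (fun _ : R => @measurable _ Omega),
    (forall s, 0 <= s -> F s `<=` @measurable _ Omega) &
    stopping_time (fun _ : R => @measurable _ Omega) tau].
  split => //; split => //.
  - exact: full_filtration.
  - by move=> t _ A /(_ (t + 1)); apply; rewrite /= ltrDl.
split; last 2 first.
- by move=> s s0 A FA K rcK FK sK; exact: FK.
- by split => // t t0 K rcK FK [_ sK]; exact: sK.
split; first split.
- move=> t t0; split => [K [[Ks _ _] _] _ _|A h K rcK aK sK|A h K rcK aK sK].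
  + by case: (Ks t t0).
  + by have [[Ks _ _] _] := rcK; rewrite setTD; apply: salgC; [exact: Ks|exact: h].
  + have [[Ks _ _] _] := rcK; apply: salg_bigcup; first exact: Ks.
    by move=> n; exact: h.
- by move=> t t0 A; case: Kt => k1 k2 k3 /(_ _ k1 k2 k3).
- by move=> s t s0 st A h K rcK aK sK; have [[_ _ Ki] _] := rcK; apply: (Ki s t) => //; exact: h.
move=> t t0 A h K rcK aK sK; have [_ Kr] := rcK; apply: Kr => // s ts; exact: h.
Qed.

End filtrations.

Section trace_filtration.
Context (R : realType) (d0 : measure_display) (Omega : measurableType d0).
Variables (B : R -> set_system Omega) (N : R -> set Omega).
Hypothesis rcB : rc_filtration B.
Hypothesis N_dec : forall s t, s <= t -> N t `<=` N s.
Hypothesis N_open : forall s w, N s w -> exists2 t, s < t & N t w.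

Definition trace_filtration (s : R) : set_system Omega :=
  [set A | measurable A /\ exists2 A', B s A' & forall w, N s w -> (A w <-> A' w)].

(** Right-continuity is preserved: if [A] agrees with [A'_n] on [N (s + 1/n)],
    it agrees on [N s] with the inferior limit of the [A'_n]. *)
Lemma trace_filtration_rc : rc_filtration trace_filtration.
Proof.
have [[Bs Bm Bi] Br] := rcB.
split; first split.
- move=> s s0; have hs := Bs s s0; split.
  + by split => //; exists set0 => //; case: hs.
  + move=> A [mA [A' BA' AA']]; split; first by rewrite setTD; exact: measurableC.
    exists (~` A'); first exact: salgC.
    by move=> w Nw; rewrite setTD /=; split => nA => /(AA' _ Nw).
  + move=> A hA; split; first by apply: bigcupT_measurable => n; case: (hA n).
    have /choice [A' hA'] : forall n, exists A', B s A' /\ forall w, N s w -> (A n w <-> A' w).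
      by move=> n; have [_ [A' ? ?]] := hA n; exists A'.
    exists (\bigcup_n A' n); first by apply: salg_bigcup => // n; case: (hA' n).
    by move=> w Nw; split => -[n _ An]; exists n => //; apply/(proj2 (hA' n) w Nw).
- by move=> s s0 A [].
- move=> s t s0 st A [mA [A' BA' AA']]; split => //; exists A'; first exact: (Bi s t).
  by move=> w Nw; apply: AA'; exact: N_dec Nw.
move=> s s0 A hA.
pose sn n : R := s + n.+1%:R^-1.
have ssn n : s < sn n by rewrite ltrDl invr_gt0.
have sn0 n : 0 <= sn n by rewrite (le_trans s0)// ltW.
have snle m n : (m <= n)%N -> sn n <= sn m.
  by move=> mn; rewrite lerD2l lef_pV2 ?posrE// ler_nat ltnS.
have /choice [A' hA'] : forall n, exists A', B (sn n) A' /\ forall w, N (sn n) w -> (A w <-> A' w).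
  by move=> n; have [_ [A' ? ?]] := hA _ (ssn n); exists A'.
split; first by have [] := hA _ (ssn 0%N).
have sn_lt t : s < t -> exists n, sn n < t.
  move=> st; have ts : 0 < t - s by rewrite subr_gt0.
  have [n /= hn] := ltr_add_invr st.
  by exists n.
exists (\bigcup_m \bigcap_n A' (m + n)%N).
  apply: Br => // t /= st; have [k kt] := sn_lt _ st.
  have -> : \bigcup_m \bigcap_n A' (m + n)%N = \bigcup_m \bigcap_n A' (m + k + n)%N.
    apply/seteqP; split => w [m _ h].
      by exists m => // n _; rewrite -addnA; exact: h.
    by exists (m + k)%N.
  have t0 : 0 <= t by rewrite (le_trans s0)// ltW.
  apply: salg_bigcup; first exact: Bs.
  move=> m; apply: salg_bigcap; first exact: Bs.
  move=> n; apply: (Bi (sn (m + k + n)%N) t) => //; last by case: (hA' (m + k + n)%N).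
  by rewrite (le_trans _ (ltW kt))// snle// -addnA addnCA leq_addr.
move=> w /N_open [t st Nt]; have [k kt] := sn_lt _ st.
have hw n : (k <= n)%N -> (A w <-> A' n w).
  move=> kn; apply: (proj2 (hA' n)); apply: (@N_dec _ t) => //.
  by rewrite (le_trans (snle _ _ kn))// ltW.
split => [Aw|[m _ h]].
  by exists k => // n _; apply/hw => //; exact: leq_addr.
by apply/(hw (m + k)%N); [exact: leq_addl|exact: h].
Qed.

End trace_filtration.

Section filtration_structure.
Context (R : realType) (d0 : measure_display) (Omega : measurableType d0).
Context (dv : measure_display) (V : measurableType dv).
Variables (X : Omega -> R -> V) (tau : Omega -> \bar R).
Variables (F G : R -> set_system Omega) (jt : nat -> Omega -> \bar R).
Hypothesis rcF : rc_filtration F.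
Hypothesis aX : adapted F X.
Hypothesis Fmin : forall K, rc_filtration K -> adapted K X ->
  forall t, 0 <= t -> F t `<=` K t.
Hypothesis rcG : rc_filtration G.
Hypothesis FG : forall s, 0 <= s -> F s `<=` G s.
Hypothesis sG : stopping_time G tau.
Hypothesis Gmin : forall K, rc_filtration K -> (forall s, 0 <= s -> F s `<=` K s) ->
  stopping_time K tau -> forall t, 0 <= t -> G t `<=` K t.
Hypothesis jt_lf : forall w, locally_finite (jt ^~ w).
Hypothesis X_const : forall w s t,
  (forall n, (jt n w <= s%:E)%E = (jt n w <= t%:E)%E) -> X w s = X w t.
Hypothesis tau_const : forall w s t,
  (forall n, (jt n w <= s%:E)%E = (jt n w <= t%:E)%E) ->
  (tau w <= s%:E)%E = (tau w <= t%:E)%E.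

Definition nojump_oc (q s : R) (w : Omega) := forall n, ~~ (q%:E < jt n w <= s%:E)%E.
Definition nojump_oo (q s : R) (w : Omega) := forall n, ~~ (q%:E < jt n w < s%:E)%E.

Lemma nojump_ocE q s w : q <= s -> nojump_oc q s w -> forall n,
  (jt n w <= s%:E)%E = (jt n w <= q%:E)%E.
Proof.
move=> qs h n; have := h n; rewrite negb_and -leNgt -ltNge => /orP[nq|sn].
  by rewrite nq (le_trans nq)// lee_fin.
by rewrite !leNgt sn/= (le_lt_trans _ sn)// lee_fin.
Qed.

Lemma nojump_oc_dec q s t : s <= t -> nojump_oc q t `<=` nojump_oc q s.
Proof.
move=> st w h n; apply: contra (h n) => /andP[-> ns]/=.
by rewrite (le_trans ns)// lee_fin.
Qed.

Lemma nojump_oc_open q s w : q <= s -> nojump_oc q s w ->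
  exists2 t, s < t & nojump_oc q t w.
Proof.
move=> qs h; have [e e0 he] := times_right (jt_lf w) s.
exists (s + e / 2); first lra.
move=> n; apply: contra (h n) => /andP[-> /=].
rewrite (he n)//; lra.
Qed.

(** As long as no jump occurs after [q], nothing is learned after [q]: the sets
    of [G s] and of [G q] have the same traces. This is minimality of [G]
    applied to the filtration of the sets with such a trace. *)
Lemma nojump_trace q s A : 0 <= q -> q <= s -> G s A ->
  exists2 A', G q A' & forall w, nojump_oc q s w -> (A w <-> A' w).
Proof.
move=> q0 qs GA; have [[Gs Gm Gi] Gr] := rcG.
pose B s := if s < q then G s else G q.
pose N s := if s < q then setT else nojump_oc q s.
have rcB : rc_filtration B.
  split; first split.
  - by move=> t t0; rewrite /B; case: ifP => _; exact: Gs.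
  - by move=> t t0; rewrite /B; case: ifP => _; exact: Gm.
  - move=> t u t0 tu; rewrite /B; case: ltP => tq; case: ltP => uq //.
    + exact: Gi.
    + by apply: Gi => //; exact: ltW.
    + by have := lt_le_trans uq tq; rewrite ltNge tu.
  - move=> t t0 E hE; rewrite /B; case: ltP => tq; last first.
      have := hE (t + 1); rewrite /B /= ltrDl ltr01 => /(_ isT).
      by rewrite ltNge (le_trans tq)//= lerDl.
    apply: Gr => // u /= tu.
    have [uq|qu] := ltP u q.
      by have := hE u tu; rewrite /B uq.
    have := hE ((t + q) / 2); rewrite /B /= => /(_ _); rewrite ifT; last lra.
    move=> /(_ _) h; apply: (Gi ((t + q) / 2)); [lra|lra|apply: h; lra].
have N_dec t u : t <= u -> N u `<=` N t.
  move=> tu w; rewrite /N; case: ltP => uq; case: ltP => tq //.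
    by have := le_lt_trans tu uq; rewrite ltNge tq.
  exact: nojump_oc_dec.
have N_open t w : N t w -> exists2 u, t < u & N u w.
  rewrite /N; case: ltP => tq.
    by move=> _; exists ((t + q) / 2); [lra|rewrite ifT//; lra].
  move=> /(nojump_oc_open tq) [u tu hu]; exists u => //.
  by rewrite ifF//; apply/negbTE; rewrite -leNgt (le_trans tq)// ltW.
have rcT := trace_filtration_rc rcB N_dec N_open.
have aT : adapted (trace_filtration B N) X.
  move=> t t0 E mE; rewrite setTI.
  have FE u : 0 <= u -> F u (X ^~ u @^-1` E) by move=> u0; have := aX u0 mE; rewrite setTI.
  split; first by apply: (Gm t t0); apply: FG => //; exact: FE.
  rewrite /B /N; case: ltP => tq.
    by exists (X ^~ t @^-1` E) => //; apply: FG => //; exact: FE.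
  exists (X ^~ q @^-1` E); first by apply: FG => //; exact: FE.
  by move=> w h /=; rewrite (X_const (nojump_ocE tq h)).
have sT : stopping_time (trace_filtration B N) tau.
  split; first exact: sG.1.
  move=> t t0; split; first by apply: (Gm t t0); exact: sG.2.
  rewrite /B /N; case: ltP => tq; first by exists [set w | (tau w <= t%:E)%E] => //; exact: sG.2.
  exists [set w | (tau w <= q%:E)%E]; first exact: sG.2.
  by move=> w h /=; rewrite (tau_const (nojump_ocE tq h)).
have s0 := le_trans q0 qs.
have [_] := Gmin rcT (Fmin rcT aT) sT s0 GA.
by rewrite /B /N ltNge qs.
Qed.

(** Until the first jump after [q], a predictable set only uses the information
    available at time [q]. *)
Lemma nojump_predictable q W : 0 <= q -> predictable G W ->
  exists2 W', prod_salgebra (G q) (@measurable _ R) W' &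
    forall w t, q < t -> nojump_oo q t w -> (W (w, t) <-> W' (w, t)).
Proof.
move=> q0; have [[Gs Gm Gi] Gr] := rcG.
pose P W := exists2 W', prod_salgebra (G q) (@measurable _ R) W' &
    forall w t, q < t -> nojump_oo q t w -> (W (w, t) <-> W' (w, t)).
move: W; change (predictable G `<=` P).
have Gq := Gs q q0.
apply: smallest_sub.
  split.
  - by exists set0 => //; exact: sigma_algebra0.
  - move=> W [W' sW' WW']; exists (~` W').
      by rewrite -setTD; exact: sigma_algebraCD.
    by move=> w t qt h; rewrite setTD /=; split => nW => /(WW' _ _ qt h).
  - move=> W hW.
    have /choice [W' hW'] : forall n, exists W', prod_salgebra (G q) (@measurable _ R) W' /\ forall w t, q < t -> nojump_oo q t w -> (W n (w, t) <-> W' (w, t)).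
      by move=> n; have [W' ? ?] := hW n; exists W'.
    exists (\bigcup_n W' n); first by apply: sigma_algebra_bigcup => n; case: (hW' n).
    by move=> w t qt h; split => -[n _ An]; exists n => //; apply/(proj2 (hW' n) w t qt h).
move=> _ [[A GA ->]|[A [s [u [s0 su GA ->]]]]].
  exists set0; first exact: sigma_algebra0.
  by move=> w t qt _; split => //= -[_ t0]; move: qt; rewrite t0 ltNge q0.
have [sq|qs] := leP s q.
  exists (A `*` `]s, u]) => //; apply: sub_sigma_algebra.
  by exists A, `]s, u]%classic; split => //; apply: (Gi s q).
have [A' GA' AA'] := nojump_trace q0 (ltW qs) GA.
exists (A' `*` `]s, u]).
  by apply: sub_sigma_algebra; exists A', `]s, u]%classic; split.
move=> w t qt h; split => -[/= Aw]; rewrite in_itv/= => /andP[st tu]; split => //=;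
  rewrite ?in_itv/= ?st ?tu//; apply/AA' => // n; apply: contra (h n) => /andP[-> /=];
  by move=> /le_lt_trans; apply; rewrite lte_fin.
Qed.

(** Before [tau] the enlargement adds no information; again by minimality of
    [G]. *)
Lemma pre_tau_trace q A : 0 <= q -> G q A ->
  exists2 A', F q A' & forall w, (q%:E < tau w)%E -> (A w <-> A' w).
Proof.
move=> q0 GA; have [[Gs Gm Gi] Gr] := rcG.
pose N (s : R) := [set w | (s%:E < tau w)%E].
have N_dec t u : t <= u -> N u `<=` N t.
  by move=> tu w /=; apply: le_lt_trans; rewrite lee_fin.
have N_open t w : N t w -> exists2 u, t < u & N u w.
  rewrite /N /=; case: (tau w) => [r| |]//.
    by rewrite lte_fin => tr; exists ((t + r) / 2); rewrite ?lte_fin; lra.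
  by move=> _; exists (t + 1); rewrite ?ltry//; lra.
have rcT := trace_filtration_rc rcF N_dec N_open.
have [[Fs Fm _] _] := rcF.
have FT s : 0 <= s -> F s `<=` trace_filtration F N s.
  by move=> s0 E FE; split; [exact: (Fm s s0)|exists E].
have sT : stopping_time (trace_filtration F N) tau.
  split; first exact: sG.1.
  move=> t t0; split; first by apply: (Gm t t0); exact: sG.2.
  exists set0; first by case: (Fs t t0).
  by move=> w; rewrite /N /= ltNge => /negP.
by have [_] := Gmin rcT FT sT q0 GA.
Qed.

(** A [G q]-measurable set becomes [F q']-measurable once the value of [tau] is
    frozen. Right-continuity of [G] costs the passage from [q] to [q']. *)
Lemma post_tau_section q q' A : 0 <= q -> q < q' -> G q A ->
  exists2 A', prod_salgebra (F q') (@measurable _ (\bar R)) A' &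
    forall w, A w <-> A' (w, tau w).
Proof.
move=> q0 qq' GA; have [[Gs Gm Gi] Gr] := rcG; have [[Fs Fm Fi] Fr] := rcF.
pose K s := [set A : set Omega | measurable A /\ forall s', s < s' ->
  exists2 A', prod_salgebra (F s') (@measurable _ (\bar R)) A' &
    forall w, A w <-> A' (w, tau w)].
have rcK : rc_filtration K.
  split; first split.
  - move=> t t0; split.
    + by split => // s' _; exists set0 => //; exact: sigma_algebra0.
    + move=> E [mE hE]; split; first by rewrite setTD; exact: measurableC.
      move=> s' /hE [E' sE' EE']; exists (~` E'); first by rewrite -setTD; exact: sigma_algebraCD.
      by move=> w; rewrite setTD /=; split => nE => /EE'.
    + move=> E hE; split; first by apply: bigcupT_measurable => n; case: (hE n).
      move=> s' ts'.
      have /choice [E' hE'] : forall n, exists E', prod_salgebra (F s') (@measurable _ (\bar R)) E' /\ forall w, E n w <-> E' (w, tau w).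
        by move=> n; have [_ /(_ _ ts') [E' ? ?]] := hE n; exists E'.
      exists (\bigcup_n E' n); first by apply: sigma_algebra_bigcup => n; case: (hE' n).
      by move=> w; split => -[n _ En]; exists n => //; apply/(proj2 (hE' n)).
  - by move=> t t0 E [].
  - move=> s t s0 st E [mE hE]; split => // s' ts'; apply: hE; exact: le_lt_trans ts'.
  - move=> t t0 E hE; split; first by have [] := hE (t + 1); rewrite //= ltrDl.
    move=> s' ts'; have [] := hE ((t + s') / 2); rewrite /=; first lra.
    move=> _ /(_ s'); apply; lra.
have FK s : 0 <= s -> F s `<=` K s.
  move=> s0 E FE; split; first exact: Fm FE.
  move=> s' ss'; exists (E `*` setT); last by move=> w; split => // -[].
  by apply: sub_sigma_algebra; exists E, setT; split => //; apply: (Fi s s') => //; exact: ltW.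
have sK : stopping_time K tau.
  split; first exact: sG.1.
  move=> t t0; split; first by apply: (Gm t t0); exact: sG.2.
  move=> s' ts'; exists (setT `*` [set y | (y <= t%:E)%E]); last by move=> w; split => // -[].
  apply: sub_sigma_algebra; exists setT, [set y | (y <= t%:E)%E]; split => //.
    by apply: salgT; apply: Fs; rewrite (le_trans t0)// ltW.
  rewrite (_ : mkset _ = `]-oo, t%:E]%classic); first exact: emeasurable_itv.
  by apply/seteqP; split => y; rewrite /= in_itv.
by have [_ /(_ _ qq')] := Gmin rcK FK sK q0 GA.
Qed.

(** Until the first jump, which is positive, the path carries only [X 0]. *)
Lemma initial_sets A w w' : (forall w, (0 < tau w)%E) -> G 0 A -> X w 0 = X w' 0 -> A w -> A w'.
Proof.
move=> tau0 GA ww' Aw; have [[Gs Gm Gi] Gr] := rcG; have [[Fs Fm Fi] Fr] := rcF.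
pose agree (t : R) (w w' : Omega) := forall s, 0 <= s -> s <= t ->
  X w s = X w' s /\ (tau w <= s%:E)%E = (tau w' <= s%:E)%E.
pose K t := [set A : set Omega | measurable A /\ forall w w', agree t w w' -> A w -> A w'].
have agreeC t v v' : agree t v v' -> agree t v' v.
  by move=> h s s0 st; have [-> ->] := h s s0 st.
have rcK : rc_filtration K.
  split; first split.
  - move=> t t0; split => //.
    + move=> E [mE hE]; split; first by rewrite setTD; exact: measurableC.
      move=> v v' vv'; rewrite setTD /= => nE Ev'; apply: nE.
      exact: hE (agreeC _ _ _ vv') Ev'.
    + move=> E hE; split; first by apply: bigcupT_measurable => n; case: (hE n).
      by move=> v v' vv' [n _ En]; exists n => //; exact: (proj2 (hE n) v).
  - by move=> t t0 E [].
  - move=> s t s0 st E [mE hE]; split => // v v' vv'; apply: hE => u u0 us.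
    by apply: vv' => //; exact: le_trans st.
  - move=> t t0 E hE; split; first by have [] := hE (t + 1); rewrite //= ltrDl.
    move=> v v' vv'.
    have [e e0 he] := times_right (jt_lf v) t.
    have [e' e'0 he'] := times_right (jt_lf v') t.
    pose m := Num.min e e' / 2.
    have m0 : 0 < m by rewrite divr_gt0// lt_min e0 e'0.
    have mE : m + m = Num.min e e' by rewrite /m -splitr.
    have mle := minL e e'; have mle' := minR e e'.
    have [] := hE (t + m); first by rewrite /= ltrDl.
    move=> _; apply => s s0 stm.
    have [st|ts] := leP s t; first exact: vv'.
    have hv n : (jt n v <= s%:E)%E = (jt n v <= t%:E)%E by apply: he; lra.
    have hv' n : (jt n v' <= s%:E)%E = (jt n v' <= t%:E)%E by apply: he'; lra.
    have [h1 h2] := vv' t t0 (lexx _).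
    by rewrite (X_const hv) (X_const hv') (tau_const hv) (tau_const hv').
have aK : adapted K X.
  move=> t t0 E mE; rewrite setTI; split.
    by apply: (Fm t t0); have := aX t0 mE; rewrite setTI.
  by move=> v v' /(_ t t0 (lexx _)) [h _] /=; rewrite h.
have sK : stopping_time K tau.
  split; first exact: sG.1.
  move=> t t0; split; first by apply: (Gm t t0); exact: sG.2.
  by move=> v v' /(_ t t0 (lexx _)) [_ h] /=; rewrite h.
have [_ h] := Gmin rcK (Fmin rcK aK) sK (lexx 0) GA.
apply: h Aw => s s0 s0'; have -> : s = 0 by apply/eqP; rewrite eq_le s0 s0'.
by split => //; rewrite !leNgt !tau0.
Qed.

End filtration_structure.

(** * Conditional laws *)

Section prod_salgebra_theory.

Lemma prod_salgebra_preimage (Z A B : Type) (S : set_system Z) (S1 : set_system A)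
    (S2 : set_system B) (f : Z -> A) (g : Z -> B) : sigma_algebra setT S ->
  (forall A1, S1 A1 -> S (f @^-1` A1)) -> (forall B1, S2 B1 -> S (g @^-1` B1)) ->
  forall E, prod_salgebra S1 S2 E -> S [set z | E (f z, g z)].
Proof.
move=> hS hf hg; change (prod_salgebra S1 S2 `<=` [set E | S [set z | E (f z, g z)]]).
apply: smallest_sub.
  split => /=.
  - by case: hS.
  - move=> E SE; have := salgC hS SE; congr S.
    by apply/seteqP; split => z /=; tauto.
  - by move=> E hE; have := salg_bigcup hS hE; congr S.
move=> _ [A1 [B1 [SA SB ->]]] /=.
by have := salgI hS (hf _ SA) (hg _ SB); congr S.
Qed.

Lemma prod_salgebra_le (A B : Type) (S1 S1' : set_system A) (S2 S2' : set_system B) :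
  S1 `<=` S1' -> S2 `<=` S2' -> prod_salgebra S1 S2 `<=` prod_salgebra S1' S2'.
Proof.
move=> h1 h2; apply: sub_sigma_algebra2 => _ [A1 [B1 [SA SB ->]]].
by exists A1, B1; split => //; [exact: h1|exact: h2].
Qed.

Lemma measurable_g_salgebraE (T : pointedType) (S : set_system T) : sigma_algebra setT S ->
  @measurable _ (g_sigma_algebraType S) = S.
Proof. exact: sigma_algebra_id. Qed.

Lemma prod_salgebraE (T : pointedType) (S : set_system T) d (V : measurableType d) :
  sigma_algebra setT S ->
  prod_salgebra S (@measurable _ V) = @measurable _ (g_sigma_algebraType S * V)%type.
Proof.
move=> hS; rewrite measurable_prod_measurableType measurable_g_salgebraE//.
congr (<<s _ >>); apply/seteqP; split => E.
  by move=> [A1 [B1 [SA SB ->]]]; exists A1 => //; exists B1.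
by move=> [A1 SA [B1 SB <-]]; exists A1, B1.
Qed.

Lemma prod_measurableE d1 (T : measurableType d1) d (V : measurableType d) :
  prod_salgebra (@measurable _ T) (@measurable _ V) = @measurable _ (T * V)%type.
Proof.
rewrite measurable_prod_measurableType.
congr (<<s _ >>); apply/seteqP; split => E.
  by move=> [A1 [B1 [SA SB ->]]]; exists A1 => //; exists B1.
by move=> [A1 SA [B1 SB <-]]; exists A1, B1.
Qed.

Lemma measurable_wrtT (T : pointedType) (S : set_system T) d (V : measurableType d)
    (f : T -> V) : sigma_algebra setT S ->
  measurable_wrt S setT f <-> measurable_fun setT (f : g_sigma_algebraType S -> V).
Proof.
move=> hS; split.
  by move=> h _ B mB; rewrite measurable_g_salgebraE//; exact: h.
by move=> h B mB; have := h measurableT B mB; rewrite measurable_g_salgebraE.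
Qed.

Lemma measurable_wrtD (T : pointedType) (S : set_system T) (D : set T) d (V : measurableType d)
    (f : T -> V) : sigma_algebra setT S -> S D ->
  measurable_wrt S D f <-> measurable_fun (D : set (g_sigma_algebraType S)) (f : g_sigma_algebraType S -> V).
Proof.
move=> hS SD; split.
  by move=> h _ B mB; rewrite measurable_g_salgebraE//; exact: h.
move=> h B mB; have := h _ B mB; rewrite measurable_g_salgebraE//; exact.
Qed.

End prod_salgebra_theory.

Section sub_measure.
Context (R : realType) (d0 : measure_display) (Omega : measurableType d0).
Variable P : probability Omega R.
Variable S : set_system Omega.

Definition sub_probability (hS : sigma_algebra setT S) (Sm : S `<=` measurable) :
  set (g_sigma_algebraType S) -> \bar R := P.

Variables (hS : sigma_algebra setT S) (Sm : S `<=` measurable).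

Let sub0 : sub_probability hS Sm set0 = 0%E. Proof. exact: measure0. Qed.
Let sub_ge0 B : (0 <= sub_probability hS Sm B)%E. Proof. exact: measure_ge0. Qed.
Let sub_add : semi_sigma_additive (sub_probability hS Sm).
Proof.
move=> F mF tF mU; apply: (@measure_semi_sigma_additive _ _ _ P) => //.
  by move=> n; apply: Sm; rewrite -(measurable_g_salgebraE hS).
by apply: Sm; rewrite -(measurable_g_salgebraE hS).
Qed.

HB.instance Definition _ := isMeasure.Build _ _ _ (sub_probability hS Sm) sub0 sub_ge0 sub_add.

Let sub1 : sub_probability hS Sm setT = 1%E.
Proof. exact: probability_setT. Qed.

HB.instance Definition _ := Measure_isProbability.Build _ _ _ (sub_probability hS Sm) sub1.

Lemma sub_measurable_fun d (V : measurableType d) (f : Omega -> V) :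
  measurable_fun setT (f : g_sigma_algebraType S -> V) -> measurable_fun setT f.
Proof.
move=> mf _ B mB; apply: Sm; have := mf measurableT B mB.
by rewrite measurable_g_salgebraE.
Qed.

Lemma ge0_integral_sub (f : Omega -> \bar R) :
  measurable_fun setT (f : g_sigma_algebraType S -> \bar R) -> (forall w, 0 <= f w)%E ->
  (\int[sub_probability hS Sm]_w f w = \int[P]_w f w)%E.
Proof.
move: f; apply: (@ge0_measurable_ind _ (g_sigma_algebraType S) R
  (fun f => \int[sub_probability hS Sm]_w f w = \int[P]_w f w)%E).
- move=> A mA; rewrite integral_indic// integral_indic ?setIT//.
  by apply: Sm; rewrite -(measurable_g_salgebraE hS).
- move=> k f k0 mf f0 ih; rewrite ge0_integralZl// ih ge0_integralZl//.
  exact: sub_measurable_fun.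
- move=> f g mf f0 mg g0 ihf ihg; rewrite ge0_integralD// ihf ihg ge0_integralD//.
  + exact: sub_measurable_fun.
  + exact: sub_measurable_fun.
- move=> F mF F0 ndF ih; rewrite monotone_convergence//.
  under eq_fun do rewrite ih.
  rewrite -monotone_convergence// => n; exact: sub_measurable_fun.
Qed.

Lemma conditional_probability (A : set Omega) : measurable A ->
  exists c : Omega -> R, [/\ measurable_wrt S setT c, forall w, 0 <= c w &
    forall B, S B -> (\int[P]_(w in B) (c w)%:E = P (A `&` B))%E].
Proof.
move=> mA.
pose nu0 : {measure set Omega -> \bar R} := mrestr P mA.
have nuA : semi_sigma_additive (nu0 : set (g_sigma_algebraType S) -> \bar R).
  move=> F mF tF mU; apply: (@measure_semi_sigma_additive _ _ _ nu0) => //.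
    by move=> n; apply: Sm; rewrite -(measurable_g_salgebraE hS).
  by apply: Sm; rewrite -(measurable_g_salgebraE hS).
have nu00 : (nu0 : set (g_sigma_algebraType S) -> \bar R) set0 = 0%E by exact: measure0.
have nu0ge0 B : (0 <= (nu0 : set (g_sigma_algebraType S) -> \bar R) B)%E by exact: measure_ge0.
pose nu1 : {measure set (g_sigma_algebraType S) -> \bar R} :=
  HB.pack (nu0 : set (g_sigma_algebraType S) -> \bar R)
   (isMeasure.Build _ (g_sigma_algebraType S) R (nu0 : set (g_sigma_algebraType S) -> \bar R)
     nu00 nu0ge0 nuA).
have nufin : fin_num_fun nu1.
  move=> B mB; rewrite ge0_fin_numE//.
  have mB' : measurable (B : set Omega) by apply: Sm; rewrite -(measurable_g_salgebraE hS).
  rewrite /= /mrestr; apply: (le_lt_trans (probability_le1 P (measurableI _ _ mB' mA))).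
  by rewrite ltry.
pose nu2 : {finite_measure set (g_sigma_algebraType S) -> \bar R} :=
  HB.pack (nu1 : set _ -> \bar R) nu1 (Measure_isFinite.Build _ _ R nu1 nufin).
have dom : nu2 `<< sub_probability hS Sm.
  apply/null_content_dominatesP => B mB B0.
  have mB' : measurable (B : set Omega) by apply: Sm; rewrite -(measurable_g_salgebraE hS).
  apply: (@subset_measure0 _ _ _ P _ B) => //; exact: measurableI.
have [f [f0 ffin fint fE]] := radon_nikodym_sigma_finite dom.
have mf : measurable_fun setT f := measurable_int _ fint.
exists (fun w => fine (f w)); split.
- apply/(measurable_wrtT _ hS); exact: measurableT_comp.
- by move=> w; rewrite fine_ge0.
- move=> B SB.
  have mB : measurable (B : set (g_sigma_algebraType S)) by rewrite measurable_g_salgebraE.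
  rewrite setIC; transitivity (nu2 B) => //; rewrite fE//.
  rewrite integral_mkcond [RHS]integral_mkcond ge0_integral_sub.
  + apply: eq_integral => w _; rewrite !patchE; case: ifP => // _.
    by rewrite fineK.
  + apply/(measurable_restrictT _ mB); exact: measurable_funTS.
  + by move=> w; rewrite patchE; case: ifP.
Qed.

End sub_measure.

Section image_probability.
Context (R : realType) (d0 : measure_display) (Omega : measurableType d0).
Context (d : measure_display) (V : measurableType d) (P : probability Omega R).
Variable f : Omega -> V.

Definition image_probability (mf : measurable_fun setT f) : set V -> \bar R :=
  fun B => P (f @^-1` B).

Variable mf : measurable_fun setT f.

Let mfB B : measurable B -> measurable (f @^-1` B).
Proof. by move=> mB; rewrite -[X in measurable X]setTI; exact: mf. Qed.

Let im0 : image_probability mf set0 = 0%E.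
Proof. by rewrite /image_probability preimage_set0 measure0. Qed.
Let im_ge0 B : (0 <= image_probability mf B)%E. Proof. exact: measure_ge0. Qed.
Let im_add : semi_sigma_additive (image_probability mf).
Proof.
move=> F mF tF mUF; rewrite /image_probability preimage_bigcup.
apply: measure_semi_sigma_additive.
- by move=> n; exact: mfB.
- apply/trivIsetP => /= i j _ _ ij; rewrite -preimage_setI.
  by move/trivIsetP : tF => /(_ _ _ _ _ ij) ->//; rewrite preimage_set0.
- by rewrite -preimage_bigcup; exact: mfB.
Qed.

HB.instance Definition _ := isMeasure.Build _ _ _ (image_probability mf) im0 im_ge0 im_add.

Let im1 : image_probability mf setT = 1%E.
Proof. by rewrite /image_probability preimage_setT probability_setT. Qed.

HB.instance Definition _ := Measure_isProbability.Build _ _ _ (image_probability mf) im1.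

End image_probability.

Section integral_sections.
Local Open Scope ereal_scope.
Context (R : realType) d1 (T1 : measurableType d1) d2 (T2 : measurableType d2).

Lemma integral_xsection (m : {measure set T2 -> \bar R}) (E : set (T1 * T2)) x :
  measurable E -> \int[m]_y (\1_E (x, y))%:E = m (xsection E x).
Proof.
move=> mE; rewrite (eq_integral (fun y => (\1_(xsection E x) y)%:E)).
  by rewrite integral_indic ?setIT//; exact: measurable_xsection.
move=> y _; rewrite !indicE; congr ((nat_of_bool _)%:R%:E).
by rewrite mem_xsection.
Qed.

Lemma integral_ysection (m : {measure set T1 -> \bar R}) (E : set (T1 * T2)) y :
  measurable E -> \int[m]_x (\1_E (x, y))%:E = m (ysection E y).
Proof.
move=> mE; rewrite (eq_integral (fun x => (\1_(ysection E y) x)%:E)).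
  by rewrite integral_indic ?setIT//; exact: measurable_ysection.
move=> x _; rewrite !indicE; congr ((nat_of_bool _)%:R%:E).
by rewrite mem_ysection.
Qed.

End integral_sections.

Section conditional_law.
Local Open Scope ereal_scope.
Context (R : realType) (d0 : measure_display) (Omega : measurableType d0).
Variable P : probability Omega R.
Variables (S : set_system Omega) (tau : Omega -> \bar R) (kappa : Omega -> probability (\bar R) R).
Hypotheses (hS : sigma_algebra setT S) (Sm : S `<=` measurable).
Hypothesis mtau : measurable_fun setT tau.
Hypothesis kappaP : regular_conditional_law P S tau kappa.

Let mE E : prod_salgebra S (@measurable _ (\bar R)) E -> measurable (E : set (Omega * \bar R)%type).
Proof. by rewrite -prod_measurableE => ?; apply: prod_salgebra_le; last eassumption. Qed.

Let mk E : prod_salgebra S (@measurable _ (\bar R)) E ->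
  measurable_fun setT ((fun w => kappa w (xsection E w)) : g_sigma_algebraType S -> \bar R).
Proof.
move=> sE; have mE' : measurable (E : set (g_sigma_algebraType S * \bar R)%type).
  by rewrite -prod_salgebraE.
rewrite (_ : (fun w => _) = fun w => \int[kappa w]_y (\1_E (w, y))%:E).
  apply: (@measurable_fun_integral_fam _ _ (g_sigma_algebraType S) _ R (fun w => kappa w) _ _
    (fun p => (\1_E p)%:E)).
  - by move=> w; apply: le_lt_trans (probability_le1 (kappa w) measurableT) (ltry _).
  - by move=> B mB; apply/(measurable_wrtT _ hS); case: kappaP => + _; exact.
  - by apply/measurable_EFinP; exact: measurable_indic.
  - by move=> p; rewrite lee_fin.
by apply/funext => w; rewrite integral_xsection//; exact: mE.
Qed.

(** Freezing lemma: the pair [(w, tau w)] is integrated first in its second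
    argument, against the conditional law. *)
Lemma conditional_law_section E : prod_salgebra S (@measurable _ (\bar R)) E ->
  P [set w | E (w, tau w)] = \int[P]_w kappa w (xsection E w).
Proof.
move=> sE; have sE' := sE; move: sE'; rewrite prod_salgebraE// measurable_prod_measurableType => sE'.
have mset F : prod_salgebra S (@measurable _ (\bar R)) F -> measurable [set w | F (w, tau w)].
  apply: (@prod_salgebra_preimage _ _ _ _ _ _ id tau) => //.
  - exact: (@sigma_algebra_measurable d0 Omega).
  - by move=> B mB; rewrite -[X in measurable X]setTI; exact: mtau.
have mk' F : prod_salgebra S (@measurable _ (\bar R)) F ->
    measurable_fun setT (fun w => kappa w (xsection F w)).
  by move=> sF; apply: (sub_measurable_fun hS Sm); exact: mk.
have mxs F w : prod_salgebra S (@measurable _ (\bar R)) F -> measurable (xsection F w).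
  by move=> sF; apply: measurable_xsection; exact: mE.
have mP F : @measurable _ (g_sigma_algebraType S * \bar R)%type F ->
  prod_salgebra S (@measurable _ (\bar R)) F by rewrite prod_salgebraE.
apply: (dynkin_induction (T := (g_sigma_algebraType S * \bar R)%type) (P := [set E | P [set w | E (w, tau w)] = \int[P]_w kappa w (xsection E w)]) _ _ _ _ _ _ sE').
- by rewrite measurable_prod_measurableType.
- move=> _ _ [X1 mX1 [X2 mX2 <-]] [Y1 mY1 [Y2 mY2 <-]].
  exists (X1 `&` Y1); first exact: measurableI.
  by exists (X2 `&` Y2); [exact: measurableI|rewrite setXI].
- rewrite /= (_ : mkset _ = setT); last by apply/seteqP.
  rewrite probability_setT (eq_integral (cst 1)); last first.
    by move=> w _; rewrite (_ : xsection _ _ = setT) ?probability_setT//; apply/seteqP; split => y //= _; rewrite /xsection /= inE.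
  by rewrite integral_cst// mul1e; exact/esym/probability_setT.
- move=> _ [A mA [B mB <-]] /=.
  have SA : S A by rewrite -(measurable_g_salgebraE hS).
  case: kappaP => _ /(_ A B SA mB).
  change (P [set w | A w /\ B (tau w)]) with (P (A `&` tau @^-1` B)) => ->.
  rewrite integral_mkcond; apply: eq_integral => w _.
  rewrite patchE; case: ifPn => wA; first by rewrite in_xsectionX.
  by rewrite notin_xsectionX// measure0.
- move=> F mF /= ih.
  have sF := mP _ mF.
  rewrite -[mkset _]/(~` [set w | F (w, tau w)]).
  rewrite probability_setC; last exact: mset.
  rewrite ih [RHS](eq_integral (fun w => 1 - kappa w (xsection F w))); last first.
    move=> w _; rewrite -probability_setC//; last exact: mxs.
    congr (kappa w _); by apply/seteqP; split => y; rewrite /xsection/= !inE.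
  have i1 : P.-integrable setT (cst 1) by exact: finite_measure_integrable_cst.
  have i2 : P.-integrable setT (fun w => kappa w (xsection F w)).
    apply: le_integrable i1 => //; first exact: mk'.
    by move=> w _ /=; rewrite gee0_abs// normr1 probability_le1//; exact: mxs.
  rewrite integralB// integral_cst// mul1e; congr (_ - _).
  exact/esym/probability_setT.
- move=> F mF tF /= ih.
  rewrite (_ : mkset _ = \bigcup_n [set w | F n (w, tau w)]); last first.
    by apply/seteqP; split => w [n _ Fn]; exists n.
  rewrite measure_bigcup//=; last first.
  + move/trivIsetP : tF => tF; apply/trivIsetP => i j _ _ ij.
    apply/seteqP; split => // w [/= Fi Fj].
    by have /seteqP[+ _] := tF i j Logic.I Logic.I ij; apply; split; eassumption.
  + by move=> n _; apply: mset; exact: mP.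
  rewrite (eq_integral (fun w => \sum_(n <oo) kappa w (xsection (F n) w))); last first.
    move=> w _; rewrite xsection_bigcup measure_bigcup//.
    - by apply: eq_eseriesl => n; rewrite in_setT.
    - by move=> n _; apply: mxs; exact: mP.
    - exact: trivIset_xsection.
  rewrite integral_nneseries//; last by move=> n; apply: mk'; exact: mP.
  rewrite (@eq_eseriesl _ _ predT); last by move=> n; rewrite in_setT.
  by apply: eq_eseriesr => n _; exact: ih.
Qed.

Hypothesis kappa_dom : {ae P, forall w, kappa w `<< pushforward P tau}.

Lemma conditional_law_null E : prod_salgebra S (@measurable _ (\bar R)) E ->
  {ae P, forall w, pushforward P tau (xsection E w) = 0} ->
  P [set w | E (w, tau w)] = 0.
Proof.
move=> sE E0; rewrite conditional_law_section//; apply: ae_ge0_integral0_nomeas.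
apply: filterS2 kappa_dom E0 => w dom E0.
have mx : measurable (xsection E w) by apply: measurable_xsection; exact: mE.
apply: (dom (xsection E w)) => // A mA AE; apply/eqP.
rewrite /pushforward in E0 *; rewrite -measure_le0 -E0; apply: le_measure; rewrite ?inE.
- by rewrite -[X in measurable X]setTI; exact: mtau.
- by rewrite -[X in measurable X]setTI; exact: mtau.
- exact: preimage_subset.
Qed.

(** If the vertical sections of [E] are null, then [E] is null for the product
    of [P] and the law of [tau], which dominates the law of [(w, tau w)]. *)
Lemma conditional_law_null_sections E : prod_salgebra S (@measurable _ (\bar R)) E ->
  (forall y, P (ysection E y) = 0) -> P [set w | E (w, tau w)] = 0.
Proof.
move=> sE E0; apply: conditional_law_null => //.
have mE' := mE sE.
pose eta := image_probability P mtau.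
have mf : measurable_fun setT (fun p : Omega * \bar R => (\1_E p)%:E : \bar R).
  by apply/measurable_EFinP; exact: measurable_indic.
have f0 (p : Omega * \bar R) : 0 <= (\1_E p)%:E :> \bar R by rewrite lee_fin.
have := fubini_tonelli (m1 := P) (m2 := eta) _ mf f0.
rewrite [RHS]integral0_eq; last first.
  by move=> y _; rewrite integral_ysection//; exact: E0.
have xE w : \int[eta]_y (\1_E (w, y))%:E = pushforward P tau (xsection E w).
  by rewrite integral_xsection.
have mF := measurable_fun_fubini_tonelli_F (m2 := eta) _ mf f0.
rewrite (eq_integral (fun w => `|pushforward P tau (xsection E w)|)); last first.
  by move=> w _; rewrite xE gee0_abs// measure_ge0.
move=> h; have mF' : measurable_fun setT (fun w => pushforward P tau (xsection E w)).
  by move/eq_measurable_fun : mF; apply => w _; exact: xE.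
by apply: filterS ((ae_eq_integral_abs P measurableT mF').1 h) => w; exact.
Qed.

End conditional_law.

(** * Inaccessible jump times *)

Definition nat_rat (n : nat) : rat := odflt 0 (unpickle n).

Lemma nat_rat_surj (c : rat) : exists n, nat_rat n = c.
Proof. by exists (pickle c); rewrite /nat_rat pickleK. Qed.

Section rational_times.
Context (R : realType) (T : pointedType).

Definition nratr (n : nat) : R := ratr (nat_rat n).

Lemma nratr_between (x y : R) : x < y -> exists n, x < nratr n < y.
Proof.
move=> /rat_in_itvoo[c]; rewrite in_itv/= => xcy.
by have [n nc] := nat_rat_surj c; exists n; rewrite /nratr nc.
Qed.

(** Recovers a time from its conditions [x <= c], for [c] rational, so that the
    recovered time is [S]-measurable when the conditions are. *)
Lemma inf_rational_time (S : set_system T) (A : nat -> set T) (q : R) :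
  sigma_algebra setT S -> (forall n, S (A n)) ->
  exists S' : T -> R, [/\ measurable_wrt S setT S', forall w, q < S' w &
    forall w x, q < x -> (forall n, A n w <-> x <= nratr n) -> S' w = x].
Proof.
move=> hS SA.
pose g w : \bar R := ereal_inf [set (nratr n)%:E | n in [set n | A n w]].
have mg : measurable_fun setT (g : g_sigma_algebraType S -> \bar R).
  apply: (measurability _ (ErealGenInftyO.measurableE R)) => _ /= [_ [r ->] <-].
  rewrite setTI (_ : _ @^-1` _ = \bigcup_(n in [set n | nratr n < r]) A n).
    by apply: bigcup_measurable => n _; rewrite measurable_g_salgebraE.
  apply/seteqP; split => w /=; rewrite in_itv/=.
    by move=> /ereal_inf_lt [_ /= [n An <-]]; rewrite lte_fin => nr; exists n.
  move=> [n /= nr An]; apply: (@le_lt_trans _ _ (nratr n)%:E).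
    by apply: ereal_inf_lbound; exists n.
  by rewrite lte_fin.
exists (fun w => if (q%:E < g w)%E && (g w < +oo)%E then fine (g w) else q + 1); split.
- apply/(measurable_wrtT _ hS); apply: measurable_fun_ifT => //.
  + by apply: measurable_and; apply: measurable_fun_lte.
  + exact: measurableT_comp.
- move=> w; case: ifPn => [/andP[qg gy]|_]; last by rewrite ltrDl.
  by rewrite -lte_fin fineK// fin_real// gy (lt_trans _ qg)// ltNyr.
- move=> w x qx Ax; suff -> : g w = x%:E by rewrite lte_fin qx ltry.
  apply/eqP; rewrite eq_le; apply/andP; split.
    rewrite leNgt; apply/negP => xg.
    have [y xy yg] : exists2 y, x < y & (y%:E <= g w)%E.
      case: (g w) xg => [r| |]//; first by rewrite lte_fin => xr; exists r.
      by move=> _; exists (x + 1); rewrite ?leey// ltrDl.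
    have [n /andP[xn ny]] := nratr_between xy.
    suff : (g w <= (nratr n)%:E)%E by apply/negP; rewrite -ltNge (lt_le_trans _ yg)// lte_fin.
    by apply: ereal_inf_lbound; exists n => //=; apply/Ax; exact: ltW.
  by apply: le_ereal_inf_tmp => _ /= [n /Ax xn <-]; rewrite lee_fin.
Qed.

End rational_times.

Section inaccessible.
Context (R : realType) (d0 : measure_display) (Omega : measurableType d0).
Variables (P : probability Omega R) (F G : R -> set_system Omega).
Variables (tau : Omega -> \bar R) (tau_ : nat -> Omega -> \bar R).
Hypotheses (rcF : rc_filtration F) (rcG : rc_filtration G).
Hypothesis FG : forall s, 0 <= s -> F s `<=` G s.
Hypothesis mtau : measurable_fun setT tau.
Hypothesis stopF : forall m, stopping_time F (tau_ m).
Hypothesis diffF : forall q S, 0 <= q -> measurable_wrt (F q) setT S ->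
  (forall w, q < S w) -> forall m, {ae P, forall w, tau_ m w <> (S w)%:E}.
Hypothesis pre : forall q A, 0 <= q -> G q A ->
  exists2 A', F q A' & forall w, (q%:E < tau w)%E -> (A w <-> A' w).
Hypothesis post : forall q q' A, 0 <= q -> q < q' -> G q A ->
  exists2 A', prod_salgebra (F q') (@measurable _ (\bar R)) A' &
    forall w, A w <-> A' (w, tau w).

Let Fs t : 0 <= t -> sigma_algebra setT (F t). Proof. by case: rcF => -[+ _ _] _; exact. Qed.
Let Fm t : 0 <= t -> F t `<=` measurable. Proof. by case: rcF => -[_ + _] _; exact. Qed.
Let Fi s t : 0 <= s -> s <= t -> F s `<=` F t. Proof. by case: rcF => -[_ _ +] _; exact. Qed.
Let Gs t : 0 <= t -> sigma_algebra setT (G t). Proof. by case: rcG => -[+ _ _] _; exact. Qed.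
Let Gm t : 0 <= t -> G t `<=` measurable. Proof. by case: rcG => -[_ + _] _; exact. Qed.

Lemma wrt_le (K : set_system Omega) (S : Omega -> R) (x : R) :
  measurable_wrt K setT S -> K [set w | S w <= x].
Proof.
move=> mS; have -> : [set w | S w <= x] = setT `&` S @^-1` `]-oo, x].
  by rewrite setTI; apply/seteqP; split => w; rewrite /= in_itv.
exact: mS.
Qed.

Lemma stop_measurable m : measurable_fun setT (tau_ m).
Proof.
apply: (measurability _ (ErealGenOInfty.measurableE R)) => _ /= [_ [r ->] <-].
rewrite setTI (_ : _ @^-1` _ = ~` [set w | (tau_ m w <= r%:E)%E]); last first.
  by apply/seteqP; split => w /=; rewrite in_itv/= andbT ltNge => /negP.
apply: measurableC; have [r0|r0] := leP 0 r.
  exact: Fm r0 _ ((stopF m).2 r r0).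
rewrite (_ : mkset _ = set0)//; apply/seteqP; split => // w /= tr.
by have := le_trans ((stopF m).1 w) tr; rewrite lee_fin leNgt r0.
Qed.

Lemma stop_le m t x : 0 <= t -> x <= t -> F t [set w | (tau_ m w <= x%:E)%E].
Proof.
move=> t0 xt; have [x0|x0] := leP 0 x; first exact: (Fi x0 xt) ((stopF m).2 x x0).
rewrite (_ : mkset _ = set0); first by case: (Fs t0).
apply/seteqP; split => // w /= tr.
by have := le_trans ((stopF m).1 w) tr; rewrite lee_fin leNgt x0.
Qed.

Lemma measurable_eq_time (f : Omega -> \bar R) (g : Omega -> R) :
  measurable_fun setT f -> measurable_fun setT g -> measurable [set w | f w = (g w)%:E].
Proof.
move=> mf mg; have mg' : measurable_fun setT (EFin \o g) by exact/measurable_EFinP.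
have := measurable_fun_eqe mf mg' => /(_ measurableT [set true] (Logic.I : measurable [set true])).
by rewrite setTI; congr measurable; apply/seteqP; split => w /= /eqP.
Qed.

Lemma wrt_measurable (K : set_system Omega) (S : Omega -> R) : K `<=` measurable ->
  measurable_wrt K setT S -> measurable_fun setT S.
Proof. by move=> Km mS _ B mB; apply: Km; exact: mS. Qed.

Lemma default_inaccessible : avoids_stopping_times P F tau ->
  forall q S, 0 <= q -> measurable_wrt (G q) setT S -> (forall w, q < S w) ->
  {ae P, forall w, tau w <> (S w)%:E}.
Proof.
move=> avoid q S q0 mS qS.
have /choice[A hA] : forall n, exists A, F q A /\
    forall w, (q%:E < tau w)%E -> (S w <= nratr R n <-> A w).
  move=> n; have [A FA AA] := pre q0 (wrt_le (nratr R n) mS).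
  by exists A.
have [S' [mS' qS' S'E]] := inf_rational_time q (Fs q0) (fun n => proj1 (hA n)).
exists [set w | tau w = (S' w)%:E]; split.
- exact: measurable_eq_time mtau (wrt_measurable (Fm q0) mS').
- rewrite -[RHS](avoid (EFin \o S')).
    by congr (P _); apply/seteqP; split => w /= => [->|[//]]; rewrite ltry.
  split => [w|t t0]; first by rewrite lee_fin (le_trans q0)// ltW.
  have [tq|qt] := leP t q.
    rewrite (_ : mkset _ = set0); first by case: (Fs t0).
    apply/seteqP; split => // w /=; rewrite lee_fin => St.
    by have := lt_le_trans (qS' w) (le_trans St tq); rewrite ltxx.
  apply: (Fi q0 (ltW qt)); have := wrt_le t mS'.
  by congr (F q); apply/seteqP; split => w /=; rewrite lee_fin.
- move=> w /= /contrapT tS; rewrite tS; congr (_%:E); apply/esym; apply: S'E => // n.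
  by have h := proj2 (hA n) w; rewrite tS lte_fin in h; split => /(h (qS w)).
Qed.

Lemma stopped_wrt (sigma : Omega -> \bar R) t : stopping_time F sigma -> 0 <= t ->
  measurable_fun setT ((fun w => if (sigma w <= t%:E)%E then sigma w else +oo%E) :
    g_sigma_algebraType (F t) -> \bar R).
Proof.
move=> [sigma0 ssigma] t0.
apply: (measurability _ (ErealGenOInfty.measurableE R)) => _ /= [_ [r ->] <-].
rewrite setTI measurable_g_salgebraE; last exact: Fs.
rewrite (_ : _ @^-1` _ = ~` [set w | (sigma w <= (Num.min r t)%:E)%E]); last first.
  apply/seteqP; split => w /=; rewrite in_itv/= andbT; case: ifPn => st.
  - by rewrite ltNge => /negP sr sm; apply: sr; rewrite (le_trans sm)// lee_fin minL.
  - by move=> _ sm; move/negP: st; apply; rewrite (le_trans sm)// lee_fin minR.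
  - move=> /negP; rewrite -ltNge => sm; rewrite ltNge; apply/negP => sr; move: sm.
    by rewrite ltNge => /negP; apply; case: (leP r t).
  - by rewrite ltry.
apply: salgC; first exact: Fs.
have [r0|r0] := leP 0 (Num.min r t).
  by apply: (Fi r0); [exact: minR|exact: ssigma].
rewrite (_ : mkset _ = set0); first by case: (Fs t0).
apply/seteqP; split => // w /= tr.
by have := le_trans (sigma0 w) tr; rewrite lee_fin leNgt r0.
Qed.

(** The graph of a stopping time, up to time [t], among the values of a function
    that is measurable at time [t]. *)
Lemma stopped_graph (sigma : Omega -> \bar R) t (f : Omega * \bar R -> \bar R) :
  stopping_time F sigma -> 0 <= t ->
  measurable_fun setT (f : g_sigma_algebraType (F t) * \bar R -> \bar R) ->
  prod_salgebra (F t) (@measurable _ (\bar R)) [set p | sigma p.1 = f p /\ (f p <= t%:E)%E].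
Proof.
move=> ssigma t0 mf; rewrite prod_salgebraE; last exact: Fs.
pose g (p : g_sigma_algebraType (F t) * \bar R) :=
  if (sigma p.1 <= t%:E)%E then sigma p.1 else +oo%E.
have mg : measurable_fun setT g.
  exact: (measurableT_comp (stopped_wrt ssigma t0) measurable_fst).
rewrite (_ : mkset _ = [set p | g p == f p] `&` [set p | (f p <= t%:E)%E]).
  apply: measurableI.
    have := measurable_fun_eqe mg mf measurableT (Logic.I : measurable [set true]).
    by rewrite setTI.
  by rewrite -[X in measurable X]setTI; exact: emeasurable_fun_infty_c.
apply/seteqP; split => p /=; rewrite /g.
  by move=> [-> ft]; rewrite ft eqxx.
move=> [/eqP + ft]; case: ifPn => // _ fy.
by move: ft; rewrite -fy leye_eq.
Qed.

(** The graph of a stopping time has null vertical sections for a diffuse law, so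
    a conditional density forces [tau] to avoid it. *)
Lemma avoids_of_absolutely_continuous : diffuse_law P tau ->
  absolutely_continuous_conditional_laws P F tau -> avoids_stopping_times P F tau.
Proof.
move=> diff ac sigma ssigma.
pose E (k : nat) : set (Omega * \bar R) := [set p | sigma p.1 = p.2 /\ (p.2 <= k%:R%:E)%E].
have sE k : prod_salgebra (F k%:R) (@measurable _ (\bar R)) (E k).
  by apply: stopped_graph => //; exact: measurable_snd.
have E0 k : {ae P, forall w, ~ E k (w, tau w)}.
  have [kappa [kappaP kappad]] := ac _ (ler0n R k).
  have h := conditional_law_null (Fs (ler0n R k)) (@Fm _ (ler0n R k)) mtau kappaP kappad (sE k).
  exists [set w | E k (w, tau w)]; split => //; last by move=> w /= /contrapT.
    apply: (@prod_salgebra_preimage _ _ _ _ _ _ id tau (@sigma_algebra_measurable d0 Omega) _ _ _ (sE k)).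
    + by move=> A FA; exact: Fm FA.
    + by move=> B mB; rewrite -[X in measurable X]setTI; exact: mtau.
  apply: h; apply: aeW => w; rewrite /pushforward.
  apply/eqP; rewrite -measure_le0 -(diff (sigma w)); apply: le_measure; rewrite ?inE.
  - rewrite -[X in measurable X]setTI; apply: mtau => //; apply: measurable_xsection.
    by rewrite -prod_measurableE; apply: prod_salgebra_le (sE k) => //; exact: Fm.
  - by rewrite -[X in measurable X]setTI; apply: mtau => //; exact: emeasurable_set1.
  - by move=> w' /=; rewrite /xsection /= inE => -[/= -> _].
have : {ae P, forall w, ~ (tau w = sigma w /\ (sigma w < +oo)%E)}.
  apply: filterS (ae_foralln E0) => w h [ts sy].
  have s0 := ssigma.1 w.
  have sfin : sigma w \is a fin_num by rewrite ge0_fin_numE.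
  apply: (h (Num.truncn (fine (sigma w))).+1); split => //=.
  by rewrite ts -(fineK sfin) lee_fin ltW// truncnS_gt.
move=> [N [mN N0 sN]]; apply/eqP; rewrite -measure_le0 -N0; apply: le_measure; rewrite ?inE//.
  have ms : measurable_fun setT sigma.
    apply: (measurability _ (ErealGenOInfty.measurableE R)) => _ /= [_ [r ->] <-].
    rewrite setTI (_ : _ @^-1` _ = ~` [set w | (sigma w <= r%:E)%E]); last first.
      by apply/seteqP; split => w /=; rewrite in_itv/= andbT ltNge => /negP.
    apply: measurableC; have [r0|r0] := leP 0 r; first exact: Fm r0 _ (ssigma.2 r r0).
    rewrite (_ : mkset _ = set0)//; apply/seteqP; split => // w /= tr.
    by have := le_trans (ssigma.1 w) tr; rewrite lee_fin leNgt r0.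
  apply: measurableI.
    have := measurable_fun_eqe mtau ms measurableT (Logic.I : measurable [set true]).
    by rewrite setTI; congr measurable; apply/seteqP; split => w /= /eqP.
  by rewrite -[X in measurable X]setTI; exact: emeasurable_fun_infty_o.
by move=> w /= h; apply: sN => /=; exact.
Qed.

(** Before [tau], the time [S] agrees with an [F]-measurable one; after [tau], it
    does so for each frozen value of [tau]. In both cases a jump of [X] misses it,
    and the density transfers the null set from the product law to the law of
    [(w, tau w)]. *)
Lemma jump_inaccessible_density : absolutely_continuous_conditional_laws P F tau ->
  forall q S, 0 <= q -> measurable_wrt (G q) setT S -> (forall w, q < S w) ->
  forall m, {ae P, forall w, tau_ m w <> (S w)%:E}.
Proof.
move=> ac q S q0 mS qS m.
suff key q' t : q < q' -> q' <= t ->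
    {ae P, forall w, ~ [/\ tau_ m w = (S w)%:E, q' < S w & S w <= t]}.
  have : {ae P, forall w, forall i j : nat, let q' := q + i.+1%:R^-1 in
      ~ [/\ tau_ m w = (S w)%:E, q' < S w & S w <= q' + j%:R]}.
    apply/ae_foralln => i; apply/ae_foralln => j; apply: key; last by rewrite lerDl.
    by rewrite ltrDl invr_gt0.
  apply: filterS => w h tS; have [i iS] := ltr_add_invr (qS w).
  apply: (h i (Num.truncn (S w)).+1); split => //.
  rewrite (le_trans (ltW (truncnS_gt _)))// lerDr addr_ge0//.
move=> qq' q't.
have q'0 : 0 <= q' by rewrite (le_trans q0)// ltW.
have t0 := le_trans q'0 q't.
have /choice[A hA] : forall n, exists A, prod_salgebra (F q') (@measurable _ (\bar R)) A /\
    forall w, S w <= nratr R n <-> A (w, tau w).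
  move=> n; have [A FA AA] := post q0 qq' (wrt_le (nratr R n) mS).
  by exists A.
have [S' [mS' qS' S'E]] := @inf_rational_time R (Omega * \bar R)%type _ A q'
  (smallest_sigma_algebra _ _) (fun n => proj1 (hA n)).
have mS'' : measurable_fun setT ((EFin \o S') : g_sigma_algebraType (F t) * \bar R -> \bar R).
  apply/measurable_EFinP => _ B mB; rewrite -prod_salgebraE; last exact: Fs.
  apply: (prod_salgebra_le (S1 := F q')) (mS' B mB) => //; exact: Fi.
have sE := stopped_graph (stopF m) t0 mS''.
set E := mkset _ in sE.
have [kappa [kappaP kappad]] := ac _ t0.
have E0 : P [set w | E (w, tau w)] = 0%E.
  apply: (conditional_law_null_sections (Fs t0) (@Fm _ t0) mtau kappaP kappad sE) => y.
  have mSy : measurable_wrt (F q') setT (fun w => S' (w, y)).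
    move=> B mB; rewrite setTI; have := mS' B mB; rewrite setTI.
    apply: (prod_salgebra_preimage (Fs q'0) (f := id) (g := fun=> y)) => //.
    move=> B1 mB1; rewrite preimage_cst; case: ifP => _; first by apply: salgT; exact: Fs.
    by case: (Fs q'0).
  have [N [mN N0 sN]] := diffF q'0 mSy (fun w => qS' (w, y)) m.
  apply/eqP; rewrite -measure_le0 -N0; apply: le_measure; rewrite ?inE//.
    apply: measurable_ysection; rewrite -prod_measurableE.
    by apply: prod_salgebra_le sE => //; exact: Fm.
  move=> w; rewrite /ysection/= inE => -[/= h _]; apply: sN => /=; exact.
exists [set w | E (w, tau w)]; split => //.
  apply: (@prod_salgebra_preimage _ _ _ _ _ _ id tau (@sigma_algebra_measurable d0 Omega) _ _ _ sE).
  + by move=> B FB; exact: Fm FB.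
  + by move=> B mB; rewrite -[X in measurable X]setTI; exact: mtau.
move=> w /= /contrapT [tS q'S St].
have S'S : S' (w, tau w) = S w by apply: S'E => // n; rewrite (proj2 (hA n) w).
by split; rewrite /= S'S// lee_fin.
Qed.

(** The martingale of conditional probabilities of [A] given [F] is a martingale
    for [G], so that conditioning [A] on [G q] or on [F q] is the same. *)
Lemma immersion_conditional q t A : martingales_preserved P F G ->
  0 <= q -> q <= t -> F t A ->
  exists c : Omega -> R, [/\ measurable_wrt (F q) setT c, forall w, 0 <= c w &
    forall B, G q B -> (\int[P]_(w in B) (c w)%:E = P (A `&` B))%E].
Proof.
move=> imm q0 qt FA; have t0 := le_trans q0 qt; have mA := Fm t0 FA.
have /choice[cs hcs] : forall s, exists c : Omega -> R, 0 <= s -> [/\ measurable_wrt (F s) setT c,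
    forall w, 0 <= c w & forall B, F s B -> (\int[P]_(w in B) (c w)%:E = P (A `&` B))%E].
  move=> s; have [s0|s0] := leP 0 s.
    by have [c h] := conditional_probability P (Fs s0) (@Fm _ s0) mA; exists c.
  by exists (fun=> 0).
pose M w s := if s < t then cs s w else \1_A w.
have intA B : measurable B -> (\int[P]_(w in B) (\1_A w)%:E = P (A `&` B))%E.
  by move=> mB; rewrite integral_indic.
have Mint s B : 0 <= s -> F s B -> (\int[P]_(w in B) (M w s)%:E = P (A `&` B))%E.
  move=> s0 FB; have [st|ts] := ltP s t.
    rewrite (eq_integral (fun w => (cs s w)%:E)); last by move=> w _; rewrite /M st.
    by have [_ _ h] := hcs s s0; exact: h.
  rewrite (eq_integral (fun w => (\1_A w)%:E)); last by move=> w _; rewrite /M ltNge ts.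
  by apply: intA; exact: Fm FB.
have aM : adapted F M.
  move=> s s0; have [st|st] := ltP s t.
    by rewrite (_ : M ^~ s = cs s); [have [] := hcs s s0|apply/funext => w; rewrite /M st].
  rewrite (_ : M ^~ s = \1_A); last by apply/funext => w; rewrite /M ltNge st.
  apply/measurable_wrtT; first exact: Fs.
  apply: measurable_indic; rewrite measurable_g_salgebraE; last exact: Fs.
  exact: (Fi t0 st).
have M0 w s : 0 <= s -> 0 <= M w s.
  by move=> s0; rewrite /M; case: ifP => // _; have [_ h _] := hcs s s0; exact: h.
have martM : martingale P F M.
  split => //.
  - move=> s s0; apply/integrableP; split.
      apply/measurable_EFinP; exact: (wrt_measurable (@Fm _ s0) (aM s s0)).
    rewrite (eq_integral (fun w => (M w s)%:E)).
      rewrite Mint//; last by apply: salgT; exact: Fs.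
      by rewrite (le_lt_trans (probability_le1 _ _)) ?ltry// setIT.
    by move=> w _; rewrite /= ger0_norm// M0.
  - move=> s u s0 su B FB; rewrite !Mint//; first exact: le_trans su.
    exact: (Fi s0 su).
have [_ _ martG] := imm M martM.
have [qt'|tq] := ltP q t; last first.
  have eqt : q = t by apply/eqP; rewrite eq_le qt.
  exists (\1_A); split => //.
  + apply/measurable_wrtT; first exact: Fs.
    by apply: measurable_indic; rewrite measurable_g_salgebraE ?eqt//; exact: Fs.
  + by move=> B GB; apply: intA; exact: Gm GB.
have [c1 c2 _] := hcs q q0.
exists (cs q); split => // B GB; rewrite -intA; last exact: Gm GB.
have := martG q t q0 qt B GB.
rewrite (eq_integral (fun w => (\1_A w)%:E)); last by move=> w _; rewrite /M ltxx.
by move=> ->; apply: eq_integral => w _; rewrite /M qt'.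
Qed.

Lemma le_of_integrals (S : set_system Omega) (f g : Omega -> R) :
  sigma_algebra setT S -> S `<=` measurable ->
  measurable_wrt S setT f -> measurable_wrt S setT g ->
  P.-integrable setT (EFin \o f) -> P.-integrable setT (EFin \o g) ->
  (forall B, S B -> \int[P]_(w in B) (f w)%:E <= \int[P]_(w in B) (g w)%:E)%E ->
  {ae P, forall w, f w <= g w}.
Proof.
move=> hS Sm mf mg intf intg fg.
have mf' : measurable_fun setT f by move=> _ B mB; apply: Sm; exact: mf.
have mg' : measurable_fun setT g by move=> _ B mB; apply: Sm; exact: mg.
pose B := [set w | g w < f w].
have SB : S B.
  have h : measurable_fun setT ((fun w => g w < f w) : g_sigma_algebraType S -> bool).
    by apply: measurable_fun_ltr; apply/(measurable_wrtT _ hS).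
  by have := h measurableT [set true] (Logic.I : measurable [set true]); rewrite setTI measurable_g_salgebraE.
have mB := Sm _ SB.
exists B; split => //; last by move=> w /= /negP; rewrite -ltNge.
have fB : P.-integrable B (EFin \o f) by exact: integrableS intf.
have gB : P.-integrable B (EFin \o g) by exact: integrableS intg.
have : (\int[P]_(w in B) `|(f w - g w)%:E| = 0)%E.
  apply/eqP; rewrite eq_le integral_ge0// andbT.
  rewrite (eq_integral (fun w => (f w)%:E - (g w)%:E)%E); last first.
    by move=> w; rewrite inE /B /= => gf; rewrite ger0_norm ?subr_ge0 ?ltW// EFinB.
  by rewrite integralB// leeBlDr ?add0e ?fg// integrable_fin_num.
have mfg : measurable_fun B (fun w => (f w - g w)%:E : \bar R).
  by apply/measurable_EFinP; apply: measurable_funB; exact: measurable_funTS.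
move=> /(ae_eq_integral_abs P mB mfg).1 [N [mN N0 sN]].
apply/eqP; rewrite -measure_le0 -N0; apply: le_measure; rewrite ?inE//.
move=> w Bw; apply: sN => /= /(_ Bw) /eqP; rewrite eqe subr_eq0 => /eqP fgw.
by move: Bw; rewrite /B /= fgw ltxx.
Qed.

End inaccessible.

(** * Predictable sets *)

Section predictable_theory.
Context (R : realType) (d0 : measure_display) (Omega : measurableType d0).
Variable K : R -> set_system Omega.

Lemma salg_preimage (T U : Type) (S : set_system T) (f : T -> U) : sigma_algebra setT S ->
  sigma_algebra setT [set E : set U | S (f @^-1` E)].
Proof.
move=> hS; split => /=; first by rewrite preimage_set0; case: hS.
- by move=> A; rewrite setTD preimage_setC; exact: salgC.
- by move=> A SA; rewrite preimage_bigcup; exact: salg_bigcup.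
Qed.

Lemma predictable_salg : sigma_algebra setT (predictable K).
Proof. exact: smallest_sigma_algebra. Qed.

Definition predictableType := g_sigma_algebraType (predictable K).

Lemma predictable_rect A s t : 0 <= s -> s < t -> K s A -> predictable K (A `*` `]s, t]).
Proof. by move=> s0 st KA; apply: sub_sigma_algebra; right; exists A, s, t. Qed.

Lemma predictable_rect0 A : K 0 A -> predictable K (A `*` [set 0]).
Proof. by move=> KA; apply: sub_sigma_algebra; left; exists A. Qed.

Lemma predictable_ray A s : 0 <= s -> K s A -> predictable K (A `*` [set t | s < t]).
Proof.
move=> s0 KA; rewrite (_ : _ `*` _ = \bigcup_n (A `*` `]s, s + n.+1%:R])).
  by apply: salg_bigcup; [exact: predictable_salg|move=> n; apply: predictable_rect; rewrite ?ltrDl].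
apply/seteqP; split => [[w t] [/= Aw st]|[w t] [n _ [/= Aw]]]; last first.
  by rewrite in_itv/= => /andP[].
exists (Num.truncn (t - s)) => //; split => //=; rewrite in_itv/= st/= -lerBlDl.
exact/ltW/truncnS_gt.
Qed.

Hypothesis fK : filtration K.

Let Ks t : 0 <= t -> sigma_algebra setT (K t). Proof. by case: fK => + _ _; exact. Qed.
Let Km t : 0 <= t -> K t `<=` measurable. Proof. by case: fK => _ + _; exact. Qed.
Let Ki s t : 0 <= s -> s <= t -> K s `<=` K t. Proof. by case: fK => _ _; exact. Qed.
Let KT t : 0 <= t -> K t setT. Proof. by move=> t0; apply: salgT; exact: Ks. Qed.

Lemma predictable_all_times : predictable K (@all_times R _ Omega).
Proof.
rewrite (_ : @all_times R _ Omega = setT `*` [set 0] `|` setT `*` [set t | 0 < t]).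
  apply: (salgU predictable_salg).
  - by apply: predictable_rect0; exact: KT.
  - by apply: predictable_ray => //; exact: KT.
apply/seteqP; split => [[w t] [_]|[w t] [[_ /= ->]|[_ /=]]]; rewrite /all_times/=.
- rewrite in_itv/= andbT le_eqVlt => /predU1P[<-|t0]; by [left|right].
- by split => //=; rewrite in_itv/= lexx.
- by move=> t0; split => //=; rewrite in_itv/= ltW.
Qed.

Lemma predictable_oc s t : 0 <= s -> predictable K (setT `*` `]s, t]).
Proof.
move=> s0; have [st|ts] := ltP s t; first by apply: predictable_rect => //; exact: KT.
rewrite (_ : _ `*` _ = set0); first by case: predictable_salg.
by apply/seteqP; split => // -[w x] [_ /=]; rewrite in_itv/= => /andP[/lt_le_trans h /h]; rewrite ltNge ts.
Qed.

Lemma predictable_horizon T : 0 <= T -> predictable K (@horizon R _ Omega T).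
Proof.
move=> T0; rewrite (_ : horizon T = setT `*` [set 0] `|` setT `*` `]0, T]).
  apply: (salgU predictable_salg).
  - by apply: predictable_rect0; exact: KT.
  - exact: predictable_oc.
apply/seteqP; split => [[w t] [_]|[w t] [[_ /= ->]|[_ /=]]]; rewrite /horizon/=.
- by rewrite in_itv/= le_eqVlt => /andP[/predU1P[<-|t0] tT]; [left|right; rewrite /= in_itv/= t0].
- by split => //=; rewrite in_itv/= lexx.
- by rewrite in_itv/= => /andP[t0 tT]; split => //=; rewrite in_itv/= ltW.
Qed.

Lemma predictable_measurable : predictable K `<=` measurable.
Proof.
apply: smallest_sub; first exact: sigma_algebra_measurable.
move=> E [[A KA ->]|[A [s [t [s0 st KA ->]]]]]; apply: measurableX => //.
- exact: (Km (lexx 0)).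
- exact: (Km s0).
Qed.

Lemma predictable_section E t : 0 <= t -> predictable K E -> K t [set w | E (w, t)].
Proof.
move=> t0; have : sigma_algebra setT [set E : set (Omega * R) | K t ((fun w => (w, t)) @^-1` E)].
  by apply: salg_preimage; exact: Ks.
move=> hS; apply: (smallest_sub hS) => {}E [[A KA ->]|[A [s [u [s0 su KA ->]]]]] /=.
- rewrite (_ : _ @^-1` _ = if t == 0 then A else set0); last first.
    by case: eqP => [->|nt]; apply/seteqP; split => w //=; case.
  by case: eqP => [->//|_]; case: (Ks t0).
- rewrite (_ : _ @^-1` _ = if s < t <= u then A else set0); last first.
    apply/seteqP; split => w /=; rewrite in_itv/=; first by case=> Aw ->.
    by case: ifP.
  case: ifPn => [/andP[st tu]|_]; last by case: (Ks t0).
  by apply: Ki KA => //; exact: ltW.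
Qed.

Lemma predictable_time : measurable_fun setT ((fun p => Num.max 0 p.2) : predictableType -> R).
Proof.
apply: (measurability _ (@RGenOInfty.measurableE R)) => _ /= [_ [x ->] <-].
rewrite setTI measurable_g_salgebraE; last exact: predictable_salg.
have [x0|x0] := leP 0 x.
  rewrite (_ : _ @^-1` _ = setT `*` [set t | x < t]); first by apply: predictable_ray => //; exact: KT.
  apply/seteqP; split => [[w t] /=|[w t] [_ /= xt]]; rewrite in_itv/= andbT lt_max.
    by rewrite ltNge x0.
  by rewrite xt orbT.
rewrite (_ : _ @^-1` _ = setT); first by apply: salgT; exact: predictable_salg.
by apply/seteqP; split => // -[w t] _ /=; rewrite in_itv/= andbT lt_max x0.
Qed.

(** What is known at time [q] is predictable strictly after [q]. *)
Lemma predictable_future q E : 0 <= q -> prod_salgebra (K q) (@measurable _ R) E ->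
  predictable K (E `&` [set p | q < p.2]).
Proof.
move=> q0 hE.
pose Q : set (Omega * R) := [set p | q < p.2].
have PQ : predictable K Q.
  rewrite (_ : Q = setT `*` [set t | q < t]); first by apply: predictable_ray => //; exact: KT.
  by apply/seteqP; split => [[w t] /=|[w t] [_ /=]].
have snd B : @measurable _ R B -> predictable K [set p | B (Num.max 0 p.2)].
  by move=> mB; have := predictable_time measurableT mB; rewrite setTI measurable_g_salgebraE//; exact: predictable_salg.
suff : <<s [set E | exists A1 B1, [/\ K q A1, @measurable _ R B1 & E = A1 `*` B1]] >> `<=`
    [set E | predictable K (E `&` Q)] by apply.
apply: smallest_sub.
  split => /=; first by rewrite set0I; case: predictable_salg.
  - move=> A h; rewrite setTD (_ : _ `&` _ = Q `\` (A `&` Q)).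
      by apply: (salgD predictable_salg).
    by apply/seteqP; split => p [h1 h2]; split => //= h3; [case: h3|apply: h2].
  - by move=> A h; rewrite setI_bigcupl; apply: salg_bigcup => //; exact: predictable_salg.
move=> _ [A [B [KA mB ->]]] /=.
rewrite (_ : _ `&` _ = (A `*` [set t | q < t]) `&` [set p | B (Num.max 0 p.2)]).
  by apply: (salgI predictable_salg); [exact: predictable_ray|exact: snd].
by apply/seteqP; split => [[w t] [[/= Aw Bt] qt]|[w t] [[/= Aw qt] Bt]];
  have t0 := le_lt_trans q0 qt; rewrite /= maxEle (ltW t0) in Bt *.
Qed.

End predictable_theory.

Section left_grid.
Context (R : realType).

(** The largest point of the grid of mesh 2^-k that lies strictly before t. *)
Definition grid_left (k : nat) (t : R) : R :=
  Num.max 0 ((Num.ceil (t * 2 ^+ k) - 1)%:~R / 2 ^+ k).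

Lemma grid_left_cell k (j : nat) t : j%:R / 2 ^+ k < t <= j.+1%:R / 2 ^+ k ->
  grid_left k t = j%:R / 2 ^+ k.
Proof.
have p2 : 0 < 2 ^+ k :> R by rewrite exprn_gt0.
rewrite ltr_pdivrMr// ler_pdivlMr// => /andP[h1 h2]; rewrite /grid_left.
have -> : Num.ceil (t * 2 ^+ k) = j.+1%:Z.
  apply: ceil_def; rewrite (_ : (j.+1%:Z - 1)%:~R = j%:R :> R) ?h1//.
  by rewrite -addn1 PoszD addrK.
rewrite (_ : (j.+1%:Z - 1)%:~R = j%:R :> R); last by rewrite -addn1 PoszD addrK.
by rewrite max_r// divr_ge0// ltW.
Qed.

Lemma grid_left_in k t : 0 < t ->
  exists j : nat, grid_left k t = j%:R / 2 ^+ k /\ j%:R / 2 ^+ k < t <= j.+1%:R / 2 ^+ k.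
Proof.
move=> t0; have p2 : 0 < 2 ^+ k :> R by rewrite exprn_gt0.
pose c := Num.ceil (t * 2 ^+ k); have c0 : 0 < c by rewrite ceil_gt0 mulr_gt0.
have [j cj] : exists j : nat, c = j.+1%:Z.
  by exists (absz c).-1; rewrite prednK ?absz_gt0 ?gt_eqF// gtz0_abs.
have h : j%:R / 2 ^+ k < t <= j.+1%:R / 2 ^+ k.
  rewrite ltr_pdivrMr// ler_pdivlMr//.
  have := ceil_itv (t * 2 ^+ k); rewrite -/c cj => /andP[h1 h2]; apply/andP; split => //.
  by move: h1; rewrite -addn1 PoszD addrK.
by exists j; split => //; exact: grid_left_cell.
Qed.

Lemma grid_left0 k : grid_left k 0 = 0.
Proof.
by rewrite /grid_left mul0r ceil0 sub0r max_l// mulrNz mulr1z mulN1r oppr_le0 invr_ge0 exprn_ge0.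
Qed.

Lemma grid_left_ge0 k t : 0 <= grid_left k t. Proof. by rewrite le_max lexx. Qed.

Lemma grid_left_lt k t : 0 < t -> grid_left k t < t.
Proof. by move=> /(grid_left_in k)[j [-> /andP[]]]. Qed.

Lemma grid_left_near (t : R) e : 0 < t -> 0 < e -> \forall k \near \oo, t - e <= grid_left k t.
Proof.
move=> t0 e0; exists (Num.truncn e^-1).+1 => // k /= ek.
have [j [-> /andP[_ h]]] := grid_left_in k t0.
have p2 : 0 < 2 ^+ k :> R by rewrite exprn_gt0.
rewrite lerBlDr (le_trans h)// -natr1 mulrDl lerD2l mul1r.
rewrite -[leRHS]invrK lef_pV2 ?posrE ?invr_gt0//.
rewrite (le_trans (ltW (truncnS_gt _)))// -natrX ler_nat.
by rewrite (leq_trans ek)// ltnW// ltn_expl.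
Qed.

(** Left limits are limits of samples on the dyadic grid, which makes them
    predictable. *)
Lemma left_limit_grid (V : normedModType R) (y : R -> V) (t : R) : 0 < t ->
  cvg (y s @[s --> t^'-]) -> y (grid_left k t) @[k --> \oo] --> left_limit y t.
Proof.
move=> t0 cy; apply: cvg_trans cy => A [e /= e0 hA]; have e20 : 0 < e / 2 by rewrite divr_gt0.
near_simpl; near=> k; apply: hA => /=; last by rewrite grid_left_lt.
have h1 : t - e / 2 <= grid_left k t by near: k; exact: grid_left_near.
have h2 := grid_left_lt k t0.
by rewrite ger0_norm ?subr_ge0 ?(ltW h2)//; lra.
Unshelve. all: by end_near. Qed.

End left_grid.

Section left_sampling.
Context (R : realType) (d0 : measure_display) (Omega : measurableType d0).
Variable K : R -> set_system Omega.
Hypothesis fK : filtration K.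
Let Ks t : 0 <= t -> sigma_algebra setT (K t). Proof. by case: fK => + _ _; exact. Qed.

Lemma adapted_grid_left d (V : measurableType d) (Y : Omega -> R -> V) k : adapted K Y ->
  predictable_on K (@all_times R _ Omega) (fun w t => Y w (grid_left k t)).
Proof.
move=> aY B mB; have p2 : 0 < 2 ^+ k :> R by rewrite exprn_gt0.
have j0 (j : nat) : 0 <= j%:R / 2 ^+ k :> R by rewrite divr_ge0// ltW.
have KY t : 0 <= t -> K t ((Y ^~ t) @^-1` B) by move=> /aY /(_ B mB); rewrite setTI.
rewrite (_ : _ `&` _ = ((Y ^~ 0) @^-1` B) `*` [set 0] `|`
    \bigcup_j (((Y ^~ (j%:R / 2 ^+ k)) @^-1` B) `*` `]j%:R / 2 ^+ k, j.+1%:R / 2 ^+ k])).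
  apply: (salgU (predictable_salg K)).
    by apply: predictable_rect0; exact: KY.
  apply: salg_bigcup; first exact: predictable_salg.
  move=> j; apply: predictable_rect => //; last exact: KY.
  by rewrite ltr_pM2r ?invr_gt0// ltr_nat.
apply/seteqP; split => [[w t] [[_ /=]]|[w t] [[/= h ->]|[j _ [/= h]]]].
- rewrite in_itv/= andbT le_eqVlt => /predU1P[<-|t0].
    by rewrite /= grid_left0 => h; left.
  have [j [-> h]] := grid_left_in k t0; move=> Bh; right; by exists j.
- by rewrite grid_left0; split => //; split => //=; rewrite in_itv/= lexx.
- rewrite in_itv/= => jt; rewrite /= (grid_left_cell jt); split => //; split => //=.
  by case/andP: jt => jt _; rewrite in_itv/= andbT (le_trans (j0 j))// ltW.
Qed.

End left_sampling.

(** * Regular conditional laws of a time *)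

Section stieltjes_measure.
Context (R : realType).

Lemma dS_oc (A : R -> R) s t : increasing_path A -> 0 <= s -> s <= t ->
  dS A `]s, t]%classic = (A t - A s)%:E.
Proof.
move=> hA s0 st; rewrite /dS; case: pselect => // h.
rewrite /= /lebesgue_stieltjes_measure/= /measure_extension/= measurable_mu_extE/=; last exact: is_ocitv.
rewrite wlength_itv_bnd// /path_cumulative /nonneg_time.
by rewrite !max_r// (le_trans s0).
Qed.

Lemma dS_le0 (A : R -> R) : dS A `]-oo, 0]%classic = 0%E.
Proof.
rewrite /dS; case: pselect => //= h.
rewrite (_ : [set` _] = \bigcup_n `](- n%:R), 0]%classic); last first.
  apply/seteqP; split => x; rewrite /= ?in_itv/=.
    move=> x0; exists (Num.truncn (- x)).+1 => //=; rewrite in_itv/= x0 andbT.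
    by rewrite ltrNl; exact: truncnS_gt.
  by move=> [n _ /=]; rewrite in_itv/= => /andP[].
apply/eqP; rewrite -measure_le0.
apply: (le_trans (measure_sigma_subadditive _ _ _ (@subset_refl _ _))).
- by move=> n; exact: measurable_itv.
- by apply: bigcupT_measurable => n; exact: measurable_itv.
rewrite eseries0// => n _ _; rewrite /= /lebesgue_stieltjes_measure/= /measure_extension/=.
rewrite measurable_mu_extE/=; last exact: is_ocitv.
rewrite wlength_itv_bnd ?oppr_le0// /path_cumulative /nonneg_time.
by rewrite !max_l ?subrr// oppr_le0.
Qed.

Lemma dS_pos (A : R -> R) (c : R) : increasing_path A -> (forall t, 0 <= t -> A t - A 0 <= c) ->
  (dS A setT <= c%:E)%E.
Proof.
move=> hA Ac.
have h : dS A (`]0, n%:R]%classic) @[n --> \oo] --> dS A (\bigcup_n `]0, n%:R]%classic).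
  apply: nondecreasing_cvg_mu => [n||a b ab]; first exact: measurable_itv.
    by apply: bigcupT_measurable => n; exact: measurable_itv.
  apply/subsetPset => x; rewrite /= !in_itv/= => /andP[-> /le_trans]; apply.
  by rewrite ler_nat.
have -> : dS A setT = dS A (\bigcup_n `]0, n%:R]%classic).
  have mU : measurable (\bigcup_n `]0, n%:R]%classic : set (measurableTypeR R)).
    by apply: bigcupT_measurable => n; exact: measurable_itv.
  apply/eqP; rewrite eq_le; apply/andP; split; last by apply: le_measure; rewrite ?inE.
  rewrite (_ : setT = (\bigcup_n `]0, n%:R]%classic) `|` `]-oo, 0]%classic); last first.
    apply/esym/seteqP; split => // x _; have [x0|x0] := leP x 0; first by right; rewrite /= in_itv.
    left; exists (Num.truncn x).+1 => //=; rewrite in_itv/= x0 ltW//; exact: truncnS_gt.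
  rewrite measureU0//; exact: dS_le0.
rewrite -(cvg_lim _ h)//; apply: lime_le; first by apply/cvg_ex; eexists; exact: h.
by apply: nearW => n; rewrite dS_oc// lee_fin Ac.
Qed.

End stieltjes_measure.

Lemma time_graph (R : realType) (T : pointedType) (S : set_system T) (f : T -> R) : sigma_algebra setT S ->
  measurable_wrt S setT f -> prod_salgebra S (@measurable _ (\bar R)) [set p | p.2 = (f p.1)%:E].
Proof.
move=> hS mf; rewrite prod_salgebraE//.
have h : measurable_fun setT ((fun p => (p.2 == (f p.1)%:E)) : g_sigma_algebraType S * \bar R -> bool).
  apply: measurable_fun_eqe; first exact: measurable_snd.
  apply/measurable_EFinP; apply: (measurableT_comp _ measurable_fst).
  by apply/(measurable_wrtT _ hS).
have := h measurableT [set true] (Logic.I : measurable [set true]); rewrite setTI.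
by congr measurable; apply/seteqP; split => p /= /eqP.
Qed.

Section law_of_a_time.
Context (R : realType) (d0 : measure_display) (Omega : measurableType d0).
Variable P : probability Omega R.
Variables (S S' : set_system Omega) (sigma : Omega -> \bar R).
Hypotheses (hS : sigma_algebra setT S) (Sm : S `<=` measurable).
Hypotheses (hS' : sigma_algebra setT S') (Sm' : S' `<=` measurable) (SS' : S `<=` S').
Hypothesis msigma : measurable_fun setT sigma.
Hypothesis sigma_gt0 : forall w, (0 < sigma w)%E.

Hypothesis cond : forall t : R, exists c : Omega -> R, [/\ measurable_wrt S setT c, forall w, 0 <= c w &
  forall B, S' B -> (\int[P]_(w in B) (c w)%:E = P ([set w | (sigma w <= t%:E)%E] `&` B))%E].

Let mle (x : R) : measurable [set w | (sigma w <= x%:E)%E].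
Proof. by rewrite -[X in measurable X]setTI; exact: measurable_lee. Qed.

Lemma conditional_cdf : exists H : Omega -> R -> R,
  [/\ forall w, increasing_path (H w), forall w t, 0 <= H w t <= 1,
      forall t, measurable_wrt S setT (H ^~ t) &
      forall t A, S' A -> (\int[P]_(w in A) (H w t)%:E = P (A `&` [set w | (sigma w <= t%:E)%E]))%E].
Proof.
have /choice[c hc] := cond.
have c0 t w : 0 <= c t w by have [] := hc t.
have mc t : measurable_wrt S setT (c t) by have [] := hc t.
have mc' t : measurable_fun setT (c t) by move=> _ B mB; apply: Sm; exact: mc.
have cE t B : S' B -> (\int[P]_(w in B) (c t w)%:E = P (B `&` [set w | (sigma w <= t%:E)%E]))%E.
  by have [_ _ h] := hc t => /h ->; rewrite setIC.
pose E w t := [set x | x = 1 \/ exists n, t < nratr R n /\ x = c (nratr R n) w].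
have E0 w t : E w t !=set0 by exists 1; left.
have El w t : has_inf (E w t).
  by split; [exact: E0|exists 0 => x [->|[n [_ ->]]]; [exact: ler01|exact: c0]].
pose H w t := inf (E w t).
have Hlt w t x : H w t < x <-> (1 < x \/ exists n, t < nratr R n /\ c (nratr R n) w < x).
  split.
    move=> h; have := @inf_lt _ (E w t) x (E0 w t) h => -[y [->|[n [tn ->]]] yx]; first by left.
    by right; exists n.
  move=> [x1|[n [tn cx]]].
    by apply: le_lt_trans x1; apply: ge_inf; [exact: (El w t).2|left].
  by apply: le_lt_trans cx; apply: ge_inf; [exact: (El w t).2|right; exists n].
have H0 w t : 0 <= H w t.
  by apply: lb_le_inf => // x [->|[n [_ ->]]]; [exact: ler01|exact: c0].
have H1 w t : H w t <= 1 by apply: ge_inf; [exact: (El w t).2|left].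
have Hmono w s t : s <= t -> H w s <= H w t.
  move=> st; rewrite leNgt; apply/negP => /Hlt[|[n [tn cn]]].
    by rewrite ltNge H1.
  have : H w s < H w s by apply/Hlt; right; exists n; split => //; exact: le_lt_trans tn.
  by rewrite ltxx.
have mH t : measurable_wrt S setT (H ^~ t).
  apply/(measurable_wrtT _ hS).
  apply: (measurability _ (@RGenInftyO.measurableE R)) => _ /= [_ [x ->] <-].
  rewrite setTI measurable_g_salgebraE//.
  rewrite (_ : _ @^-1` _ = (if 1 < x then setT else set0) `|`
      \bigcup_n (if t < nratr R n then [set w | c (nratr R n) w < x] else set0)).
    apply: salgU => //; first by case: ifP => _; [exact: salgT|case: hS].
    apply: salg_bigcup => // n; case: ifP => _; last by case: hS.
    rewrite (_ : mkset _ = setT `&` c (nratr R n) @^-1` `]-oo, x[); first exact: mc.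
    by rewrite setTI; apply/seteqP; split => w /=; rewrite in_itv.
  apply/seteqP; split => w /=; rewrite in_itv/=.
    move=> /Hlt[->|[n [tn cx]]]; first by left.
    by right; exists n => //; rewrite tn.
  move=> [|[n _]]; case: ifP => // h; first by move=> _; apply/Hlt; left.
  by move=> cx; apply/Hlt; right; exists n.
exists H; split => //.
- move=> w; split.
    by move=> s t st; apply: Hmono; rewrite ge_max !le_max lexx st orbT.
  move=> t; apply/cvgrPdist_lt => e e0.
  have : H w (Num.max 0 t) < H w (Num.max 0 t) + e by rewrite ltrDl.
  have near_lt x : Num.max 0 t < x -> \forall s \near t^'+, Num.max 0 s < x.
    rewrite gt_max => /andP[x0 tx]; exists (x - t) => /=; first by rewrite subr_gt0.
    move=> s /= + ts; rewrite gt_max x0 /= ltr0_norm ?subr_lt0// opprB ltrD2r.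
    exact.
  rewrite /nonneg_time /=.
  have fin y : H w (Num.max 0 t) <= y -> y < H w (Num.max 0 t) + e -> `|H w (Num.max 0 t) - y| < e.
    by move=> h1 h2; rewrite ler0_norm ?subr_le0// opprB ltrBlDl.
  move=> /Hlt[h1|[n [tn cn]]].
    near=> s; apply: fin => //.
    + apply: Hmono; rewrite ge_max !le_max lexx/=; apply/orP; right.
      by apply: ltW; near: s; exact: nbhs_right_gt.
    + exact: le_lt_trans h1.
  near=> s; apply: fin => //.
  + apply: Hmono; rewrite ge_max !le_max lexx/=; apply/orP; right.
    by apply: ltW; near: s; exact: nbhs_right_gt.
  + by apply/Hlt; right; exists n; split => //; near: s; exact: near_lt.
- by move=> w t; rewrite H0 H1.
move=> t A SA; have mA := Sm' SA.
have mHt : measurable_fun setT (H ^~ t) by move=> _ B mB; apply: Sm; exact: mH.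
apply/eqP; rewrite eq_le; apply/andP; split.
- have cv : P (A `&` [set w | (sigma w <= (t + n.+1%:R^-1)%:E)%E]) @[n --> \oo] -->
      P (\bigcap_n (A `&` [set w | (sigma w <= (t + n.+1%:R^-1)%:E)%E])).
    apply: nonincreasing_cvg_mu.
    + by rewrite (le_lt_trans (probability_le1 _ _)) ?ltry//; exact: measurableI.
    + by move=> n; exact: measurableI.
    + by apply: bigcapT_measurable => n; exact: measurableI.
    + move=> a b ab; apply/subsetPset; apply: setIS => w /= /le_trans; apply.
      by rewrite lee_fin lerD2l lef_pV2 ?posrE// ler_nat.
  have -> : A `&` [set w | (sigma w <= t%:E)%E] =
      \bigcap_n (A `&` [set w | (sigma w <= (t + n.+1%:R^-1)%:E)%E]).
    apply/seteqP; split => w.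
      move=> [Aw st] n _; split => //=; apply: (le_trans st).
      by rewrite lee_fin lerDl invr_ge0.
    move=> h; split; first by have [] := h 0%N Logic.I.
    rewrite /=; apply/lee_addgt0Pr => e e0.
    have [_ /= /le_trans] := h (Num.truncn e^-1) Logic.I; apply.
    rewrite -EFinD lee_fin lerD2l -[leRHS]invrK lef_pV2 ?posrE ?invr_gt0//.
    exact/ltW/truncnS_gt.
  rewrite -(cvg_lim _ cv)//; apply: lime_ge; first by apply/cvg_ex; eexists; exact: cv.
  apply: nearW => n.
  have tn : t < t + n.+1%:R^-1 by rewrite ltrDl.
  have [m /andP[tm mn]] := nratr_between tn.
  apply: (@le_trans _ _ (\int[P]_(w in A) (c (nratr R m) w)%:E)%E).
    apply: ge0_le_integral => //.
    + by move=> w _; rewrite lee_fin.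
    + by exact/measurable_EFinP/measurable_funTS.
    + by exact/measurable_EFinP/measurable_funTS.
    + by move=> w _; rewrite lee_fin; apply: ge_inf; [exact: (El w t).2|right; exists m].
  rewrite cE//; apply: le_measure; rewrite ?inE; [exact: measurableI|exact: measurableI|].
  by apply: setIS => w /= /le_trans; apply; rewrite lee_fin ltW.
- have ct x : P.-integrable setT (EFin \o c x).
    apply/integrableP; split; first exact/measurable_EFinP.
    rewrite (eq_integral (fun w => (c x w)%:E)); last by move=> w _; rewrite /= ger0_norm.
    rewrite cE; last exact: (salgT hS').
    by rewrite (le_lt_trans (probability_le1 _ _)) ?ltry//; exact: measurableI.
  have ae : {ae P, forall w, forall n, t < nratr R n -> c t w <= c (nratr R n) w}.
    apply/ae_foralln => n; have [tn|nt] := ltP t (nratr R n); last by apply: aeW.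
    have : {ae P, forall w, c t w <= c (nratr R n) w}.
      apply: (le_of_integrals hS Sm) => // B SB; have mB := Sm SB.
      rewrite !cE//; try exact: SS'.
      apply: le_measure; rewrite ?inE; [exact: measurableI|exact: measurableI|].
      by apply: setIS => w /= /le_trans; apply; rewrite lee_fin ltW.
    by apply: filterS => w.
  have ae1 : {ae P, forall w, c t w <= 1}.
    apply: (le_of_integrals hS Sm) => //.
    + by apply/(measurable_wrtT _ hS).
    + exact: finite_measure_integrable_cst.
    + move=> B SB; have mB := Sm SB; rewrite cE; [|exact: SS']; rewrite integral_cst// mul1e.
      by apply: le_measure; rewrite ?inE//; exact: measurableI.
  rewrite -cE//; apply: ae_ge0_le_integral => //.
  + by move=> w _; rewrite lee_fin.
  + by exact/measurable_EFinP/measurable_funTS.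
  + by move=> w _; rewrite lee_fin.
  + by exact/measurable_EFinP/measurable_funTS.
  + move: ae ae1; apply: filterS2 => w h h1 _; rewrite lee_fin.
    by apply: lb_le_inf => // x [->//|[n [tn ->]]]; exact: h.
Unshelve. all: by end_near. Qed.

Let leEN (x : R) : [set y : \bar R | (y <= x%:E)%E] = ~` [set y | (x%:E < y)%E].
Proof. by apply/seteqP; split => y /=; rewrite leNgt => /negP. Qed.

(** The conditional distribution functions at rational times are made
    right-continuous by an infimum over rationals. They are then nondecreasing for
    every [w], so that no exceptional set has to be removed. The density [c] of
    [cond] serves both sigma-algebras, hence so does the law built from it. *)
Lemma common_conditional_law : exists kappa : Omega -> probability (\bar R) R,
  regular_conditional_law P S sigma kappa /\ regular_conditional_law P S' sigma kappa.
Proof.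
have [H [Hinc H01 mH HE]] := conditional_cdf.
have mass_le1 w : (dS (H w) setT <= 1)%E.
  apply: dS_pos => // t t0; have /andP[_ h1] := H01 w t; have /andP[h0 _] := H01 w 0; lra.
have mass_fin w : dS (H w) setT \is a fin_num.
  by rewrite ge0_fin_numE// (le_lt_trans (mass_le1 w))// ltry.
have m0 w : 0 <= 1 - fine (dS (H w) setT).
  by rewrite subr_ge0 -lee_fin fineK.
have mE : measurable_fun setT (EFin : measurableTypeR R -> \bar R) by exact: EFin_measurable.
pose kk (w : Omega) : {measure set (\bar R) -> \bar R} :=
  measure_add (pushforward (dS (H w)) (EFin : measurableTypeR R -> \bar R))
    (mscale (NngNum (m0 w)) (\d_(+oo%E : \bar R))).
pose k0 := kk mE.
have k0E (w : Omega) (B : set (\bar R)) : measurable B -> k0 w B =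
    (dS (H w) (EFin @^-1` B) + (1 - fine (dS (H w) setT))%:E * \d_(+oo%E : \bar R) B)%E.
  by move=> mB; exact: measure_addE.
have k01 (w : Omega) : k0 w setT = 1%E.
  rewrite k0E// preimage_setT diracT mule1 -[X in (X + _)%E](fineK (mass_fin w)) -EFinD.
  by rewrite addrCA subrr addr0.
pose kappa w : probability (\bar R) R :=
  HB.pack (k0 w : set (\bar R) -> \bar R) (k0 w) (Measure_isProbability.Build _ _ _ (k0 w) (k01 w)).
have kE w B : kappa w B = k0 w B by [].
exists kappa.
have ray w (x : R) : 0 <= x -> kappa w [set y | (x%:E < y)%E] = (1 - (H w x - H w 0))%:E.
  move=> x0; have mB : measurable [set y : \bar R | (x%:E < y)%E].
    by rewrite -[X in measurable X]setTI; exact: measurable_lte.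
  have mC : measurable [set y : \bar R | (y <= x%:E)%E].
    by rewrite -[X in measurable X]setTI; exact: measurable_lee.
  rewrite -[X in kappa w X]setCK -leEN probability_setC// kE k0E//.
  rewrite diracE memNset ?mule0 ?adde0; last by rewrite /= leNgt ltry.
  rewrite (_ : _ @^-1` _ = `]-oo, 0]%classic `|` `]0, x]%classic); last first.
    apply/seteqP; split => y; rewrite /= !in_itv/= lee_fin.
      by move=> ->; rewrite andbT; have [_|_] := leP y 0; [left|right].
    by move=> [/le_trans|/andP[]//]; exact.
  transitivity (1 - (H w x - H w 0)%:E)%E => //; congr (1 - _)%E.
  transitivity (dS (H w) `]-oo, 0%R]%classic + dS (H w) `]0%R, x]%classic)%E.
    apply: measureU; [exact: measurable_itv|exact: measurable_itv|].
    by apply/seteqP; split => // y [/=]; rewrite !in_itv/= => y0 /andP[/lt_le_trans/(_ y0)]; rewrite ltxx.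
  by rewrite dS_le0 add0e dS_oc.
clear kE; clearbody kappa.
pose Q (B : set (\bar R)) := measurable_wrt S setT (fun w => kappa w B : \bar R) /\
  forall A, S' A -> P (A `&` sigma @^-1` B) = (\int[P]_(w in A) kappa w B)%E.
suff : forall B, <<s @ErealGenOInfty.G R >> B -> Q B.
  move=> h; have {}h B : measurable B -> Q B.
    by move=> mB; apply: h; exact: (eq_ind _ (fun S => S B) mB _ (ErealGenOInfty.measurableE R)).
  split; split => [B mB|A B SA mB]; have [h1 h2] := h B mB => //.
  - by apply: h2; exact: SS'.
  - by move=> D mD; apply: SS'; exact: h1.
  - exact: h2.
have mkS B : Q B -> measurable_fun setT (fun w => kappa w B : \bar R).
  by move=> [h _] _ C mC; apply: Sm; exact: h.
have msB (B : set (\bar R)) : measurable B -> measurable (sigma @^-1` B).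
  by move=> mB; rewrite -[X in measurable X]setTI; exact: msigma.
have i1 B : Q B -> measurable B -> forall A, S' A -> P.-integrable A (fun w => kappa w B).
  move=> QB mB A SA; have mA := Sm' SA.
  have c1 : P.-integrable A (cst 1%E).
    by apply: (integrableS measurableT) => //; exact: finite_measure_integrable_cst.
  apply: le_integrable c1 => //; first by apply: measurable_funTS; exact: mkS.
  by move=> w _; rewrite /= gee0_abs// normr1; exact: (probability_le1 (kappa w) mB).
have QT : Q setT.
  split; first by apply/(measurable_wrtT _ hS); rewrite (_ : (fun w => _) = cst 1%E)//; apply/funext => w; rewrite probability_setT.
  move=> A SA; rewrite preimage_setT setIT (eq_integral (cst 1%E)); last by move=> w _; rewrite probability_setT.
  by rewrite integral_cst ?mul1e//; exact: Sm'.
have QC (B : set (\bar R)) : measurable B -> Q B -> Q (~` B).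
  move=> mB QB; split.
    apply/(measurable_wrtT _ hS); rewrite (_ : (fun w => _) = (fun w => 1 - kappa w B)%E); last first.
      by apply/funext => w; rewrite probability_setC.
    by apply: emeasurable_funB => //; apply/(measurable_wrtT _ hS); exact: QB.1.
  move=> A SA; have mA := Sm' SA.
  rewrite (_ : A `&` sigma @^-1` (~` B) = A `\` (sigma @^-1` B))// measureD//; last 2 first.
    exact: msB.
    by rewrite (le_lt_trans (probability_le1 _ _)) ?ltry.
  rewrite [X in (_ - X)%E](_ : _ = (\int[P]_(w in A) kappa w B)%E); last exact: QB.2.
  rewrite [RHS](eq_integral (fun w => 1 - kappa w B)%E); last by move=> w _; rewrite probability_setC.
  rewrite integralB//; last 2 first.
  - by apply: (integrableS measurableT) => //; exact: finite_measure_integrable_cst.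
  - exact: i1.
  by rewrite integral_cst// mul1e.
apply: dynkin_induction.
- exact: ErealGenOInfty.measurableE.
- move=> _ _ [x ->] [y ->]; exists (Num.max x y); apply/seteqP; split => z; rewrite /= !in_itv/= !andbT.
    by move=> [h1 h2]; rewrite EFin_max gt_max h1.
  by rewrite EFin_max gt_max => /andP[].
- exact: QT.
- move=> _ [x ->]; rewrite (_ : [set` _] = [set y | (x%:E < y)%E]); last first.
    by apply/seteqP; split => y; rewrite /= in_itv/= andbT.
  have [x0|x0] := leP 0 x; last first.
    have e : [set w | (x%:E < sigma w)%E] = setT.
      by apply/seteqP; split => // w _; rewrite /= (lt_trans _ (sigma_gt0 w)).
    have k1 w : kappa w [set y | (x%:E < y)%E] = 1%E.
      have mB (z : R) : measurable [set y : \bar R | (z%:E < y)%E].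
        by rewrite -[X in measurable X]setTI; exact: measurable_lte.
      apply/eqP; rewrite eq_le probability_le1//=.
      have : (kappa w [set y | 0%:E < y] <= kappa w [set y | x%:E < y])%E.
        by apply: le_measure; rewrite ?inE// => y /=; apply: lt_trans; rewrite lte_fin.
      by have r0 := ray w 0 (lexx 0); rewrite subrr subr0 in r0; rewrite r0.
    split; first by apply/(measurable_wrtT _ hS); rewrite (_ : (fun w => _) = cst 1%E)//; apply/funext => w; rewrite k1.
    move=> A SA; rewrite (_ : _ @^-1` _ = setT)// setIT (eq_integral (cst 1%E)); last by move=> w _; rewrite k1.
    by rewrite integral_cst ?mul1e//; exact: Sm'.
  suff : Q [set y | (y <= x%:E)%E].
    move=> /QC; rewrite leEN setCK; apply.
    by rewrite -leEN -[X in measurable X]setTI; exact: measurable_lee.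
  have kle w : kappa w [set y | (y <= x%:E)%E] = (H w x - H w 0)%:E.
    have mB : measurable [set y : \bar R | (x%:E < y)%E].
      by rewrite -[X in measurable X]setTI; exact: measurable_lte.
    by rewrite leEN probability_setC// ray// -EFinB opprB addrCA subrr addr0.
  split.
    apply/(measurable_wrtT _ hS); under eq_fun do rewrite kle.
    by apply/measurable_EFinP; apply: measurable_funB; apply/(measurable_wrtT _ hS).
  move=> A SA; have mA := Sm' SA; under eq_integral do rewrite kle.
  have iH t : P.-integrable A (fun w => (H w t)%:E).
    have c1 : P.-integrable A (cst 1%E).
      by apply: (integrableS measurableT) => //; exact: finite_measure_integrable_cst.
    apply: le_integrable c1 => //.
      apply/measurable_EFinP; apply: measurable_funTS => _ C mC; apply: Sm; exact: mH.
    by move=> w _ /=; have /andP[h0 h1] := H01 w t; rewrite normr1 lee_fin ger0_norm.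
  under eq_integral do rewrite EFinB.
  rewrite integralB// !HE// (_ : A `&` [set w | (sigma w <= 0%:E)%E] = set0) ?measure0 ?sube0//.
  by apply/seteqP; split => // w [_ /=]; rewrite leNgt sigma_gt0.
- exact: QC.
- move=> B mB tB QB.
  have mB' n : measurable (B n) by exact: mB.
  have kU w : kappa w (\bigcup_n B n) = (\sum_(n <oo) kappa w (B n))%E.
    rewrite measure_bigcup//; first by apply: eq_eseriesl => n; rewrite in_setT.
  split.
    apply/(measurable_wrtT _ hS); under eq_fun do rewrite kU.
    by apply: ge0_emeasurable_sum => // n _; apply/(measurable_wrtT _ hS); exact: (QB n).1.
  move=> A SA; have mA := Sm' SA; under eq_integral do rewrite kU.
  rewrite integral_nneseries//; last by move=> n; apply: measurable_funTS; exact: mkS.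
  rewrite preimage_bigcup setI_bigcupr measure_bigcup//=; last 2 first.
  + by move=> n _; apply: measurableI => //; exact: msB.
  + move/trivIsetP : tB => tB; apply/trivIsetP => i j _ _ ij.
    by rewrite setIACA setIid -preimage_setI tB// preimage_set0 setI0.
  rewrite (@eq_eseriesl _ _ predT); last by move=> n; rewrite in_setT.
  by apply: eq_eseriesr => n _; exact: (QB n).2.
Qed.

(** If [sigma] avoids every [S]-measurable time after [q], its conditional law
    has no atom after [q]: each atom is a first passage time of the conditional
    distribution function over a rational level. *)
Lemma conditional_law_atomless (q : R) (kappa : Omega -> probability (\bar R) R) : 0 <= q ->
  regular_conditional_law P S sigma kappa ->
  (forall S', measurable_wrt S setT S' -> (forall w, q < S' w) -> {ae P, forall w, sigma w <> (S' w)%:E}) ->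
  {ae P, forall w, forall x : R, q < x -> kappa w [set x%:E] = 0%E}.
Proof.
move=> q0 hk avoid; have [mk kE] := hk.
have mle' (x : R) : measurable [set y : \bar R | (y <= x%:E)%E].
  by rewrite -[X in measurable X]setTI; exact: measurable_lee.
pose H w (x : R) := fine (kappa w [set y | (y <= x%:E)%E]).
have kfin w B : measurable B -> kappa w B \is a fin_num by move=> mB; exact: fin_num_measure.
have HE w x : (H w x)%:E = kappa w [set y | (y <= x%:E)%E] by rewrite fineK// kfin.
have mH x a : S [set w | a <= H w x].
  have h : measurable_fun setT ((fun w => H w x) : g_sigma_algebraType S -> R).
    by apply: measurableT_comp => //; apply/(measurable_wrtT _ hS); exact: mk.
  have := h measurableT `[a, +oo[%classic (measurable_itv _); rewrite setTI measurable_g_salgebraE//.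
  by congr S; apply/seteqP; split => w; rewrite /= in_itv/= andbT.
have /choice[Sa hSa] : forall n, exists S' : Omega -> R, [/\ measurable_wrt S setT S', forall w, q < S' w &
    forall w x, q < x -> (forall k, nratr R n <= H w (nratr R k) <-> x <= nratr R k) -> S' w = x].
  by move=> n; exact: (inf_rational_time q hS (fun k => mH (nratr R k) (nratr R n))).
have null n : {ae P, forall w, kappa w [set (Sa n w)%:E] = 0%E}.
  have [mS qS _] := hSa n.
  pose E : set (Omega * \bar R) := [set p | p.2 = (Sa n p.1)%:E].
  have sE : prod_salgebra S (@measurable _ (\bar R)) E by exact: time_graph.
  have P0 : P [set w | E (w, sigma w)] = 0%E.
    have [N [mN N0 sN]] := avoid _ mS qS.
    apply: (@subset_measure0 _ _ _ P _ N) => //.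
    - apply: (@prod_salgebra_preimage _ _ _ _ _ _ id sigma _ _ _ _ sE) => //.
      + exact: (@sigma_algebra_measurable d0 Omega).
      + by move=> B mB; rewrite -[X in measurable X]setTI; exact: msigma.
    - by move=> w Ew; apply: sN.
  have e w : xsection E w = [set (Sa n w)%:E] by apply/seteqP; split => y; rewrite /xsection /= inE.
  rewrite (conditional_law_section hS Sm msigma hk sE) in P0.
  have mks : measurable_fun setT (fun w => kappa w (xsection E w)).
    apply: (sub_measurable_fun hS Sm).
    have mE' : measurable (E : set (g_sigma_algebraType S * \bar R)%type) by rewrite -prod_salgebraE.
    rewrite (_ : (fun w => _) = (fun w => \int[kappa w]_y (\1_E (w, y))%:E)%E); last first.
      by apply/funext => w; rewrite -integral_xsection//; move: sE; rewrite -prod_measurableE; apply: prod_salgebra_le.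
    apply: (@measurable_fun_integral_fam _ _ (g_sigma_algebraType S) (\bar R) R (fun w => kappa w) _ _ (fun p => (\1_E p)%:E)).
    - by move=> w; rewrite (le_lt_trans (probability_le1 (kappa w) measurableT))// ltry.
    - by move=> B mB; apply/(measurable_wrtT _ hS); exact: mk.
    - by apply/measurable_EFinP; exact: measurable_indic.
    - by move=> p; rewrite lee_fin.
  have := (ae_eq_integral_abs P measurableT mks).1; rewrite (eq_integral (fun w => kappa w (xsection E w))); last first.
    by move=> w _; rewrite gee0_abs.
  move=> /(_ P0); apply: filterS => w /(_ Logic.I); by rewrite e.
have {null} : {ae P, forall w, forall n, kappa w [set (Sa n w)%:E] = 0%E} by apply/ae_foralln.
apply: filterS => w null x qx.
apply/eqP; rewrite -measure_le0 leNgt; apply/negP => pos.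
have mlt : measurable [set y : \bar R | (y < x%:E)%E].
  by rewrite -[X in measurable X]setTI; exact: measurable_lte.
have splitx : kappa w [set y | (y <= x%:E)%E] = (kappa w [set y | (y < x%:E)%E] + kappa w [set x%:E])%E.
  rewrite -measureU//; last by apply/seteqP; split => // y [/= + yx]; rewrite yx ltxx.
  congr (kappa w _); apply/seteqP; split => y /=; rewrite le_eqVlt.
    by move=> /predU1P[->|]; [right|left].
  by move=> [->|->]; rewrite ?orbT ?eqxx.
have lt0 : fine (kappa w [set y | (y < x%:E)%E]) < H w x.
  by rewrite -lte_fin HE splitx fineK ?kfin// lteDl// kfin.
have [n /andP[an nb]] := nratr_between lt0.
have [_ _ /(_ w x qx) Sx] := hSa n.
have : Sa n w = x.
  apply: Sx => k; split => [h|xk].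
    rewrite leNgt; apply/negP => kx; move: an; rewrite ltNge => /negP; apply.
    apply: (le_trans h); rewrite -lee_fin HE fineK ?kfin//.
    apply: le_measure; rewrite ?inE// => y /= /le_lt_trans; apply.
    by rewrite lte_fin.
  apply: (le_trans (ltW nb)); rewrite -lee_fin !HE; apply: le_measure; rewrite ?inE// => y /= /le_trans; apply.
  by rewrite lee_fin.
by move=> Snx; have := null n; rewrite Snx => k0; have : (0 < kappa w [set x%:E])%E := pos; rewrite k0 ltxx.
Qed.

End law_of_a_time.

Lemma regular_conditional_law_exists (R : realType) (d0 : measure_display) (Omega : measurableType d0)
    (P : probability Omega R) (S : set_system Omega) (sigma : Omega -> \bar R) :
  sigma_algebra setT S -> S `<=` measurable -> measurable_fun setT sigma -> (forall w, (0 < sigma w)%E) ->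
  exists kappa : Omega -> probability (\bar R) R, regular_conditional_law P S sigma kappa.
Proof.
move=> hS Sm ms s0; have [//|t|k [hk _]] := common_conditional_law (P := P) hS Sm hS Sm _ ms s0; last by exists k.
by apply: conditional_probability => //; rewrite -[X in measurable X]setTI; exact: measurable_lee.
Qed.

(** * Immersion *)

Section immersion.
Context (R : realType) (d0 : measure_display) (Omega : measurableType d0).
Variables (P : probability Omega R) (F G : R -> set_system Omega) (tau_ : nat -> Omega -> \bar R).
Hypotheses (rcF : rc_filtration F) (rcG : rc_filtration G).
Hypothesis FG : forall s, 0 <= s -> F s `<=` G s.
Hypothesis stopF : forall m, stopping_time F (tau_ m).
Hypothesis diffF : forall q S, 0 <= q -> measurable_wrt (F q) setT S ->
  (forall w, q < S w) -> forall m, {ae P, forall w, tau_ m w <> (S w)%:E}.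

(** Under immersion, a conditional law of a jump time given [F q] is also its
    conditional law given [G q]. By quasi-left-continuity it has no atom after
    [q], so that a [G q]-measurable time after [q] is not hit. *)
Lemma jump_inaccessible_immersion : martingales_preserved P F G ->
  forall q S, 0 <= q -> measurable_wrt (G q) setT S -> (forall w, q < S w) ->
  forall m, {ae P, forall w, tau_ m w <> (S w)%:E}.
Proof.
move=> imm q S q0 mS qS m.
have Fs t : 0 <= t -> sigma_algebra setT (F t) by case: rcF => -[+ _ _] _; exact.
have Gs : sigma_algebra setT (G q) by case: rcG => -[+ _ _] _; exact.
have Fm : F q `<=` measurable by case: rcF => -[_ + _] _; exact.
have Gm : G q `<=` measurable by case: rcG => -[_ + _] _; exact.
pose sg w := if (tau_ m w <= 0)%E then +oo%E else tau_ m w.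
have mt : measurable_fun setT (tau_ m) by exact: (stop_measurable rcF stopF).
have msg : measurable_fun setT sg.
  apply: measurable_fun_if => //; first exact: measurable_fun_lee.
  exact: measurable_funTS.
have sg0 w : (0 < sg w)%E by rewrite /sg; case: ifPn; rewrite ?ltry// -ltNge.
have sgE w (x : R) : sg w = x%:E -> tau_ m w = x%:E by rewrite /sg; case: ifPn.
have cond t : exists c : Omega -> R, [/\ measurable_wrt (F q) setT c, forall w, 0 <= c w &
    forall B, G q B -> (\int[P]_(w in B) (c w)%:E = P ([set w | (sg w <= t%:E)%E] `&` B))%E].
  have qt : q <= Num.max q t by rewrite le_max lexx.
  have t0 := le_trans q0 qt; apply: (immersion_conditional rcF rcG imm q0 qt).
  rewrite (_ : mkset _ = [set w | (tau_ m w <= t%:E)%E] `\` [set w | (tau_ m w <= 0%:E)%E]).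
    by apply: (salgD (Fs _ t0)); apply: (stop_le rcF stopF) => //; rewrite le_max lexx orbT.
  apply/seteqP; split => w /=; rewrite /sg; case: ifPn => h; rewrite ?leye_eq//; last by case.
  by case=> _ [].
have [kappa [kF kG]] := common_conditional_law (Fs q q0) Fm Gs Gm (FG q0) msg sg0 cond.
have atom : {ae P, forall w, forall x : R, q < x -> kappa w [set x%:E] = 0%E}.
  apply: (conditional_law_atomless (Fs q q0) Fm msg q0 kF) => S' mS' qS'.
  by move: (diffF q0 mS' qS' m); apply: filterS => w h e; apply: h; exact: sgE.
have sE := time_graph Gs mS.
exists [set w | sg w = (S w)%:E]; split.
- exact: measurable_eq_time msg (wrt_measurable Gm mS).
- change (P [set w | [set p : Omega * \bar R | p.2 = (S p.1)%:E] (w, sg w)] = 0%E).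
  rewrite (conditional_law_section Gs Gm msg kG sE); apply: ae_ge0_integral0_nomeas.
  move: atom; apply: filterS => w h; rewrite (_ : xsection _ _ = [set (S w)%:E]); first exact: h.
  by apply/seteqP; split => y; rewrite /xsection /= inE.
- move=> w /= /contrapT e.
  by rewrite /sg e lee_fin leNgt (le_lt_trans q0 (qS w)).
Qed.

End immersion.

(** * Predictable sets miss the jumps *)

Section finite_tonelli.
Local Open Scope ereal_scope.
Context (R : realType) d1 (T1 : measurableType d1) d2 (T2 : measurableType d2).

Lemma finite_tonelli (m1 : {measure set T1 -> \bar R}) (m2 : {measure set T2 -> \bar R})
    (f : T1 * T2 -> \bar R) : m1 setT < +oo -> m2 setT < +oo ->
  measurable_fun setT f -> (forall p, 0 <= f p) ->
  \int[m1]_x \int[m2]_y f (x, y) = \int[m2]_y \int[m1]_x f (x, y).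
Proof.
move=> h1 h2 mf f0.
pose n1 : {finite_measure set T1 -> \bar R} := mfrestr measurableT h1.
pose n2 : {finite_measure set T2 -> \bar R} := mfrestr measurableT h2.
have e1 g : \int[m1]_x g x = \int[n1]_x g x.
  by apply: eq_measure_integral => A mA _; transitivity (m1 (A `&` setT)) => //; rewrite setIT.
have e2 g : \int[m2]_x g x = \int[n2]_x g x.
  by apply: eq_measure_integral => A mA _; transitivity (m2 (A `&` setT)) => //; rewrite setIT.
rewrite e1 e2; under eq_integral do rewrite e2; under [RHS]eq_integral do rewrite e1.
exact: fubini_tonelli.
Qed.

End finite_tonelli.

Section atomless_measures.
Local Open Scope ereal_scope.
Context (R : realType).

(** By Tonelli on the diagonal, the integral of [m [set x]] against [k] over [A]
    is that of [k [set x]] against [m]. *)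
Lemma atomless_null_atoms (k m : {measure set R -> \bar R}) (D : set R) :
  k setT < +oo -> m setT < +oo -> measurable D -> (forall x, D x -> k [set x] = 0) ->
  forall A, measurable A -> (forall x, A x -> D x /\ m [set x] <> 0) -> k A = 0.
Proof.
move=> hk hm mD kD A mA Am.
pose E : set (R * R) := [set p | A p.1 /\ p.1 = p.2].
have mE : measurable E.
  have h : measurable_fun setT (fun p : R * R => p.1 == p.2).
    by apply: measurable_fun_eqr; [exact: measurable_fst|exact: measurable_snd].
  have mA' : measurable ((fst : R * R -> R) @^-1` A).
    by rewrite -[X in measurable X]setTI; exact: measurable_fst.
  have := h measurableT [set true] (Logic.I : measurable [set true]); rewrite setTI => h'.
  rewrite (_ : E = fst @^-1` A `&` (fun p : R * R => p.1 == p.2) @^-1` [set true]).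
    exact: measurableI.
  by apply/seteqP; split => p /= [? /eqP ?].
have mf : measurable_fun setT (fun p => (\1_E p)%:E : \bar R).
  by apply/measurable_EFinP; exact: measurable_indic.
have f0 p : 0 <= (\1_E p)%:E :> \bar R by rewrite lee_fin.
have eqE := finite_tonelli hk hm mf f0.
have mx x : measurable (xsection E x) by exact: measurable_xsection.
have rhs0 : \int[m]_y \int[k]_x (\1_E (x, y))%:E = 0.
  apply: integral0_eq => y _; rewrite integral_ysection//.
  have [Ay|nAy] := pselect (A y).
    have [Dy _] := Am y Ay; apply: (@subset_measure0 _ _ _ k _ [set y]) => //.
    - exact: measurable_ysection.
    - by move=> x; rewrite /ysection /= inE => -[].
    - exact: kD.
  rewrite (_ : ysection E y = set0) ?measure0//.
  by apply/seteqP; split => // x; rewrite /ysection /= inE => -[/= + xy]; rewrite xy.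
rewrite rhs0 in eqE.
have mg : measurable_fun setT (fun x => \int[m]_y (\1_E (x, y))%:E).
  by apply: (@measurable_fun_integral_fam _ _ _ _ R (fun=> m) _ _ (fun p => (\1_E p)%:E)).
have := (ae_eq_integral_abs k measurableT mg).1.
rewrite (eq_integral (fun x => \int[m]_y (\1_E (x, y))%:E)); last first.
  by move=> x _; rewrite gee0_abs// integral_ge0// => y _; rewrite lee_fin.
move=> /(_ eqE) [N [mN N0 sN]].
apply: (@subset_measure0 _ _ _ k _ N) => // x Ax; apply: sN => /= /(_ Logic.I).
rewrite integral_xsection// (_ : xsection E x = [set x]); first exact: (Am x Ax).2.
by apply/seteqP; split => y; rewrite /xsection /= inE; [move=> [_ /= <-]|move=> ->].
Qed.

End atomless_measures.

Section predictable_functions.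
Context (R : realType) (d0 : measure_display) (Omega : measurableType d0).
Variable K : R -> set_system Omega.

Let PrT := predictableType K.

Lemma predictable_patch d (V : measurableType d) (Y : Omega -> R -> V) (D : set (Omega * R)) (c : V) :
  predictable K D -> predictable_on K D Y ->
  measurable_fun setT ((fun p => if p \in D then Y p.1 p.2 else c) : PrT -> V).
Proof.
move=> KD mY; have hS := predictable_salg K.
have mD : measurable (D : set PrT) by rewrite measurable_g_salgebraE.
apply: (measurable_fun_if measurableT) => //.
- by apply: (measurable_fun_bool true); rewrite setTI; rewrite (_ : _ @^-1` _ = D)//; apply/seteqP; split => p /=; [exact: set_mem|exact: mem_set].
- rewrite setTI (_ : _ @^-1` _ = D); last by apply/seteqP; split => p /=; [exact: set_mem|exact: mem_set].
  by apply/(measurable_wrtD _ hS KD).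
Qed.

Lemma field_onT d1 (E : measurableType d1) d (V : measurableType d)
    (W : Omega -> R -> E -> V) (D : set (Omega * R)) :
  predictable K D -> measurable_fun setT ((fun q => W q.1.1 q.1.2 q.2) : (PrT * E)%type -> V) ->
  predictable_field_on K D W.
Proof.
move=> KD mW B mB; have hS := predictable_salg K.
rewrite prod_salgebraE//; apply: measurableI.
  by apply: measurableX => //; rewrite measurable_g_salgebraE.
by rewrite -[X in measurable X]setTI; exact: mW.
Qed.

Lemma field_patch d1 (E : measurableType d1) d (V : measurableType d)
    (W : Omega -> R -> E -> V) (D : set (Omega * R)) (c : V) :
  predictable K D -> predictable_field_on K D W ->
  measurable_fun setT ((fun q => if q.1 \in D then W q.1.1 q.1.2 q.2 else c) : (PrT * E)%type -> V).
Proof.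
move=> KD mW; have hS := predictable_salg K.
have mD : measurable (D : set PrT) by rewrite measurable_g_salgebraE.
have mDE : measurable (D `*` setT : set (PrT * E)%type) by exact: measurableX.
apply: (measurable_fun_if measurableT) => //.
- apply: (measurable_fun_bool true); rewrite setTI (_ : _ @^-1` _ = D `*` setT)//.
  by apply/seteqP; split => p /=; [move=> h; split => //; exact: set_mem|move=> [h _]; exact: mem_set].
- rewrite setTI (_ : _ @^-1` _ = D `*` setT); last first.
    by apply/seteqP; split => p /=; [move=> h; split => //; exact: set_mem|move=> [h _]; exact: mem_set].
  by move=> _ B mB; have := mW B mB; rewrite prod_salgebraE.
Qed.

Hypothesis fK : filtration K.

Lemma predictable_adapted d (V : measurableType d) (Y : Omega -> R -> V) :
  predictable_on K (@all_times R _ Omega) Y -> adapted K Y.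
Proof.
move=> pY t t0 B mB; rewrite setTI; have := predictable_section fK t0 (pY B mB).
by congr (K t); apply/seteqP; split => w /=; [case|split => //; split => //=; rewrite in_itv/= t0].
Qed.

Lemma predictable_fun_measurable d (V : measurableType d) (Y : Omega * R -> V) :
  measurable_fun setT (Y : PrT -> V) -> measurable_fun setT Y.
Proof.
move=> mY _ B mB; rewrite setTI; apply: (predictable_measurable fK).
by rewrite -(measurable_g_salgebraE (predictable_salg K)) -[X in measurable X]setTI; exact: mY.
Qed.

Lemma field_measurable d1 (E : measurableType d1) d (V : measurableType d) (W : (Omega * R) * E -> V) :
  measurable_fun setT (W : (PrT * E)%type -> V) -> measurable_fun setT W.
Proof.
move=> mW _ B mB; rewrite setTI.
have := mW measurableT B mB; rewrite setTI -prod_salgebraE; last exact: predictable_salg.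
move=> h; rewrite -prod_measurableE; apply: (prod_salgebra_le _ _ h) => //.
exact: predictable_measurable.
Qed.

End predictable_functions.

Section no_predictable_hit.
Context (R : realType) (d0 : measure_display) (Omega : measurableType d0).
Variables (P : probability Omega R) (G : R -> set_system Omega) (jt : nat -> Omega -> \bar R).
Hypothesis rcG : rc_filtration G.
Hypothesis mjt : forall n, measurable_fun setT (jt n).
Hypothesis jt_lf : forall w, locally_finite (jt ^~ w).
Hypothesis jt_inaccessible : forall n q S, 0 <= q -> measurable_wrt (G q) setT S ->
  (forall w, q < S w) -> {ae P, forall w, jt n w <> (S w)%:E}.
Hypothesis nojump : forall q W, 0 <= q -> predictable G W ->
  exists2 W', prod_salgebra (G q) (@measurable _ R) W' &
    forall w t, q < t -> nojump_oo jt q t w -> (W (w, t) <-> W' (w, t)).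

Let fG : filtration G. Proof. by case: rcG. Qed.
Let Gs t : 0 <= t -> sigma_algebra setT (G t). Proof. by case: fG => + _ _; exact. Qed.
Let Gm t : 0 <= t -> G t `<=` measurable. Proof. by case: fG => _ + _; exact. Qed.

Let ltE (a : \bar R) : measurable [set x | (a < x)%E].
Proof. by rewrite -[X in measurable X]setTI; exact: measurable_lte. Qed.

Let leE (a : \bar R) : measurable [set x | (x <= a)%E].
Proof. by rewrite -[X in measurable X]setTI; exact: measurable_lee. Qed.

(** On the event that no jump occurs after [q] before [t], membership of [t] in
    [W] is known at time [q]. The conditional law of the next jump being
    atomless, it does not charge the countable section of [W] as long as no jump
    has occurred; the times past the last one at which this can happen are not
    charged either. *)
Lemma no_predictable_hit T W n : 0 < T -> predictable G W ->
  {ae P, forall w, forall k : {measure set R -> \bar R}, (k setT < +oo)%E ->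
     (forall x, 0 < x -> k [set x] = 0%E) -> k ([set t | W (w, t)] `&` `]0, T]) = 0%E} ->
  {ae P, forall w, forall t, jt n w = t%:E -> 0 < t <= T -> ~ W (w, t)}.
Proof.
move=> T0 GW hW.
pose hit (q : R) w := exists t, [/\ jt n w = t%:E, q < t <= T, nojump_oo jt q t w & W (w, t)].
suff main q : 0 <= q -> {ae P, forall w, ~ hit q w}.
  have : {ae P, forall w, forall k, 0 <= nratr R k -> ~ hit (nratr R k) w}.
    apply/ae_foralln => k; have [k0|k0] := leP 0 (nratr R k); last by apply: aeW.
    by apply: filterS (main _ k0) => w h _.
  apply: filterS => w h t jnt /andP[t0 tT] Wt.
  have [e e0 he] := times_left (jt_lf w) t.
  have lt0 : Num.max 0 (t - e) < t by rewrite gt_max t0 ltrBlDr ltrDl.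
  have [k /andP[]] := nratr_between lt0; rewrite gt_max => /andP[k0 ek] kt.
  apply: (h k (ltW k0)); exists t; split => //; first by rewrite kt.
  move=> m; apply/negP => /andP[km mt].
  have /(he m) : t - e <= nratr R k < t by rewrite kt ltW.
  by rewrite mt leNgt km.
move=> q0.
have [W' GW' WW'] := nojump q0 GW.
pose C := [set w | (q%:E < jt n w)%E /\ (jt n w <= T%:E)%E /\
  forall m, ~~ ((q%:E < jt m w)%E && (jt m w < jt n w)%E)].
have mC : measurable C.
  have m1 (a : \bar R) : measurable [set w | (a < jt n w)%E].
    by rewrite -[X in measurable X]setTI; exact: measurable_lte.
  rewrite (_ : C = [set w | (q%:E < jt n w)%E] `&` ([set w | (jt n w <= T%:E)%E] `&`
     \bigcap_m ~` ([set w | (q%:E < jt m w)%E] `&` [set w | (jt m w < jt n w)%E]))).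
    apply: measurableI => //; apply: measurableI.
      by rewrite -[X in measurable X]setTI; exact: measurable_lee.
    apply: bigcapT_measurable => m; apply: measurableC; apply: measurableI.
      by rewrite -[X in measurable X]setTI; exact: measurable_lte.
    by rewrite -[X in measurable X]setTI; exact: measurable_lte.
  apply/seteqP; split => w; first by move=> [h1 [h2 h3]]; split => //; split => // m _ /= /andP; apply/negP.
  by move=> [h1 [h2 h3]]; split => //; split => // m; apply/negP => /andP; exact: h3.
pose sigma w := if w \in C then jt n w else +oo%E.
have msigma : measurable_fun setT sigma.
  apply: measurable_fun_ifT => //.
  apply: (measurable_fun_bool true); rewrite setTI (_ : _ @^-1` _ = C)//.
  by apply/seteqP; split => w /=; [exact: set_mem|exact: mem_set].
have sigma_q w : (q%:E < sigma w)%E.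
  by rewrite /sigma; case: ifPn => [|_]; [rewrite inE => -[]|exact: ltry].
have sigma0 w : (0 < sigma w)%E by apply: le_lt_trans (sigma_q w); rewrite lee_fin.
have hitC w : hit q w -> exists t, [/\ sigma w = t%:E, q < t <= T, nojump_oo jt q t w & W (w, t)].
  move=> [t [jnt qtT nj Wt]]; exists t; split => //; rewrite /sigma mem_set//.
  by case/andP: qtT => qt tT; rewrite /C /= jnt lte_fin lee_fin.
have sigmaC w t : sigma w = t%:E -> jt n w = t%:E /\ nojump_oo jt q t w.
  rewrite /sigma; case: ifPn => //; rewrite inE => -[_ [_ h]] jnt; split => // m.
  by have := h m; rewrite jnt.
have [kappa hk] := regular_conditional_law_exists P (Gs q0) (@Gm _ q0) msigma sigma0.
have [mk _] := hk.
have atomless : {ae P, forall w, forall x : R, q < x -> kappa w [set x%:E] = 0%E}.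
  apply: (conditional_law_atomless (Gs q0) (@Gm _ q0) msigma q0 hk).
  move=> S mS qS; apply: filterS (jt_inaccessible n q0 mS qS) => w h sS; apply: h.
  by have [] := sigmaC _ _ sS.
pose GqT := g_sigma_algebraType (G q).
have mxk E : prod_salgebra (G q) (@measurable _ (\bar R)) E ->
    measurable_fun setT ((fun w => kappa w (xsection E w)) : GqT -> \bar R).
  move=> sE; have mE' : measurable (E : set (GqT * \bar R)%type) by rewrite -prod_salgebraE//; exact: Gs.
  rewrite (_ : (fun w => _) = (fun w => \int[kappa w]_y (\1_E (w, y))%:E)%E); last first.
    apply/funext => w; rewrite -integral_xsection//; move: sE; rewrite -prod_measurableE.
    by apply: prod_salgebra_le => //; exact: Gm.
  apply: (@measurable_fun_integral_fam _ _ GqT (\bar R) R (fun w => kappa w) _ _ (fun p => (\1_E p)%:E)).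
  - by move=> w; rewrite (le_lt_trans (probability_le1 (kappa w) measurableT))// ltry.
  - by move=> B mB; apply/(measurable_wrtT _ (Gs q0)); exact: mk.
  - by apply/measurable_EFinP; exact: measurable_indic.
  - by move=> p; rewrite lee_fin.
have null E : prod_salgebra (G q) (@measurable _ (\bar R)) E ->
    {ae P, forall w, ~ E (w, sigma w)} -> {ae P, forall w, kappa w (xsection E w) = 0%E}.
  move=> sE [N [mN N0 sN]].
  have mks : measurable_fun setT (fun w => kappa w (xsection E w)).
    by apply: (sub_measurable_fun (Gs q0) (@Gm _ q0)); exact: mxk.
  have P0 : P [set w | E (w, sigma w)] = 0%E.
    apply: (@subset_measure0 _ _ _ P _ N) => //.
    - apply: (@prod_salgebra_preimage _ _ _ _ _ _ id sigma _ _ _ _ sE) => //.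
      + exact: (@sigma_algebra_measurable d0 Omega).
      + exact: Gm.
      + by move=> B mB; rewrite -[X in measurable X]setTI; exact: msigma.
    - by move=> w Ew; apply: sN => /=; exact.
  rewrite (conditional_law_section (Gs q0) (@Gm _ q0) msigma hk sE) in P0.
  have := (ae_eq_integral_abs P measurableT mks).1; rewrite (eq_integral (fun w => kappa w (xsection E w))); last first.
    by move=> w _; rewrite gee0_abs.
  by move=> /(_ P0); apply: filterS => w /(_ Logic.I).
have hS := Gs q0.
have mfine : measurable_fun setT (fine : \bar R -> R) by exact: fine_measurable.
have mfB (B : set R) : measurable B -> measurable (fine @^-1` B : set (\bar R)).
  by move=> mB; rewrite -[X in measurable X]setTI; exact: mfine.
pose ER (B : set (Omega * R)) (a b : R) : set (Omega * \bar R) :=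
  [set p | (a%:E < p.2)%E /\ (p.2 <= b%:E)%E /\ B (p.1, fine p.2)].
have sER B a b : prod_salgebra (G q) (@measurable _ R) B -> prod_salgebra (G q) (@measurable _ (\bar R)) (ER B a b).
  move=> sB; rewrite prod_salgebraE//.
  have m2 : measurable_fun setT (snd : GqT * \bar R -> \bar R) by exact: measurable_snd.
  have h1 : measurable [set p : GqT * \bar R | (a%:E < p.2)%E].
    by rewrite -[X in measurable X]setTI; exact: measurable_lte.
  have h2 : measurable [set p : GqT * \bar R | (p.2 <= b%:E)%E].
    by rewrite -[X in measurable X]setTI; exact: measurable_lee.
  have h3 : measurable [set p : GqT * \bar R | B (p.1, fine p.2)].
    rewrite (_ : mkset _ = (fun p : GqT * \bar R => ((p.1 : GqT), fine p.2)) @^-1` (B : set (GqT * R)%type))//.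
    rewrite -[X in measurable X]setTI.
    have h : measurable_fun setT (fun p : GqT * \bar R => ((p.1 : GqT), fine p.2)).
      by apply: measurable_fun_pair; [exact: measurable_fst|exact: measurableT_comp].
    by apply: h => //; move: sB; rewrite prod_salgebraE.
  exact: measurableI h1 (measurableI _ _ h2 h3).
pose bnd k := Num.min (nratr R k) T.
pose E k := ER W' q (bnd k).
have sE k : prod_salgebra (G q) (@measurable _ (\bar R)) (E k) by exact: sER.
(* before any jump past nratr k, the section of W' up to nratr k is that of W *)
have kE0 : {ae P, forall w, forall k, nojump_oc jt q (nratr R k) w -> kappa w (xsection (E k) w) = 0%E}.
  apply/ae_foralln => k; move: hW atomless; apply: filterS2 => w hw aw nj.
  pose D : set (\bar R) := [set y | (q%:E < y)%E /\ (y <= T%:E)%E].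
  have mD : measurable D.
    exact: measurableI (ltE _) (leE _).
  pose kk : {measure set R -> \bar R} :=
    pushforward (mrestr (kappa w) mD) (fine : \bar R -> R).
  have kkE B : kk mfine B = kappa w ((fine @^-1` B) `&` D) by [].
  have mWs : measurable [set t | W (w, t)].
    have /(measurable_xsection w) := predictable_measurable fG GW.
    by congr measurable; apply/seteqP; split => t; rewrite /xsection /= inE.
  have h0 : kk mfine ([set t | W (w, t)] `&` `]0, T]) = 0%E.
    apply: hw => [|x x0].
      rewrite kkE (le_lt_trans (probability_le1 (kappa w) _)) ?ltry// preimage_setT setTI//.
    rewrite kkE; have [qx|xq] := ltP q x.
      apply: (@subset_measure0 _ _ _ (kappa w) _ [set x%:E]) => //.
      + by apply: measurableI => //; exact: mfB.
      + move=> y [/= fy [qy yT]]; rewrite -fy fineK// fin_real// (lt_trans _ qy) ?ltNyr//=.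
        by rewrite (le_lt_trans yT)// ltry.
      + exact: aw.
    rewrite (_ : _ `&` _ = set0) ?measure0//; apply/seteqP; split => // y [/= fy [qy yT]].
    have yfin : y \is a fin_num by rewrite fin_real// (lt_trans _ qy) ?ltNyr//= (le_lt_trans yT)// ltry.
    by move: qy; rewrite -(fineK yfin) fy lte_fin ltNge xq.
  rewrite kkE in h0.
  apply: (@subset_measure0 _ _ _ (kappa w) _ _ _ _ _ h0).
  - apply: measurable_xsection; move: (sE k); rewrite -prod_measurableE; apply: prod_salgebra_le => //; exact: Gm.
  - apply: measurableI => //; apply: mfB.
    by apply: measurableI => //; exact: measurable_itv.
  - move=> y; rewrite /xsection /= inE => -[/= qy [yb Wy]].
    have yfin : y \is a fin_num by rewrite fin_real// (lt_trans _ qy) ?ltNyr//= (le_lt_trans yb)// ltry.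
    move: qy yb; rewrite -(fineK yfin) lte_fin lee_fin /bnd le_min => qy /andP[yk yT].
    split; last by split; rewrite ?lte_fin ?lee_fin.
    split => /=; last by rewrite in_itv/= yT (le_lt_trans q0 qy).
    apply/(WW' w _ qy) => // m; apply/negP => /andP[qm my]; have := nj m.
    by rewrite qm /= (le_trans (ltW my))// lee_fin.
(* the event that the section is charged forbids a jump after nratr k *)
have dich : {ae P, forall w, forall k, kappa w (xsection (E k) w) = 0%E \/
    kappa w [set y | (nratr R k)%:E < y /\ q%:E < y /\ y <= T%:E]%E = 0%E}.
  apply/ae_foralln => k.
  pose B : set Omega := [set w | (0 < kappa w (xsection (E k) w))%E].
  have GB : G q B.
    have h : measurable_fun setT ((fun w => (0 < kappa w (xsection (E k) w))%E) : GqT -> bool).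
      by apply: measurable_fun_lte => //; exact: mxk.
    by have := h measurableT [set true] (Logic.I : measurable [set true]); rewrite setTI measurable_g_salgebraE.
  pose E' := ER (B `*` setT) (Num.max q (nratr R k)) T.
  have sE' : prod_salgebra (G q) (@measurable _ (\bar R)) E'.
    by apply: sER; apply: sub_sigma_algebra; exists B, setT.
  have : {ae P, forall w, ~ E' (w, sigma w)}.
    move: kE0; apply: filterS => w h [/= sk [sT [Bw _]]].
    have sfin : sigma w \is a fin_num.
      by rewrite fin_real// (lt_trans _ sk) ?ltNyr//= (le_lt_trans sT)// ltry.
    have [_ nj] := sigmaC w (fine (sigma w)) (esym (fineK sfin)).
    move: Bw; rewrite /B /= h ?ltxx// => m; apply/negP => /andP[qm mk'].
    have := nj m; rewrite qm fineK//= (le_lt_trans mk')//.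
    by apply: le_lt_trans sk; rewrite lee_fin le_max lexx orbT.
  move=> /(null _ sE'); apply: filterS => w.
  have [Bw|nBw] := pselect (B w).
    rewrite (_ : xsection E' w = [set y | (nratr R k)%:E < y /\ q%:E < y /\ y <= T%:E]%E); first by right.
    apply/seteqP; split => y; rewrite /xsection /= inE /E' /ER /= EFin_max gt_max.
      by move=> [/andP[h1 h2] [h3 _]].
    by move=> [h1 [h2 h3]]; rewrite h1 h2.
  move=> _; left; apply/eqP; rewrite -measure_le0 leNgt; exact/negP.
have all0 : {ae P, forall w, kappa w (xsection (ER W' q T) w) = 0%E}.
  move: dich atomless; apply: filterS2 => w hd aw.
  have mER a b : measurable (xsection (ER W' a b) w).
    apply: measurable_xsection; have := sER W' a b GW'; rewrite -prod_measurableE.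
    by apply: prod_salgebra_le => //; exact: Gm.
  pose J k := if kappa w (xsection (E k) w) == 0%E then xsection (E k) w
     else [set y | (nratr R k)%:E < y /\ q%:E < y /\ y <= T%:E]%E.
  have mJ k : measurable (J k).
    rewrite /J; case: ifP => _; first exact: mER.
    exact: measurableI (ltE _) (measurableI _ _ (ltE _) (leE _)).
  have J0 k : kappa w (J k) = 0%E.
    by rewrite /J; case: ifPn => [/eqP//|/eqP nk]; case: (hd k).
  have mU : measurable (\bigcup_k J k) by exact: bigcup_measurable.
  have U0 : kappa w (\bigcup_k J k) = 0%E.
    apply/eqP; rewrite -measure_le0 (le_trans (measure_sigma_subadditive _ mJ mU (@subset_refl _ _)))//.
    by rewrite eseries0// => k _ _; exact: J0.
  pose rest := xsection (ER W' q T) w `\` \bigcup_k J k.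
  have restfin y : rest y -> y \is a fin_num /\ (q%:E < y)%E /\ (y <= T%:E)%E.
    move=> [+ _]; rewrite /xsection /= inE => -[/= qy [yT _]]; split => //.
    by rewrite fin_real// (lt_trans _ qy) ?ltNyr//= (le_lt_trans yT)// ltry.
  have rest1 y z : rest y -> rest z -> (y < z)%E -> False.
    move=> ry rz; have [yf [qy yT]] := restfin _ ry; have [zf [qz zT]] := restfin _ rz.
    rewrite -(fineK yf) -(fineK zf) lte_fin => /nratr_between[k /andP[yk kz]].
    have [Jk|Jk] := boolP (kappa w (xsection (E k) w) == 0%E).
      apply: ry.2; exists k => //; rewrite /J Jk; case: ry => + _; rewrite /xsection /= !inE.
      move=> [/= h1 [h2 h3]]; split => //; split => //.
      by rewrite -(fineK yf) lee_fin le_min (ltW yk) -lee_fin fineK.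
    apply: rz.2; exists k => //; rewrite /J (negbTE Jk) /=; split => //.
    by rewrite -(fineK zf) lte_fin.
  have mrest : measurable rest by apply: measurableD => //; exact: mER.
  have r0 : kappa w rest = 0%E.
    have [[y ry]|nr] := pselect (exists y, rest y).
      have [yf [qy _]] := restfin _ ry.
      apply: (@subset_measure0 _ _ _ (kappa w) _ [set (fine y)%:E]) => //.
        move=> z rz; rewrite /= fineK//; apply/eqP; rewrite eq_le !leNgt.
        by apply/andP; split; apply/negP => h; [exact: rest1 ry rz h|exact: rest1 rz ry h].
      by apply: aw; rewrite -lte_fin fineK.
    rewrite (_ : rest = set0) ?measure0//; apply/seteqP; split => // y ry.
    by apply: nr; exists y.
  apply: (@subset_measure0 _ _ _ (kappa w) _ (\bigcup_k J k `|` rest)) => //.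
  - exact: measurableU.
  - by move=> y ye; have [Jy|nJy] := pselect ((\bigcup_k J k) y); [left|right].
  - exact: (etrans (measureU0 mU mrest r0) U0).
have PE : P [set w | ER W' q T (w, sigma w)] = 0%E.
  rewrite (conditional_law_section (Gs q0) (@Gm _ q0) msigma hk (sER W' q T GW')).
  by apply: ae_ge0_integral0_nomeas.
exists [set w | ER W' q T (w, sigma w)]; split => //.
  apply: (@prod_salgebra_preimage _ _ _ _ _ _ id sigma _ _ _ _ (sER W' q T GW')) => //.
  - exact: (@sigma_algebra_measurable d0 Omega).
  - exact: Gm.
  - by move=> B mB; rewrite -[X in measurable X]setTI; exact: msigma.
move=> w /= /contrapT /hitC [t [st /andP[qt tT] nj Wt]].
rewrite /ER /= st lte_fin lee_fin; split => //; split => //=.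
exact/(WW' w _ qt).
Qed.

End no_predictable_hit.

(** * Compensators have no time atoms *)

Lemma measurable_fun_ereal_sup (R : realType) d (T : measurableType d) (f : (T -> \bar R)^nat) :
  (forall n, measurable_fun setT (f n)) -> measurable_fun setT (fun x => ereal_sup (range (f ^~ x))).
Proof.
move=> mf; rewrite (_ : (fun x => _) = (fun x => esups (f ^~ x) 0)); first exact: measurable_fun_esups.
apply/funext => x; congr ereal_sup; apply/seteqP; split => y /= [n _ <-]; exists n => //.
Qed.

Section atomless_compensator.
Context (R : realType) (d0 : measure_display) (Omega : measurableType d0).
Variables (P : probability Omega R) (G : R -> set_system Omega).
Context (d1 : measure_display) (E : measurableType d1).
Variables mu nu : Omega -> {measure set (R * E) -> \bar R}.
Hypothesis fG : filtration G.

Lemma predictable_random_measure_measurable (W : Omega -> R -> E -> R) : predictable_random_measure G nu ->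
  predictable_field_on G (@all_times R _ Omega) W -> (forall w t x, 0 <= W w t x) ->
  forall t, 0 <= t -> measurable_wrt (G t) setT
    (fun w => (\int[nu w]_(p in `]0%R, t] `*` setT) (W w p.1 p.2)%:E)%E : \bar R).
Proof.
move=> [_ h] mW W0 t t0; exact: (predictable_adapted fG (h W mW W0)).
Qed.

Hypothesis comp : compensator P G mu nu.
Variables (T : R) (jt : nat -> Omega -> \bar R).
Hypothesis T0 : 0 < T.
Hypothesis nu_fin : {ae P, forall w, (nu w (`]0%R, T] `*` setT) < +oo)%E}.
Hypothesis mu_jt : forall w (A : set R), measurable A -> (forall n t, jt n w = t%:E -> ~ A t) ->
  mu w (A `*` setT) = 0%E.
Hypothesis hit : forall W n, predictable G W ->
  {ae P, forall w, forall k : {measure set R -> \bar R}, (k setT < +oo)%E ->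
     (forall x, 0 < x -> k [set x] = 0%E) -> k ([set t | W (w, t)] `&` `]0, T]) = 0%E} ->
  {ae P, forall w, forall t, jt n w = t%:E -> 0 < t <= T -> ~ W (w, t)}.

(** The atoms of [nu] form a predictable set, which [mu] does not charge since
    its jumps avoid it; hence [nu] does not charge it either. *)
Lemma compensator_atomless : {ae P, forall w, forall t, 0 < t <= T ->
  nu w ([set t] `*` setT) = 0%E}.
Proof.
have [pnu eqmn] := comp; have [_ pint] := pnu.
have KA := predictable_all_times fG.
pose A w t := nu w (`]0, t] `*` setT).
have pA : predictable_on G (@all_times R _ Omega) A.
  have := pint (fun _ _ _ => 1); rewrite /predictable_on => h.
  have m1 : predictable_field_on G (@all_times R _ Omega) (fun _ _ (_ : E) => 1 : R).
    by apply: (field_onT KA); exact: measurable_cst.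
  have {}h := h m1 (fun _ _ _ => ler01).
  rewrite (_ : (fun p : Omega * R => A p.1 p.2) = (fun p => \int[nu p.1]_(_ in `]0%R, p.2] `*` setT) 1)%E)//.
  by apply/funext => -[w t]; rewrite /A /= integral_cst ?mul1e//; apply: measurableX => //; exact: measurable_itv.
have aA := predictable_adapted fG pA.
pose PrT := predictableType G.
pose a : PrT -> \bar R := fun p => if p \in @all_times R _ Omega then A p.1 p.2 else 0%E.
have ma : measurable_fun setT a by exact: predictable_patch.
pose b k : PrT -> \bar R := fun p => if p \in @all_times R _ Omega then A p.1 (grid_left k p.2) else 0%E.
have mb k : measurable_fun setT (b k).
  apply: (@predictable_patch _ _ _ _ _ _ (fun w t => A w (grid_left k t)) _ 0%E KA).
  exact: adapted_grid_left.
pose W : set (Omega * R) := (setT `*` `]0, T]) `&` [set p | (a p < +oo)%E /\ (ereal_sup (range (b ^~ p)) < a p)%E].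
have msup : measurable_fun setT (fun p : PrT => ereal_sup (range (b ^~ p))) by exact: measurable_fun_ereal_sup.
have GW : predictable G W.
  have hS := predictable_salg G.
  apply: (salgI hS); first exact: predictable_oc.
  rewrite -(measurable_g_salgebraE hS).
  have h1 : measurable [set p : PrT | (a p < +oo)%E].
    by rewrite -[X in measurable X]setTI; exact: measurable_lte.
  have h2 : measurable [set p : PrT | (ereal_sup (range (b ^~ p)) < a p)%E].
    by rewrite -[X in measurable X]setTI; exact: measurable_lte.
  exact: measurableI h1 h2.
have inall w t : 0 <= t -> (w, t) \in @all_times R _ Omega.
  by move=> t0; rewrite inE; split => //=; rewrite in_itv/= t0.
have mI (s t : R) : measurable (`]s, t]%classic `*` (setT : set E)).
  by apply: measurableX => //; exact: measurable_itv.
have mO (s t : R) : measurable (`]s, t[%classic `*` (setT : set E)).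
  by apply: measurableX => //; exact: measurable_itv.
have mS (t : R) : measurable ([set t] `*` (setT : set E)) by apply: measurableX.
have splitA w t : 0 < t -> A w t = (nu w (`]0%R, t[%classic `*` setT) + nu w ([set t] `*` setT))%E.
  move=> t0; rewrite -measureU//; last first.
    by apply/seteqP; split => // -[s x] [[/= h _] [/= st _]]; rewrite st in_itv/= ltxx andbF in h.
  congr (nu w _); apply/seteqP; split => [[s x] [/= + _]|[s x] [|] [/= + _]]; rewrite ?in_itv/=.
  - move=> /andP[s0]; rewrite le_eqVlt => /predU1P[->|st]; [by right|left].
    by rewrite s0.
  - by move=> /andP[s0 st]; rewrite s0 ltW.
  - by move=> ->; rewrite t0 lexx.
have Amono w s t : s <= t -> (A w s <= A w t)%E.
  move=> st; apply: le_measure; rewrite ?inE// => -[x y] [/= + _]; rewrite !in_itv/= => /andP[-> xs].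
  by split => //=; exact: le_trans st.
have grid_le w t k : 0 < t -> (A w (grid_left k t) <= nu w (`]0%R, t[%classic `*` setT))%E.
  move=> t0; apply: le_measure; rewrite ?inE// => -[x y] [/= + _]; rewrite !in_itv/= => /andP[-> xs].
  by split => //=; exact: le_lt_trans xs (grid_left_lt k t0).
have atomW w t : 0 < t <= T -> (A w T < +oo)%E -> nu w ([set t] `*` setT) <> 0%E -> W (w, t).
  move=> /andP[t0 tT] fin nz; split; first by split => //=; rewrite in_itv/= t0.
  have At : (A w t < +oo)%E by apply: le_lt_trans fin; exact: Amono.
  rewrite /= /a inall ?ltW//; split => //.
  apply: (@le_lt_trans _ _ (nu w (`]0%R, t[%classic `*` setT))).
    by apply: ge_ereal_sup => _ /= [k _ <-]; rewrite /b inall ?(ltW t0)//=; exact: grid_le.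
  rewrite /= splitA// lteDl.
    by rewrite lt0e measure_ge0 andbT; apply/eqP.
  rewrite ge0_fin_numE//; apply: le_lt_trans At; rewrite splitA// leeDl//.
have Watom w t : W (w, t) -> 0 < t <= T /\ nu w ([set t] `*` setT) <> 0%E.
  move=> [[_ /=]]; rewrite in_itv/= => /andP[t0 tT] [+ +]; rewrite t0 tT.
  rewrite /a inall ?ltW//= => At sA; split => // z.
  move: sA; rewrite splitA// z adde0; apply/negP; rewrite -leNgt.
  pose s n := t - n.+1%:R^-1.
  have cv : nu w (`]0, s n]%classic `*` setT) @[n --> \oo] --> nu w (\bigcup_n (`]0, s n]%classic `*` setT)).
    apply: nondecreasing_cvg_mu => [n||n m nm]; first exact: mI.
      by apply: bigcupT_measurable => n; exact: mI.
    apply/subsetPset => -[x y] [/= + _]; rewrite !in_itv/= => /andP[-> xs]; split => //=.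
    by apply: (le_trans xs); rewrite lerD2l lerN2 lef_pV2 ?posrE// ler_nat.
  have -> : `]0, t[%classic `*` setT = \bigcup_n (`]0, s n]%classic `*` (setT : set E)).
    apply/seteqP; split => [[x y] [/= + _]|[x y] [n _ [/= + _]]]; rewrite !in_itv/= => /andP[x0 xt].
      exists (Num.truncn (t - x)^-1) => //; split => //=; rewrite in_itv/= x0/= /s lerBrDr -lerBrDl.
      rewrite -[leRHS]invrK lef_pV2 ?posrE ?invr_gt0 ?subr_gt0//; exact/ltW/truncnS_gt.
    split => //; rewrite x0/= (le_lt_trans xt)// /s ltrBlDr ltrDl invr_gt0//.
  rewrite -(cvg_lim _ cv)//; apply: lime_le; first by apply/cvg_ex; eexists; exact: cv.
  apply: nearW => n.
  have : \forall k \near \oo, s n <= grid_left k t by apply: grid_left_near.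
  move=> [k _ /(_ k (leqnn k)) /= sk].
  apply: (le_trans (Amono _ _ _ sk)); apply: ereal_sup_ubound; exists k => //.
  by rewrite /b inall// ltW.
have hitW : {ae P, forall w, forall k : {measure set R -> \bar R}, (k setT < +oo)%E ->
     (forall x, 0 < x -> k [set x] = 0%E) -> k ([set t | W (w, t)] `&` `]0, T]) = 0%E}.
  move: nu_fin; apply: filterS => w fin k kfin k0.
  pose m0 : {measure set R -> \bar R} := pushforward (mrestr (nu w) (mI 0 T)) (fst : R * E -> R).
  pose m := m0 measurable_fst.
  have mE B : m B = nu w ((fst @^-1` B) `&` (`]0, T]%classic `*` setT)) by [].
  have mWs : measurable [set t | W (w, t)].
    have /(measurable_xsection w) := predictable_measurable fG GW.
    by congr measurable; apply/seteqP; split => t; rewrite /xsection /= inE.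
  apply: (@atomless_null_atoms _ k m `]0, T]%classic) => //.
  - by rewrite mE preimage_setT setTI.
  - by move=> x; rewrite /= in_itv/= => /andP[x0 _]; exact: k0.
  - by apply: measurableI => //; exact: measurable_itv.
  - move=> t [/= /Watom[h1 h2] h3]; split => //; rewrite mE => h; apply: h2; rewrite -h.
    congr (nu w _); apply/seteqP; split => [[x y] [/= -> _]|[x y] [/= -> _]] //=.
have noW : {ae P, forall w n t, jt n w = t%:E -> 0 < t <= T -> ~ W (w, t)}.
  by apply/ae_foralln => n; exact: hit.
pose W1 (w : Omega) (t : R) (x : E) : R := \1_W (w, t).
have mW1 : predictable_field_on G (@all_times R _ Omega) W1.
  apply: (field_onT KA).
  rewrite (_ : (fun q => _) = (\1_W : PrT -> R) \o fst); last by apply/funext => -[[w t] x].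
  apply: (measurableT_comp _ measurable_fst).
  apply: measurable_indic; rewrite measurable_g_salgebraE//; exact: predictable_salg.
have W10 w t x : 0 <= W1 w t x by rewrite /W1.
have := eqmn W1 mW1 W10.
have -> : (\int[P]_w \int[mu w]_(p in `]0%R, +oo[ `*` setT) (W1 w p.1 p.2)%:E = 0)%E.
  apply: ae_ge0_integral0_nomeas; move: noW; apply: filterS => w h.
  have mWs : measurable [set t | W (w, t)].
    have /(measurable_xsection w) := predictable_measurable fG GW.
    by congr measurable; apply/seteqP; split => t; rewrite /xsection /= inE.
  rewrite integral_mkcond; apply: ae_ge0_integral0_nomeas.
  exists ([set t | W (w, t)] `*` setT); split.
  - exact: measurableX.
  - apply: mu_jt => // n t jnt Wt; apply: (h n t jnt _ Wt).
    by have [] := Watom _ _ Wt.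
  - move=> [t x] /= nz; split => //=; apply: contrapT => nW; apply: nz.
    by rewrite patchE; case: ifP => // _; rewrite /W1 indicE memNset.
move=> /esym int0.
have eT w : (\int[nu w]_(p in `]0%R, +oo[ `*` setT) (W1 w p.1 p.2)%:E =
    \int[nu w]_(p in `]0%R, T] `*` setT) (W1 w p.1 p.2)%:E)%E.
  rewrite integral_mkcond [RHS]integral_mkcond; apply: eq_integral => -[t x] _.
  rewrite !patchE; case: ifPn; case: ifPn => //; rewrite !(inE, notin_setE) /=.
    move=> h1 [h2 _]; rewrite /W1 indicE memNset// => -[[_ h3] _]; apply: h1.
    by split.
  by move=> [h1 _] h2; exfalso; apply: h2; split => //=; move: h1; rewrite !in_itv/= andbT => /andP[].
rewrite (eq_integral _ _ (fun w _ => eT w)) in int0.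
have mI1 : measurable_fun setT (fun w => (\int[nu w]_(p in `]0%R, T] `*` setT) (W1 w p.1 p.2)%:E)%E).
  move=> _ B mB; have := predictable_random_measure_measurable pnu mW1 W10 (ltW T0) mB.
  by have [_ + _] := fG => /(_ T (ltW T0)); apply.
have := (ae_eq_integral_abs P measurableT mI1).1.
rewrite (eq_integral (fun w => \int[nu w]_(p in `]0%R, T] `*` setT) (W1 w p.1 p.2)%:E)%E); last first.
  by move=> w _; rewrite gee0_abs// integral_ge0// => p _; rewrite lee_fin.
move=> /(_ int0) nu0.
move: nu0 nu_fin; apply: filterS2 => w /(_ Logic.I) n0 fin t tT.
apply: contrapT => nz; have Wt := atomW w t tT fin nz.
rewrite /cst in n0.
have e : nu w ([set t] `*` setT) = (\int[nu w]_(p in [set t] `*` setT) (W1 w p.1 p.2)%:E)%E.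
  rewrite (eq_integral (cst 1%E)); first by rewrite integral_cst ?mul1e.
  by move=> [s x]; rewrite inE => -[/= -> _]; rewrite /W1 indicE mem_set.
apply: nz; apply/eqP; rewrite eq_le measure_ge0 andbT e -[leRHS]n0.
apply: ge0_subset_integral => //.
- apply/measurable_EFinP; apply: measurable_funTS.
  have mWs : measurable [set t | W (w, t)].
    have /(measurable_xsection w) := predictable_measurable fG GW.
    by congr measurable; apply/seteqP; split => s; rewrite /xsection /= inE.
  rewrite (_ : (fun p => _) = (\1_[set t | W (w, t)] : R -> R) \o fst); last first.
    by apply/funext => -[s x]; rewrite /W1 /= !indicE; congr (_%:R); apply/idP/idP; rewrite !inE.
  by apply: measurableT_comp => //; exact: measurable_indic.
- by move=> p _; rewrite lee_fin.
- by move=> [s x] [/= -> _]; split => //=; rewrite in_itv.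
Qed.

End atomless_compensator.

(** * Integrals over times and marks *)

Section bounded_measurable.
Context (R : realType) d (S : measurableType d).
Implicit Types f g : S -> R.

Definition bounded_mfun f := measurable_fun setT f /\ exists K, forall x, `|f x| <= K.

Lemma bounded_mfun_cst c : bounded_mfun (cst c).
Proof. by split => //; exists `|c|. Qed.

Lemma bounded_mfunD f g : bounded_mfun f -> bounded_mfun g -> bounded_mfun (fun x => f x + g x).
Proof.
move=> [mf [K hK]] [mg [L hL]]; split; first exact: measurable_funD.
by exists (K + L) => x; rewrite (le_trans (ler_normD _ _))// lerD.
Qed.

Lemma bounded_mfunM f g : bounded_mfun f -> bounded_mfun g -> bounded_mfun (fun x => f x * g x).
Proof.
move=> [mf [K hK]] [mg [L hL]]; split; first exact: measurable_funM.
by exists (K * L) => x; rewrite normrM ler_pM.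
Qed.

Lemma bounded_mfunN f : bounded_mfun f -> bounded_mfun (fun x => - f x).
Proof.
move=> [mf [K hK]]; split; first exact: measurableT_comp.
by exists K => x; rewrite normrN.
Qed.

Lemma bounded_mfunB f g : bounded_mfun f -> bounded_mfun g -> bounded_mfun (fun x => f x - g x).
Proof. by move=> bf bg; apply: bounded_mfunD => //; exact: bounded_mfunN. Qed.

Lemma bounded_mfunX f k : bounded_mfun f -> bounded_mfun (fun x => f x ^+ k).
Proof.
move=> bf; elim: k => [|k ih]; first by under eq_fun do rewrite expr0; exact: bounded_mfun_cst.
by under eq_fun do rewrite exprS; exact: bounded_mfunM.
Qed.

Lemma bounded_mfun_exp f : bounded_mfun f -> bounded_mfun (fun x => expR (f x)).
Proof.
move=> [mf [K hK]]; split; first exact: measurableT_comp.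
by exists (expR K) => x; rewrite ger0_norm ?expR_ge0// ler_expR (le_trans (ler_norm _)).
Qed.

Lemma bounded_mfun_bool (b : S -> bool) : measurable_fun setT b -> bounded_mfun (fun x => (b x)%:R).
Proof.
move=> mb; split; last by exists 1 => x; case: (b x); rewrite ?normr0 ?normr1.
rewrite (_ : (fun x => _) = (fun x => if b x then 1 else 0)); last by apply/funext => x; case: (b x).
exact: measurable_fun_ifT.
Qed.

Lemma bounded_mfun_sum (I : eqType) (s : seq I) (F : I -> S -> R) :
  (forall i, i \in s -> bounded_mfun (F i)) -> bounded_mfun (fun x => \sum_(i <- s) F i x).
Proof.
elim: s => [|i s ih] h; first by under eq_fun do rewrite big_nil; exact: bounded_mfun_cst.
under eq_fun do rewrite big_cons; apply: bounded_mfunD; first by apply: h; rewrite inE eqxx.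
by apply: ih => j js; apply: h; rewrite inE js orbT.
Qed.

End bounded_measurable.

Section bounded_integral.
Context (R : realType) d (S : measurableType d).
Variable m : {measure set S -> \bar R}.
Hypothesis mfin : (m setT < +oo)%E.
Implicit Types f g : S -> R.

Lemma bounded_mfun_integrable f : bounded_mfun f -> m.-integrable setT (EFin \o f).
Proof.
move=> [mf [K hK]]; apply: measurable_bounded_integrable => //.
by exists K; split; [rewrite num_real|move=> x Kx y _; exact: le_trans (hK y) (ltW Kx)].
Qed.
Let bint := bounded_mfun_integrable.

Lemma Rint_D f g : bounded_mfun f -> bounded_mfun g ->
  \int[m]_x (f x + g x) = \int[m]_x f x + \int[m]_x g x.
Proof. by move=> bf bg; rewrite RintegralD//; exact: bint. Qed.

Lemma Rint_B f g : bounded_mfun f -> bounded_mfun g ->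
  \int[m]_x (f x - g x) = \int[m]_x f x - \int[m]_x g x.
Proof. by move=> bf bg; rewrite RintegralB//; exact: bint. Qed.

Lemma Rint_Z c f : bounded_mfun f -> \int[m]_x (c * f x) = c * \int[m]_x f x.
Proof. by move=> bf; rewrite RintegralZl//; exact: bint. Qed.

Lemma Rint_sum (I : eqType) (s : seq I) (F : I -> S -> R) : (forall i, i \in s -> bounded_mfun (F i)) ->
  \int[m]_x (\sum_(i <- s) F i x) = \sum_(i <- s) \int[m]_x F i x.
Proof.
elim: s => [|i s ih] h.
  by rewrite big_nil (@eq_Rintegral _ _ _ m _ (cst 0)) ?Rintegral_cst ?mul0r// => x _; rewrite big_nil.
rewrite big_cons (@eq_Rintegral _ _ _ m _ (fun x => F i x + \sum_(j <- s) F j x)); last first.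
  by move=> x _; rewrite big_cons.
rewrite Rint_D ?ih//; first by move=> j js; apply: h; rewrite inE js orbT.
  by apply: h; rewrite inE eqxx.
by apply: bounded_mfun_sum => j js; apply: h; rewrite inE js orbT.
Qed.

Lemma EFin_Rint f : bounded_mfun f -> ((\int[m]_x f x)%:E = \int[m]_x (f x)%:E)%E.
Proof. by move=> bf; rewrite /Rintegral fineK//; exact: (integrable_fin_num measurableT (bint bf)). Qed.

Lemma Rint_bound f (K : R) : bounded_mfun f -> (forall x, `|f x| <= K) -> `|\int[m]_x f x| <= K * fine (m setT).
Proof.
move=> bf fK; apply: (le_trans (le_normr_Rintegral measurableT (bint bf))).
rewrite -(Rintegral_cst m measurableT); apply: le_Rintegral => //.
- by have := integrable_abse (bint bf).
- by apply: (bounded_mfun_integrable (f := cst K)); exact: bounded_mfun_cst.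
Qed.

Lemma Rint_cvg (F : nat -> S -> R) (f : S -> R) (K : R) : (forall k, measurable_fun setT (F k)) ->
  (forall k x, `|F k x| <= K) -> (forall x, F k x @[k --> \oo] --> f x) ->
  \int[m]_x F k x @[k --> \oo] --> \int[m]_x f x.
Proof.
move=> mF FK Ff.
have fK x : `|f x| <= K.
  have h : `|F k x| @[k --> \oo] --> `|f x| by exact: cvg_norm.
  rewrite -(cvg_lim _ h)//; apply: limr_le; first by apply/cvg_ex; eexists; exact: h.
  exact: nearW.
have mf : measurable_fun setT f by apply: (measurable_fun_cvg mF) => x _; exact: Ff.
have bf : bounded_mfun f by split => //; exists K.
have bF k : bounded_mfun (F k) by split => //; exists K.
have [_ _] : [/\ m.-integrable setT (EFin \o f), (\int[m]_x `|(F n x)%:E - (f x)%:E| @[n --> \oo] --> 0)%E &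
    (\int[m]_x (F n x)%:E @[n --> \oo] --> \int[m]_x (f x)%:E)%E].
  apply: (@dominated_convergence _ _ _ m setT measurableT (fun n => EFin \o F n) _ (cst K%:E)) => //.
  - by move=> n; exact/measurable_EFinP.
  - exact/measurable_EFinP.
  - by apply: aeW => x _; apply/fine_cvgP; split; [exact: nearW|exact: Ff].
  - by apply: (bounded_mfun_integrable (f := cst K)); exact: bounded_mfun_cst.
  - by apply: aeW => x n _; rewrite /= lee_fin.
rewrite -EFin_Rint// => h; apply: (@fine_cvg _ _ _ _ (fun n => \int[m]_x (F n x)%:E)%E) => //.
Qed.

End bounded_integral.

Section bounded_fubini.
Context (R : realType) d1 (S1 : measurableType d1) d2 (S2 : measurableType d2).
Variables (m1 : {measure set S1 -> \bar R}) (m2 : {measure set S2 -> \bar R}).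
Hypothesis m1fin : (m1 setT < +oo)%E.
Hypothesis m2fin : (m2 setT < +oo)%E.

Lemma bounded_mfun_sectionr (f : S1 * S2 -> R) x : bounded_mfun f -> bounded_mfun (fun y => f (x, y)).
Proof. by move=> [mf [K hK]]; split; [exact: measurableT_comp|exists K]. Qed.

Lemma bounded_mfun_sectionl (f : S1 * S2 -> R) y : bounded_mfun f -> bounded_mfun (fun x => f (x, y)).
Proof. by move=> [mf [K hK]]; split; [exact: measurableT_comp|exists K]. Qed.

Lemma bounded_mfun_Rint (f : S1 * S2 -> R) : bounded_mfun f -> bounded_mfun (fun x => \int[m2]_y f (x, y)).
Proof.
move=> bf; have [mf [K hK]] := bf; split; last first.
  by exists (K * fine (m2 setT)) => x; apply: Rint_bound => //; exact: bounded_mfun_sectionr.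
have bg : bounded_mfun (fun p => f p + K) by apply: bounded_mfunD => //; exact: bounded_mfun_cst.
have -> : (fun x => \int[m2]_y f (x, y)) =
    (fun x => fine (\int[m2]_y (f (x, y) + K)%:E)%E - K * fine (m2 setT)).
  apply/funext => x; rewrite -[fine _]/(\int[m2]_y (f (x, y) + K)) Rint_D//.
  - by rewrite Rintegral_cst// addrK.
  - exact: bounded_mfun_sectionr.
  - exact: bounded_mfun_cst.
apply: measurable_funB => //; apply: measurableT_comp => //.
apply: (@measurable_fun_integral_fam _ _ S1 S2 R (fun=> m2) _ _ (fun p => (f p + K)%:E)) => //.
- by apply/measurable_EFinP; exact: bg.1.
- by move=> p; rewrite lee_fin -lerBlDr sub0r; have := hK p; rewrite ler_norml => /andP[].
Qed.

End bounded_fubini.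

Section bounded_fubini_swap.
Context (R : realType) d1 (S1 : measurableType d1) d2 (S2 : measurableType d2).
Variables (m1 : {measure set S1 -> \bar R}) (m2 : {measure set S2 -> \bar R}).
Hypothesis m1fin : (m1 setT < +oo)%E.
Hypothesis m2fin : (m2 setT < +oo)%E.

Lemma bounded_mfun_swap (f : S1 * S2 -> R) : bounded_mfun f -> bounded_mfun (fun q : S2 * S1 => f (q.2, q.1)).
Proof.
move=> [mf [K hK]]; split; last by exists K.
apply: (measurableT_comp mf).
by apply: measurable_fun_pair; [exact: measurable_snd|exact: measurable_fst].
Qed.

Lemma Rint_swap (f : S1 * S2 -> R) : bounded_mfun f ->
  \int[m1]_x \int[m2]_y f (x, y) = \int[m2]_y \int[m1]_x f (x, y).
Proof.
move=> bf; have [mf [K hK]] := bf.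
have bg : bounded_mfun (fun p => f p + K) by apply: bounded_mfunD => //; exact: bounded_mfun_cst.
have bs x : bounded_mfun (fun y => f (x, y)) by exact: bounded_mfun_sectionr.
have bs' y : bounded_mfun (fun x => f (x, y)) by exact: bounded_mfun_sectionl.
have bswap := bounded_mfun_swap bf.
have key : \int[m1]_x \int[m2]_y (f (x, y) + K) = \int[m2]_y \int[m1]_x (f (x, y) + K).
  apply: EFin_inj; rewrite !EFin_Rint//; last 2 first.
  - exact: (@bounded_mfun_Rint _ _ _ _ _ m1 m1fin _ (bounded_mfun_swap bg)).
  - exact: (bounded_mfun_Rint m2fin bg).
  transitivity (\int[m1]_x \int[m2]_y (f (x, y) + K)%:E)%E.
    by apply: eq_integral => x _; rewrite EFin_Rint//; apply: bounded_mfunD => //; exact: bounded_mfun_cst.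
  rewrite (finite_tonelli m1fin m2fin (f := fun p => (f p + K)%:E)).
  - by apply: eq_integral => y _; rewrite EFin_Rint//; apply: bounded_mfunD => //; exact: bounded_mfun_cst.
  - by apply/measurable_EFinP; exact: bg.1.
  - by move=> p; rewrite lee_fin -lerBlDr sub0r; have := hK p; rewrite ler_norml => /andP[].
have e1 : \int[m1]_x \int[m2]_y (f (x, y) + K) = \int[m1]_x \int[m2]_y f (x, y) + K * fine (m2 setT) * fine (m1 setT).
  rewrite (@eq_Rintegral _ _ _ m1 _ (fun x => \int[m2]_y f (x, y) + K * fine (m2 setT))); last first.
    by move=> x _; rewrite Rint_D ?Rintegral_cst//; exact: bounded_mfun_cst.
  by rewrite Rint_D ?Rintegral_cst//; [exact: bounded_mfun_Rint|exact: bounded_mfun_cst].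
have e2 : \int[m2]_y \int[m1]_x (f (x, y) + K) = \int[m2]_y \int[m1]_x f (x, y) + K * fine (m1 setT) * fine (m2 setT).
  rewrite (@eq_Rintegral _ _ _ m2 _ (fun y => \int[m1]_x f (x, y) + K * fine (m1 setT))); last first.
    by move=> x _; rewrite Rint_D ?Rintegral_cst//; exact: bounded_mfun_cst.
  rewrite Rint_D ?Rintegral_cst//; last exact: bounded_mfun_cst.
  exact: (@bounded_mfun_Rint _ _ _ _ _ m1 m1fin _ bswap).
by apply: (@addIr _ (K * fine (m2 setT) * fine (m1 setT))); rewrite -e1 key e2 mulrAC.
Qed.

End bounded_fubini_swap.

Section time_integrals.
Context (R : realType) d (E : measurableType d).
Let S := (R * E)%type.
Implicit Types (n k : {measure set S -> \bar R}) (f g h : S -> R) (s : seq S).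

Definition upto n f (t : R) := \int[n]_p (f p * (p.1 <= t)%R%:R).
Definition before n f (t : R) := \int[n]_p (f p * (p.1 < t)%R%:R).

Definition no_time_atom n := forall t, n ([set t] `*` setT) = 0%E.

Lemma bounded_le (t : R) : bounded_mfun (fun p : S => (p.1 <= t)%R%:R : R).
Proof. by apply: bounded_mfun_bool; apply: measurable_fun_ler. Qed.

Lemma bounded_lt (t : R) : bounded_mfun (fun p : S => (p.1 < t)%R%:R : R).
Proof. by apply: bounded_mfun_bool; apply: measurable_fun_ltr. Qed.

Lemma bounded_gt (t : R) : bounded_mfun (fun p : S => (t < p.1)%R%:R : R).
Proof. by apply: bounded_mfun_bool; apply: measurable_fun_ltr. Qed.

Lemma bounded_fst f : bounded_mfun f -> bounded_mfun (fun q : S * S => f q.1).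
Proof. by move=> [mf [K hK]]; split; [exact: measurableT_comp|exists K]. Qed.

Lemma bounded_snd f : bounded_mfun f -> bounded_mfun (fun q : S * S => f q.2).
Proof. by move=> [mf [K hK]]; split; [exact: measurableT_comp|exists K]. Qed.

Lemma bounded_lt12 : bounded_mfun (fun q : S * S => (q.1.1 < q.2.1)%R%:R : R).
Proof.
apply: bounded_mfun_bool; apply: measurable_fun_ltr.
- exact: (measurableT_comp measurable_fst measurable_fst).
- exact: (measurableT_comp measurable_fst measurable_snd).
Qed.

Lemma bounded_le12 : bounded_mfun (fun q : S * S => (q.1.1 <= q.2.1)%R%:R : R).
Proof.
apply: bounded_mfun_bool; apply: measurable_fun_ler.
- exact: (measurableT_comp measurable_fst measurable_fst).
- exact: (measurableT_comp measurable_fst measurable_snd).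
Qed.

Let measT : measurable_fun setT (fst : S -> R) := @measurable_fst _ _ R E.

Lemma bounded_upto n f : (n setT < +oo)%E -> bounded_mfun f -> bounded_mfun (fun q : S => upto n f q.1).
Proof.
move=> nfin bf.
apply: (@bounded_mfun_Rint _ _ _ _ _ n nfin (fun q : S * S => f q.2 * (q.2.1 <= q.1.1)%R%:R)).
apply: bounded_mfunM; first exact: bounded_snd.
exact: (bounded_mfun_swap bounded_le12).
Qed.

Lemma bounded_before n f : (n setT < +oo)%E -> bounded_mfun f -> bounded_mfun (fun q : S => before n f q.1).
Proof.
move=> nfin bf.
apply: (@bounded_mfun_Rint _ _ _ _ _ n nfin (fun q : S * S => f q.2 * (q.2.1 < q.1.1)%R%:R)).
apply: bounded_mfunM; first exact: bounded_snd.
exact: (bounded_mfun_swap bounded_lt12).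
Qed.

Lemma Rint_off_times n s f g : no_time_atom n ->
  (forall p, p.1 \notin map fst s -> f p = g p) -> \int[n]_p f p = \int[n]_p g p.
Proof.
move=> na fg; congr fine; apply: ae_eq_integral_nomeas.
have [mN nN] : measurable ([set` map fst s] `*` setT : set S) /\ n ([set` map fst s] `*` setT) = 0%E.
  elim: (map fst s) => [|t s' [ih1 ih2]].
    by rewrite set_nil set0X measure0; split => //; exact: measurable0.
  have mt : measurable ([set t] `*` setT : set S) by exact: measurableX.
  rewrite (_ : _ `*` _ = [set t] `*` setT `|` [set` s'] `*` setT).
    by split; [exact: measurableU|rewrite (measureU0 mt ih1 ih2)].
  apply/seteqP; split => [[u x] [/= + _]|[u x] [[/= -> _]|[/= us _]]].
  - by rewrite inE => /predU1P[->|us]; [left|right].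
  - by split => //=; rewrite inE eqxx.
  - by split => //=; rewrite inE us orbT.
exists ([set` map fst s] `*` setT); split => //.
move=> p /= h; split => //=; apply: contrapT => /negP ps; apply: h => _.
  by rewrite fg.
Qed.

Lemma before_upto n f t : no_time_atom n -> before n f t = upto n f t.
Proof.
move=> na.
have [x|nE] := pselect (exists x : E, True); last first.
  by apply: eq_Rintegral => -[u x]; exfalso; apply: nE; exists x.
have [x0 _] := cid x.
apply: (@Rint_off_times n [:: (t, x0)]) => // p; rewrite /= inE => pt.
by rewrite lt_neqAle pt.
Qed.

(** Fubini on the square of times, cut along the diagonal. The diagonal itself is
    put in the first term. *)
Lemma Rint_mul n1 n2 f h : (n1 setT < +oo)%E -> (n2 setT < +oo)%E -> bounded_mfun f -> bounded_mfun h ->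
  (\int[n1]_p f p) * (\int[n2]_q h q) =
  \int[n2]_q (upto n1 f q.1 * h q) + \int[n1]_p (before n2 h p.1 * f p).
Proof.
move=> fin1 fin2 bf bh.
have bgt t : bounded_mfun (fun p : S => f p * (t < p.1)%R%:R) by apply: bounded_mfunM => //; exact: bounded_gt.
have split1 t : \int[n1]_p f p = upto n1 f t + \int[n1]_p (f p * (t < p.1)%R%:R).
  rewrite /upto -Rint_D//; last by apply: bounded_mfunM => //; exact: bounded_le.
  by apply: eq_Rintegral => p _; rewrite -mulrDr ltNge; case: (p.1 <= t); rewrite ?addr0 ?add0r mulr1.
have bF : bounded_mfun (fun q : S * S => f q.1 * h q.2 * (q.2.1 < q.1.1)%R%:R).
  apply: bounded_mfunM; last exact: (bounded_mfun_swap bounded_lt12).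
  by apply: bounded_mfunM; [exact: bounded_fst|exact: bounded_snd].
have bG : bounded_mfun (fun q : S => \int[n1]_p (f p * (q.1 < p.1)%R%:R) * h q).
  apply: bounded_mfunM => //.
  apply: (@bounded_mfun_Rint _ _ _ _ _ n1 fin1 (fun q : S * S => f q.2 * (q.1.1 < q.2.1)%R%:R)).
  by apply: bounded_mfunM; [exact: bounded_snd|exact: bounded_lt12].
rewrite -Rint_Z//.
rewrite (@eq_Rintegral _ _ _ n2 _ (fun q => upto n1 f q.1 * h q + \int[n1]_p (f p * (q.1 < p.1)%R%:R) * h q)); last first.
  by move=> q _; rewrite (split1 q.1) mulrDl.
rewrite Rint_D//; last by apply: bounded_mfunM => //; exact: bounded_upto.
congr (_ + _).
transitivity (\int[n2]_q \int[n1]_p (f p * h q * (q.1 < p.1)%R%:R)).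
  apply: eq_Rintegral => q _; rewrite mulrC -Rint_Z//.
  by apply: eq_Rintegral => p _; rewrite mulrCA mulrA.
rewrite -(Rint_swap fin1 fin2 bF); apply: eq_Rintegral => p _ /=.
rewrite mulrC /before -(Rint_Z fin2); last by apply: bounded_mfunM => //; exact: bounded_lt.
by apply: eq_Rintegral => q _; rewrite mulrA.
Qed.

End time_integrals.

(** * Exponentials and integration by parts along a path *)

Section exponential_formula.
Context (R : realType) d (E : measurableType d).
Let S := (R * E)%type.

Lemma upto_cut (n : {measure set S -> \bar R}) (f : S -> R) u t : u <= t ->
  upto n (fun p => f p * (p.1 <= t)%R%:R) u = upto n f u.
Proof.
move=> ut; apply: eq_Rintegral => p _; have [pu|] := leP p.1 u; rewrite ?mulr0// !mulr1.
by rewrite (le_trans pu ut) mulr1.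
Qed.

Lemma before_cut (n : {measure set S -> \bar R}) (f : S -> R) u t : u <= t ->
  before n (fun p => f p * (p.1 <= t)%R%:R) u = before n f u.
Proof.
move=> ut; apply: eq_Rintegral => p _; have [pu|] := ltP p.1 u; rewrite ?mulr0// !mulr1.
by rewrite (ltW (lt_le_trans pu ut)) mulr1.
Qed.

Lemma upto_mul (n1 n2 : {measure set S -> \bar R}) (f h : S -> R) t : (n1 setT < +oo)%E -> (n2 setT < +oo)%E ->
  no_time_atom n2 -> bounded_mfun f -> bounded_mfun h ->
  upto n1 f t * upto n2 h t =
  upto n2 (fun q => upto n1 f q.1 * h q) t + upto n1 (fun p => upto n2 h p.1 * f p) t.
Proof.
move=> fin1 fin2 na bf bh; have bl := @bounded_le R _ E t.
rewrite /upto Rint_mul//; [|exact: bounded_mfunM|exact: bounded_mfunM].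
congr (_ + _); apply: eq_Rintegral => q _.
  by have [qt|] := leP q.1 t; rewrite ?mulr0// !mulr1 upto_cut.
by have [qt|] := leP q.1 t; rewrite ?mulr0// !mulr1 before_cut// before_upto.
Qed.

Variable n : {measure set S -> \bar R}.
Hypothesis nfin : (n setT < +oo)%E.
Hypothesis na : no_time_atom n.

Lemma bounded_upto_cut (f : S -> R) t : bounded_mfun f -> bounded_mfun (fun p : S => f p * (p.1 <= t)%R%:R).
Proof. by move=> bf; apply: bounded_mfunM => //; exact: bounded_le. Qed.

(** The chain rule for powers: without atoms, the times of a product of integrals
    are almost everywhere distinct and can be ordered. *)
Lemma upto_pow (h : S -> R) k t : bounded_mfun h ->
  upto n h t ^+ k.+1 = upto n (fun p => k.+1%:R * upto n h p.1 ^+ k * h p) t.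
Proof.
move=> bh; have ba := bounded_upto nfin bh.
elim: k t => [|k ih] t.
  by rewrite expr1; apply: eq_Rintegral => p _; rewrite expr0 !mul1r.
have bg : bounded_mfun (fun p : S => k.+1%:R * upto n h p.1 ^+ k * h p).
  apply: bounded_mfunM => //; apply: bounded_mfunM; first exact: bounded_mfun_cst.
  exact: bounded_mfunX.
rewrite exprSr ih upto_mul// /upto -Rint_D//; last 2 first.
- apply: bounded_upto_cut; apply: bounded_mfunM => //; exact: bounded_upto.
- by apply: bounded_upto_cut; exact: bounded_mfunM.
apply: eq_Rintegral => p _; rewrite -/(upto n _ p.1) -/(upto n h p.1) -ih.
rewrite !exprS -(natr1 k.+1).
by move: (upto n h p.1 ^+ k) (k.+1%:R : R) => b c; ring.
Qed.

Lemma expR_series (x : R) : series (exp_coeff x) k @[k --> \oo] --> expR x.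
Proof. exact: is_cvg_series_exp_coeff. Qed.

Lemma norm_exp_series_le (x A : R) k : `|x| <= A -> `|series (exp_coeff x) k| <= expR A.
Proof.
move=> xA; apply: (@le_trans _ _ (series (exp_coeff A) k)).
  rewrite /series/= (le_trans (ler_norm_sum _ _ _))//; apply: ler_sum => i _.
  rewrite /exp_coeff/= normrM normrX [X in _ * X]ger0_norm// ler_wpM2r//.
  by apply: lerXn2r => //; rewrite nnegrE// (le_trans _ xA).
have A0 : 0 <= A by apply: le_trans xA.
have h := @expR_series A; rewrite -(cvg_lim _ h)//.
apply: nondecreasing_cvgn_le; last by apply/cvg_ex; eexists; exact: h.
apply: nondecreasing_series => i _ _; rewrite /exp_coeff /= divr_ge0// exprn_ge0//.
Qed.

(** The chain rule for an atomless measure, by summing the formulas for the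
    powers of the primitive. *)
Lemma expR_upto (h : S -> R) t : bounded_mfun h ->
  expR (upto n h t) = 1 + upto n (fun p => expR (upto n h p.1) * h p) t.
Proof.
move=> bh; have ba := bounded_upto nfin bh.
have [_ [A hA]] := ba; have [mh [B hB]] := bh.
pose F k (p : S) := series (exp_coeff (upto n h p.1)) k * h p * (p.1 <= t)%R%:R.
have bF k : bounded_mfun (F k).
  apply: bounded_upto_cut; apply: bounded_mfunM => //; rewrite /series /=.
  apply: (bounded_mfun_sum (F := fun i p => exp_coeff (upto n h p.1) i)) => i _.
  by apply: bounded_mfunM; [exact: bounded_mfunX|exact: bounded_mfun_cst].
have B0 (p : S) : 0 <= B := le_trans (normr_ge0 _) (hB p).
have cF : \int[n]_p F k p @[k --> \oo] --> upto n (fun p => expR (upto n h p.1) * h p) t.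
  apply: (Rint_cvg nfin (K := expR A * B)).
  - by move=> k; exact: (bF k).1.
  - move=> k p; rewrite normrM normrM -[leRHS]mulr1 ler_pM ?mulr_ge0//.
      by rewrite ler_pM//; exact: norm_exp_series_le.
    by case: (p.1 <= t); rewrite ?normr0 ?normr1.
  - move=> p; apply: cvgMr_tmp; apply: cvgMr_tmp; exact: expR_series.
have FE k : \int[n]_p F k p = series (exp_coeff (upto n h t)) k.+1 - 1.
  rewrite (@eq_Rintegral _ _ _ n _ (fun p => \sum_(0 <= i < k)
     ((i.+1)`!%:R^-1 * ((i.+1%:R * upto n h p.1 ^+ i * h p) * (p.1 <= t)%R%:R)))); last first.
    move=> p _; rewrite /F /series /= !mulr_suml; apply: eq_bigr => i _.
    rewrite /exp_coeff /= factS natrM invfM.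
    have i0 : (i.+1%:R : R) != 0 by rewrite pnatr_eq0.
    move: (upto n h p.1 ^+ i) (h p) ((p.1 <= t)%R%:R : R) (i`!%:R^-1 : R) (i.+1%:R : R) i0 => a b c f x x0.
    by field.
  have bi (i : nat) : bounded_mfun (fun p : S => i.+1%:R * upto n h p.1 ^+ i * h p * (p.1 <= t)%R%:R).
    apply: bounded_upto_cut; apply: bounded_mfunM => //; apply: bounded_mfunM; first exact: bounded_mfun_cst.
    exact: bounded_mfunX.
  rewrite Rint_sum//; last by move=> i _; apply: bounded_mfunM => //; exact: bounded_mfun_cst.
  rewrite /series /= big_nat_recl// [exp_coeff _ 0]/exp_coeff /= expr0 fact0 divr1 addrAC subrr add0r.
  apply: eq_bigr => i _; rewrite Rint_Z// -/(upto n _ t) -upto_pow//.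
  by rewrite mulrC.
have c2 : series (exp_coeff (upto n h t)) k.+1 - 1 @[k --> \oo] --> expR (upto n h t) - 1.
  apply: cvgB; last exact: cvg_cst.
  by have := @expR_series (upto n h t); rewrite -cvg_shiftS.
have c3 : \int[n]_p F k p @[k --> \oo] --> expR (upto n h t) - 1.
  rewrite (_ : (fun k => \int[n]_p F k p) = (fun k => series (exp_coeff (upto n h t)) k.+1 - 1))//.
  by apply/funext.
have -> : upto n (fun p => expR (upto n h p.1) * h p) t = expR (upto n h t) - 1.
  exact: (cvg_unique _ cF c3).
by rewrite addrCA subrr addr0.
Qed.

End exponential_formula.

Section integration_by_parts.
Context (R : realType) d (E : measurableType d).
Let S := (R * E)%type.
Variables (n : {measure set S -> \bar R}) (s : seq S) (l0 : R) (g1 g2 : S -> R).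
Hypothesis nfin : (n setT < +oo)%E.
Hypothesis bg2 : bounded_mfun g2.

Definition jump_path (t : R) := l0 + \sum_(x <- s) g1 x * (x.1 <= t)%R%:R - upto n g2 t.
Definition jump_path_left (t : R) := l0 + \sum_(x <- s) g1 x * (x.1 < t)%R%:R - before n g2 t.
Let L := jump_path.

Lemma bounded_jump_path : bounded_mfun (fun p : S => L p.1).
Proof.
apply: bounded_mfunB; last exact: bounded_upto.
apply: bounded_mfunD; first exact: bounded_mfun_cst.
apply: (bounded_mfun_sum (F := fun x (p : S) => g1 x * (x.1 <= p.1)%R%:R)) => x _.
apply: bounded_mfunM; first exact: bounded_mfun_cst.
by apply: bounded_mfun_bool; apply: measurable_fun_ler.
Qed.

Lemma jump_path_increment u t : u <= t ->
  L t = L u + \sum_(x <- s) g1 x * ((u < x.1) && (x.1 <= t))%R%:R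
        - \int[n]_q (g2 q * ((u < q.1) && (q.1 <= t))%R%:R).
Proof.
move=> ut.
have bI : bounded_mfun (fun q : S => g2 q * ((u < q.1) && (q.1 <= t))%R%:R).
  apply: bounded_mfunM => //; apply: bounded_mfun_bool; apply: measurable_and.
    exact: measurable_fun_ltr.
  exact: measurable_fun_ler.
have dec (z : R) : (z <= t)%R%:R = (z <= u)%R%:R + ((u < z) && (z <= t))%R%:R :> R.
  have [zu|uz] := leP z u; first by rewrite (le_trans zu ut) addr0.
  by rewrite add0r.
have e : upto n g2 t = upto n g2 u + \int[n]_q (g2 q * ((u < q.1) && (q.1 <= t))%R%:R).
  rewrite /upto -Rint_D//; last exact: bounded_upto_cut.
  by apply: eq_Rintegral => q _; rewrite dec mulrDr.
rewrite /L /jump_path e (eq_bigr (fun x => g1 x * (x.1 <= u)%R%:R + g1 x * ((u < x.1) && (x.1 <= t))%R%:R)); last first.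
  by move=> x _; rewrite dec mulrDr.
by rewrite big_split /=; ring.
Qed.

(** Integration by parts of a jump path with an absolutely continuous path; no
    jump is common to the two. *)
Lemma ibp_integral (k : {measure set S -> \bar R}) (f : S -> R) t : (k setT < +oo)%E -> bounded_mfun f ->
  L t * upto k f t = upto k (fun p => L p.1 * f p) t
    + \sum_(x <- s) before k f x.1 * g1 x * (x.1 <= t)%R%:R
    - upto n (fun q => before k f q.1 * g2 q) t.
Proof.
move=> kfin bf.
have bft := bounded_upto_cut t bf.
have bLf : bounded_mfun (fun p : S => L p.1 * f p * (p.1 <= t)%R%:R).
  by apply: bounded_upto_cut; apply: bounded_mfunM => //; exact: bounded_jump_path.
have bx (x : S) : bounded_mfun (fun p : S => f p * (p.1 < x.1)%R%:R).
  by apply: bounded_mfunM => //; exact: bounded_lt.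
have b2 : bounded_mfun (fun z : S * S => (f z.1 * (z.1.1 < z.2.1)%R%:R) * (g2 z.2 * (z.2.1 <= t)%R%:R)).
  apply: bounded_mfunM; first by apply: bounded_mfunM; [exact: bounded_fst|exact: bounded_lt12].
  exact: (bounded_snd (bounded_upto_cut t bg2)).
rewrite -(Rint_Z kfin)// (@eq_Rintegral _ _ _ k _ (fun p => L p.1 * f p * (p.1 <= t)%R%:R
   + \sum_(x <- s) (g1 x * (x.1 <= t)%R%:R) * (f p * (p.1 < x.1)%R%:R)
   - \int[n]_q ((f p * (p.1 < q.1)%R%:R) * (g2 q * (q.1 <= t)%R%:R)))); last first.
  move=> p _; have [pt|tp] := leP p.1 t; last first.
    rewrite !mulr0 big1 ?add0r => [|x _].
      rewrite (@eq_Rintegral _ _ _ n _ (cst 0)) ?Rintegral_cst ?mul0r ?oppr0// => q _.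
      have [pq|_] := ltP p.1 q.1; last by rewrite mulr0 mul0r.
      by rewrite leNgt (lt_trans tp pq) !mulr0.
    have [px|_] := ltP p.1 x.1; last by rewrite !mulr0.
    by rewrite leNgt (lt_trans tp px) mulr0 mul0r.
  rewrite !mulr1 (jump_path_increment pt) mulrBl mulrDl mulr_suml; congr (_ + _ - _).
    apply: eq_bigr => x _; have [px|_] := ltP p.1 x.1; last by rewrite !mulr0 mul0r.
    by rewrite mulr1.
  rewrite mulrC -(Rint_Z nfin); last first.
    apply: bounded_mfunM => //; apply: bounded_mfun_bool; apply: measurable_and.
      exact: measurable_fun_ltr.
    exact: measurable_fun_ler.
  apply: eq_Rintegral => q _; have [pq|_] := ltP p.1 q.1; last by rewrite !mulr0 mul0r.
  by rewrite mulr1.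
have bS : bounded_mfun (fun p : S => \sum_(x <- s) (g1 x * (x.1 <= t)%R%:R) * (f p * (p.1 < x.1)%R%:R)).
  apply: (bounded_mfun_sum (F := fun x (p : S) => (g1 x * (x.1 <= t)%R%:R) * (f p * (p.1 < x.1)%R%:R))) => x _.
  by apply: bounded_mfunM => //; exact: bounded_mfun_cst.
rewrite Rint_B//; last 2 first.
- exact: bounded_mfunD.
- exact: (bounded_mfun_Rint nfin b2).
rewrite Rint_D// Rint_sum//; last first.
  by move=> x _; apply: bounded_mfunM => //; exact: bounded_mfun_cst.
congr (_ + _ - _).
  by apply: eq_bigr => x _; rewrite Rint_Z// -/(before k f x.1); ring.
rewrite (Rint_swap kfin nfin b2); apply: eq_Rintegral => q _ /=.
rewrite -mulrA [RHS]mulrC -(Rint_Z kfin)//.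
by apply: eq_Rintegral => p _; rewrite mulrC.
Qed.

(** Integration by parts of a jump path with a pure jump path. At a common jump
    the new value of the first path meets the old value of the second. *)
Lemma ibp_sum (s' : seq S) (f : S -> R) t :
  L t * (\sum_(y <- s') f y * (y.1 <= t)%R%:R) = \sum_(y <- s') L y.1 * f y * (y.1 <= t)%R%:R
    + \sum_(x <- s) (\sum_(y <- s') f y * (y.1 < x.1)%R%:R) * g1 x * (x.1 <= t)%R%:R
    - upto n (fun q => (\sum_(y <- s') f y * (y.1 < q.1)%R%:R) * g2 q) t.
Proof.
have b1 y : bounded_mfun (fun q : S => (f y * (y.1 < q.1)%R%:R) * (g2 q * (q.1 <= t)%R%:R)).
  apply: bounded_mfunM; last exact: bounded_upto_cut.
  by apply: bounded_mfunM; [exact: bounded_mfun_cst|exact: bounded_gt].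
have -> : upto n (fun q => (\sum_(y <- s') f y * (y.1 < q.1)%R%:R) * g2 q) t =
    \sum_(y <- s') \int[n]_q ((f y * (y.1 < q.1)%R%:R) * (g2 q * (q.1 <= t)%R%:R)).
  rewrite -Rint_sum//; apply: eq_Rintegral => q _; rewrite -mulrA mulr_suml.
  by apply: eq_bigr.
rewrite [X in _ + X - _](_ : _ = \sum_(y <- s') \sum_(x <- s) (f y * (y.1 < x.1)%R%:R) * (g1 x * (x.1 <= t)%R%:R)); last first.
  rewrite exchange_big /=; apply: eq_bigr => x _; rewrite -mulrA mulr_suml.
  by apply: eq_bigr.
rewrite mulr_sumr -big_split /= -sumrB; apply: eq_bigr => y _.
have [yt|ty] := leP y.1 t; last first.
  rewrite !mulr0 big1 ?add0r => [|x _].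
    rewrite (@eq_Rintegral _ _ _ n _ (cst 0)) ?Rintegral_cst ?mul0r ?oppr0// => q _.
    have [pq|_] := ltP y.1 q.1; last by rewrite mulr0 mul0r.
    by rewrite leNgt (lt_trans ty pq) !mulr0.
  have [px|_] := ltP y.1 x.1; last by rewrite mulr0 mul0r.
  by rewrite leNgt (lt_trans ty px) !mulr0.
rewrite !mulr1 (jump_path_increment yt) mulrBl mulrDl mulr_suml; congr (_ + _ - _).
  apply: eq_bigr => x _; have [px|_] := ltP y.1 x.1; last by rewrite !mulr0 !mul0r.
  by rewrite mulr1 mulrC.
rewrite mulrC -(Rint_Z nfin); last first.
  apply: bounded_mfunM => //; apply: bounded_mfun_bool; apply: measurable_and.
    exact: measurable_fun_ltr.
  exact: measurable_fun_ler.
apply: eq_Rintegral => q _; have [pq|_] := ltP y.1 q.1; last by rewrite !mulr0 mul0r.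
by rewrite mulr1.
Qed.

Lemma jump_path_left_cvg t : 0 < t -> L (grid_left k t) @[k --> \oo] --> jump_path_left t.
Proof.
move=> t0.
have ind (z : R) : (z <= grid_left k t)%R%:R @[k --> \oo] --> ((z < t)%R%:R : R).
  have [zt|tz] := ltP z t.
    have : \forall k \near \oo, t - (t - z) <= grid_left k t by apply: grid_left_near => //; rewrite subr_gt0.
    rewrite opprB addrCA subrr addr0 => h; apply: cvg_near_cst; apply: filterS h => k ->.
    by [].
  apply: cvg_near_cst; apply: nearW => k; rewrite leNgt (lt_le_trans (grid_left_lt k t0) tz).
  by [].
apply: cvgB.
  apply: cvgD; first exact: cvg_cst.
  elim: s => [|x s' ih]; first by rewrite big_nil; under eq_fun do rewrite big_nil; exact: cvg_cst.
  rewrite big_cons; under eq_fun do rewrite big_cons.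
  by apply: cvgD => //; apply: cvgMl_tmp; exact: ind.
have [mg [K hK]] := bg2.
apply: (Rint_cvg nfin (K := K)).
- by move=> k; apply: (bounded_upto_cut _ bg2).1.
- by move=> k p; rewrite normrM; case: (p.1 <= _); rewrite ?normr0 ?normr1 ?mulr1// mulr0 (le_trans _ (hK p)).
- by move=> p; apply: cvgMl_tmp; exact: ind.
Qed.

Lemma jump_pathE t : no_time_atom n ->
  L t = jump_path_left t + \sum_(x <- s) g1 x * (x.1 == t)%:R.
Proof.
move=> na; rewrite /L /jump_path /jump_path_left before_upto// [RHS]addrAC; congr (_ + _).
rewrite -addrA -big_split /=; congr (_ + _); apply: eq_bigr => x _; rewrite -mulrDr; congr (_ * _).
by rewrite le_eqVlt; case: eqVneq => [->|_]; rewrite ?ltxx ?add0r ?addr0.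
Qed.

End integration_by_parts.

(** * The paths of Doleans-Dade exponentials *)

Section marked_lists.
Context (R : realType) (E : eqType).
Let S := (R * E)%type.
Implicit Types (s : seq S) (t : R).

Definition nbefore s t := count (fun x : S => (x.1 < t)%R) s.
Definition nupto s t := count (fun x : S => (x.1 <= t)%R) s.

Let after (x y : S) := (y.1 < x.1)%R.

Lemma after_trans : transitive after.
Proof. by move=> y x z; rewrite /after => h1 h2; exact: lt_trans h1. Qed.

Lemma sort_times s : uniq (map fst s) ->
  exists s', [/\ sorted after s', uniq (map fst s') & exists2 p : seq nat, perm_eq p (iota 0 (size s)) &
    forall x0, s' = [seq nth x0 s i | i <- p]].
Proof.
move=> us; pose leT (x y : S) := (y.1 <= x.1)%R.
have tot : total leT by move=> x y; rewrite /leT; exact: le_total.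
have tr : transitive leT by move=> y x z; rewrite /leT => h1 h2; exact: le_trans h1.
case: s us => [|x0 s] us; first by exists [::]; split => //; exists [::].
set s0 := x0 :: s in us *.
have [p pp sp] : exists2 p : seq nat, perm_eq p (iota 0 (size s0)) & sort leT s0 = [seq nth x0 s0 i | i <- p].
  pose leI := relpre (nth x0 s0) leT.
  exists (sort leI (iota 0 (size s0))); first by rewrite perm_sort.
  by rewrite -sort_map -/(mkseq _ _) mkseq_nth.
have um : uniq (map fst (sort leT s0)).
  rewrite sp -map_comp; rewrite (perm_uniq (perm_map _ pp)).
  by move: us; rewrite -{1}(mkseq_nth x0 s0) /mkseq -map_comp.
exists (sort leT s0); split => //.
- move: (sort_sorted tot s0) um; elim: (sort leT s0) => //= y s' ih.
  rewrite /sorted /= => h /andP[yn us']; have := ih (path_sorted h) us'.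
  case: s' h yn {ih us'} => //= z s' /andP[yz _]; rewrite inE negb_or => /andP[nyz _] ->.
  by rewrite andbT /after lt_neqAle eq_sym nyz; exact: yz.
- exists p => // y0; rewrite sp; apply/eq_in_map => i ip; apply: set_nth_default.
  by move: ip; rewrite (perm_mem pp) mem_iota.
Qed.

Lemma big_sort s s' (p : seq nat) (F : S -> R) : perm_eq p (iota 0 (size s)) ->
  (forall x0, s' = [seq nth x0 s i | i <- p]) -> \sum_(x <- s') F x = \sum_(x <- s) F x.
Proof.
case: s => [|x0 s] pp h.
  have [x|nS] := pselect (exists x : S, True).
    have [x0 _] := cid x; rewrite (h x0); move/perm_size : pp => /= /size0nil ->.
    by rewrite !big_nil.
  by case: s' h => [|x s'] h; [rewrite !big_nil|exfalso; apply: nS; exists x].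
rewrite (h x0) big_map (perm_big _ pp) /= -[in RHS](mkseq_nth x0 (x0 :: s)) /mkseq big_map.
by [].
Qed.

Lemma nbeforeE s t : (nbefore s t)%:R = \sum_(x <- s) (x.1 < t)%R%:R :> R.
Proof.
rewrite /nbefore; elim: s => [|x s ih]; rewrite /= ?big_nil// big_cons natrD ih.
by [].
Qed.

Lemma nbefore_perm s s' (p : seq nat) t : perm_eq p (iota 0 (size s)) ->
  (forall x0, s' = [seq nth x0 s i | i <- p]) -> nbefore s' t = nbefore s t.
Proof.
move=> pp h; apply/eqP; rewrite -(eqr_nat R) !nbeforeE; apply/eqP.
exact: (big_sort (fun x => (x.1 < t)%R%:R) pp h).
Qed.

Lemma size_sort s s' (p : seq nat) : perm_eq p (iota 0 (size s)) ->
  (forall x0, s' = [seq nth x0 s i | i <- p]) -> size s' = size s.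
Proof.
move=> pp h; have [x|nS] := pselect (exists x : S, True).
  by have [x0 _] := cid x; rewrite (h x0) size_map (perm_size pp) size_iota.
case: s {pp h} => [|x s]; last by exfalso; apply: nS; exists x.
by case: s' => // x s'; exfalso; apply: nS; exists x.
Qed.

Lemma nbefore_all s t : all (fun x : S => x.1 < t) s -> nbefore s t = size s.
Proof. by move=> h; apply/eqP; rewrite -all_count. Qed.

Lemma sum_nbefore_sorted (phi : nat -> R) s : sorted after s ->
  \sum_(x <- s) phi (nbefore s x.1) = \sum_(i < size s) phi i.
Proof.
elim: s => [|x s ih] h; first by rewrite big_nil big_ord0.
have xs : all (after x) s by exact: order_path_min after_trans h.
have -> : size (x :: s) = (size s).+1 by [].
rewrite big_cons big_ord_recr /= addrC; congr (_ + _).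
  by congr phi; rewrite ltxx add0n; exact: nbefore_all.
apply: etrans (ih (path_sorted h)); apply: eq_big_seq => y ys; congr phi.
by rewrite ltNge (ltW (allP xs y ys)).
Qed.

(** Sorting by time numbers the points of [s] by the values of [nbefore]. *)
Lemma sum_nbefore (phi : nat -> R) s : uniq (map fst s) ->
  \sum_(x <- s) phi (nbefore s x.1) = \sum_(i < size s) phi i.
Proof.
move=> us; have [s' [ss' _ [p pp h]]] := sort_times us.
rewrite -(size_sort pp h) -(sum_nbefore_sorted phi ss') -(big_sort _ pp h).
by apply: eq_bigr => x _; rewrite (nbefore_perm _ pp h).
Qed.

Lemma nbefore_filter s t u : u <= t -> nbefore [seq x <- s | x.1 <= t] u = nbefore s u.
Proof.
move=> ut; rewrite /nbefore count_filter; apply: eq_count => x /=.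
by case: ltP => //= xu; rewrite (ltW (lt_le_trans xu ut)).
Qed.

Lemma sum_nbefore_upto (phi : nat -> R) s t : uniq (map fst s) ->
  \sum_(x <- s) phi (nbefore s x.1) * (x.1 <= t)%R%:R = \sum_(i < nupto s t) phi i.
Proof.
move=> us; pose s' := [seq x <- s | x.1 <= t].
have us' : uniq (map fst s').
  by apply: subseq_uniq us; apply: map_subseq; exact: filter_subseq.
have -> : nupto s t = size s' by rewrite size_filter.
rewrite -sum_nbefore// big_filter (big_mkcond (fun x : S => x.1 <= t)); apply: eq_bigr => x _.
by case: ifPn => [xt|_]; rewrite ?mulr0// mulr1 nbefore_filter.
Qed.

Lemma nbefore_nupto s t : t \notin map fst s -> nupto s t = nbefore s t.
Proof.
rewrite /nupto /nbefore => h; apply/eqP; elim: s h => //= x s ih.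
by rewrite inE negb_or => /andP[xt /ih /eqP ->]; rewrite le_eqVlt (eq_sym x.1) (negbTE xt).
Qed.

(** Each point multiplies the path by a factor between [0] and [M]. *)
Lemma jump_product_bound_sorted (M : R) (h : S -> R) (q : R -> R) s t : 1 <= M -> sorted after s ->
  (forall x, 0 <= 1 + h x <= M) ->
  (forall u, u <= t -> q u = 1 + \sum_(y <- s) q y.1 * h y * (y.1 < u)%R%:R) ->
  0 <= q t <= M ^+ nbefore s t.
Proof.
move=> M1; elim: s t => [|x s ih] t sx hM hq.
  by rewrite hq// big_nil addr0 expr0 ler01 lexx.
have xs : all (after x) s by exact: order_path_min after_trans sx.
have small u : u <= x.1 -> \sum_(y <- x :: s) q y.1 * h y * (y.1 < u)%R%:R = \sum_(y <- s) q y.1 * h y * (y.1 < u)%R%:R.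
  by move=> ux; rewrite big_cons ltNge ux mulr0 add0r.
have [xt|tx] := ltP x.1 t; last first.
  have -> : nbefore (x :: s) t = nbefore s t by rewrite /nbefore /= ltNge tx.
  apply: ih; rewrite ?(path_sorted sx)// => u ut; rewrite hq// small//; exact: le_trans tx.
have hx : 0 <= q x.1 <= M ^+ nbefore s x.1.
  apply: ih; rewrite ?(path_sorted sx)// => u ux; rewrite hq ?small//.
  exact: le_trans ux (ltW xt).
have -> : nbefore (x :: s) t = (nbefore s x.1).+1.
  rewrite (nbefore_all xs) nbefore_all//= xt /=.
  by apply: sub_all xs => y yx; exact: lt_trans xt.
have -> : q t = q x.1 * (1 + h x).
  rewrite hq// big_cons xt mulr1 mulrDr mulr1 addrCA addrC; congr (_ + _).
  rewrite [in RHS]hq ?(ltW xt)// small//; congr (1 + _).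
  by apply: eq_big_seq => y ys; have yx := allP xs y ys; rewrite (yx : y.1 < x.1) (lt_trans yx xt).
have /andP[q0 qM] := hx; have /andP[h0 h1] := hM x.
by rewrite mulr_ge0//= exprSr ler_pM.
Qed.

Lemma jump_product_bound (M : R) (h : S -> R) (q : R -> R) s t : 1 <= M -> uniq (map fst s) ->
  (forall x, 0 <= 1 + h x <= M) ->
  (forall u, q u = 1 + \sum_(y <- s) q y.1 * h y * (y.1 < u)%R%:R) ->
  0 <= q t <= M ^+ nbefore s t.
Proof.
move=> M1 us hM hq; have [s' [ss' _ [p pp e]]] := sort_times us.
rewrite -(nbefore_perm t pp e); apply: (jump_product_bound_sorted M1 ss' hM) => u _.
by rewrite hq (big_sort (fun y => q y.1 * h y * (y.1 < u)%R%:R) pp e).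
Qed.

End marked_lists.

Section path_identities.
Context (R : realType) d (E : measurableType d).
Let S := (R * E)%type.
Variables (n : {measure set S -> \bar R}) (s : seq S).
Hypothesis nfin : (n setT < +oo)%E.
Hypothesis na : no_time_atom n.
Hypothesis us : uniq (map fst s).

Lemma bounded_nbefore (phi : nat -> R) : bounded_mfun (fun p : S => phi (nbefore s p.1)).
Proof.
elim: s phi => [|x s' ih] phi; first exact: (@bounded_mfun_cst R _ S (phi 0%N)).
have -> : (fun p : S => phi (nbefore (x :: s') p.1)) =
    (fun p : S => (x.1 < p.1)%R%:R * phi (nbefore s' p.1).+1 + (1 - (x.1 < p.1)%R%:R) * phi (nbefore s' p.1)).
  by apply/funext => p; rewrite /nbefore /=; case: (x.1 < p.1); rewrite ?mul1r ?subrr ?mul0r ?addr0 ?subr0 ?mul1r ?add0r ?add1n.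
apply: bounded_mfunD; apply: bounded_mfunM.
- exact: bounded_gt.
- exact: (ih (fun k => phi k.+1)).
- by apply: bounded_mfunB; [exact: bounded_mfun_cst|exact: bounded_gt].
- exact: ih.
Qed.

Let bup (f : S -> R) : bounded_mfun f -> bounded_mfun (fun q : S => upto n f q.1).
Proof. exact: bounded_upto. Qed.

(** The path form of the exponential moment of the number of jumps, stopped at
    the [N]-th jump: [rho ^ count] compensated by the exponential of the
    compensator. *)
Lemma power_exponential_path (rho : R) (N : nat) t :
  let h := fun p : S => - ((rho - 1) * (nbefore s p.1 < N)%N%:R) in
  let W := fun p : S => expR (upto n h p.1) * (rho ^+ nbefore s p.1 * (rho - 1) * (nbefore s p.1 < N)%N%:R) in
  rho ^+ minn (nupto s t) N * expR (upto n h t) = 1 + \sum_(x <- s) W x * (x.1 <= t)%R%:R - upto n W t.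
Proof.
move=> h W.
pose g (p : S) := rho ^+ nbefore s p.1 * (rho - 1) * (nbefore s p.1 < N)%N%:R.
have bh : bounded_mfun h by apply: bounded_mfunN; apply: (bounded_nbefore (fun k => (rho - 1) * (k < N)%N%:R)).
have bg : bounded_mfun g by exact: (bounded_nbefore (fun k => rho ^+ k * (rho - 1) * (k < N)%N%:R)).
have be : bounded_mfun (fun p : S => expR (upto n h p.1)) by apply: bounded_mfun_exp; exact: bup.
pose J := jump_path n s 1 g (cst 0).
have upto0 u : upto n (cst 0) u = 0.
  by rewrite /upto (@eq_Rintegral _ _ _ n _ (cst 0)) ?Rintegral_cst ?mul0r// => p _; rewrite mul0r.
have JE u : J u = rho ^+ minn (nupto s u) N.
  rewrite /J /jump_path upto0 subr0 (sum_nbefore_upto (fun k => rho ^+ k * (rho - 1) * (k < N)%N%:R) u us).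
  elim: (nupto s u) => [|k ih]; first by rewrite big_ord0 addr0 min0n expr0.
  rewrite big_ord_recr /= addrA ih; have [kN|Nk] := ltnP k N.
    by rewrite (minn_idPl kN) mulr1 exprS; ring.
  by rewrite (minn_idPr (leqW Nk)) mulr0 addr0.
have b0 : bounded_mfun (cst 0 : S -> R) by exact: bounded_mfun_cst.
have beh : bounded_mfun (fun p : S => expR (upto n h p.1) * h p) by exact: bounded_mfunM.
have := ibp_integral s 1 g nfin b0 t nfin beh.
rewrite -/J.
have -> : upto n (fun p => expR (upto n h p.1) * h p) t = expR (upto n h t) - 1.
  by rewrite [in RHS](expR_upto nfin na t bh) addrAC subrr add0r.
rewrite (_ : upto n (fun q => before n (fun p => expR (upto n h p.1) * h p) q.1 * cst 0 q) t = 0); last first.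
  by rewrite -[RHS](upto0 t); apply: eq_Rintegral => p _; rewrite /cst !(mulr0, mul0r).
rewrite subr0 mulrBr mulr1 JE => /eqP; rewrite subr_eq => /eqP ->.
rewrite -JE {2}/J /jump_path upto0 subr0.
have -> : upto n (fun p => J p.1 * (expR (upto n h p.1) * h p)) t = - upto n W t.
  rewrite -mulN1r -(Rint_Z nfin); last by apply: bounded_upto_cut; exact: bounded_mfunM.
  apply: (@Rint_off_times _ _ _ n s) => // p ps.
  rewrite JE nbefore_nupto// /W (_ : h p = - ((rho - 1) * (nbefore s p.1 < N)%N%:R))//.
  by have [kN|_] := ltnP (nbefore s p.1) N; [rewrite !mulr1; ring|rewrite !(mulr0, oppr0, mul0r)].
have -> : \sum_(x <- s) before n (fun p => expR (upto n h p.1) * h p) x.1 * g x * (x.1 <= t)%R%:R =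
    \sum_(x <- s) W x * (x.1 <= t)%R%:R - \sum_(x <- s) g x * (x.1 <= t)%R%:R.
  rewrite -sumrB; apply: eq_bigr => x _; rewrite before_upto//.
  have -> : upto n (fun p => expR (upto n h p.1) * h p) x.1 = expR (upto n h x.1) - 1.
    by rewrite [in RHS](expR_upto nfin na x.1 bh) addrAC subrr add0r.
  by rewrite /W -/(g x); ring.
ring.
Qed.

Section doleans_path.
Variables (h g2 : S -> R) (g1 : S -> R).
Hypothesis bh : bounded_mfun h.
Hypothesis bg2 : bounded_mfun g2.
Let L := jump_path n s 1 g1 g2.
Let Lm := jump_path_left n s 1 g1 g2.
Hypothesis g1E : forall x, x \in s -> g1 x = Lm x.1 * h x.
Hypothesis g2E : forall p, g2 p = Lm p.1 * h p.
Variable M : R.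
Hypothesis M1 : 1 <= M.
Hypothesis hM : forall p, 0 <= 1 + h p <= M.
Hypothesis s_gt0 : forall x, x \in s -> 0 < x.1.

Let e t := expR (upto n h t).
Let beh : bounded_mfun (fun p : S => e p.1 * h p).
Proof. by apply: bounded_mfunM => //; apply: bounded_mfun_exp; exact: bup. Qed.
Let eE t : upto n (fun p => e p.1 * h p) t = e t - 1.
Proof. by rewrite [in RHS]/e (expR_upto nfin na t bh) addrAC subrr add0r. Qed.

Lemma jump_path_at_jump x : x \in s -> L x.1 = Lm x.1 * (1 + h x).
Proof.
move=> xs; rewrite /L jump_pathE// -/Lm mulrDr mulr1; congr (_ + _); rewrite -g1E//.
rewrite (bigD1_seq x) //=; last by exact: map_uniq us.
rewrite eqxx mulr1 big1_seq ?addr0// => y /andP[yx ys].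
case: eqP => [e1|]; last by rewrite mulr0.
exfalso; move/eqP : yx; apply.
have [i ilt xi] : exists2 i, (i < size s)%N & nth x s i = x by exists (index x s); [rewrite index_mem|exact: nth_index].
have [j jlt yj] : exists2 j, (j < size s)%N & nth x s j = y by exists (index y s); [rewrite index_mem|exact: nth_index].
have ji : j = i.
  apply: (uniqP x.1 us); rewrite ?inE ?size_map//.
  by rewrite !(nth_map x)// xi yj.
by rewrite -yj ji xi.
Qed.

(** Multiplying [L] by the exponential of its drift leaves a pure jump path, to
    which the product bound applies. *)
Lemma exponential_product_upto t : L t * e t = 1 + \sum_(x <- s) e x.1 * Lm x.1 * h x * (x.1 <= t)%R%:R.
Proof.
have := ibp_integral s 1 g1 nfin bg2 t nfin beh; rewrite -/L eE.
have -> : upto n (fun p => L p.1 * (e p.1 * h p)) t = upto n (fun q => e q.1 * g2 q) t.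
  apply: (@Rint_off_times _ _ _ n s) => // p ps.
  rewrite g2E /L jump_pathE// big1_seq ?addr0 -/Lm; first by ring.
  move=> x /= xs; case: eqP => [xp|]; last by rewrite mulr0.
  by exfalso; move/negP : ps; apply; rewrite -xp map_f.
have -> : upto n (fun q => before n (fun p => e p.1 * h p) q.1 * g2 q) t =
    upto n (fun q => e q.1 * g2 q) t - upto n g2 t.
  have beg : bounded_mfun (fun q : S => e q.1 * g2 q).
    by apply: bounded_mfunM => //; apply: bounded_mfun_exp; exact: bup.
  rewrite /upto -Rint_B//; [|exact: bounded_upto_cut|exact: bounded_upto_cut].
  by apply: eq_Rintegral => q _; rewrite before_upto// eE; ring.
have -> : \sum_(x <- s) before n (fun p => e p.1 * h p) x.1 * g1 x * (x.1 <= t)%R%:R =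
   \sum_(x <- s) e x.1 * Lm x.1 * h x * (x.1 <= t)%R%:R - \sum_(x <- s) g1 x * (x.1 <= t)%R%:R.
  rewrite -sumrB; apply: eq_big_seq => x xs.
  by rewrite before_upto// eE g1E//; ring.
rewrite mulrBr mulr1 => /eqP; rewrite subr_eq => /eqP ->.
by rewrite [in X in _ + X = _]/L /jump_path; ring.
Qed.

Lemma exponential_product_before t : 0 < t ->
  Lm t * e t = 1 + \sum_(x <- s) e x.1 * Lm x.1 * h x * (x.1 < t)%R%:R.
Proof.
move=> t0.
have b0 : bounded_mfun (cst 0 : S -> R) by exact: bounded_mfun_cst.
have upto0 u : upto n (cst 0) u = 0.
  by rewrite /upto (@eq_Rintegral _ _ _ n _ (cst 0)) ?Rintegral_cst ?mul0r// => p _; rewrite mul0r.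
have before0 u : before n (cst 0) u = 0.
  by rewrite /before (@eq_Rintegral _ _ _ n _ (cst 0)) ?Rintegral_cst ?mul0r// => p _; rewrite mul0r.
have cL := jump_path_left_cvg (s := s) (l0 := 1) (g1 := g1) nfin bg2 t0.
have cU := jump_path_left_cvg (s := s) (l0 := 1) (g1 := fun x => e x.1 * Lm x.1 * h x) nfin b0 t0.
have ce : e (grid_left k t) @[k --> \oo] --> e t.
  have c := jump_path_left_cvg (s := [::]) (l0 := 0) (g1 := cst 0) nfin bh t0.
  apply: (@continuous_cvg _ _ _ _ _ _ expR); first exact: continuous_expR.
  have : - jump_path n [::] 0 (cst 0) h (grid_left k t) @[k --> \oo] --> - jump_path_left n [::] 0 (cst 0) h t by exact: cvgN.
  rewrite /jump_path_left big_nil addr0 add0r opprK before_upto//.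
  by under eq_fun do rewrite /jump_path big_nil addr0 add0r opprK.
have h1 : L (grid_left k t) * e (grid_left k t) @[k --> \oo] --> Lm t * e t by exact: cvgM.
have h2 : L (grid_left k t) * e (grid_left k t) @[k --> \oo] -->
    1 + \sum_(x <- s) e x.1 * Lm x.1 * h x * (x.1 < t)%R%:R.
  rewrite (_ : (fun k => _) = (fun k => jump_path n s 1 (fun x => e x.1 * Lm x.1 * h x) (cst 0) (grid_left k t))).
    by move: cU; rewrite /jump_path_left before0 subr0.
  by apply/funext => k; rewrite exponential_product_upto /jump_path upto0 subr0.
exact: (cvg_unique _ h1 h2).
Qed.

Let q (u : R) := 1 + \sum_(x <- s) e x.1 * Lm x.1 * h x * (x.1 < u)%R%:R.

Let q_bound t : 0 <= q t <= M ^+ nbefore s t.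
Proof.
apply: (@jump_product_bound _ _ M h q s t) => // u; rewrite {1}/q; congr (1 + _).
apply: eq_big_seq => x xs; congr (_ * _ * _).
by rewrite mulrC exponential_product_before//; exact: s_gt0.
Qed.

Let e_lower t : (e t)^-1 <= expR (fine (n setT)).
Proof.
rewrite /e -expRN ler_expR.
have b1 : bounded_mfun (cst 1 : S -> R) by exact: bounded_mfun_cst.
have := Rintegral_cst n measurableT (1 : R); rewrite mul1r => <-.
rewrite -mulN1r -(Rint_Z nfin); last exact: bounded_upto_cut.
apply: le_Rintegral => //.
- apply: (bounded_mfun_integrable nfin); apply: bounded_mfunM; first exact: bounded_mfun_cst.
  exact: bounded_upto_cut.
- exact: (bounded_mfun_integrable nfin b1).
- move=> p _; have /andP[h0 _] := hM p.
  by case: (p.1 <= t); rewrite ?mulr1 ?mulr0; lra.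
Qed.

Lemma jump_path_left_bound t : 0 < t -> 0 <= Lm t <= M ^+ nbefore s t * expR (fine (n setT)).
Proof.
move=> t0; have /andP[q0 qM] := q_bound t; have e0 := expR_gt0 (upto n h t).
have -> : Lm t = q t * (e t)^-1 by rewrite /q -exponential_product_before// mulfK// gt_eqF.
by rewrite mulr_ge0 ?invr_ge0 ?(ltW e0)//= ler_pM// ?e_lower// invr_ge0 ltW.
Qed.

Lemma jump_path_bound t : (forall x, x \in s -> x.1 <= t) ->
  0 <= L t <= M ^+ size s * expR (fine (n setT)).
Proof.
move=> st; have e0 := expR_gt0 (upto n h t).
have st1 : all (fun x : S => x.1 < t + 1) s.
  by apply/allP => x xs; rewrite (le_lt_trans (st _ xs))// ltrDl.
have /andP[q0 qM] := q_bound (t + 1); rewrite nbefore_all// in qM.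
have -> : L t = q (t + 1) * (e t)^-1.
  have -> : q (t + 1) = L t * e t; last by rewrite mulfK// gt_eqF.
  rewrite exponential_product_upto /q; congr (1 + _); apply: eq_big_seq => x xs.
  by rewrite st// (allP st1 _ xs).
by rewrite mulr_ge0 ?invr_ge0 ?(ltW e0)//= ler_pM// ?e_lower// invr_ge0 ltW.
Qed.

(** Integration by parts turns [L] times an integral compensated under the
    changed measure into integrals compensated under the original one. *)
Lemma girsanov_path (f : S -> R) t : bounded_mfun f ->
  let D := fun u => \sum_(y <- s) f y * (y.1 < u)%R%:R - before n (fun p => f p * (1 + h p)) u in
  let W1 := fun p : S => Lm p.1 * f p * (1 + h p) in
  let W2 := fun p : S => D p.1 * (Lm p.1 * h p) in
  L t * (\sum_(y <- s) f y * (y.1 <= t)%R%:R - upto n (fun p => f p * (1 + h p)) t) =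
  (\sum_(x <- s) W1 x * (x.1 <= t)%R%:R - upto n W1 t) + (\sum_(x <- s) W2 x * (x.1 <= t)%R%:R - upto n W2 t).
Proof.
move=> bf D W1 W2.
have b1h : bounded_mfun (fun p : S => 1 + h p) by apply: bounded_mfunD => //; exact: bounded_mfun_cst.
have bfr : bounded_mfun (fun p : S => f p * (1 + h p)) by exact: bounded_mfunM.
rewrite mulrBr ibp_sum// ibp_integral//.
have -> : upto n (fun p => L p.1 * (f p * (1 + h p))) t = upto n W1 t.
  apply: (@Rint_off_times _ _ _ n s) => // p ps.
  rewrite /L jump_pathE// big1_seq ?addr0 -/Lm; first by rewrite /W1 mulrA.
  move=> x /= xs; case: eqP => [xp|]; last by rewrite mulr0.
  by exfalso; move/negP : ps; apply; rewrite -xp map_f.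
have -> : \sum_(y <- s) jump_path n s 1 g1 g2 y.1 * f y * (y.1 <= t)%R%:R = \sum_(x <- s) W1 x * (x.1 <= t)%R%:R.
  by apply: eq_big_seq => x xs; rewrite -/(L x.1) jump_path_at_jump// /W1; ring.
have -> : \sum_(x <- s) W2 x * (x.1 <= t)%R%:R =
   \sum_(x <- s) (\sum_(y <- s) f y * (y.1 < x.1)%R%:R) * g1 x * (x.1 <= t)%R%:R -
   \sum_(x <- s) before n (fun p => f p * (1 + h p)) x.1 * g1 x * (x.1 <= t)%R%:R.
  by rewrite -sumrB; apply: eq_big_seq => x xs; rewrite /W2 /D -g1E//; ring.
have bK : bounded_mfun (fun q : S => \sum_(y <- s) f y * (y.1 < q.1)%R%:R).
  apply: (bounded_mfun_sum (F := fun y (q : S) => f y * (y.1 < q.1)%R%:R)) => y _.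
  by apply: bounded_mfunM; [exact: bounded_mfun_cst|exact: bounded_gt].
have -> : upto n W2 t = upto n (fun q => (\sum_(y <- s) f y * (y.1 < q.1)%R%:R) * g2 q) t -
   upto n (fun q => before n (fun p => f p * (1 + h p)) q.1 * g2 q) t.
  rewrite /upto -Rint_B//; last 2 first.
  - by apply: bounded_upto_cut; exact: bounded_mfunM.
  - by apply: bounded_upto_cut; apply: bounded_mfunM => //; exact: bounded_before.
  by apply: eq_Rintegral => p _; rewrite /W2 /D -g2E; ring.
ring.
Qed.

End doleans_path.

End path_identities.

(** * Integrals of predictable fields over marked points *)

Lemma integrable_ae_eq (R : realType) (d : measure_display) (A : measurableType d)
    (m : {measure set A -> \bar R}) (f g : A -> \bar R) : measurable_fun setT g ->
  {ae m, forall x, setT x -> f x = g x} -> m.-integrable setT f -> m.-integrable setT g.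
Proof.
move=> mg fg /integrableP[_ fi]; apply/integrableP; split => //; apply: le_lt_trans fi.
rewrite le_eqVlt; apply/predU1P; left; apply: ae_eq_integral_nomeas.
by apply: filterS fg => x h xT; rewrite h.
Qed.

Lemma measurable_fun_pair_in (da db dc : measure_display) (A : measurableType da)
    (B : measurableType db) (C : measurableType dc) (D : set A) (f : A -> B) (g : A -> C) :
  measurable_fun D f -> measurable_fun D g -> measurable_fun D (fun x => (f x, g x)).
Proof.
move=> mf mg mD; apply: (@measurability _ _ _ _ D _ [set B1 `*` C1 | B1 in measurable & C1 in measurable] _ _ mD).
  exact: measurable_prod_measurableType.
move=> _ [_ [B1 mB1 [C1 mC1 <-]] <-].
rewrite (_ : _ `&` _ = (D `&` f @^-1` B1) `&` (D `&` g @^-1` C1)).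
  exact: measurableI (mf mD _ mB1) (mg mD _ mC1).
by apply/seteqP; split => x /=; [move=> [Dx [? ?]]|move=> [[Dx ?] [_ ?]]].
Qed.

Section marked_points.
Context (R : realType) (d0 : measure_display) (Omega : measurableType d0).
Variables (P : probability Omega R) (G : R -> set_system Omega).
Context (d1 : measure_display) (E : measurableType d1).
Variables (T : R) (theta : nat -> Omega -> \bar R) (zeta : nat -> Omega -> E).
Hypothesis T0 : 0 < T.
Hypothesis fG : filtration G.
Hypothesis theta_stop : forall n, stopping_time G (theta n).
Hypothesis theta_gt0 : forall n w, (0 < theta n w)%E.
Hypothesis zeta_stop : forall n t B, 0 <= t -> measurable B ->
  G t ([set w | (theta n w <= t%:E)%E] `&` zeta n @^-1` B).
Hypothesis theta_lf : forall w, locally_finite (theta ^~ w).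

Let Gs t : 0 <= t -> sigma_algebra setT (G t). Proof. by case: fG => + _ _; exact. Qed.
Let Gm t : 0 <= t -> G t `<=` measurable. Proof. by case: fG => _ + _; exact. Qed.
Let Gi s t : 0 <= s -> s <= t -> G s `<=` G t. Proof. by case: fG => _ _; exact. Qed.
Let T0' : 0 <= T := ltW T0.

Local Notation PrT := (predictableType G).
Local Notation field := ((PrT * E)%type -> R).

Let bd w : nat := sval (cid (theta_lf w T)).

Let bdP w n : (bd w <= n)%N -> (T%:E < theta n w)%E.
Proof. exact: (svalP (cid (theta_lf w T))). Qed.

Definition points w : seq (R * E) :=
  [seq (fine (theta n w), zeta n w) | n <- iota 0 (bd w) & (theta n w <= T%:E)%E].

Lemma sum_points (V : nmodType) (f : R * E -> V) w N : (bd w <= N)%N ->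
  \sum_(x <- points w) f x =
  \sum_(n < N) (if (theta n w <= T%:E)%E then f (fine (theta n w), zeta n w) else 0).
Proof.
move=> bN; rewrite /points big_map big_filter big_mkcond /= -(subn0 (bd w)) -/(index_iota 0 (bd w)).
rewrite -(big_mkord xpredT (fun n => if (theta n w <= T%:E)%E then f (fine (theta n w), zeta n w) else 0)).
rewrite [RHS](big_cat_nat (n := bd w))//= [X in _ = _ + X]big_nat_cond [X in _ = _ + X]big1 ?addr0//.
by move=> n /andP[/andP[bn _] _]; rewrite leNgt bdP.
Qed.

Lemma points_in w x : x \in points w -> 0 < x.1 <= T.
Proof.
move=> /mapP[n]; rewrite mem_filter => /andP[nT _] -> /=.
have fn : theta n w \is a fin_num by rewrite fin_real// (lt_trans _ (theta_gt0 n w)) ?ltNyr//= (le_lt_trans nT)// ltry.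
by rewrite -lte_fin -lee_fin fineK// theta_gt0.
Qed.

Lemma pointsP w x : reflect (exists2 n, (theta n w <= T%:E)%E & x = (fine (theta n w), zeta n w))
  (x \in points w).
Proof.
apply: (iffP mapP) => [[n]|[n nT ->]]; first by rewrite mem_filter => /andP[nT _] ->; exists n.
exists n => //; rewrite mem_filter nT mem_iota /= add0n ltnNge; apply/negP => /bdP.
by rewrite ltNge nT.
Qed.

Definition distinct_points w := forall n m t, theta n w = t%:E -> theta m w = t%:E -> n = m.

Lemma points_uniq w : distinct_points w -> uniq (map fst (points w)).
Proof.
move=> dw; rewrite /points -map_comp map_inj_in_uniq ?filter_uniq ?iota_uniq// => n m.
rewrite !mem_filter => /andP[nT _] /andP[mT _] /= e.
have fn k : (theta k w <= T%:E)%E -> theta k w \is a fin_num.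
  by move=> kT; rewrite fin_real// (lt_trans _ (theta_gt0 k w)) ?ltNyr//= (le_lt_trans kT)// ltry.
by apply: (dw n m (fine (theta n w))); [rewrite fineK ?fn|rewrite e fineK ?fn].
Qed.

Definition point_term (Th : field) n (w : Omega) (t : R) : R :=
  if (theta n w <= (Num.min t T)%:E)%E then Th ((w, fine (theta n w)), zeta n w) else 0.

Lemma point_term_adapted (Th : field) n : measurable_fun setT Th -> adapted G (point_term Th n).
Proof.
move=> mTh t t0; have hS := Gs t0; pose GT := g_sigma_algebraType (G t).
pose A := [set w | (theta n w <= (Num.min t T)%:E)%E].
have mt0 : 0 <= Num.min t T by rewrite le_min t0.
have GA : G t A.
  by apply: (Gi mt0 (minL t T)); have [_] := theta_stop n; exact.
have mA : measurable (A : set GT) by rewrite measurable_g_salgebraE.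
apply/(measurable_wrtT _ hS).
apply: (measurable_fun_if measurableT) => //.
  apply: (measurable_fun_bool true); rewrite setTI (_ : _ @^-1` _ = A)//.
rewrite setTI (_ : _ @^-1` _ = A)//.
have mf : @measurable_fun _ _ GT (PrT * E)%type A (fun w => ((w, fine (theta n w)), zeta n w)).
  apply: (@measurable_fun_pair_in _ _ _ GT PrT E).
    have hP := predictable_salg G.
    refine (@measurability _ _ GT PrT A _ [set S | (exists2 A, G 0 A & S = A `*` [set 0]) \/
               (exists A s t, [/\ 0 <= s, s < t, G s A & S = A `*` `]s, t]%classic])] _ _).
      exact: (sigma_algebra_id hP).
    move=> _ [_ [[B GB ->]|[B [s [u [s0 su GB ->]]]]] <-]; rewrite measurable_g_salgebraE//.
      rewrite (_ : _ `&` _ = set0); first by case: hS.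
      apply/seteqP; split => // w [Aw [/= _ fw]].
      have := theta_gt0 n w; have fn : theta n w \is a fin_num.
        by rewrite fin_real// (lt_trans _ (theta_gt0 n w)) ?ltNyr//= (le_lt_trans Aw)// ltry.
      by rewrite -(fineK fn) fw ltxx.
    have [su'|us] := ltP s (Num.min t T); last first.
      rewrite (_ : _ `&` _ = set0); first by case: hS.
      apply/seteqP; split => // w [Aw [/= _]]; rewrite in_itv/= => /andP[sf _].
      have fn : theta n w \is a fin_num.
        by rewrite fin_real// (lt_trans _ (theta_gt0 n w)) ?ltNyr//= (le_lt_trans Aw)// ltry.
      move: Aw; rewrite /A /= -(fineK fn) lee_fin => /le_trans/(_ us).
      by rewrite leNgt sf.
    have stle x : 0 <= x -> x <= t -> G t [set w | (theta n w <= x%:E)%E].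
      by move=> x0 xt; apply: (Gi x0 xt); have [_] := theta_stop n; exact.
    have u0 : 0 <= u by rewrite (le_trans s0)// ltW.
    have st : s <= t by apply: ltW; apply: lt_le_trans su' (minL _ _).
    rewrite (_ : _ `&` _ = A `&` (B `&` ([set w | (theta n w <= (Num.min u (Num.min t T))%:E)%E] `\` [set w | (theta n w <= s%:E)%E]))).
      apply: salgI => //; apply: salgI => //; first exact: (Gi s0 st).
      apply: salgD => //; last exact: stle.
      apply: stle; first by rewrite le_min u0.
      exact: le_trans (minR _ _) (minL _ _).
    apply/seteqP; split => w [Aw].
      have fn : theta n w \is a fin_num.
        by rewrite fin_real// (lt_trans _ (theta_gt0 n w)) ?ltNyr//= (le_lt_trans Aw)// ltry.
      move=> [/= Bw]; rewrite in_itv/= => /andP[sf fu]; split => //; split => //; split.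
        by move: Aw; rewrite /A /= -(fineK fn) !lee_fin => h; rewrite le_min fu.
      by rewrite /= -(fineK fn) lee_fin leNgt sf.
    have fn : theta n w \is a fin_num.
      by rewrite fin_real// (lt_trans _ (theta_gt0 n w)) ?ltNyr//= (le_lt_trans Aw)// ltry.
    move=> [Bw [/= + +]]; rewrite -(fineK fn) !lee_fin le_min => /andP[fu _] ns; split => //; split => //=.
    by rewrite in_itv/= fu andbT ltNge; exact/negP.
  move=> _ B mB; rewrite measurable_g_salgebraE//.
  have := zeta_stop n mt0 mB; exact: (Gi mt0 (minL t T)).
exact: (measurableT_comp mTh mf).
Qed.

Lemma point_sum_cvg (Th : field) w t : 
  (fun N => \sum_(n < N) point_term Th n w t) @ \oo -->
  \sum_(x <- points w) Th (w, x.1, x.2) * (x.1 <= t)%R%:R.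
Proof.
apply: cvg_near_cst; exists (bd w) => // N /= bN.
rewrite (sum_points _ bN); apply: eq_bigr => n _; rewrite /point_term.
have [nT|Tn] := boolP (theta n w <= T%:E)%E; last first.
  by case: ifPn => // nt; exfalso; move/negP : Tn; apply; rewrite (le_trans nt)// lee_fin minR.
have fn : theta n w \is a fin_num by rewrite fin_real// (lt_trans _ (theta_gt0 n w)) ?ltNyr//= (le_lt_trans nT)// ltry.
move: nT; rewrite -(fineK fn) !lee_fin le_min => nT; rewrite nT andbT /=.
by case: ifPn => _; rewrite ?mulr1 ?mulr0.
Qed.

Lemma measurable_point_sum (Th : field) : measurable_fun setT Th ->
  measurable_fun setT (fun w => \sum_(x <- points w) Th (w, x.1, x.2)).
Proof.
move=> mTh; apply: (@measurable_fun_cvg _ _ _ setT (fun N w => \sum_(n < N) point_term Th n w T)).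
- move=> N; apply: measurable_sum => n.
  by move=> _ B mB; apply: (Gm T0'); exact: (point_term_adapted n mTh T0' mB).
- move=> w _; rewrite (eq_big_seq (fun x => Th (w, x.1, x.2) * (x.1 <= T)%R%:R)).
    exact: point_sum_cvg.
  by move=> x /points_in /andP[_ ->]; rewrite mulr1.
Qed.

(** A sum over the points strictly before the current time is left-continuous
    and adapted. *)
Lemma predictable_point_sum (Th : field) : measurable_fun setT Th ->
  measurable_fun setT ((fun p => \sum_(x <- points p.1) Th ((p.1, x.1), x.2) * (x.1 < p.2)%R%:R) : PrT -> R).
Proof.
move=> mTh; have KA := predictable_all_times fG.
pose F k (p : PrT) : R := \sum_(n < k) (if p \in @all_times R _ Omega then point_term Th n p.1 (grid_left k p.2) else 0).
apply: (@measurable_fun_cvg _ _ _ setT F).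
  move=> k; apply: measurable_sum => n.
  apply: (@predictable_patch _ _ _ _ _ _ (fun w t => point_term Th n w (grid_left k t)) _ 0 KA).
  by apply: adapted_grid_left => //; exact: point_term_adapted.
move=> [w t] _; apply: cvg_near_cst; rewrite /F /=.
have [t0|t0] := leP t 0.
  apply: nearW => k; rewrite big1 => [|n _].
    rewrite big1_seq// => x /= /points_in /andP[x0 _].
    by rewrite ltNge (le_trans t0 (ltW x0)) mulr0.
  case: ifPn => //; rewrite inE => -[_ /=]; rewrite in_itv/= andbT => t0'.
  have -> : t = 0 by apply/eqP; rewrite eq_le t0.
  rewrite grid_left0 /point_term (min_idPl T0') leNgt theta_gt0.
  by [].
have tA : (w, t) \in @all_times R _ Omega by rewrite inE; split => //=; rewrite in_itv/= ltW.
have ev : \forall k \near \oo, forall n : 'I_(bd w), (theta n w < t%:E)%E -> (theta n w <= (grid_left k t)%:E)%E.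
  elim: (bd w) => [|m ih]; first by apply: nearW => k [].
  have : \forall k \near \oo, (theta m w < t%:E)%E -> (theta m w <= (grid_left k t)%:E)%E.
    have [mt|tm] := ltP (theta m w) t%:E; last by apply: nearW.
    have fn : theta m w \is a fin_num by rewrite fin_real// (lt_trans _ (theta_gt0 m w)) ?ltNyr//= (lt_trans mt)// ltry.
    have h0 : 0 < t - fine (theta m w) by rewrite subr_gt0 -lte_fin fineK.
    apply: filterS (grid_left_near t0 h0) => k; rewrite opprB addrCA subrr addr0 => h _.
    by rewrite -(fineK fn) lee_fin.
  move: ih; apply: filterS2 => k h1 h2 [n nm] /=.
  move: nm; rewrite ltnS leq_eqVlt => /predU1P[->//|nm]; exact: (h1 (Ordinal nm)).
near=> k.
rewrite (_ : \sum_(x <- points w) _ = \sum_(n < k) (if (theta n w <= T%:E)%E then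
   Th ((w, fine (theta n w)), zeta n w) * (fine (theta n w) < t)%R%:R else 0)); last first.
  by apply: (@sum_points _ (fun x => Th (w, x.1, x.2) * (x.1 < t)%R%:R)); near: k; exists (bd w).
apply: eq_bigr => n _; rewrite tA /point_term.
have [nT|Tn] := boolP (theta n w <= T%:E)%E; last first.
  by case: ifPn => // nt; exfalso; move/negP : Tn; apply; rewrite (le_trans nt)// lee_fin minR.
have fn : theta n w \is a fin_num by rewrite fin_real// (lt_trans _ (theta_gt0 n w)) ?ltNyr//= (le_lt_trans nT)// ltry.
have nb : (n < bd w)%N by rewrite ltnNge; apply/negP => /bdP; rewrite ltNge nT.
have : forall n : 'I_(bd w), (theta n w < t%:E)%E -> (theta n w <= (grid_left k t)%:E)%E by near: k.
move=> /(_ (Ordinal nb)) /=; move: nT; rewrite -(fineK fn) !lee_fin !lte_fin le_min => nT h; rewrite nT andbT.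
have [nt|tn] := ltP (fine (theta n w)) t; first by rewrite h// mulr1.
by rewrite leNgt (lt_le_trans (grid_left_lt k t0) tn) mulr0.
Unshelve. all: by end_near. Qed.

Variables mu nu : Omega -> {measure set (R * E) -> \bar R}.
Hypothesis comp : compensator P G mu nu.
Hypothesis mu_points : {ae P, forall w, forall f : R * E -> \bar R, measurable_fun setT f -> (forall p, 0 <= f p)%E ->
  (\int[mu w]_(p in `]0%R, T] `*` setT) f p = \sum_(x <- points w) f x)%E}.

Let KA := predictable_all_times fG.

Let all_field (W : field) : measurable_fun setT W ->
  predictable_field_on G (@all_times R _ Omega) (fun w t x => W ((w, t), x)).
Proof.
move=> mW; apply: (field_onT KA).
by rewrite (_ : (fun q => _) = W)//; apply/funext => -[[w t] x].
Qed.

Let mI (s t : R) : measurable (`]s, t]%classic `*` (setT : set E)).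
Proof. by apply: measurableX => //; exact: measurable_itv. Qed.

Lemma field_section (W : field) w : measurable_fun setT W -> measurable_fun setT (fun p : R * E => W (w, p.1, p.2)).
Proof.
move=> /(field_measurable fG) mW.
apply: (measurableT_comp mW); apply: measurable_fun_pair; last exact: measurable_snd.
by apply: measurable_fun_pair => //; exact: measurable_fst.
Qed.

Lemma measurable_nu_integral (W : field) t : 0 <= t -> measurable_fun setT W -> (forall q, 0 <= W q) ->
  measurable_fun setT (fun w => \int[nu w]_(p in `]0%R, t] `*` setT) (W (w, p.1, p.2))%:E)%E.
Proof.
move=> t0 mW W0 _ B mB; apply: (Gm t0).
exact: (predictable_random_measure_measurable fG comp.1 (all_field mW) _ t0 mB).
Qed.

Lemma measurable_nu_Rintegral (W : field) t : 0 <= t -> measurable_fun setT W ->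
  measurable_fun setT (fun w => \int[nu w]_(p in `]0, t] `*` setT) W (w, p.1, p.2)).
Proof.
move=> t0 mW; have mp : measurable_fun setT (fun q => Num.max (W q) 0) by exact: measurable_maxr.
have mn : measurable_fun setT (fun q => Num.max (- W q) 0) by apply: measurable_maxr => //; exact: measurable_funN.
have m1 := measurable_nu_integral t0 mp (fun q => ltac:(by rewrite le_max lexx orbT)).
have m2 := measurable_nu_integral t0 mn (fun q => ltac:(by rewrite le_max lexx orbT)).
have mfine : measurable_fun setT (@fine R) by exact: fine_measurable.
apply: (measurableT_comp mfine); move: (emeasurable_funB m1 m2); congr measurable_fun.
apply/funext => w; rewrite [RHS]integralE; congr (_ - _)%E; apply: eq_integral => p _.
  by rewrite funeposE -EFin_max.
by rewrite funenegE -EFin_max.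
Qed.

Lemma predictable_nu_integral (W : field) : measurable_fun setT W -> (forall q, 0 <= W q) ->
  measurable_fun setT ((fun p => fine (\int[nu p.1]_(q in `]0%R, p.2] `*` setT) (W ((p.1, q.1), q.2))%:E)%E) : PrT -> R).
Proof.
move=> mW W0; apply: measurableT_comp; first exact: fine_measurable.
have [[_ h] _] := comp; have := h _ (all_field mW) (fun w t x => W0 _).
move=> /(predictable_patch 0%E KA); congr measurable_fun; apply/funext => -[w t] /=.
case: ifPn => //; rewrite notin_setE => nt; rewrite (_ : `]0%R, t]%classic = set0) ?set0X ?integral_set0//.
apply/seteqP; split => // s /=; rewrite in_itv/= => /andP[s0 st]; apply: nt; split => //=.
by rewrite in_itv/= andbT ltW// (lt_le_trans s0).
Qed.

Lemma compensator_strip (W : field) : measurable_fun setT W -> (forall q, 0 <= W q) ->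
  (\int[P]_w \int[mu w]_(p in `]0%R, T] `*` setT) (W (w, p.1, p.2))%:E =
   \int[P]_w \int[nu w]_(p in `]0%R, T] `*` setT) (W (w, p.1, p.2))%:E)%E.
Proof.
move=> mW W0; pose W' : field := fun q => W q * (q.1.2 <= T)%R%:R.
have mle : measurable_fun setT ((fun p => (p.2 <= T)%R%:R) : PrT -> R).
  have h : measurable ([set p | p.2 <= T] : set PrT).
    rewrite measurable_g_salgebraE; last exact: predictable_salg.
    have : predictable G (setT `*` [set t | T < t]).
      by apply: predictable_ray => //; apply: salgT; exact: Gs.
    move=> /(salgC (predictable_salg G)); congr (predictable G _).
    by apply/seteqP; split => -[w t] /=; rewrite leNgt => h'; [apply/negP => Tt; apply: h'|move=> [_]; exact/negP].
  rewrite (_ : (fun p => _) = \1_[set p : PrT | p.2 <= T]); first exact: measurable_indic.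
  by apply/funext => p; rewrite indicE /=; congr (nat_of_bool _)%:R; apply/idP/idP; rewrite inE.
have mW' : measurable_fun setT W'.
  by apply: measurable_funM => //; exact: (measurableT_comp mle measurable_fst).
have W'0 q : 0 <= W' q by rewrite mulr_ge0.
have cut (m : {measure set (R * E) -> \bar R}) w :
    (\int[m]_(p in `]0%R, +oo[ `*` setT) (W' (w, p.1, p.2))%:E =
     \int[m]_(p in `]0%R, T] `*` setT) (W (w, p.1, p.2))%:E)%E.
  rewrite integral_mkcond [RHS]integral_mkcond; apply: eq_integral => -[t x] _.
  rewrite !patchE /W' /=; case: ifPn => [|]; case: ifPn => //; rewrite !(inE, notin_setE) /= !in_itv/=.
  - by move=> [/andP[_ ->] _] _; rewrite mulr1.
  - move=> nT [/andP[t0 _] _]; case: ltP => [Tt|tT]; first by rewrite mulr0.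
    by exfalso; apply: nT; rewrite t0 tT.
  - by move=> [/andP[t0 _] _] nt; exfalso; apply: nt; rewrite t0.
have := comp.2 _ (all_field mW') (fun w t x => W'0 _).
by rewrite (eq_integral _ _ (fun w _ => cut (mu w) w)) (eq_integral _ _ (fun w _ => cut (nu w) w)).
Qed.

Lemma compensator_mean (W : field) : measurable_fun setT W -> (forall q, 0 <= W q) ->
  (\int[P]_w (\sum_(x <- points w) W (w, x.1, x.2))%:E =
   \int[P]_w \int[nu w]_(p in `]0%R, T] `*` setT) (W (w, p.1, p.2))%:E)%E.
Proof.
move=> mW W0; rewrite -compensator_strip//.
apply: ae_eq_integral_nomeas; move: mu_points; apply: filterS => w h _.
rewrite h//; last by move=> p; rewrite lee_fin.
  by rewrite sumEFin.
by apply/measurable_EFinP; exact: field_section.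
Qed.

Let Iw (W : field) w := \int[nu w]_(p in `]0, T] `*` setT) W (w, p.1, p.2).

(** The two integrals of a field have the same mean by definition of a
    compensator when the field is nonnegative; in general, its positive and
    negative parts are subtracted. *)
Lemma compensated_mean0 (W : field) : measurable_fun setT W ->
  (\int[P]_w \int[nu w]_(p in `]0%R, T] `*` setT) `|(W (w, p.1, p.2))|%:E < +oo)%E ->
  P.-integrable setT (fun w => (\sum_(x <- points w) W (w, x.1, x.2) - Iw W w)%:E) /\
  (\int[P]_w (\sum_(x <- points w) W (w, x.1, x.2) - Iw W w)%:E = 0)%E.
Proof.
move=> mW fin.
pose Wp : field := fun q => Num.max (W q) 0; pose Wn : field := fun q => Num.max (- W q) 0.
have mWp : measurable_fun setT Wp by exact: measurable_maxr.
have mWn : measurable_fun setT Wn by apply: measurable_maxr => //; exact: measurableT_comp.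
have Wp0 q : 0 <= Wp q by rewrite le_max lexx orbT.
have Wn0 q : 0 <= Wn q by rewrite le_max lexx orbT.
have WE q : W q = Wp q - Wn q.
  rewrite /Wp /Wn; have [h|h] := leP 0 (W q).
    by rewrite max_r ?subr0// oppr_le0.
  by rewrite max_l ?oppr_ge0 ?(ltW h)// sub0r opprK.
have Wple q : Wp q <= `|W q| by rewrite ge_max normr_ge0 ler_norm.
have Wnle q : Wn q <= `|W q| by rewrite ge_max normr_ge0 andbT -normrN ler_norm.
have key (V : field) : measurable_fun setT V -> (forall q, 0 <= V q) -> (forall q, V q <= `|W q|) ->
   [/\ P.-integrable setT (fun w => (\sum_(x <- points w) V (w, x.1, x.2))%:E),
       P.-integrable setT (fun w => (Iw V w)%:E),
       (\int[P]_w (\sum_(x <- points w) V (w, x.1, x.2))%:E = \int[P]_w (Iw V w)%:E)%E &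
       {ae P, forall w, (\int[nu w]_(p in `]0%R, T] `*` setT) (V (w, p.1, p.2))%:E)%E \is a fin_num}].
  move=> mV V0 VW.
  have mN := measurable_nu_integral T0' mV V0.
  have N0 w : (0 <= \int[nu w]_(p in `]0%R, T] `*` setT) (V (w, p.1, p.2))%:E)%E.
    by apply: integral_ge0 => p _; rewrite lee_fin.
  have finV : (\int[P]_w \int[nu w]_(p in `]0%R, T] `*` setT) (V (w, p.1, p.2))%:E < +oo)%E.
    apply: le_lt_trans fin; apply: ge0_le_integral => //.
    - by apply: (measurable_nu_integral (W := fun q => `|W q|) T0') => //; exact: measurableT_comp.
    - move=> w _; apply: ge0_le_integral => //.
      + by move=> p _; rewrite lee_fin.
      + by apply/measurable_EFinP/measurable_funTS; exact: field_section.
      + by apply/measurable_EFinP/measurable_funTS; apply: measurableT_comp => //; exact: field_section.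
      + by move=> p _; rewrite lee_fin.
  have intN : P.-integrable setT (fun w => \int[nu w]_(p in `]0%R, T] `*` setT) (V (w, p.1, p.2))%:E)%E.
    by apply/integrableP; split => //; under eq_integral do rewrite gee0_abs//.
  have aefin : {ae P, forall w, (\int[nu w]_(p in `]0%R, T] `*` setT) (V (w, p.1, p.2))%:E)%E \is a fin_num}.
    by have := integrable_ae measurableT intN; apply: filterS => w; exact.
  have eqI : {ae P, forall w, setT w -> (\int[nu w]_(p in `]0%R, T] `*` setT) (V (w, p.1, p.2))%:E)%E = (Iw V w)%:E}.
    by move: aefin; apply: filterS => w h _; rewrite /Iw /Rintegral fineK.
  have mI' : measurable_fun setT (fun w => (Iw V w)%:E).
    by apply/measurable_EFinP; apply: measurableT_comp; [exact: fine_measurable|exact: mN].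
  have intI : P.-integrable setT (fun w => (Iw V w)%:E).
    by apply: (integrable_ae_eq mI' eqI).
  have eqE := compensator_mean mV V0.
  split => //.
  - apply/integrableP; split; first by apply/measurable_EFinP; exact: measurable_point_sum.
    rewrite (eq_integral (fun w => (\sum_(x <- points w) V (w, x.1, x.2))%:E)); last first.
      by move=> w _; rewrite /= ger0_norm// sumr_ge0.
    by rewrite eqE.
  - by rewrite eqE; exact: ae_eq_integral_nomeas.
have [p1 p2 p3 p4] := key Wp mWp Wp0 Wple; have [n1 n2 n3 n4] := key Wn mWn Wn0 Wnle.
have IE : {ae P, forall w, setT w -> (\sum_(x <- points w) Wp (w, x.1, x.2))%:E - (Iw Wp w)%:E
     - ((\sum_(x <- points w) Wn (w, x.1, x.2))%:E - (Iw Wn w)%:E)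
     = (\sum_(x <- points w) W (w, x.1, x.2) - Iw W w)%:E}%E.
  move: p4 n4; apply: filterS2 => w h1 h2 _; rewrite -!EFinB; congr (_%:E).
  have -> : Iw W w = Iw Wp w - Iw Wn w.
    rewrite /Iw /Rintegral -fineB//; congr fine; rewrite integralE; congr (_ - _)%E.
      by apply: eq_integral => p _; rewrite funeposE /Wp /= -EFin_max.
    by apply: eq_integral => p _; rewrite funenegE /Wn /= -EFin_max.
  rewrite [X in _ = X - _](eq_bigr (fun x => Wp (w, x.1, x.2) - Wn (w, x.1, x.2))); last by move=> x _; rewrite WE.
  by rewrite sumrB; ring.
have intB : P.-integrable setT (fun w => (\sum_(x <- points w) Wp (w, x.1, x.2))%:E - (Iw Wp w)%:E
     - ((\sum_(x <- points w) Wn (w, x.1, x.2))%:E - (Iw Wn w)%:E))%E.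
  by apply: integrableB => //; exact: integrableB.
have mIW : measurable_fun setT (Iw W).
  have mm : measurable_fun setT (fun w => (\int[nu w]_(p in `]0%R, T] `*` setT) (Wp (w, p.1, p.2))%:E
       - \int[nu w]_(p in `]0%R, T] `*` setT) (Wn (w, p.1, p.2))%:E)%E).
    by apply: emeasurable_funB; exact: measurable_nu_integral.
  rewrite (_ : Iw W = fine \o (fun w => (\int[nu w]_(p in `]0%R, T] `*` setT) (Wp (w, p.1, p.2))%:E
       - \int[nu w]_(p in `]0%R, T] `*` setT) (Wn (w, p.1, p.2))%:E)%E)).
    by apply: measurableT_comp => //; exact: fine_measurable.
  apply/funext => w; rewrite /Iw /Rintegral /= integralE; congr (fine (_ - _)%E).
    by apply: eq_integral => p _; rewrite funeposE /Wp /= -EFin_max.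
  by apply: eq_integral => p _; rewrite funenegE /Wn /= -EFin_max.
split.
  apply: (integrable_ae_eq _ IE intB).
  by apply/measurable_EFinP; apply: measurable_funB => //; exact: measurable_point_sum.
rewrite -(ae_eq_integral_nomeas IE).
have z (f g : Omega -> \bar R) : P.-integrable setT f -> P.-integrable setT g ->
    (\int[P]_w f w = \int[P]_w g w -> \int[P]_w (f w - g w) = 0)%E.
  move=> fi gi fg; apply: (etrans (integralB measurableT fi gi)); rewrite fg subee//.
  exact: (integrable_fin_num measurableT gi).
apply: (z); [exact: integrableB|exact: integrableB|].
by rewrite (z _ _ p1 p2 p3) (z _ _ n1 n2 n3).
Qed.

End marked_points.

(** * Identification of the Doleans-Dade exponential *)

Lemma integral_mrestr (R : realType) d (S : measurableType d) (m : {measure set S -> \bar R})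
    (D : set S) (mD : measurable D) (f : S -> \bar R) : measurable_fun setT f ->
  (\int[mrestr m mD]_x f x = \int[m]_(x in D) f x)%E.
Proof.
move=> mf.
have key (h : S -> \bar R) : measurable_fun setT h -> (forall x, 0 <= h x)%E ->
    (\int[mrestr m mD]_x h x = \int[m]_(x in D) h x)%E.
  move=> mh h0; rewrite (@ge0_integral_density _ S R m (mrestr m mD) \1_D)//.
  - rewrite [RHS]integral_mkcond; apply: eq_integral => x _.
    by rewrite patchE indicE; case: ifPn; rewrite ?mul1e ?mul0e.
  - move=> A mA; rewrite integral_indic//.
    by rewrite /mrestr setIC.
rewrite [LHS]integralE [RHS]integralE.
by rewrite !key//; [exact: measurable_funeneg|exact: measurable_funepos].
Qed.

Section cadlag_paths.
Context (R : realType).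

Lemma cvg_locally_bounded (F : set_system R) (FF : ProperFilter F) (y : R -> R) (l : R) :
  y s @[s --> F] --> l -> \forall s \near F, `|y s| <= `|l| + 1.
Proof.
move=> /cvgrPdist_lt /(_ 1 ltr01); apply: filterS => s; rewrite distrC => h.
by rewrite -[y s](subrK l) (le_trans (ler_normD _ _))// addrC lerD2l ltW.
Qed.

Lemma cadlag_bounded (T : R) (y : R -> R) : 0 <= T -> cadlag_on T y ->
  exists K : R, forall t, 0 <= t <= T -> `|y t| <= K.
Proof.
move=> T0 [yr yl].
have /compact_near_coveringP cov := @segment_compact R 0 T.
have := cov R +oo (fun K t => 0 <= t <= T -> `|y t| <= K) _ _.
case.
  move=> t /=; rewrite in_itv/= => /andP[t0 tT].
  have [Kr hr] : exists Kr : R, \forall s \near t^'+, s <= T -> `|y s| <= Kr.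
    have [tT'|] := ltP t T.
      exists (`|y t| + 1); have := yr t; rewrite t0 tT' => /(_ isT) /cvg_locally_bounded.
      by apply: filterS => s h _.
    move=> Tt; exists 0; apply: filterS (nbhs_right_gt t) => s ts sT.
    by move: (lt_le_trans ts sT); rewrite ltNge Tt.
  have [Kl hl] : exists Kl : R, \forall s \near t^'-, 0 <= s -> `|y s| <= Kl.
    have [t0'|] := ltP 0 t.
      exists (`|left_limit y t| + 1); have := yl t; rewrite t0' tT => /(_ isT) /cvg_locally_bounded.
      by apply: filterS => s h _.
    move=> t0'; exists 0; apply: filterS (nbhs_left_lt t) => s ts s0.
    by move: (le_lt_trans s0 ts); rewrite ltNge t0'.
  pose K := Num.max (`|y t|) (Num.max Kr Kl).
  have hN : \forall s \near t, 0 <= s <= T -> `|y s| <= K.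
    move: hr hl; rewrite /at_right /at_left !near_withinE; apply: filterS2 => s hr hl /andP[s0 sT].
    rewrite /K !le_max; have [st|ts|->] := ltgtP s t; last by rewrite lexx.
      by rewrite hl ?orbT.
    by rewrite hr ?orbT.
  exists ([set s | 0 <= s <= T -> `|y s| <= K], [set M | K < M]) => /=.
    by split=> //; exists K; split => //; exact: num_real.
  by move=> [s M] /= [h KM] sT; rewrite (le_trans (h sT))// ltW.
move=> M [_ h]; exists (M + 1) => t /andP[t0 tT]; apply: (h (M + 1)) => //=.
- by rewrite ltrDl.
- by rewrite in_itv/= t0.
- by rewrite t0.
Qed.
End cadlag_paths.

Section doleans_identification.
Context (R : realType) d1 (E : measurableType d1).
Let S := (R * E)%type.
Variables (T : R) (m nu : {measure set S -> \bar R}) (s : seq S).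
Hypothesis T0 : 0 < T.
Hypothesis m_points : forall f : S -> \bar R, measurable_fun setT f -> (forall p, 0 <= f p)%E ->
  (\int[m]_(p in `]0%R, T] `*` setT) f p = \sum_(x <- s) f x)%E.
Hypothesis s_in : forall x, x \in s -> 0 < x.1 <= T.
Hypothesis nu_fin : (nu (`]0%R, T] `*` setT) < +oo)%E.
Hypothesis nu_atomless : forall t, 0 < t <= T -> nu ([set t] `*` setT) = 0%E.

Lemma measurable_strip (a b : R) : measurable (`]a, b]%classic `*` (setT : set E)).
Proof. by apply: measurableX => //; exact: measurable_itv. Qed.

Definition strip_measure : {measure set S -> \bar R} := mrestr nu (measurable_strip 0 T).
Local Notation n := strip_measure.

Lemma strip_measure_fin : (n setT < +oo)%E.
Proof. by rewrite /strip_measure /= /mrestr setTI. Qed.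

Lemma strip_measure_no_atom : no_time_atom n.
Proof.
move=> t; rewrite /strip_measure /= /mrestr -setXI setTI.
have [tT|nt] := pselect (0 < t <= T).
  rewrite (_ : _ `&` _ = [set t]) ?nu_atomless//.
  by apply/seteqP; split => [u []|u /= ->]//; split => //=; rewrite in_itv.
rewrite (_ : _ `&` _ = set0) ?set0X ?measure0//.
by apply/seteqP; split => // u /= [->]; rewrite in_itv.
Qed.

Lemma upto_strip (f : S -> R) t : t <= T -> measurable_fun setT f ->
  upto n f t = \int[nu]_(p in `]0, t] `*` setT) f p.
Proof.
move=> tT mf; rewrite /upto /Rintegral integral_mrestr; last first.
  apply/measurable_EFinP; apply: measurable_funM => //.
  by have [] := @bounded_le R _ E t.
congr fine; rewrite integral_mkcond [RHS]integral_mkcond; apply: eq_integral => -[u x] _.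
rewrite !patchE /=; case: ifPn => [|]; case: ifPn => //; rewrite !(inE, notin_setE) /= !in_itv/=.
- by move=> [/andP[_ ->] _] _; rewrite mulr1.
- move=> nT [/andP[t0 _] _]; have [ut|tu] := leP u t; last by rewrite mulr0.
  by exfalso; apply: nT; rewrite t0 ut.
- by move=> [/andP[t0 ut] _] nt; exfalso; apply: nt; rewrite t0 (le_trans ut).
Qed.

Lemma Rint_points (f : S -> R) t : t <= T -> measurable_fun setT f ->
  \int[m]_(p in `]0, t] `*` setT) f p = \sum_(x <- s) f x * (x.1 <= t)%R%:R.
Proof.
move=> tT mf; pose ft p := f p * (p.1 <= t)%R%:R.
have mft : measurable_fun setT ft.
  by apply: measurable_funM => //; have [] := @bounded_le R _ E t.
rewrite /Rintegral (_ : integral _ _ _ = \int[m]_(p in `]0%R, T] `*` setT) (ft p)%:E)%E; last first.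
  rewrite integral_mkcond [RHS]integral_mkcond; apply: eq_integral => -[u x] _.
  rewrite !patchE /ft /=; case: ifPn => [|]; case: ifPn => //; rewrite !(inE, notin_setE) /= !in_itv/=.
  - by move=> _ [/andP[_ ->] _]; rewrite mulr1.
  - by move=> nT [/andP[t0 ut] _]; exfalso; apply: nT; rewrite t0 (le_trans ut).
  - move=> [/andP[u0 _] _] nt; have [ut|tu] := leP u t; last by rewrite mulr0.
    by exfalso; apply: nt; rewrite u0 ut.
rewrite integralE !m_points//; last 2 first.
- by apply: measurable_funeneg; exact/measurable_EFinP.
- by apply: measurable_funepos; exact/measurable_EFinP.
rewrite (eq_bigr (fun x => (Num.max (ft x) 0)%:E)); last first.
  by move=> x _; rewrite funeposE EFin_max.
rewrite [X in (_ - X)%E](eq_bigr (fun x => (Num.max (- ft x) 0)%:E)); last first.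
  by move=> x _; rewrite funenegE EFin_max.
rewrite !sumEFin -EFinB /= -sumrB; apply: eq_bigr => x _; rewrite -/(ft x).
have [h|h] := leP 0 (ft x); first by rewrite max_r ?subr0// oppr_le0.
by rewrite max_l ?oppr_ge0 ?(ltW h)// sub0r opprK.
Qed.

Variables (l lm : R -> R) (hh : S -> R).
Hypothesis l_cadlag : cadlag_on T l.
Hypothesis mlm : measurable_fun setT lm.
Hypothesis lmE : forall t, 0 < t <= T -> left_limit l t = lm t.
Hypothesis bhh : bounded_mfun hh.
Hypothesis lE : forall t, 0 <= t <= T -> l t = 1 + compensated_integral m nu `]0, t]
  (fun u x => left_limit l u * hh (u, x)).

Definition strip_cut (f : S -> R) (p : S) : R := f p * (0 < p.1 <= T)%R%:R.
Local Notation h := (strip_cut hh).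
Let g p := lm p.1 * h p.

Lemma bounded_strip : bounded_mfun (fun p : S => (0 < p.1 <= T)%R%:R : R).
Proof.
rewrite (_ : (fun p : S => _) = (fun p : S => (0 < p.1)%R%:R * (p.1 <= T)%R%:R)).
  by apply: bounded_mfunM; [exact: bounded_gt|exact: bounded_le].
by apply/funext => p; rewrite -natrM mulnb.
Qed.

(** A cadlag path is bounded on compact intervals, which makes the pathwise
    calculus for bounded integrands available. *)
Lemma doleans_strip_bounded : bounded_mfun (fun p => lm p.1 * h p).
Proof.
have [K hK] := cadlag_bounded (ltW T0) l_cadlag.
have [mh [B hB]] := bhh.
split.
  apply: measurable_funM; first exact: measurableT_comp.
  by apply: measurable_funM => //; have [] := bounded_strip.
exists (K * B) => p; rewrite /g /h.
have [pT|_] := boolP (0 < p.1 <= T); last first.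
  rewrite !mulr0 normr0; have h0 := hK 0; rewrite lexx ltW// in h0.
  by rewrite mulr_ge0// (le_trans _ (hB p), le_trans _ (h0 isT)).
rewrite mulr1 normrM ler_pM// -lmE//; have /andP[p0 _] := pT.
have lc : cvg (l u @[u --> p.1^'-]) by have [_] := l_cadlag; exact.
have := left_limit_grid p0 lc => /cvg_norm h1.
rewrite -(cvg_lim _ h1)//; apply: limr_le; first by apply/cvg_ex; eexists; exact: h1.
apply: nearW => k; apply: hK; rewrite grid_left_ge0 /=.
by rewrite (le_trans _ (proj2 (andP pT)))// ltW// grid_left_lt.
Qed.

Let bg : bounded_mfun g := doleans_strip_bounded.

(** The integral equation of [L] says that [L] is the jump path driven by its own
    left limits. *)
Lemma doleans_strip t : 0 <= t <= T -> l t = jump_path n s 1 g g t.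
Proof.
move=> /[dup] tT' /andP[t0 tT]; rewrite (lE tT') /jump_path -addrA; congr (_ + _).
have cut (k : {measure set S -> \bar R}) : \int[k]_(p in `]0, t] `*` setT) (left_limit l p.1 * hh (p.1, p.2)) =
    \int[k]_(p in `]0, t] `*` setT) g p.
  apply: eq_Rintegral => -[u x]; rewrite inE /= in_itv/= => -[/andP[u0 ut] _].
  by rewrite /g /strip_cut /= u0 (le_trans ut tT) mulr1 lmE ?u0 ?(le_trans ut).
by rewrite /compensated_integral !cut Rint_points// ?upto_strip//; have [] := bg.
Qed.

Lemma doleans_strip_left t : 0 < t <= T -> left_limit l t = jump_path_left n s 1 g g t.
Proof.
move=> /andP[t0 tT].
have lc : cvg (l u @[u --> t^'-]) by have [_] := l_cadlag; apply; rewrite t0.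
apply: (cvg_unique _ (left_limit_grid t0 lc)) => //.
rewrite (_ : (fun k => l (grid_left k t)) = (fun k => jump_path n s 1 g g (grid_left k t))).
  exact: (jump_path_left_cvg strip_measure_fin bg t0).
apply/funext => k; rewrite doleans_strip// grid_left_ge0 /=.
by rewrite (le_trans _ tT)// ltW// grid_left_lt.
Qed.

Lemma doleans_strip_slope p : g p = jump_path_left n s 1 g g p.1 * h p.
Proof.
rewrite /g /strip_cut; have [pT|_] := boolP (0 < p.1 <= T); last by rewrite !mulr0.
by rewrite -lmE// doleans_strip_left.
Qed.

End doleans_identification.

(** * The change of measure *)

Lemma cvg_integral_nd (R : realType) d (A : measurableType d) (m : {measure set A -> \bar R})
    (f_ : nat -> A -> \bar R) (f : A -> \bar R) :
  (forall k, measurable_fun setT (f_ k)) -> (forall k x, 0 <= f_ k x)%E ->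
  (forall x, {homo f_ ^~ x : k l / (k <= l)%N >-> (k <= l)%E}) ->
  (forall x, f_ ^~ x @ \oo --> f x) ->
  (\int[m]_x f_ k x)%E @[k --> \oo] --> (\int[m]_x f x)%E.
Proof.
move=> mf f0 nd cf.
have := @cvg_monotone_convergence _ A R m setT measurableT f_ mf (fun k x _ => f0 k x) (fun x _ k l => nd x k l).
by under [X in _ --> X -> _]eq_integral do rewrite (cvg_lim _ (cf _))//.
Qed.

Lemma exponential_dominates (R : realType) (x : R) : 0 <= x -> x ^+ 2 <= 4 * expR x.
Proof.
move=> x0; have h : x / 2 <= expR (x / 2) by rewrite (le_trans _ (expR_ge1Dx _))// lerDr.
have -> : x ^+ 2 = 4 * ((x / 2) * (x / 2)) by field.
rewrite ler_pM2l//; have -> : expR x = expR (x / 2) * expR (x / 2) by rewrite -expRD; congr expR; field.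
by apply: ler_pM => //; rewrite divr_ge0.
Qed.

Lemma bernoulli_power (R : realType) (M : R) k : 1 < M -> k%:R <= (M - 1)^-1 * M ^+ k.
Proof.
move=> M1; rewrite mulrC ler_pdivlMr ?subr_gt0//.
elim: k => [|k ih]; first by rewrite mul0r expr0.
rewrite exprS -natr1 mulrDl mul1r.
have h : 1 <= M ^+ k by rewrite exprn_ege1// ltW.
have : 0 <= (M - 1) * (M ^+ k - 1) by rewrite mulr_ge0 ?subr_ge0// ltW.
by move: ih; rewrite mulrBr mulr1 [X in _ -> _ -> _ <= X](_ : _ = M ^+ k + (M - 1) * M ^+ k); [lra|ring].
Qed.

Section girsanov.
Context (R : realType) (d0 : measure_display) (Omega : measurableType d0).
Variables (P : probability Omega R) (G : R -> set_system Omega).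
Context (d1 : measure_display) (E : measurableType d1).
Variables (T : R) (theta : nat -> Omega -> \bar R) (zeta : nat -> Omega -> E).
Hypothesis T0 : 0 < T.
Hypothesis fG : filtration G.
Hypothesis theta_stop : forall n, stopping_time G (theta n).
Hypothesis theta_gt0 : forall n w, (0 < theta n w)%E.
Hypothesis zeta_stop : forall n t B, 0 <= t -> measurable B ->
  G t ([set w | (theta n w <= t%:E)%E] `&` zeta n @^-1` B).
Hypothesis theta_lf : forall w, locally_finite (theta ^~ w).
Variables mu nu : Omega -> {measure set (R * E) -> \bar R}.
Hypothesis comp : compensator P G mu nu.
Local Notation points := (points T zeta theta_lf).
Hypothesis mu_points : {ae P, forall w, forall f : R * E -> \bar R, measurable_fun setT f -> (forall p, 0 <= f p)%E ->
  (\int[mu w]_(p in `]0%R, T] `*` setT) f p = \sum_(x <- points w) f x)%E}.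
Hypothesis distinct : {ae P, forall w, distinct_points theta w}.
Hypothesis nu_fin : {ae P, forall w, (nu w (`]0%R, T] `*` setT) < +oo)%E}.
Hypothesis nu_atomless : {ae P, forall w, forall t, 0 < t <= T -> nu w ([set t] `*` setT) = 0%E}.

Local Notation PrT := (predictableType G).
Local Notation field := ((PrT * E)%type -> R).
Let T0' : 0 <= T := ltW T0.
Let KA := predictable_all_times fG.

Let predictable_sum (Th : field) : measurable_fun setT Th ->
  measurable_fun setT ((fun p => \sum_(x <- points p.1) Th ((p.1, x.1), x.2) * (x.1 < p.2)%R%:R) : PrT -> R).
Proof. exact: (predictable_point_sum T0 fG theta_stop theta_gt0 zeta_stop theta_lf). Qed.

Let measurable_sum (Th : field) : measurable_fun setT Th ->
  measurable_fun setT (fun w => \sum_(x <- points w) Th (w, x.1, x.2)).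
Proof. exact: (measurable_point_sum T0 fG theta_stop theta_gt0 zeta_stop theta_lf). Qed.

Let Iw (W : field) w := \int[nu w]_(p in `]0, T] `*` setT) W (w, p.1, p.2).
Local Notation n w := (strip_measure T (nu w)).
Let sec (W : field) w (p : R * E) : R := W (w, p.1, p.2).

(** The paths on which the random measures are as expected. *)
Let good w := [/\ uniq (map fst (points w)), (n w setT < +oo)%E & no_time_atom (n w)].

Let ae_good : {ae P, forall w, good w}.
Proof.
move: distinct nu_fin nu_atomless; apply: filterS3 => w h1 h2 h3; split.
- exact: points_uniq theta_gt0 _ _ h1.
- exact: strip_measure_fin.
- exact: strip_measure_no_atom.
Qed.

Let c w := fine (n w setT).

Let nET w : n w setT = (\int[nu w]_(p in `]0%R, T] `*` setT) 1)%E.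
Proof. by rewrite integral_cst ?mul1e; [rewrite /strip_measure /= /mrestr setTI|exact: measurable_strip]. Qed.

Let mnT : measurable_fun setT (fun w => n w setT).
Proof.
rewrite (_ : (fun w => _) = (fun w => \int[nu w]_(p in `]0%R, T] `*` setT) ((cst 1 : field) (w, p.1, p.2))%:E)%E).
  exact: (measurable_nu_integral fG comp T0' (W := cst 1)).
by apply/funext => w; rewrite nET.
Qed.

Let mc : measurable_fun setT c.
Proof. by apply: measurableT_comp => //; exact: fine_measurable. Qed.

Let c_ge0 w : 0 <= c w. Proof. by rewrite fine_ge0// measure_ge0. Qed.

Let cstP (a : R) : (\int[P]_w a%:E = a%:E)%E.
Proof.
apply: (etrans (integral_cst P measurableT a%:E)).
by apply: (etrans (congr1 _ (probability_setT P))); rewrite mule1.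
Qed.

Let num w : R := (size (points w))%:R.

Let mnum : measurable_fun setT num.
Proof.
rewrite (_ : num = (fun w => \sum_(x <- points w) ((cst 1 : field) (w, x.1, x.2)))).
  by apply: measurable_sum; exact: measurable_cst.
by apply/funext => w; rewrite /num big_const_seq count_predT iter_addr_0.
Qed.

Let count_field : field := fun q => \sum_(x <- points q.1.1) (x.1 < q.1.2)%R%:R.

Let mcount : measurable_fun setT count_field.
Proof.
have mp : measurable_fun setT (fun p : PrT => \sum_(x <- points p.1) (x.1 < p.2)%R%:R : R); last first.
  exact: (measurableT_comp mp measurable_fst).
rewrite (_ : (fun p : PrT => _) = (fun p => \sum_(x <- points p.1) (cst 1 : field) ((p.1, x.1), x.2) * (x.1 < p.2)%R%:R)).
  by apply: predictable_sum; exact: measurable_cst.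
by apply/funext => p; apply: eq_bigr => x _; rewrite mul1r.
Qed.

Let countE q : count_field q = (nbefore (points q.1.1) q.1.2)%:R.
Proof. by rewrite nbeforeE. Qed.

Let power_exp (a : R) k : 0 < a -> expR (k%:R * ln a) = a ^+ k.
Proof. by move=> a0; rewrite expRM_natl lnK. Qed.

(** The integrand is the terminal value of the exponential martingale of the
    counting process. Stopped at its [N]-th jump it is bounded, so that its mean
    is at most 1; then [N] grows to infinity. *)
Lemma exponential_moment (rho : R) : 1 <= rho ->
  (\int[P]_w (rho ^+ size (points w) * expR (- ((rho - 1) * c w)))%:E <= 1)%E.
Proof.
move=> rho1; have rho0 : 0 < rho by rewrite (lt_le_trans ltr01).
have r1 : 0 <= rho - 1 by rewrite subr_ge0.
pose ind N : field := fun q => (count_field q < N%:R)%R%:R.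
have mind N : measurable_fun setT (ind N).
  have : measurable_fun setT (fun q => count_field q < N%:R : bool).
    by apply: measurable_fun_ltr => //; exact: mcount.
  by move=> mb; have [] := bounded_mfun_bool R mb.
have indE N q : ind N q = (nbefore (points q.1.1) q.1.2 < N)%N%:R by rewrite /ind countE ltr_nat.
have ind0 N q : 0 <= ind N q by rewrite /ind.
pose A N : PrT -> R := fun p => fine (\int[nu p.1]_(q in `]0%R, p.2] `*` setT) (ind N ((p.1, q.1), q.2))%:E)%E.
have mA N : measurable_fun setT (A N) by apply: (predictable_nu_integral fG comp).
have A0 N p : 0 <= A N p by apply: fine_ge0; apply: integral_ge0 => q _; rewrite lee_fin.
pose W N : field := fun q => expR (- ((rho - 1) * A N q.1)) * (expR (count_field q * ln rho) * (rho - 1) * ind N q).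
have mW N : measurable_fun setT (W N).
  apply: measurable_funM.
    apply: measurableT_comp => //; apply: measurableT_comp => //; apply: measurable_funM => //.
    by apply: (measurableT_comp (mA N)); exact: measurable_fst.
  apply: measurable_funM => //; apply: measurable_funM => //; apply: measurableT_comp => //.
  by apply: measurable_funM => //; exact: mcount.
have W0 N q : 0 <= W N q by rewrite !mulr_ge0// expR_ge0.
have WE N q : W N q = expR (- ((rho - 1) * A N q.1)) *
    (rho ^+ nbefore (points q.1.1) q.1.2 * (rho - 1) * (nbefore (points q.1.1) q.1.2 < N)%N%:R).
  by rewrite /W indE countE power_exp.
have sumle N w : good w -> \sum_(x <- points w) W N (w, x.1, x.2) <= rho ^+ N * (rho - 1) * N%:R.
  move=> [uw _ _].
  have h : \sum_(x <- points w) W N (w, x.1, x.2) <=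
      \sum_(x <- points w) rho ^+ N * (rho - 1) * (nbefore (points w) x.1 < N)%N%:R.
    apply: ler_sum => x _; rewrite WE /=; case: ltnP => [hN|_]; last by rewrite !mulr0.
    rewrite !mulr1 mulrA ler_wpM2r// -[X in _ <= X]mul1r ler_pM ?expR_ge0 ?exprn_ge0 ?(ltW rho0)//.
      by rewrite expR_le1 oppr_le0 mulr_ge0.
    by rewrite ler_weXn2l// ltnW.
  apply: (le_trans h); rewrite -mulr_sumr ler_wpM2l ?mulr_ge0 ?exprn_ge0 ?(ltW rho0)//.
  rewrite (sum_nbefore (fun k => (k < N)%N%:R : R) uw).
  suff -> : \sum_(i < size (points w)) (i < N)%N%:R = (minn (size (points w)) N)%:R :> R by rewrite ler_nat geq_minr.
  elim: (size (points w)) => [|k ih]; first by rewrite big_ord0 min0n.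
  rewrite big_ord_recr /= ih; have [kN|Nk] := ltnP k N.
    by rewrite natr1 (minn_idPl kN).
  by rewrite addr0 (minn_idPr (leqW Nk)).
have finW N : (\int[P]_w \int[nu w]_(p in `]0%R, T] `*` setT) `|W N (w, p.1, p.2)|%:E < +oo)%E.
  under eq_integral => w _ do under eq_integral => p _ do rewrite ger0_norm//.
  rewrite -(compensator_mean T0 fG comp mu_points (mW N) (W0 N)).
  apply: (@le_lt_trans _ _ (\int[P]_w (rho ^+ N * (rho - 1) * N%:R)%:E)%E).
    apply: ae_ge0_le_integral => //.
    - by move=> w _; rewrite lee_fin sumr_ge0.
    - by apply/measurable_EFinP; exact: measurable_sum.
    - by move=> w _; rewrite lee_fin !mulr_ge0// exprn_ge0// ltW.
    - by move: ae_good; apply: filterS => w gw _; rewrite lee_fin; exact: sumle.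
  by rewrite cstP ltry.
pose f N w := rho ^+ minn (size (points w)) N * expR (- ((rho - 1) * A N (w, T))).
have mpow N : measurable_fun setT (fun w => rho ^+ minn (size (points w)) N).
  rewrite (_ : (fun w => _) = (fun w => expR (Num.min (num w) N%:R * ln rho))).
    apply: measurableT_comp => //; apply: measurable_funM => //.
    exact: measurable_minr.
  by apply/funext => w; rewrite /num -natr_min power_exp.
have mexpA N : measurable_fun setT (fun w => expR (- ((rho - 1) * A N (w, T)))).
  apply: measurableT_comp => //; apply: measurableT_comp => //; apply: measurable_funM => //.
  have := predictable_fun_measurable fG (mA N) => h; exact: (measurableT_comp h).
have fE N : {ae P, forall w, f N w = 1 + (\sum_(x <- points w) W N (w, x.1, x.2) - Iw (W N) w)}.
  move: ae_good; apply: filterS => w [uw nf na].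
  pose h (p : R * E) : R := - ((rho - 1) * (nbefore (points w) p.1 < N)%N%:R).
  pose W' (p : R * E) : R := expR (upto (n w) h p.1) *
    (rho ^+ nbefore (points w) p.1 * (rho - 1) * (nbefore (points w) p.1 < N)%N%:R).
  have pe : rho ^+ minn (nupto (points w) T) N * expR (upto (n w) h T) =
      1 + \sum_(x <- points w) W' x * (x.1 <= T)%R%:R - upto (n w) W' T.
    exact: (power_exponential_path nf na uw rho N T).
  move: pe.
  have bi : bounded_mfun (fun p : R * E => (nbefore (points w) p.1 < N)%N%:R : R).
    exact: (bounded_nbefore (points w) (fun k => (k < N)%N%:R)).
  have hA t : t <= T -> upto (n w) h t = - ((rho - 1) * A N (w, t)).
    move=> tT; rewrite (_ : upto (n w) h t = upto (n w) (fun p => - (rho - 1) * (nbefore (points w) p.1 < N)%N%:R) t); last first.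
      by congr upto; apply/funext => p; rewrite /h mulNr.
    rewrite /upto (_ : (fun p => _) = (fun p => - (rho - 1) * ((nbefore (points w) p.1 < N)%N%:R * (p.1 <= t)%R%:R))); last first.
      by apply/funext => p; rewrite mulrA.
    rewrite Rint_Z//; last by exact: bounded_upto_cut.
    rewrite -/(upto _ _ _) upto_strip//; last by have [] := bi.
    by rewrite mulNr /A; congr (- (_ * fine _)); apply: eq_integral => p _; rewrite indE.
  have W'E p : p.1 <= T -> W' p = sec (W N) w p.
    by move=> pT; rewrite /W' hA// /sec WE.
  rewrite (hA T (lexx _)) (_ : nupto (points w) T = size (points w)); last first.
    by apply/eqP; rewrite /nupto -all_count; apply/allP => x /(points_in theta_gt0)/andP[].
  rewrite -/(f N w) => ->; rewrite -addrA; congr (_ + (_ - _)).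
    by apply: eq_big_seq => x /(points_in theta_gt0)/andP[_ xT]; rewrite xT mulr1 W'E.
  rewrite (_ : upto (n w) W' T = upto (n w) (sec (W N) w) T); last first.
    by apply: eq_Rintegral => p _; have [pT|] := leP p.1 T; [rewrite W'E|rewrite !mulr0].
  by rewrite upto_strip//; exact: field_section.
have bound N : (\int[P]_w (rho ^+ minn (size (points w)) N * expR (- ((rho - 1) * c w)))%:E <= 1)%E.
  have [iD D0] := compensated_mean0 T0 fG theta_stop theta_gt0 zeta_stop comp mu_points (mW N) (finW N).
  apply: (@le_trans _ _ (\int[P]_w (f N w)%:E)%E).
    apply: ae_ge0_le_integral => //.
    - by move=> w _; rewrite lee_fin mulr_ge0 ?expR_ge0 ?exprn_ge0 ?(ltW rho0).
    - apply/measurable_EFinP; apply: measurable_funM => //; apply: measurableT_comp => //.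
      by apply: measurableT_comp => //; exact: measurable_funM.
    - by move=> w _; rewrite lee_fin mulr_ge0 ?expR_ge0 ?exprn_ge0 ?(ltW rho0).
    - by apply/measurable_EFinP; apply: measurable_funM.
    - move: ae_good; apply: filterS => w [uw nf na] _.
      rewrite lee_fin ler_wpM2l ?exprn_ge0 ?(ltW rho0)// ler_expR lerN2 ler_wpM2l//.
      have le : (\int[nu w]_(q in `]0%R, T] `*` setT) (ind N ((w, q.1), q.2))%:E <= n w setT)%E.
        rewrite nET; apply: ge0_le_integral; first exact: measurable_strip.
        + by move=> q _; rewrite lee_fin.
        + by apply/measurable_EFinP/measurable_funTS; exact: (field_section fG).
        + exact: measurable_cst.
        + by move=> q _; rewrite lee_fin /ind lern1 leq_b1.
      apply: fine_le => //.
      + by rewrite ge0_fin_numE ?(le_lt_trans le)// integral_ge0// => q _; rewrite lee_fin.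
      + by rewrite ge0_fin_numE.
  have -> : (\int[P]_w (f N w)%:E =
      \int[P]_w (1%:E + (\sum_(x <- points w) W N (w, x.1, x.2) - Iw (W N) w)%:E))%E.
    by apply: ae_eq_integral_nomeas; move: (fE N); apply: filterS => w -> _; rewrite EFinD.
  rewrite integralD//; last exact: finite_measure_integrable_cst.
  by rewrite D0 adde0 cstP.
have cv : ((\int[P]_w (rho ^+ minn (size (points w)) N * expR (- ((rho - 1) * c w)))%:E)%E @[N --> \oo] -->
    (\int[P]_w (rho ^+ size (points w) * expR (- ((rho - 1) * c w)))%:E)%E).
  apply: cvg_integral_nd.
  - move=> N; apply/measurable_EFinP; apply: measurable_funM => //; apply: measurableT_comp => //.
    by apply: measurableT_comp => //; exact: measurable_funM.
  - by move=> N w; rewrite lee_fin mulr_ge0 ?expR_ge0 ?exprn_ge0 ?(ltW rho0).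
  - move=> w k l kl; rewrite lee_fin ler_wpM2r ?expR_ge0// ler_weXn2l//.
    by rewrite leq_min geq_minl (leq_trans (geq_minr _ _)).
  - move=> w; apply: cvg_near_cst; exists (size (points w)) => // k /= hk.
    by rewrite (minn_idPl hk).
rewrite -(cvg_lim _ cv)//; apply: lime_le; last exact: nearW.
by apply/cvg_ex; eexists; exact: cv.
Qed.

Variables (M : R) (H : field) (L : Omega -> R -> R).
Hypothesis M1 : 1 < M.
Hypothesis mH : measurable_fun setT H.
Hypothesis H_bound : forall q, 0 <= 1 + H q <= M.
Hypothesis H_supp : forall q, ~~ (0 < q.1.2 <= T) -> H q = 0.
Hypothesis L_adapted : adapted G L.
Hypothesis L_eq : {ae P, forall w, cadlag_on T (L w) /\ forall t, 0 <= t <= T ->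
    L w t = 1 + compensated_integral (mu w) (nu w) `]0, t]
      (fun s x => left_limit (L w) s * H ((w, s), x))}.
Hypothesis expint : (\int[P]_w (expR ((3 + M ^+ 4) * fine (strip_measure T (nu w) setT)))%:E < +oo)%E.

Let Hle q : `|H q| <= M.
Proof. have h (x : R) : 0 <= 1 + x <= M -> `|x| <= M.
  by have := M1; move=> M1' /andP[h1 h2]; rewrite ler_norml; apply/andP; split; lra.
exact: h. Qed.

Let Lm : PrT -> R := fun p =>
  fine (limn_esup (fun k => (if p \in @all_times R _ Omega then L p.1 (grid_left k p.2) else 0)%:E)).

Let mLm : measurable_fun setT Lm.
Proof.
apply: measurableT_comp; first exact: fine_measurable.
apply: measurable_fun_limn_esup => k; apply/measurable_EFinP.
apply: (@predictable_patch _ _ _ _ _ _ (fun w t => L w (grid_left k t)) _ 0 KA).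
exact: adapted_grid_left.
Qed.

Let LmE w t : 0 < t <= T -> cadlag_on T (L w) -> left_limit (L w) t = Lm (w, t).
Proof.
move=> /andP[t0 tT] [_ lc]; rewrite /Lm /= mem_set; last by split => //=; rewrite in_itv/= ltW.
have := left_limit_grid t0 (lc t _); rewrite t0 tT => /(_ isT) h.
have {}h : (L w (grid_left k t))%:E @[k --> \oo] --> (left_limit (L w) t)%:E by apply: cvg_EFin => //; exact: nearW.
rewrite is_cvg_limn_esupE; last by apply/cvg_ex; eexists; exact: h.
by rewrite (cvg_lim _ h).
Qed.

Let g w (p : R * E) := Lm (w, p.1) * sec H w p.
Let J w := jump_path (n w) (points w) 1 (g w) (g w).
Let Jl w := jump_path_left (n w) (points w) 1 (g w) (g w).

Let bH w : bounded_mfun (sec H w).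
Proof. by split; [exact: (field_section fG)|exists M => p; exact: Hle]. Qed.

Let doleans_path w := [/\ good w, bounded_mfun (g w), forall t, 0 <= t <= T -> L w t = J w t,
  forall p, g w p = Jl w p.1 * sec H w p & forall t, 0 < t <= T -> Lm (w, t) = Jl w t].

Let ae_doleans : {ae P, forall w, doleans_path w}.
Proof.
have hcut w : strip_cut T (sec H w) = sec H w.
  apply/funext => p; rewrite /strip_cut; case: (boolP (0 < p.1 <= T)) => [_|h]; first by rewrite mulr1.
  by rewrite mulr0 /sec H_supp.
move: mu_points L_eq ae_good; apply: filterS3 => w h1 [h3 h4] h5.
have h2 : (nu w (`]0%R, T] `*` setT) < +oo)%E.
  by have [_ + _] := h5; rewrite /strip_measure /= /mrestr setTI.
have mlm : measurable_fun setT (fun t => Lm (w, t)).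
  have := predictable_fun_measurable fG mLm => h; exact: (measurableT_comp h).
have lmE t : 0 < t <= T -> left_limit (L w) t = Lm (w, t) by move=> tT; exact: LmE.
have e1 := doleans_strip T0 h1 h3 mlm lmE (bH w) h4.
have e2 := doleans_strip_left T0 h1 h2 h3 mlm lmE (bH w) h4.
have e3 := doleans_strip_slope T0 h1 h2 h3 mlm lmE (bH w) h4.
have e4 := doleans_strip_bounded T0 h3 mlm lmE (bH w).
rewrite hcut in e1 e2 e3 e4; split => //.
by move=> t tT; rewrite -LmE// e2.
Qed.

Let B w := M ^+ size (points w) * expR (c w).

Let M0 : 0 < M. Proof. by rewrite (lt_trans _ M1). Qed.

Let mB : measurable_fun setT B.
Proof.
apply: measurable_funM; last exact: measurableT_comp.
rewrite (_ : (fun w => _) = (fun w => expR (num w * ln M))).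
  by apply: measurableT_comp => //; exact: measurable_funM.
by apply/funext => w; rewrite power_exp.
Qed.

Let expB w : expR (c w) <= B w.
Proof. by rewrite -[X in X <= _]mul1r ler_wpM2r ?expR_ge0// exprn_ege1// ltW. Qed.

Let B1 w : 1 <= B w.
Proof. by rewrite (le_trans _ (expB w))// -[X in X <= _]expR0 ler_expR. Qed.

Let B0 w : 0 <= B w. Proof. by rewrite (le_trans _ (B1 w)). Qed.

Let numB w : num w * expR (c w) <= (M - 1)^-1 * B w.
Proof. by rewrite /B mulrA ler_wpM2r ?expR_ge0// bernoulli_power. Qed.

Let square_integrable_bound : (\int[P]_w (B w ^+ 2)%:E < +oo)%E.
Proof.
pose f1 w := M ^+ 4 ^+ size (points w) * expR (- ((M ^+ 4 - 1) * c w)).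
pose f2 w := expR ((3 + M ^+ 4) * c w).
have mf2 : measurable_fun setT f2.
  by apply: measurableT_comp => //; exact: measurable_funM.
have mf1 : measurable_fun setT f1.
  apply: measurable_funM; last first.
    by apply: measurableT_comp => //; apply: measurableT_comp => //; exact: measurable_funM.
  rewrite (_ : (fun w => _) = (fun w => expR (num w * ln (M ^+ 4)))).
    by apply: measurableT_comp => //; exact: measurable_funM.
  by apply/funext => w; rewrite power_exp// exprn_gt0.
have f10 w : 0 <= f1 w by rewrite mulr_ge0 ?expR_ge0// !exprn_ge0// ltW.
have f20 w : 0 <= f2 w by exact: expR_ge0.
apply: (@le_lt_trans _ _ (\int[P]_w ((f1 w)%:E + (f2 w)%:E))%E).
  apply: ge0_le_integral => //.
  - by move=> w _; rewrite lee_fin exprn_ge0.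
  - by apply/measurable_EFinP; exact: measurable_funX.
  - by apply/measurable_EFinP; exact: measurable_funD.
  move=> w _; rewrite -EFinD lee_fin.
  pose y := M ^+ size (points w).
  pose a := y ^+ 2 * expR (- ((M ^+ 4 - 1) * c w) / 2).
  pose b := expR ((3 + M ^+ 4) * c w / 2).
  have half (x : R) : expR x = expR (x / 2) ^+ 2 by rewrite -expRM_natl; congr expR; field.
  have -> : f1 w = a ^+ 2 by rewrite /f1 /a half exprAC -/y; ring.
  have -> : f2 w = b ^+ 2 by rewrite /f2 half.
  have -> : B w ^+ 2 = a * b.
    rewrite /B -/y /a /b -mulrA -expRD exprMn -expRM_natl; congr (_ * expR _); by field.
  have amgm (u v : R) : u * v <= u ^+ 2 + v ^+ 2 by nra.
  exact: amgm.
rewrite ge0_integralD//.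
- apply: lte_add_pinfty => //.
  by apply: (le_lt_trans (exponential_moment _)); rewrite ?ltry// exprn_ege1// ltW.
- by move=> w _; rewrite lee_fin.
- exact/measurable_EFinP.
- by move=> w _; rewrite lee_fin.
- exact/measurable_EFinP.
Qed.

Let dominated_finite (W : field) (K : R) : measurable_fun setT W ->
  {ae P, forall w, exists2 b, (forall t x, 0 < t <= T -> `|W ((w, t), x)| <= b) & b * c w <= K * B w ^+ 2} ->
  (\int[P]_w \int[nu w]_(p in `]0%R, T] `*` setT) `|W (w, p.1, p.2)|%:E < +oo)%E.
Proof.
move=> mW hW.
apply: (@le_lt_trans _ _ (\int[P]_w ((`|K|)%:E * (B w ^+ 2)%:E))%E).
  apply: ae_ge0_le_integral => //.
  - by move=> w _; apply: integral_ge0.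
  - by apply: (measurable_nu_integral fG comp T0' (W := fun q => `|W q|)) => //; exact: measurableT_comp.
  - by move=> w _; rewrite mule_ge0 ?lee_fin ?exprn_ge0.
  - by apply: emeasurable_funM => //; apply/measurable_EFinP; exact: measurable_funX.
  move: ae_good hW; apply: filterS2 => w [_ nf _] [b hb bK] _.
  apply: (@le_trans _ _ (\int[nu w]_(p in `]0%R, T] `*` setT) b%:E)%E).
    apply: ge0_le_integral => //; first exact: measurable_strip.
    - by apply/measurable_EFinP/measurable_funTS; apply: measurableT_comp => //; exact: (field_section fG).
    - by move=> [t x] /= [tT _]; rewrite lee_fin hb//; move: tT; rewrite /= in_itv.
  rewrite integral_cst; last exact: measurable_strip.
  have -> : nu w (`]0%R, T]%classic `*` setT) = (c w)%:E.
    by rewrite /c fineK ?ge0_fin_numE// /strip_measure /= /mrestr setTI.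
  by rewrite -!EFinM lee_fin (le_trans bK)// ler_wpM2r ?exprn_ge0// ler_norm.
rewrite ge0_integralZl//.
- by apply: lte_mul_pinfty => //; exact: square_integrable_bound.
- by apply/measurable_EFinP; exact: measurable_funX.
- by move=> w _; rewrite lee_fin exprn_ge0.
Qed.

Let cB w : c w * B w <= B w ^+ 2.
Proof.
rewrite expr2 ler_wpM2r// (le_trans _ (expB w))// (le_trans _ (expR_ge1Dx _))//.
by rewrite lerDr.
Qed.

(** [L] is nonnegative and grows by a factor at most [M] at each jump, the drift
    contributing the exponential of the compensator. *)
Lemma doleans_bound : {ae P, forall w, 0 <= L w T <= B w}.
Proof.
move: ae_doleans; apply: filterS => w [[uw nf na] bg lJ gE _].
rewrite lJ; last by rewrite T0' /=.
apply: (jump_path_bound nf na uw (bH w) bg) => //.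
- exact: ltW.
- by move=> p; exact: H_bound.
- by move=> x /(points_in theta_gt0)/andP[].
- by move=> x /(points_in theta_gt0)/andP[].
Qed.

Let left_bound w t : doleans_path w -> 0 < t <= T -> 0 <= Lm (w, t) <= B w.
Proof.
move=> [[uw nf na] bg _ gE lE] tT; rewrite lE//.
have s0 x : x \in points w -> 0 < x.1 by move=> /(points_in theta_gt0)/andP[].
have gEs x : x \in points w -> g w x = Jl w x.1 * sec H w x by move=> _; exact: gE.
have /andP[t0 _] := tT.
have /andP[h0 h1] := jump_path_left_bound nf na uw (bH w) bg gEs gE (ltW M1) (fun p => H_bound (w, p.1, p.2)) s0 t0.
rewrite /Jl h0 /= (le_trans h1)// ler_wpM2r ?expR_ge0// ler_weXn2l ?(ltW M1)//.
exact: count_size.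
Qed.

Let mean0 (W : field) (K : R) : measurable_fun setT W ->
  {ae P, forall w, exists2 b, (forall t x, 0 < t <= T -> `|W ((w, t), x)| <= b) & b * c w <= K * B w ^+ 2} ->
  P.-integrable setT (fun w => (\sum_(x <- points w) W (w, x.1, x.2) - Iw W w)%:E) /\
  (\int[P]_w (\sum_(x <- points w) W (w, x.1, x.2) - Iw W w)%:E = 0)%E.
Proof.
move=> mW hW.
exact: (compensated_mean0 T0 fG theta_stop theta_gt0 zeta_stop comp mu_points mW (dominated_finite mW hW)).
Qed.

Let left_field : field := fun q => Lm q.1.
Let mleft : measurable_fun setT left_field.
Proof. exact: (measurableT_comp mLm measurable_fst). Qed.

Let mLT : measurable_fun setT (fun w => L w T).
Proof. by move=> _ A mA; case: fG => _ + _; apply; [exact: T0'|exact: L_adapted]. Qed.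

(** [L] is 1 plus the compensated integral of [L_- H], which the bound on [L] and
    the exponential moment make integrable. *)
Lemma doleans_mean : P.-integrable setT (fun w => (L w T)%:E) /\ (\int[P]_w (L w T)%:E = 1)%E.
Proof.
pose W : field := fun q => left_field q * H q.
have mW : measurable_fun setT W by exact: measurable_funM.
have [|iD D0] := mean0 (K := M) mW.
  move: ae_doleans; apply: filterS => w dw; exists (B w * M).
    move=> t x /(left_bound dw)/andP[l0 lB].
    by rewrite /W /left_field /= normrM ler_pM ?Hle// ger0_norm.
  by rewrite mulrAC mulrC ler_wpM2l ?(ltW M0)// mulrC.
have E1 : {ae P, forall w, setT w -> ((\sum_(x <- points w) W (w, x.1, x.2) - Iw W w)%:E + 1%:E)%E = (L w T)%:E}.
  move: ae_doleans; apply: filterS => w [_ [mg _] lJ _ _] _; rewrite -EFinD; congr (_%:E).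
  rewrite lJ ?T0' ?lexx// /J /jump_path upto_strip//; rewrite addrC addrA; congr (_ + _ - _).
  by apply: eq_big_seq => x /(points_in theta_gt0)/andP[_ ->]; rewrite mulr1.
have i1 : P.-integrable setT (EFin \o cst (1 : R)) by exact: finite_measure_integrable_cst.
have mT : measurable_fun setT (fun w => (L w T)%:E) by exact/measurable_EFinP.
split; first by apply: (integrable_ae_eq mT E1); exact: integrableD.
rewrite -(ae_eq_integral_nomeas E1); apply: (etrans (integralD measurableT iD i1)).
by rewrite D0 add0e cstP.
Qed.

Let c_exp w : c w <= expR (c w).
Proof. by rewrite (le_trans _ (expR_ge1Dx _))// lerDr. Qed.

Let I1 (W : field) w := Iw (fun q => W q * (1 + H q)) w.

Let m1H : measurable_fun setT (fun q => 1 + H q).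
Proof. exact: measurable_funD. Qed.

Let bounded_left w : doleans_path w -> bounded_mfun (fun p : R * E => Jl w p.1).
Proof.
move=> [[_ nf _] bg _ _ _]; apply: bounded_mfunB; last exact: bounded_before.
apply: bounded_mfunD; first exact: bounded_mfun_cst.
apply: (bounded_mfun_sum (F := fun x (p : R * E) => g w x * (x.1 < p.1)%R%:R)) => x _.
by apply: bounded_mfunM; [exact: bounded_mfun_cst|exact: bounded_gt].
Qed.

Let girsanov_bounded (Th : field) (K : R) : measurable_fun setT Th -> 0 <= K -> (forall q, 0 <= Th q <= K) ->
  (\int[P]_w (L w T * \sum_(x <- points w) Th (w, x.1, x.2))%:E = \int[P]_w (L w T * I1 Th w)%:E)%E.
Proof.
move=> mTh K0 Th_b.
have Th0 q : 0 <= Th q by have /andP[] := Th_b q.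
have mThH : measurable_fun setT (fun q => Th q * (1 + H q)) by exact: measurable_funM.
have ThH0 q : 0 <= Th q * (1 + H q) by rewrite mulr_ge0//; have /andP[] := H_bound q.
pose D1 (p : PrT) : R := \sum_(x <- points p.1) Th ((p.1, x.1), x.2) * (x.1 < p.2)%R%:R.
pose D2 (p : PrT) : R := fine (\int[nu p.1]_(q in `]0%R, p.2] `*` setT) (Th ((p.1, q.1), q.2) * (1 + H ((p.1, q.1), q.2)))%:E)%E.
have mD1 : measurable_fun setT D1 by exact: predictable_sum.
have mD2 : measurable_fun setT D2 by exact: (predictable_nu_integral fG comp mThH ThH0).
pose W : field := fun q => left_field q * Th q * (1 + H q) + (D1 q.1 - D2 q.1) * (left_field q * H q).
have mW : measurable_fun setT W.
  apply: measurable_funD; first by apply: measurable_funM; [exact: measurable_funM|exact: m1H].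
  apply: measurable_funM; last exact: measurable_funM.
  by apply: measurable_funB; [exact: (measurableT_comp mD1 measurable_fst)|exact: (measurableT_comp mD2 measurable_fst)].
have D2E w t : doleans_path w -> 0 < t <= T ->
    D2 (w, t) = before (n w) (fun p => sec Th w p * (1 + sec H w p)) t.
  move=> [[uw nf na] _ _ _ _] /andP[t0 tT]; rewrite before_upto// upto_strip//.
  exact: (field_section fG w mThH).
have D2b w t : doleans_path w -> 0 < t <= T -> 0 <= D2 (w, t) <= K * M * c w.
  move=> dw tT; apply/andP; split.
    by apply: fine_ge0; apply: integral_ge0 => q _; rewrite lee_fin.
  rewrite D2E//; have [[uw nf na] _ _ _ _] := dw.
  apply: le_trans (ler_norm _) _; apply: Rint_bound => //.
    apply: bounded_mfunM; last exact: bounded_lt.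
    apply: bounded_mfunM; last by apply: bounded_mfunD; [exact: bounded_mfun_cst|exact: bH].
    split; first exact: (field_section fG).
    by exists K => p; rewrite ger0_norm//; have /andP[] := Th_b (w, p.1, p.2).
  move=> p; have /andP[a1 a2] := H_bound (w, p.1, p.2).
  have /andP[b1 b2] := Th_b (w, p.1, p.2).
  have v0 : 0 <= sec Th w p * (1 + sec H w p) by exact: mulr_ge0.
  rewrite ger0_norm; last by rewrite mulr_ge0.
  rewrite -[X in _ <= X]mulr1 ler_pM//; last by case: (_ < _).
  exact: ler_pM.
have D1b w t : 0 <= D1 (w, t) <= K * num w.
  apply/andP; split; first by apply: sumr_ge0 => x _; rewrite mulr_ge0.
  rewrite /D1 /num -sum1_size natr_sum mulr_sumr; apply: ler_sum => x _.
  rewrite ler_pM//; first by have /andP[] := Th_b (w, x.1, x.2).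
  by case: (_ < _).
pose K' := K * M + K * M * (M - 1)^-1 + 4 * K * M ^+ 2.
have [|iD D0] := mean0 (K := K') mW.
  move: ae_doleans; apply: filterS => w dw.
  exists (B w * K * M + (K * num w + K * M * c w) * (B w * M)).
    move=> t x tT; have /andP[l0 lB] := left_bound dw tT.
    have /andP[a1 a2] := H_bound ((w, t), x); have /andP[b1 b2] := Th_b ((w, t), x).
    have /andP[d1' d2] := D1b w t; have /andP[d3 d4] := D2b w t dw tT.
    rewrite /W /left_field /= (le_trans (ler_normD _ _))// lerD//.
      by rewrite ger0_norm ?mulr_ge0// !ler_pM ?mulr_ge0.
    rewrite !normrM ler_pM// ?mulr_ge0// ?normr_ge0//; last first.
      by rewrite ler_pM ?Hle// ger0_norm.
    by rewrite (le_trans (ler_normB _ _))// lerD// ger0_norm.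
  have e1 : c w * B w <= B w ^+ 2 by exact: cB.
  have e2 : num w * c w * B w <= (M - 1)^-1 * B w ^+ 2.
    rewrite [B w ^+ 2]expr2 [X in _ <= X]mulrA ler_wpM2r// (le_trans _ (numB w))//.
    by rewrite ler_wpM2l// /num ler0n.
  have e3 : c w ^+ 2 * B w <= 4 * B w ^+ 2.
    rewrite [B w ^+ 2]expr2 [X in _ <= X]mulrA ler_wpM2r// (le_trans (exponential_dominates (c_ge0 w)))//.
    by rewrite ler_wpM2l.
  have -> : (B w * K * M + (K * num w + K * M * c w) * (B w * M)) * c w =
     K * M * (c w * B w) + K * M * (num w * c w * B w) + K * M ^+ 2 * (c w ^+ 2 * B w) by ring.
  have KM0 : 0 <= K * M by rewrite mulr_ge0// ltW.
  have KM20 : 0 <= K * M ^+ 2 by rewrite mulr_ge0// exprn_ge0// ltW.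
  have := ler_wpM2l KM0 e1; have := ler_wpM2l KM0 e2; have := ler_wpM2l KM20 e3.
  have -> : K' * B w ^+ 2 = K * M * B w ^+ 2 + K * M * ((M - 1)^-1 * B w ^+ 2) + K * M ^+ 2 * (4 * B w ^+ 2).
    by rewrite /K'; ring.
  by move=> f1 f2 f3; rewrite !lerD.
pose Df w := \sum_(x <- points w) W (w, x.1, x.2) - Iw W w.
have E1 : {ae P, forall w, L w T * (\sum_(x <- points w) Th (w, x.1, x.2) - I1 Th w) = Df w}.
  move: ae_doleans; apply: filterS => w dw; have [[uw nf na] bg lJ gE lE] := dw.
  have gEs x : x \in points w -> g w x = Jl w x.1 * sec H w x by move=> _; exact: gE.
  have bf : bounded_mfun (sec Th w).
    split; first exact: (field_section fG).
    by exists K => p; rewrite ger0_norm//; have /andP[] := Th_b (w, p.1, p.2).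
  pose D' u := \sum_(y <- points w) sec Th w y * (y.1 < u)%R%:R - before (n w) (fun p => sec Th w p * (1 + sec H w p)) u.
  pose V1 p := Jl w p.1 * sec Th w p * (1 + sec H w p).
  pose V2 p := D' p.1 * (Jl w p.1 * sec H w p).
  have b1h : bounded_mfun (fun p => 1 + sec H w p) by apply: bounded_mfunD; [exact: bounded_mfun_cst|exact: bH].
  have bV1 : bounded_mfun V1 by apply: bounded_mfunM => //; apply: bounded_mfunM => //; exact: bounded_left.
  have bV2 : bounded_mfun V2.
    apply: bounded_mfunM; last by apply: bounded_mfunM; [exact: bounded_left|exact: bH].
    apply: bounded_mfunB; last by apply: bounded_before => //; exact: bounded_mfunM.
    apply: (bounded_mfun_sum (F := fun x (p : R * E) => sec Th w x * (x.1 < p.1)%R%:R)) => x _.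
    by apply: bounded_mfunM; [exact: bounded_mfun_cst|exact: bounded_gt].
  have WE p : 0 < p.1 <= T -> sec W w p = V1 p + V2 p.
    by move=> pT; rewrite /sec /W /left_field /= lE// D2E.
  have pe : J w T * (\sum_(y <- points w) sec Th w y * (y.1 <= T)%R%:R -
        upto (n w) (fun p => sec Th w p * (1 + sec H w p)) T) =
      (\sum_(x <- points w) V1 x * (x.1 <= T)%R%:R - upto (n w) V1 T) +
      (\sum_(x <- points w) V2 x * (x.1 <= T)%R%:R - upto (n w) V2 T).
    exact: (girsanov_path nf na uw (bH w) bg gEs gE T bf).
  have cutT (f : R * E -> R) : \sum_(y <- points w) f y * (y.1 <= T)%R%:R = \sum_(y <- points w) f y.
    by apply: eq_big_seq => y /(points_in theta_gt0)/andP[_ ->]; rewrite mulr1.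
  move: pe; rewrite -lJ ?T0' ?lexx// !cutT upto_strip//; last exact: (field_section fG w mThH).
  rewrite -/(I1 Th w) => ->.
  have -> : Df w = \sum_(x <- points w) (V1 x + V2 x) - upto (n w) (fun p => V1 p + V2 p) T.
    congr (_ - _).
      by apply: eq_big_seq => x /(points_in theta_gt0) xT; rewrite -WE.
    rewrite upto_strip//; last by have [] := bounded_mfunD bV1 bV2.
    apply: eq_Rintegral => p; rewrite inE => -[/=]; rewrite in_itv/= => pT _.
    by rewrite -WE.
  have -> : upto (n w) (fun p => V1 p + V2 p) T = upto (n w) V1 T + upto (n w) V2 T.
    rewrite /upto -Rint_D//; [|exact: bounded_upto_cut|exact: bounded_upto_cut].
    by apply: eq_Rintegral => p _; rewrite mulrDl.
  by rewrite big_split /=; ring.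
have mS : measurable_fun setT (fun w => (L w T * \sum_(x <- points w) Th (w, x.1, x.2))%:E).
  by apply/measurable_EFinP; apply: measurable_funM; [exact: mLT|exact: measurable_sum].
have mI : measurable_fun setT (fun w => (L w T * I1 Th w)%:E).
  apply/measurable_EFinP; apply: measurable_funM; first exact: mLT.
  have mfine : measurable_fun setT (@fine R) by exact: fine_measurable.
  exact: (measurableT_comp mfine (measurable_nu_integral fG comp T0' mThH ThH0)).
have iS : P.-integrable setT (fun w => (L w T * \sum_(x <- points w) Th (w, x.1, x.2))%:E).
  apply/integrableP; split => //.
  apply: (@le_lt_trans _ _ (\int[P]_w ((K * (M - 1)^-1)%:E * (B w ^+ 2)%:E))%E).
    have KM : 0 <= K * (M - 1)^-1 by rewrite mulr_ge0// invr_ge0 subr_ge0 ltW.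
    apply: ae_ge0_le_integral => //.
    - exact: measurableT_comp.
    - by move=> w _; rewrite mule_ge0 ?lee_fin ?exprn_ge0.
    - by apply: emeasurable_funM => //; apply/measurable_EFinP; exact: measurable_funX.
    move: doleans_bound; apply: filterS => w /andP[l0 lB] _.
    rewrite lee_fin normrM ger0_norm// ger0_norm ?sumr_ge0//.
    have sK : \sum_(x <- points w) Th (w, x.1, x.2) <= K * num w.
      rewrite /num -sum1_size natr_sum mulr_sumr; apply: ler_sum => x _.
      by rewrite mulr1; have /andP[] := Th_b (w, x.1, x.2).
    apply: (@le_trans _ _ (B w * (K * num w))); first by rewrite ler_pM// sumr_ge0.
    have nB : num w <= (M - 1)^-1 * B w.
      by rewrite (le_trans _ (numB w))// ler_peMr ?ler0n// -[X in X <= _]expR0 ler_expR.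
    rewrite [X in _ <= X](_ : _ = B w * (K * ((M - 1)^-1 * B w))); last by ring.
    by rewrite ler_wpM2l// ler_wpM2l.
  rewrite ge0_integralZl//.
  - apply: lte_mul_pinfty; [by rewrite lee_fin mulr_ge0// invr_ge0 subr_ge0 ltW|by []|].
    exact: square_integrable_bound.
  - by apply/measurable_EFinP; exact: measurable_funX.
  - by move=> w _; rewrite lee_fin exprn_ge0.
  - by rewrite lee_fin mulr_ge0// invr_ge0 subr_ge0 ltW.
have E2 : {ae P, forall w, setT w ->
   ((L w T * \sum_(x <- points w) Th (w, x.1, x.2))%:E - (Df w)%:E)%E = (L w T * I1 Th w)%:E}.
  by move: E1; apply: filterS => w h _; rewrite -h -EFinB; congr (_%:E); ring.
rewrite -[RHS](ae_eq_integral_nomeas E2); apply/esym.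
apply: (etrans (integralB measurableT iS iD)).
by rewrite D0 sube0.
Qed.

(* the nonnegative version of the density *)
Let Lp w : R := Num.max (L w T) 0.

Let Lp0 w : 0 <= Lp w. Proof. by rewrite le_max lexx orbT. Qed.

Let mLp : measurable_fun setT Lp.
Proof. by apply: measurable_maxr. Qed.

Let LpE : {ae P, forall w, Lp w = L w T /\ Lp w <= B w}.
Proof.
by move: doleans_bound; apply: filterS => w /andP[l0 lB]; rewrite /Lp max_l.
Qed.

Let girsanov_ge0 (Th : field) : measurable_fun setT Th -> (forall q, 0 <= Th q) ->
  (\int[P]_w (Lp w * \sum_(x <- points w) Th (w, x.1, x.2))%:E =
   \int[P]_w ((Lp w)%:E * \int[nu w]_(p in `]0%R, T] `*` setT) (Th (w, p.1, p.2) * (1 + H (w, p.1, p.2)))%:E))%E.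
Proof.
move=> mTh Th0.
pose Tk k : field := fun q => Num.min (Th q) k%:R.
have mTk k : measurable_fun setT (Tk k) by exact: measurable_minr.
have Tkb k q : 0 <= Tk k q <= k%:R by rewrite le_min Th0 ler0n /= ge_min lexx orbT.
have Tk0 k q : 0 <= Tk k q by have /andP[] := Tkb k q.
have Tkle k l q : (k <= l)%N -> Tk k q <= Tk l q.
  move=> kl; rewrite le_min ge_min lexx /= ge_min; apply/orP; right; rewrite ler_nat//.
have Tkcst q : \forall k \near \oo, Tk k q = Th q.
  exists (Num.bound (Th q)) => // k /= mk.
  by rewrite /Tk min_l// (le_trans (ltW (archi_boundP (Th0 q))))// ler_nat.
have h1H q : 0 <= 1 + H q by have /andP[] := H_bound q.
have mTkH k : measurable_fun setT (fun q => Tk k q * (1 + H q)) by exact: measurable_funM.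
have TkH0 k q : 0 <= Tk k q * (1 + H q) by exact: mulr_ge0.
have c1 : ((\int[P]_w (Lp w * \sum_(x <- points w) Tk k (w, x.1, x.2))%:E)%E @[k --> \oo] -->
    (\int[P]_w (Lp w * \sum_(x <- points w) Th (w, x.1, x.2))%:E)%E).
  apply: cvg_integral_nd.
  - by move=> k; apply/measurable_EFinP; apply: measurable_funM => //; exact: measurable_sum.
  - by move=> k w; rewrite lee_fin mulr_ge0// sumr_ge0.
  - by move=> w k l kl; rewrite lee_fin ler_wpM2l// ler_sum// => x _; exact: Tkle.
  - move=> w; apply: cvg_EFin; first exact: nearW.
    apply: cvgMl_tmp; apply: cvg_near_cst; elim: (points w) => [|x s ih].
      by apply: nearW => k; rewrite !big_nil.
    by move: ih (Tkcst (w, x.1, x.2)); apply: filterS2 => k h1 h2; rewrite !big_cons h1 h2.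
have c2 : ((\int[P]_w ((Lp w)%:E * \int[nu w]_(p in `]0%R, T] `*` setT) (Tk k (w, p.1, p.2) * (1 + H (w, p.1, p.2)))%:E))%E
   @[k --> \oo] -->
   (\int[P]_w ((Lp w)%:E * \int[nu w]_(p in `]0%R, T] `*` setT) (Th (w, p.1, p.2) * (1 + H (w, p.1, p.2)))%:E))%E).
  have mstrip : measurable (`]0%R, T]%classic `*` (setT : set E)) by exact: measurable_strip.
  have msec k w : measurable_fun setT (fun p : R * E => (Tk k (w, p.1, p.2) * (1 + H (w, p.1, p.2)))%:E).
    by apply/measurable_EFinP; exact: (field_section fG w (mTkH k)).
  apply: cvg_integral_nd.
  - move=> k; apply: emeasurable_funM; first exact/measurable_EFinP.
    exact: (measurable_nu_integral fG comp T0' (mTkH k) (TkH0 k)).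
  - by move=> k w; rewrite mule_ge0 ?lee_fin// integral_ge0// => p _; rewrite lee_fin.
  - move=> w k l kl; rewrite lee_wpmul2l ?lee_fin//; apply: ge0_le_integral => //.
    + by move=> p _; rewrite lee_fin.
    + exact: measurable_funTS.
    + exact: measurable_funTS.
    + by move=> p _; rewrite lee_fin ler_wpM2r// Tkle.
  - move=> w; apply: cvgeZl => //.
    have mTs : measurable_fun setT (fun p : R * E => (Th (w, p.1, p.2) * (1 + H (w, p.1, p.2)))%:E).
      by apply/measurable_EFinP; apply: (field_section fG w (W := fun q => Th q * (1 + H q))); exact: measurable_funM.
    rewrite -(integral_mrestr (nu w) mstrip mTs).
    under [X in X @ _ --> _]eq_fun => k do rewrite -(integral_mrestr (nu w) mstrip (msec k w)).
    apply: cvg_integral_nd => //.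
    + by move=> k p; rewrite lee_fin.
    + by move=> p k l kl; rewrite lee_fin ler_wpM2r// Tkle.
    + move=> p; apply: cvg_EFin; first exact: nearW.
      by apply: cvgMr_tmp; apply: cvg_near_cst; exact: Tkcst.
apply: (cvg_unique _ c1) => //.
apply: cvg_trans c2; apply: near_eq_cvg; apply: nearW => k.
have -> : (\int[P]_w (Lp w * \sum_(x <- points w) Tk k (w, x.1, x.2))%:E =
    \int[P]_w (L w T * \sum_(x <- points w) Tk k (w, x.1, x.2))%:E)%E.
  by apply: ae_eq_integral_nomeas; move: LpE; apply: filterS => w [-> _].
rewrite (girsanov_bounded (mTk k) (ler0n _ k) (Tkb k)).
apply: ae_eq_integral_nomeas; move: LpE ae_good; apply: filterS2 => w [<- _] [_ nf _] _.
rewrite EFinM; congr (_ * _)%E; rewrite /I1 /Iw /Rintegral fineK//.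
rewrite ge0_fin_numE; last by apply: integral_ge0 => p _; rewrite lee_fin.
apply: (@le_lt_trans _ _ (\int[nu w]_(p in `]0%R, T] `*` setT) (k%:R * M)%:E)%E).
  apply: ge0_le_integral; first exact: measurable_strip.
  - by move=> p _; rewrite lee_fin.
  - by apply/measurable_EFinP/measurable_funTS; exact: (field_section fG w (mTkH k)).
  - exact: measurable_cst.
  - move=> p _; rewrite lee_fin; have /andP[a1 a2] := H_bound (w, p.1, p.2).
    by have /andP[b1 b2] := Tkb k (w, p.1, p.2); rewrite ler_pM.
rewrite integral_cst; last exact: measurable_strip.
rewrite lte_mul_pinfty//; first by rewrite lee_fin mulr_ge0// ltW.
by move: nf; rewrite /strip_measure /= /mrestr setTI.
Qed.

Let Lp_integrable (Th : field) : measurable_fun setT Th -> (forall q, 0 <= Th q) ->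
  (\int[P]_w ((B w)%:E * \int[nu w]_(p in `]0%R, T] `*` setT) (Th (w, p.1, p.2))%:E) < +oo)%E ->
  [/\ P.-integrable setT (fun w => (Lp w * \sum_(x <- points w) Th (w, x.1, x.2))%:E),
      P.-integrable setT (fun w => (Lp w * I1 Th w)%:E),
      (\int[P]_w (Lp w * \sum_(x <- points w) Th (w, x.1, x.2))%:E = \int[P]_w (Lp w * I1 Th w)%:E)%E &
      {ae P, forall w, (\int[nu w]_(p in `]0%R, T] `*` setT) (Th (w, p.1, p.2) * (1 + H (w, p.1, p.2)))%:E)%E \is a fin_num}].
Proof.
move=> mTh Th0 fin.
have h1H q : 0 <= 1 + H q by have /andP[] := H_bound q.
have mThH : measurable_fun setT (fun q => Th q * (1 + H q)) by exact: measurable_funM.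
have ThH0 q : 0 <= Th q * (1 + H q) by exact: mulr_ge0.
pose IN w := (\int[nu w]_(p in `]0%R, T] `*` setT) (Th (w, p.1, p.2))%:E)%E.
pose IH w := (\int[nu w]_(p in `]0%R, T] `*` setT) (Th (w, p.1, p.2) * (1 + H (w, p.1, p.2)))%:E)%E.
have mIN : measurable_fun setT IN by exact: (measurable_nu_integral fG comp T0' mTh Th0).
have mIH : measurable_fun setT IH by exact: (measurable_nu_integral fG comp T0' mThH ThH0).
have IN0 w : (0 <= IN w)%E by apply: integral_ge0 => p _; rewrite lee_fin.
have IH0 w : (0 <= IH w)%E by apply: integral_ge0 => p _; rewrite lee_fin.
have mBE : measurable_fun setT (fun w => (B w)%:E) by exact/measurable_EFinP.
have IHle w : (IH w <= M%:E * IN w)%E.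
  rewrite -ge0_integralZl//.
  - apply: ge0_le_integral; first exact: measurable_strip.
    + by move=> p _; rewrite lee_fin.
    + by apply/measurable_EFinP/measurable_funTS; exact: (field_section fG w mThH).
    + by apply: emeasurable_funM => //; apply/measurable_EFinP/measurable_funTS; exact: (field_section fG w mTh).
    + by move=> p _; rewrite -EFinM lee_fin mulrC ler_wpM2r//; have /andP[] := H_bound (w, p.1, p.2).
  - exact: measurable_strip.
  - by apply/measurable_EFinP/measurable_funTS; exact: (field_section fG w mTh).
  - by move=> p _; rewrite lee_fin.
  - by rewrite lee_fin ltW.
have aeIN : {ae P, forall w, (IN w < +oo)%E}.
  have iBN : P.-integrable setT (fun w => ((B w)%:E * IN w)%E).
    apply/integrableP; split; first exact: emeasurable_funM.
    by under eq_integral => w _ do rewrite gee0_abs ?mule_ge0 ?lee_fin//.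
  have := integrable_ae measurableT iBN; apply: filterS => w /(_ Logic.I).
  case: (IN w) (IN0 w) => [a| |]//= _; first by rewrite ltry.
  by rewrite gt0_muley// lte_fin (lt_le_trans ltr01).
have aeIH : {ae P, forall w, IH w \is a fin_num}.
  move: aeIN; apply: filterS => w h; rewrite ge0_fin_numE// (le_lt_trans (IHle w))//.
  by apply: lte_mul_pinfty => //; rewrite lee_fin ltW.
have eqG := girsanov_ge0 mTh Th0.
have eqI : (\int[P]_w ((Lp w)%:E * IH w) = \int[P]_w (Lp w * I1 Th w)%:E)%E.
  by apply: ae_eq_integral_nomeas; move: aeIH; apply: filterS => w h _; rewrite EFinM /I1 /Iw /Rintegral fineK.
have mI1 : measurable_fun setT (I1 Th).
  have mfine : measurable_fun setT (@fine R) by exact: fine_measurable.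
  exact: (measurableT_comp mfine mIH).
have I10 w : 0 <= I1 Th w by apply: fine_ge0; exact: IH0.
have finI : (\int[P]_w (Lp w * I1 Th w)%:E < +oo)%E.
  rewrite -eqI; apply: (@le_lt_trans _ _ (\int[P]_w (M%:E * ((B w)%:E * IN w)))%E).
    apply: ae_ge0_le_integral => //.
    - by move=> w _; rewrite mule_ge0 ?lee_fin.
    - by apply: emeasurable_funM => //; exact/measurable_EFinP.
    - by move=> w _; rewrite !mule_ge0 ?lee_fin// ltW.
    - by apply: emeasurable_funM => //; exact: emeasurable_funM.
    - move: LpE; apply: filterS => w [_ lB] _; rewrite muleCA.
      by apply: lee_pmul => //; rewrite lee_fin.
  rewrite ge0_integralZl//; [|exact: emeasurable_funM|by move=> w _; rewrite mule_ge0 ?lee_fin|by rewrite lee_fin ltW].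
  by apply: lte_mul_pinfty => //; rewrite lee_fin ltW.
have ge0_integrable (f : Omega -> R) : measurable_fun setT f -> (forall w, 0 <= f w) -> (\int[P]_w (f w)%:E < +oo)%E ->
    P.-integrable setT (fun w => (f w)%:E).
  move=> mf f0 ff; apply/integrableP; split; first exact/measurable_EFinP.
  by under eq_integral => w _ do rewrite gee0_abs ?lee_fin//.
split => //; last by rewrite eqG.
- apply: ge0_integrable; [by apply: measurable_funM => //; exact: measurable_sum|by move=> w; rewrite mulr_ge0// sumr_ge0|].
  by rewrite eqG [X in (X < _)%E]eqI.
- by apply: ge0_integrable => //; [exact: measurable_funM|move=> w; rewrite mulr_ge0].
Qed.

(** Under the probability with density [L w T], the compensator of the jump
    measure becomes [(1 + H) nu]: the difference of the two integrals of a
    field that is integrable enough has mean zero. *)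
Lemma girsanov_mean (Th : field) : measurable_fun setT Th ->
  (\int[P]_w ((B w)%:E * \int[nu w]_(p in `]0%R, T] `*` setT) `|Th (w, p.1, p.2)|%:E) < +oo)%E ->
  P.-integrable setT (fun w => (L w T * (\sum_(x <- points w) Th (w, x.1, x.2) -
    \int[nu w]_(p in `]0, T] `*` setT) (Th (w, p.1, p.2) * (1 + H (w, p.1, p.2)))))%:E) /\
  (\int[P]_w (L w T * (\sum_(x <- points w) Th (w, x.1, x.2) -
    \int[nu w]_(p in `]0, T] `*` setT) (Th (w, p.1, p.2) * (1 + H (w, p.1, p.2)))))%:E = 0)%E.
Proof.
move=> mTh fin.
have h1H q : 0 <= 1 + H q by have /andP[] := H_bound q.
pose Tp : field := fun q => Num.max (Th q) 0; pose Tn : field := fun q => Num.max (- Th q) 0.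
have mTp : measurable_fun setT Tp by exact: measurable_maxr.
have mTn : measurable_fun setT Tn by apply: measurable_maxr => //; exact: measurableT_comp.
have Tp0 q : 0 <= Tp q by rewrite le_max lexx orbT.
have Tn0 q : 0 <= Tn q by rewrite le_max lexx orbT.
have TE q : Th q = Tp q - Tn q.
  rewrite /Tp /Tn; have [h|h] := leP 0 (Th q); first by rewrite max_r ?subr0// oppr_le0.
  by rewrite max_l ?oppr_ge0 ?(ltW h)// sub0r opprK.
have Tple q : Tp q <= `|Th q| by rewrite ge_max normr_ge0 ler_norm.
have Tnle q : Tn q <= `|Th q| by rewrite ge_max normr_ge0 andbT -normrN ler_norm.
have finV (V : field) : measurable_fun setT V -> (forall q, 0 <= V q) -> (forall q, V q <= `|Th q|) ->
    (\int[P]_w ((B w)%:E * \int[nu w]_(p in `]0%R, T] `*` setT) (V (w, p.1, p.2))%:E) < +oo)%E.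
  move=> mV V0 VT; apply: le_lt_trans fin; apply: ge0_le_integral => //.
  - by move=> w _; rewrite mule_ge0 ?lee_fin// integral_ge0// => p _; rewrite lee_fin.
  - apply: emeasurable_funM; first exact/measurable_EFinP.
    exact: (measurable_nu_integral fG comp T0' mV V0).
  - apply: emeasurable_funM; first exact/measurable_EFinP.
    by apply: (measurable_nu_integral (W := fun q => `|Th q|) fG comp T0') => //; exact: measurableT_comp.
  - move=> w _; rewrite lee_wpmul2l ?lee_fin//; apply: ge0_le_integral => //.
    + exact: measurable_strip.
    + by move=> p _; rewrite lee_fin.
    + by apply/measurable_EFinP/measurable_funTS; exact: (field_section fG w mV).
    + by apply/measurable_EFinP/measurable_funTS; apply: measurableT_comp => //; exact: (field_section fG w mTh).
    + by move=> p _; rewrite lee_fin.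
have [p1 p2 p3 p4] := Lp_integrable mTp Tp0 (finV Tp mTp Tp0 Tple).
have [n1 n2 n3 n4] := Lp_integrable mTn Tn0 (finV Tn mTn Tn0 Tnle).
pose Sg (V : field) w := Lp w * \sum_(x <- points w) V (w, x.1, x.2).
have IE : {ae P, forall w, setT w -> ((Sg Tp w)%:E - (Lp w * I1 Tp w)%:E - ((Sg Tn w)%:E - (Lp w * I1 Tn w)%:E))%E =
    (L w T * (\sum_(x <- points w) Th (w, x.1, x.2) - I1 Th w))%:E}.
  move: p4 n4 LpE; apply: filterS3 => w h1 h2 [LE _] _; rewrite /Sg LE -!EFinB; congr (_%:E).
  have -> : I1 Th w = I1 Tp w - I1 Tn w.
    rewrite /I1 /Iw /Rintegral -fineB//; congr fine; rewrite integralE; congr (_ - _)%E.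
      apply: eq_integral => p _; rewrite funeposE /Tp /= -EFin_max; congr (_%:E).
      by rewrite maxr_pMl ?mul0r.
    apply: eq_integral => p _; rewrite funenegE /Tn /= -EFin_max; congr (_%:E).
    by rewrite maxr_pMl ?mul0r ?mulNr.
  rewrite [X in _ = _ * (X - _)](eq_bigr (fun x => Tp (w, x.1, x.2) - Tn (w, x.1, x.2))); last by move=> x _; rewrite TE.
  by rewrite sumrB; ring.
have mI1 : measurable_fun setT (I1 Th).
  by apply: (measurable_nu_Rintegral fG comp T0' (W := fun q => Th q * (1 + H q))); exact: measurable_funM.
have z (f h : Omega -> \bar R) : P.-integrable setT f -> P.-integrable setT h ->
    (\int[P]_w f w = \int[P]_w h w -> \int[P]_w (f w - h w) = 0)%E.
  move=> fi hi fh; apply: (etrans (integralB measurableT fi hi)); rewrite fh subee//.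
  exact: (integrable_fin_num measurableT hi).
have i1 := integrableB measurableT p1 p2; have i2 := integrableB measurableT n1 n2.
split.
  apply: (integrable_ae_eq _ IE); last exact: integrableB.
  apply/measurable_EFinP; apply: measurable_funM; first exact: mLT.
  by apply: measurable_funB; [exact: measurable_sum|exact: mI1].
rewrite -(ae_eq_integral_nomeas IE); apply: (z _ _ i1 i2).
by rewrite (z _ _ p1 p2 p3) (z _ _ n1 n2 n3).
Qed.

Let compensator_time : PrT -> R := fun p => fine (nu p.1 (`]0%R, p.2] `*` setT)).

(** Square integrability against the exponentially weighted compensator makes
    the previous lemma applicable, since [beta] times the integral of
    [exp (- beta A)] with respect to [dA] is at most one. *)
Lemma weighted_integrable (Th : field) (a : Omega -> R -> R) (beta : R) : 0 < beta -> measurable_fun setT Th ->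
  {ae P, forall w, forall t, 0 < t <= T -> a w t = fine (nu w (`]0%R, t] `*` setT))} ->
  (\int[P]_w \int[nu w]_(p in `]0%R, T] `*` setT) (Th (w, p.1, p.2) ^+ 2 * expR (beta * a w p.1))%:E < +oo)%E ->
  (\int[P]_w ((B w)%:E * \int[nu w]_(p in `]0%R, T] `*` setT) `|Th (w, p.1, p.2)|%:E) < +oo)%E.
Proof.
move=> b0 mTh aE fin.
have ctE (p : PrT) : compensator_time p = fine (\int[nu p.1]_(q in `]0%R, p.2] `*` setT) ((cst 1 : field) ((p.1, q.1), q.2))%:E)%E.
  congr fine; apply/esym; apply: (etrans (integral_cst (nu p.1) (measurable_strip 0 p.2) 1%E)).
  exact: mul1e.
have mct : measurable_fun setT compensator_time.
  rewrite (_ : compensator_time = (fun p => fine (\int[nu p.1]_(q in `]0%R, p.2] `*` setT) ((cst 1 : field) ((p.1, q.1), q.2))%:E)%E)).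
    exact: (predictable_nu_integral (W := cst 1) fG comp).
  by apply/funext => p; rewrite ctE.
pose V : field := fun q => Th q ^+ 2 * expR (beta * compensator_time q.1).
have mV : measurable_fun setT V.
  apply: measurable_funM; first exact: measurable_funX.
  apply: measurableT_comp => //; apply: measurable_funM => //.
  exact: (measurableT_comp mct measurable_fst).
have V0 q : 0 <= V q by rewrite mulr_ge0 ?expR_ge0 ?sqr_ge0.
pose IV w := (\int[nu w]_(p in `]0%R, T] `*` setT) (V (w, p.1, p.2))%:E)%E.
have IV0 w : (0 <= IV w)%E by apply: integral_ge0 => p _; rewrite lee_fin.
have mIV : measurable_fun setT IV by exact: (measurable_nu_integral fG comp T0' mV V0).
have finV : (\int[P]_w IV w < +oo)%E.
  apply: le_lt_trans fin; rewrite le_eqVlt; apply/predU1P; left.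
  apply: ae_eq_integral_nomeas; move: aE; apply: filterS => w h _.
  apply: eq_integral => p; rewrite inE => -[/=]; rewrite in_itv/= => pT _.
  by rewrite h.
apply: (@le_lt_trans _ _ (\int[P]_w ((beta^-1)%:E * (B w ^+ 2)%:E + IV w))%E).
  apply: ae_ge0_le_integral => //.
  - by move=> w _; rewrite mule_ge0 ?lee_fin// integral_ge0.
  - apply: emeasurable_funM; first exact/measurable_EFinP.
    by apply: (measurable_nu_integral (W := fun q => `|Th q|) fG comp T0') => //; exact: measurableT_comp.
  - by move=> w _; rewrite adde_ge0// mule_ge0 ?lee_fin ?exprn_ge0// invr_ge0 ltW.
  - by apply: emeasurable_funD => //; apply: emeasurable_funM => //; apply/measurable_EFinP; exact: measurable_funX.
  move: ae_good; apply: filterS => w [uw nf na] _.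
  pose et (p : R * E) := expR (- beta * upto (n w) (cst 1) p.1).
  have b1 : bounded_mfun (cst 1 : R * E -> R) by exact: bounded_mfun_cst.
  have bb : bounded_mfun (cst (- beta) : R * E -> R) by exact: bounded_mfun_cst.
  have upE t : upto (n w) (cst (- beta)) t = - beta * upto (n w) (cst 1) t.
    rewrite /upto -Rint_Z//; last exact: bounded_upto_cut.
    by apply: eq_Rintegral => p _; rewrite /= mul1r.
  have bet : bounded_mfun et.
    apply: bounded_mfun_exp; apply: bounded_mfunM; first exact: bounded_mfun_cst.
    exact: bounded_upto.
  have exp1 : upto (n w) et T <= beta^-1.
    have := expR_upto nf na T bb; rewrite upE.
    have -> : upto (n w) (fun p => expR (upto (n w) (cst (- beta)) p.1) * cst (- beta) p) T = - beta * upto (n w) et T.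
      rewrite /upto -Rint_Z//; last exact: bounded_upto_cut.
      by apply: eq_Rintegral => p _; rewrite /et -upE /upto /=; ring.
    move=> h; have := expR_ge0 (- beta * upto (n w) (cst 1) T); rewrite h mulNr subr_ge0 => h'.
    by rewrite -[X in _ <= X]mul1r ler_pdivlMr// mulrC.
  have etE p : p.1 <= T -> expR (beta * compensator_time (w, p.1)) = (et p)^-1.
    move=> pT; rewrite /et -expRN mulNr opprK upto_strip//; congr (expR (_ * _)).
    by rewrite ctE.
  have mThs : measurable_fun setT (fun p : R * E => Th (w, p.1, p.2)) by exact: (field_section fG).
  have met : measurable_fun setT et by have [] := bet.
  rewrite -ge0_integralZl//; [|exact: measurable_strip| |by rewrite lee_fin]; last first.
    by apply/measurable_EFinP/measurable_funTS; exact: measurableT_comp.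
  apply: (@le_trans _ _ (\int[nu w]_(p in `]0%R, T] `*` setT) ((B w ^+ 2)%:E * (et p)%:E + (V (w, p.1, p.2))%:E))%E).
    apply: ge0_le_integral.
    - exact: measurable_strip.
    - by move=> p _; rewrite mule_ge0 ?lee_fin.
    - by apply: emeasurable_funM => //; apply/measurable_EFinP/measurable_funTS; exact: measurableT_comp.
    - apply: emeasurable_funD.
        by apply: emeasurable_funM => //; exact/measurable_EFinP/measurable_funTS.
      by apply/measurable_EFinP/measurable_funTS; exact: (field_section fG w mV).
    - move=> p [/=]; rewrite in_itv/= => /andP[_ pT] _.
      rewrite -!EFinM -EFinD lee_fin /V /= etE//.
      have e0 : 0 < et p by exact: expR_gt0.
      have amgm (x y e : R) : 0 < e -> x * y <= x ^+ 2 * e + y ^+ 2 * e^-1.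
        move=> e1; have ei : e * e^-1 = 1 by rewrite mulfV ?gt_eqF.
        have h : 0 <= (x * e - y / 2) ^+ 2 + y ^+ 2 * (3 / 4) by apply: addr_ge0; [exact: sqr_ge0|apply: mulr_ge0; [exact: sqr_ge0|rewrite divr_ge0]].
        rewrite -(ler_pM2l e1).
        have -> : e * (x ^+ 2 * e + y ^+ 2 * e^-1) = e * (x * y) + ((x * e - y / 2) ^+ 2 + y ^+ 2 * (3 / 4)).
          have -> : e * (x ^+ 2 * e + y ^+ 2 * e^-1) = e ^+ 2 * x ^+ 2 + y ^+ 2 * (e * e^-1) by ring.
          by rewrite ei; field.
        by rewrite lerDl.
      by rewrite (le_trans (amgm _ _ _ e0))// lerD2l real_normK// num_real.
  rewrite ge0_integralD//; [|exact: measurable_strip| | | |].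
  - rewrite leeD2r//.
    rewrite ge0_integralZl//; [|exact: measurable_strip| | |by rewrite lee_fin exprn_ge0]; last 2 first.
    + by exact/measurable_EFinP/measurable_funTS.
    + by move=> p _; rewrite lee_fin expR_ge0.
    rewrite muleC lee_wpmul2r ?lee_fin ?exprn_ge0//.
    have fet : (\int[nu w]_(p in `]0%R, T] `*` setT) (et p)%:E)%E \is a fin_num.
      rewrite -(integral_mrestr (nu w) (measurable_strip 0 T)); last exact/measurable_EFinP.
      by rewrite -(EFin_Rint nf bet).
    rewrite -(fineK fet) lee_fin (_ : fine _ = upto (n w) et T)//.
    by rewrite upto_strip.
  - by move=> p _; rewrite mule_ge0 ?lee_fin ?exprn_ge0 ?expR_ge0.
  - by apply: emeasurable_funM => //; exact/measurable_EFinP/measurable_funTS.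
  - by move=> p _; rewrite lee_fin.
  - by apply/measurable_EFinP/measurable_funTS; exact: (field_section fG w mV).
rewrite ge0_integralD//.
- apply: lte_add_pinfty => //; rewrite ge0_integralZl//.
  + apply: lte_mul_pinfty; [by rewrite lee_fin invr_ge0 ltW|by []|exact: square_integrable_bound].
  + by apply/measurable_EFinP; exact: measurable_funX.
  + by move=> w _; rewrite lee_fin exprn_ge0.
  + by rewrite lee_fin invr_ge0 ltW.
- by move=> w _; rewrite mule_ge0 ?lee_fin ?exprn_ge0// invr_ge0 ltW.
- by apply: emeasurable_funM => //; apply/measurable_EFinP; exact: measurable_funX.
Qed.

End girsanov.

(** * Uniqueness of compensators *)

Section compensator_uniqueness.
Context (R : realType) (d0 : measure_display) (Omega : measurableType d0).
Variables (P : probability Omega R) (G : R -> set_system Omega).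
Context (d1 : measure_display) (E : measurableType d1).
Variables (T : R) (nu : bool -> Omega -> {measure set (R * E) -> \bar R}) (k : Omega -> R).
Hypothesis T0 : 0 < T.
Hypothesis fG : filtration G.
Hypothesis pred_nu : forall b, predictable_random_measure G (nu b).
Local Notation PrT := (predictableType G).
Local Notation field := ((PrT * E)%type -> R).
Local Notation strip := (`]0%R, T]%classic `*` (setT : set E)).
Hypothesis mean_nu : forall W : field, measurable_fun setT W -> (forall q, 0 <= W q) ->
  (\int[P]_w \int[nu true w]_(p in strip) (W (w, p.1, p.2))%:E =
   \int[P]_w \int[nu false w]_(p in strip) (W (w, p.1, p.2))%:E)%E.
Hypothesis nu_le : {ae P, forall w, forall b, (nu b w strip <= (k w)%:E)%E}.
Hypothesis nu_atomless : {ae P, forall w, forall b t, 0 < t <= T -> nu b w ([set t] `*` setT) = 0%E}.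
Hypothesis mk : measurable_fun setT k.
Hypothesis k2 : (\int[P]_w (k w ^+ 2)%:E < +oo)%E.

Let T0' : 0 <= T := ltW T0.
Let comp b : compensator P G (nu b) (nu b). Proof. by split. Qed.
Local Notation n b w := (strip_measure T (nu b w)).

Let good w := forall b, [/\ (n b w setT <= (k w)%:E)%E, (n b w setT < +oo)%E & no_time_atom (n b w)].

Let ae_good : {ae P, forall w, good w}.
Proof.
move: nu_le nu_atomless; apply: filterS2 => w h1 h2 b.
have e : (n b w setT <= (k w)%:E)%E by rewrite /strip_measure /= /mrestr setTI.
by split => //; [exact: le_lt_trans e (ltry _)|apply: strip_measure_no_atom; exact: h2].
Qed.

Let bounded_unique (W : field) (K : R) : measurable_fun setT W -> (forall q, 0 <= W q <= K) ->
  {ae P, forall w, \int[nu true w]_(p in strip) (W (w, p.1, p.2))%:E =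
    \int[nu false w]_(p in strip) (W (w, p.1, p.2))%:E}%E.
Proof.
move=> mW Wb; have W0 q : 0 <= W q by have /andP[] := Wb q.
pose a b (p : PrT) : R := fine (\int[nu b p.1]_(q in `]0%R, p.2] `*` setT) (W ((p.1, q.1), q.2))%:E)%E.
have ma b : measurable_fun setT (a b) by exact: (predictable_nu_integral fG (comp b) mW W0).
have a0 b p : 0 <= a b p by apply: fine_ge0; apply: integral_ge0 => q _; rewrite lee_fin.
have bW w : bounded_mfun (fun p : R * E => W (w, p.1, p.2)).
  by split; [exact: (field_section fG)|exists K => p; rewrite ger0_norm; have /andP[] := Wb (w, p.1, p.2)].
have aE w t b : t <= T -> a b (w, t) = upto (n b w) (fun p => W (w, p.1, p.2)) t.
  by move=> tT; rewrite upto_strip//; have [] := bW w.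
have aK w t b : good w -> t <= T -> a b (w, t) <= K * k w.
  move=> /(_ b) [nk nf _] tT; rewrite aE//.
  have K0 : 0 <= K by rewrite (le_trans (W0 ((w, t), point)))//; have /andP[] := Wb ((w, t), point).
  apply: le_trans (ler_norm _) _; apply: (@le_trans _ _ (K * fine (n b w setT))).
    apply: Rint_bound => //; first by apply: bounded_mfunM => //; exact: bounded_le.
    move=> p; have /andP[b1 b2] := Wb (w, p.1, p.2).
    by rewrite normrM (ger0_norm b1) normr_nat -[X in _ <= X]mulr1 ler_pM// lern1 leq_b1.
  by rewrite ler_wpM2l// -lee_fin fineK// ge0_fin_numE.
pose V (s : bool) : field := fun q => Num.max (if s then a true q.1 - a false q.1 else a false q.1 - a true q.1) 0 * W q.
have mV s : measurable_fun setT (V s).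
  apply: measurable_funM => //; apply: measurable_maxr => //.
  by case: s; apply: measurable_funB; apply: (measurableT_comp (ma _)); exact: measurable_fst.
have V0 s q : 0 <= V s q by rewrite mulr_ge0// le_max lexx orbT.
pose r b s w : R := fine (\int[nu b w]_(p in strip) (V s (w, p.1, p.2))%:E)%E.
have mI b s : measurable_fun setT (fun w => \int[nu b w]_(p in strip) (V s (w, p.1, p.2))%:E)%E.
  exact: (measurable_nu_integral fG (comp b) T0' (mV s) (V0 s)).
have Vle w s t x : good w -> t <= T -> V s ((w, t), x) <= K * k w * K.
  move=> gw tT; have /andP[b1 b2] := Wb ((w, t), x).
  have h1 := aK w t true gw tT; have h2 := aK w t false gw tT.
  rewrite ler_pM// ?le_max ?lexx ?orbT// ge_max (le_trans (a0 true (w, t)))// andbT.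
  have h3 := a0 true (w, t); have h4 := a0 false (w, t).
  by case: s => /=; lra.
have Ile b s : {ae P, forall w, (\int[nu b w]_(p in strip) (V s (w, p.1, p.2))%:E <= (K ^+ 2)%:E * (k w ^+ 2)%:E)%E}.
  move: ae_good; apply: filterS => w gw; have [nk _ _] := gw b.
  apply: (@le_trans _ _ (\int[nu b w]_(p in strip) (K * k w * K)%:E)%E).
    apply: ge0_le_integral; first exact: measurable_strip.
    - by move=> p _; rewrite lee_fin.
    - by apply/measurable_EFinP/measurable_funTS; exact: (field_section fG).
    - exact: measurable_cst.
    - by move=> p [/=]; rewrite in_itv/= => /andP[_ pT] _; rewrite lee_fin Vle.
  rewrite integral_cst; last exact: measurable_strip.
  have K0 : 0 <= K * k w * K by rewrite (le_trans (V0 s ((w, T), point)))// Vle.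
  rewrite -EFinM (_ : K ^+ 2 * k w ^+ 2 = K * k w * K * k w); last by ring.
  rewrite [X in (_ <= X)%E]EFinM lee_wpmul2l ?lee_fin//.
  by move: nk; rewrite /strip_measure /= /mrestr setTI.
have fI b s : (\int[P]_w \int[nu b w]_(p in strip) (V s (w, p.1, p.2))%:E < +oo)%E.
  apply: (@le_lt_trans _ _ (\int[P]_w ((K ^+ 2)%:E * (k w ^+ 2)%:E))%E).
    apply: ae_ge0_le_integral => //.
    - by move=> w _; apply: integral_ge0 => p _; rewrite lee_fin.
    - by move=> w _; rewrite mule_ge0// lee_fin sqr_ge0.
    - by apply: emeasurable_funM => //; apply/measurable_EFinP; exact: measurable_funX.
    - by move: (Ile b s); apply: filterS => w.
  rewrite ge0_integralZl//; [|by apply/measurable_EFinP; exact: measurable_funX| |by rewrite lee_fin sqr_ge0].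
    by apply: lte_mul_pinfty => //; rewrite lee_fin sqr_ge0.
  by move=> w _; rewrite lee_fin sqr_ge0.
have rE b s : {ae P, forall w, setT w -> (\int[nu b w]_(p in strip) (V s (w, p.1, p.2))%:E)%E = (r b s w)%:E}.
  move: (Ile b s); apply: filterS => w h _; rewrite /r fineK// ge0_fin_numE.
    by apply: (le_lt_trans h); rewrite -EFinM ltry.
  by apply: integral_ge0 => p _; rewrite lee_fin.
have mr b s : measurable_fun setT (r b s).
  have mfine : measurable_fun setT (@fine R) by exact: fine_measurable.
  exact: (measurableT_comp mfine (mI b s)).
have ir b s : P.-integrable setT (EFin \o r b s).
  apply: (integrable_ae_eq _ (rE b s)); first exact/measurable_EFinP.
  apply/integrableP; split => //; apply: le_lt_trans (fI b s); rewrite le_eqVlt; apply/predU1P; left.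
  by apply: eq_integral => w _; rewrite gee0_abs// integral_ge0// => p _; rewrite lee_fin.
have er s : (\int[P]_w (r true s w)%:E = \int[P]_w (r false s w)%:E)%E.
  by rewrite -(ae_eq_integral_nomeas (rE true s)) -(ae_eq_integral_nomeas (rE false s)) mean_nu.
pose D w := 2 * ((r true true w - r false true w) - (r true false w - r false false w)).
have ED : (\int[P]_w (D w)%:E = 0)%E.
  have z s : (\int[P]_w ((r true s w)%:E - (r false s w)%:E) = 0)%E.
    rewrite (integralB measurableT (ir true s) (ir false s)) er subee//.
    exact: (integrable_fin_num measurableT (ir false s)).
  have iB s : P.-integrable setT (fun w => (r true s w)%:E - (r false s w)%:E)%E.
    exact: (integrableB measurableT (ir true s) (ir false s)).
  have h := etrans (integralB measurableT (iB true) (iB false))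
    (etrans (congr2 (fun x y => x - y)%E (z true) (z false)) (sube0 _)).
  have h2 := etrans (integralZl measurableT (integrableB measurableT (iB true) (iB false)) 2) (etrans (congr1 _ h) (mule0 _)).
  by apply: (etrans _ h2); apply: eq_integral => w _; rewrite /D EFinM !EFinB.
have DE : {ae P, forall w, D w = (a true (w, T) - a false (w, T)) ^+ 2}.
  move: ae_good; apply: filterS => w gw.
  pose f (p : R * E) := W (w, p.1, p.2); pose U b c := upto (n b w) (fun p => upto (n c w) f p.1 * f p) T.
  have nf b : (n b w setT < +oo)%E by have [] := gw b.
  have na b : no_time_atom (n b w) by have [] := gw b.
  have fb : bounded_mfun f by exact: bW.
  have mul b c : upto (n b w) f T * upto (n c w) f T = U c b + U b c.
    by rewrite (upto_mul T (nf b) (nf c) (na c) fb fb).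
  pose A b t := upto (n b w) f t.
  have bA b : bounded_mfun (fun p : R * E => A b p.1) by exact: bounded_upto.
  pose v (s : bool) (p : R * E) := Num.max (if s then A true p.1 - A false p.1 else A false p.1 - A true p.1) 0 * f p.
  have bv s : bounded_mfun (v s).
    apply: bounded_mfunM => //.
    have [g1 [M hM]] : bounded_mfun (fun p : R * E => if s then A true p.1 - A false p.1 else A false p.1 - A true p.1).
      by case: s; exact: bounded_mfunB.
    split; first exact: measurable_maxr.
    by exists M => p; have := hM p; case: (leP 0) => // _ h; rewrite normr0 (le_trans _ h).
  have rv b s : r b s w = upto (n b w) (v s) T.
    apply: (etrans _ (esym (upto_strip (nu b w) (lexx T) (proj1 (bv s))))).
    apply: eq_Rintegral => p; rewrite inE => -[/=]; rewrite in_itv/= => /andP[_ pT] _.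
    by rewrite /V /v /= !aE.
  have rU b : r b true w - r b false w = U b true - U b false.
    have RB (f1 f2 : R * E -> R) : bounded_mfun f1 -> bounded_mfun f2 ->
        upto (n b w) f1 T - upto (n b w) f2 T = upto (n b w) (fun p => f1 p - f2 p) T.
      move=> b1 b2; rewrite /upto -Rint_B//; [|exact: bounded_upto_cut|exact: bounded_upto_cut].
      by apply: eq_Rintegral => p _; rewrite mulrBl.
    have bAf c : bounded_mfun (fun p : R * E => upto (n c w) f p.1 * f p) := bounded_mfunM (bA c) fb.
    rewrite !rv /U (RB _ _ (bv true) (bv false)) (RB _ _ (bAf true) (bAf false)).
    congr upto; apply/funext => p; rewrite /v -!/(A _ _).
    have m (x : R) : Num.max x 0 - Num.max (- x) 0 = x.
      by have [h|h] := leP 0 x; [rewrite max_r ?subr0// oppr_le0|rewrite max_l ?oppr_ge0 ?(ltW h)// sub0r opprK].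
    by have := m (A true p.1 - A false p.1); rewrite opprB => e; rewrite -!mulrBl e.
  have := rU true; have := rU false; have := mul true true; have := mul true false; have := mul false false.
  rewrite -!/(A _ _) !aE// -!/(A _ _) /D => e1 e2 e3 e4 e5.
  have -> : (A true T - A false T) ^+ 2 = A true T * A true T - 2 * (A true T * A false T) + A false T * A false T by ring.
  rewrite e1 e2 e3.
  have id4 (x1 x2 x3 x4 : R) : x1 - x2 - (x3 - x4) = (x1 - x3) - (x2 - x4) by ring.
  have id5 (x1 x2 x3 x4 : R) : 2 * (x1 - x2 - (x3 - x4)) = (x1 + x1) - 2 * (x3 + x2) + (x4 + x4) by ring.
  by rewrite id4 e4 e5; exact: id5.
have D0 : ae_eq P setT (fun w => (D w)%:E) (cst 0%E).
  have mD : measurable_fun setT (fun w => (D w)%:E).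
    apply/measurable_EFinP; apply: measurable_funM => //.
    by apply: measurable_funB; exact: measurable_funB.
  apply: (proj1 (ae_eq_integral_abs P measurableT mD)); apply: (etrans _ ED); apply: ae_eq_integral_nomeas.
  by move: DE; apply: filterS => w h _; rewrite h /= ger0_norm// sqr_ge0.
move: D0 DE ae_good; apply: filterS3 => w /(_ Logic.I) [d0'] h gw.
have e : a true (w, T) = a false (w, T).
  by move: h; rewrite d0' => /esym/eqP; rewrite sqrf_eq0 subr_eq0 => /eqP.
have fin b : (\int[nu b w]_(p in strip) (W (w, p.1, p.2))%:E)%E \is a fin_num.
  rewrite -(integral_mrestr (nu b w) (measurable_strip 0 T)); last by apply/measurable_EFinP; have [] := bW w.
  by have [_ nf _] := gw b; rewrite -(EFin_Rint nf (bW w)).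
by rewrite -(fineK (fin true)) -(fineK (fin false)); congr (_%:E).
Qed.

(** Two predictable random measures without time atoms that have the same mean
    on predictable fields coincide on them: the square of the difference [D] of
    the integral processes is twice the integral of the predictable process [D]
    with respect to [D], which has mean zero. *)
Lemma compensator_unique (W : field) : measurable_fun setT W -> (forall q, 0 <= W q) ->
  {ae P, forall w, \int[nu true w]_(p in strip) (W (w, p.1, p.2))%:E =
    \int[nu false w]_(p in strip) (W (w, p.1, p.2))%:E}%E.
Proof.
move=> mW W0; pose Wk m : field := fun q => Num.min (W q) m%:R.
have mWk m : measurable_fun setT (Wk m) by exact: measurable_minr.
have Wkb m q : 0 <= Wk m q <= m%:R by rewrite le_min W0 ler0n /= ge_min lexx orbT.
have := ae_foralln (fun m => bounded_unique (mWk m) (Wkb m)).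
apply: filterS => w h.
have c b : (\int[nu b w]_(p in strip) (Wk m (w, p.1, p.2))%:E @[m --> \oo] -->
    \int[nu b w]_(p in strip) (W (w, p.1, p.2))%:E)%E.
  have ms (V : field) : measurable_fun setT V -> measurable_fun setT (fun p : R * E => (V (w, p.1, p.2))%:E).
    by move=> mV; apply/measurable_EFinP; exact: (field_section fG).
  rewrite -(integral_mrestr (nu b w) (measurable_strip 0 T) (ms _ mW)).
  under [X in X @ _ --> _]eq_fun => m do rewrite -(integral_mrestr (nu b w) (measurable_strip 0 T) (ms _ (mWk m))).
  apply: cvg_integral_nd.
  - by move=> m; exact: ms.
  - by move=> m p; rewrite lee_fin; have /andP[] := Wkb m (w, p.1, p.2).
  - by move=> p m m' mm; rewrite lee_fin le_min ge_min lexx /= ge_min ler_nat mm orbT.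
  - move=> p; apply: cvg_EFin; first exact: nearW.
    apply: cvg_near_cst; exists (Num.bound (W (w, p.1, p.2))) => // m /= mb.
    by rewrite /Wk min_l// (le_trans (ltW (archi_boundP (W0 _))))// ler_nat.
apply: (cvg_unique _ (c true)) => //; apply: cvg_trans (c false).
by apply: near_eq_cvg; apply: nearW => m; rewrite h.
Qed.

End compensator_uniqueness.

(** * Disintegrated integrals *)

Section disintegrated_integrals.
Context (R : realType) d (E : measurableType d) ds (S : measurableType ds) d' (I : measurableType d').
Variables (m : {measure set (I * E) -> \bar R}) (k : {measure set S -> \bar R}).
Variables (i : S -> I) (l : S -> {measure set E -> \bar R}).
Hypothesis mi : measurable_fun setT i.
Hypothesis lfin : forall t, (l t setT < +oo)%E.
Hypothesis ml : forall B, measurable B -> measurable_fun setT (l ^~ B).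
Hypothesis mE : forall B, measurable B -> m B = (\int[k]_t l t (xsection B (i t)))%E.

Lemma ge0_integral_disintegration (f : I * E -> \bar R) : measurable_fun setT f -> (forall p, 0 <= f p)%E ->
  (\int[m]_p f p = \int[k]_t \int[l t]_x f (i t, x))%E.
Proof.
have mf1 (h : I * E -> \bar R) (t : S) : measurable_fun setT h -> measurable_fun setT (fun x => h (i t, x)).
  by move=> mh; exact: (measurableT_comp mh (measurable_pair1 (i t))).
have mI (h : I * E -> \bar R) : measurable_fun setT h -> (forall p, 0 <= h p)%E ->
    measurable_fun setT (fun t => \int[l t]_x h (i t, x))%E.
  move=> mh h0; apply: (measurable_fun_integral_fam lfin ml (f := fun q : S * E => h (i q.1, q.2))) => //.
  apply: (measurableT_comp mh); apply: measurable_fun_pair; last exact: measurable_snd.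
  exact: (measurableT_comp mi measurable_fst).
have I0 (h : I * E -> \bar R) (t : S) : (forall p, 0 <= h p)%E -> (0 <= \int[l t]_x h (i t, x))%E.
  by move=> h0; apply: integral_ge0.
move: f; apply: ge0_measurable_ind.
- move=> A mA; rewrite integral_indic// setIT mE//; apply: eq_integral => t _.
  by rewrite integral_xsection.
- move=> c h c0 mh h0 ih; rewrite ge0_integralZl// ih -ge0_integralZl//; last 2 first.
  + exact: mI.
  + by move=> t _; exact: I0.
  by apply: eq_integral => t _; rewrite ge0_integralZl//; exact: mf1.
- move=> h1 h2 mh1 h10 mh2 h20 ih1 ih2.
  apply: (etrans (ge0_integralD m measurableT (fun p _ => h10 p) mh1 (fun p _ => h20 p) mh2)); rewrite ih1 ih2.
  apply/esym; apply: (etrans _ (ge0_integralD k measurableT (fun t _ => I0 h1 t h10) (mI h1 mh1 h10) (fun t _ => I0 h2 t h20) (mI h2 mh2 h20))).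
  by apply: eq_integral => t _; rewrite ge0_integralD//; exact: mf1.
- move=> H mH H0 ndH ih; rewrite monotone_convergence//.
  under eq_fun do rewrite ih.
  rewrite -monotone_convergence//.
  + by apply: eq_integral => t _; rewrite monotone_convergence// => n; exact: mf1.
  + by move=> n; exact: mI.
  + by move=> n t _; exact: I0.
  + by move=> t _ a b ab; apply: ge0_le_integral => //; [exact: mf1|exact: mf1|move=> x _; exact: ndH].
Qed.

Lemma integral_disintegration (f : I * E -> R) : measurable_fun setT f ->
  (\int[m]_p `|f p|%:E < +oo)%E ->
  [/\ {ae k, forall t, (l t).-integrable setT (fun x => (f (i t, x))%:E)},
      k.-integrable setT (fun t => \int[l t]_x (f (i t, x))%:E)%E &
      (\int[m]_p (f p)%:E = \int[k]_t \int[l t]_x (f (i t, x))%:E)%E].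
Proof.
move=> mf fin.
have mfE : measurable_fun setT (fun p => (f p)%:E) by exact/measurable_EFinP.
have mf1 t : measurable_fun setT (fun x => (f (i t, x))%:E).
  exact: (measurableT_comp mfE (measurable_pair1 (i t))).
have mfa : measurable_fun setT (fun p => `|f p|%:E) by apply/measurable_EFinP; exact: measurableT_comp.
have mpos := measurable_funepos mfE; have mneg := measurable_funeneg mfE.
have Ia := ge0_integral_disintegration mfa (fun p => normr_ge0 _).
pose fam (h : I * E -> \bar R) t := (\int[l t]_x h (i t, x))%E.
have mI (h : I * E -> \bar R) : measurable_fun setT h -> (forall p, 0 <= h p)%E -> measurable_fun setT (fam h).
  move=> mh h0; apply: (measurable_fun_integral_fam lfin ml (f := fun q : S * E => h (i q.1, q.2))) => //.
  apply: (measurableT_comp mh); apply: measurable_fun_pair; last exact: measurable_snd.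
  exact: (measurableT_comp mi measurable_fst).
have posE t : (fun x => (f (i t, x))%:E)^\+%E = (fun x => (fun p => (f p)%:E)^\+%E (i t, x)).
  by apply/funext => x; rewrite !funeposE.
have negE t : (fun x => (f (i t, x))%:E)^\-%E = (fun x => (fun p => (f p)%:E)^\-%E (i t, x)).
  by apply/funext => x; rewrite !funenegE.
pose fp := fam (fun p => (f p)%:E)^\+%E; pose fn := fam (fun p => (f p)%:E)^\-%E.
have le_a (h : I * E -> \bar R) : measurable_fun setT h -> (forall p, 0 <= h p)%E -> (forall p, h p <= `|f p|%:E)%E ->
    k.-integrable setT (fam h).
  move=> mh h0 hf; apply/integrableP; split; first exact: mI.
  apply: le_lt_trans fin; rewrite Ia; apply: ge0_le_integral => //.
  - by apply: measurableT_comp => //; exact: mI.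
  - by apply: (mI (fun p => `|f p|%:E)).
  - move=> t _; rewrite gee0_abs; last exact: integral_ge0.
    apply: ge0_le_integral => //.
    + exact: (measurableT_comp mh (measurable_pair1 (i t))).
    + exact: (measurableT_comp mfa (measurable_pair1 (i t))).
have ip : k.-integrable setT fp.
  by apply: le_a => // p; rewrite funeposE -EFin_max lee_fin ge_max normr_ge0 ler_norm.
have in_ : k.-integrable setT fn.
  by apply: le_a => // p; rewrite funenegE -EFin_max lee_fin ge_max normr_ge0 -normrN ler_norm.
have FE t : (\int[l t]_x (f (i t, x))%:E = fp t - fn t)%E by rewrite integralE posE negE.
split.
- have : k.-integrable setT (fam (fun p => `|f p|%:E)) by exact: le_a.
  move=> /(integrable_ae measurableT); apply: filterS => t /(_ Logic.I).
  rewrite ge0_fin_numE; last exact: integral_ge0.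
  by move=> h; apply/integrableP; split => //; exact: h.
- by rewrite (_ : (fun t => _) = (fun t => fp t - fn t)%E); [exact: integrableB|apply/funext].
- rewrite [LHS]integralE (ge0_integral_disintegration mpos)// (ge0_integral_disintegration mneg)//.
  rewrite -[LHS](integralB measurableT ip in_).
  by apply: eq_integral => t _; rewrite FE.
Qed.

End disintegrated_integrals.

Lemma integral_mono_integrable (R : realType) d (A : measurableType d) (m : {measure set A -> \bar R}) (D : set A)
    (f g : A -> \bar R) : measurable D -> m.-integrable D f -> measurable_fun D g ->
  {ae m, forall x, D x -> f x <= g x}%E -> (\int[m]_(x in D) f x <= \int[m]_(x in D) g x)%E.
Proof.
move=> mD fi mg fg; have mf := measurable_int m fi.
rewrite integralE [leRHS]integralE; apply: leeB; apply: ae_ge0_le_integral => //.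
all: try by [exact: measurable_funepos|exact: measurable_funeneg].
- by apply: filterS fg => x h Dx; rewrite !funeposE ge_max le_max h// le_max lexx !orbT.
- by apply: filterS fg => x h Dx; rewrite !funenegE ge_max !le_max leeN2 h// lexx orbT.
Qed.

Lemma measure_eq_rational_rays (R : realType) (m1 m2 : {measure set R -> \bar R}) : (m1 setT < +oo)%E ->
  (forall i, m1 `]-oo, nratr R i]%classic = m2 `]-oo, nratr R i]%classic) -> forall A, measurable A -> m1 A = m2 A.
Proof.
move=> fin e; pose Q := range (fun i => `]-oo, nratr R i]%classic).
have Qs : sigma_algebra setT <<s Q >> by exact: smallest_sigma_algebra.
have Qr i : <<s Q >> `]-oo, nratr R i]%classic by apply: sub_sigma_algebra; exists i.
have gen : @measurable _ R = <<s Q >>.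
  apply/seteqP; split; last first.
    by apply: smallest_sub; [exact: sigma_algebra_measurable|move=> _ [i _ <-]; exact: measurable_itv].
  have -> : (@measurable _ R : set_system R) = <<s @RGenOInfty.G R >> by exact: RGenOInfty.measurableE.
  apply: smallest_sub => // _ [a ->].
  pose A i := if a < nratr R i then ~` `]-oo, nratr R i]%classic else set0.
  rewrite (_ : `]a, +oo[%classic = \bigcup_i A i).
    apply: salg_bigcup => // i; rewrite /A; case: ifPn => _; last by case: Qs.
    exact: (salgC Qs (Qr i)).
  apply/seteqP; split => [x|x [i _]]; rewrite /= in_itv/= andbT.
    move=> /nratr_between[i /andP[ai ix]]; exists i => //; rewrite /A ai /= in_itv/= leNgt.
    by apply/negP; rewrite negbK.
  by rewrite /A; case: ifPn => // ai /=; rewrite in_itv/= => /negP; rewrite -ltNge; exact: lt_trans.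
have lt1 (j : nat) : (j%:R : R) < j%:R + 1 by rewrite ltrDl.
pose i_ (j : nat) : nat := sval (cid (nratr_between (lt1 j))).
have hi j : j%:R < nratr R (i_ j).
  by rewrite /i_; case: cid => i /= /andP[].
apply: (measure_unique Q (fun j => `]-oo, nratr R (i_ j)]%classic) gen).
- move=> _ _ [i _ <-] [j _ <-].
  have [h|h] := leP (nratr R i) (nratr R j); [exists i|exists j] => //.
    by apply/seteqP; split => x /=; rewrite !in_itv/=; [move=> xi; split => //; exact: le_trans h|case].
  by apply/seteqP; split => x /=; rewrite !in_itv/=; [move=> xj; split => //; exact: le_trans (ltW h)|case].
- by move=> j; exists (i_ j).
- apply/seteqP; split => // x _; exists (Num.bound `|x|) => //=; rewrite in_itv/=.
  rewrite (le_trans (ler_norm x))// (le_trans (ltW (archi_boundP (normr_ge0 x))))// ltW//.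
- by move=> _ [i _ <-]; exact: e.
- by move=> j; apply: le_lt_trans fin; apply: le_measure; rewrite ?inE//; exact: measurable_itv.
Qed.

Section density_integrals.
Context (R : realType) d (A : measurableType d) (P : {measure set A -> \bar R}) (L : A -> R).
Hypothesis iL : P.-integrable setT (EFin \o L).
Hypothesis L0 : {ae P, forall w, 0 <= L w}.

(** Integrals with respect to the measure of density [L] are computed from a
    measurable version of the integrand. *)
Lemma integral_density_measure (h h' : A -> R) : {ae P, forall w, h w = h' w} -> measurable_fun setT h' ->
  (\int[density_measure P L]_w (h w)%:E = \int[P]_w (L w * h' w)%:E)%E.
Proof.
move=> hh mh; pose Lp w := Num.max (L w) 0.
have mL : measurable_fun setT L by apply/measurable_EFinP; exact: (measurable_int P iL).
have mLp : measurable_fun setT Lp by exact: measurable_maxr.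
have Lp0 w : 0 <= Lp w by rewrite le_max lexx orbT.
have LpE : {ae P, forall w, L w = Lp w} by apply: filterS L0 => w l0; rewrite /Lp max_l.
have qE B : (\int[P]_(w in B) (L w)%:E = \int[P]_(w in B) (Lp w)%:E)%E.
  by apply: ae_eq_integral_nomeas; apply: filterS LpE => w ->.
have ism : is_measure (fun B => \int[P]_(w in B) (L w)%:E)%E.
  split; first exact: integral_set0.
    by move=> B; rewrite qE; apply: integral_ge0 => w _; rewrite lee_fin.
  rewrite (_ : (fun B => _) = (fun B => \int[P]_(w in B) (Lp w)%:E)%E); last by apply/funext.
  by apply: semi_sigma_additive_nng_induced => //; exact/measurable_EFinP.
have dE B : density_measure P L B = (\int[P]_(w in B) (Lp w)%:E)%E.
  by rewrite /density_measure; case: pselect => // hm; rewrite /= /set_function_measure qE.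
rewrite (_ : integral _ _ _ = \int[density_measure P L]_w (h' w)%:E)%E; last first.
  apply: ae_eq_integral_nomeas; case: hh => N [mN N0 hN]; exists N; split => //.
    by rewrite dE; apply: null_set_integral => //; apply/measurable_funTS/measurable_EFinP.
  by move=> w hw; apply: hN => /= e; apply: hw => _; rewrite e.
apply: (etrans (@integral_density _ A R P (density_measure P L) Lp mLp Lp0 (fun B _ => dE B) h' mh)).
by apply: ae_eq_integral_nomeas; apply: filterS LpE => w ->.
Qed.

End density_integrals.

(** * Integrals along increasing paths and projected marks *)

Section path_disintegration.
Context (R : realType) d (E : measurableType d).
Variables (T : R) (n : {measure set (R * E) -> \bar R}) (A : R -> R) (phi : R -> probability E R).
Hypothesis T0 : 0 < T.
Hypothesis A_inc : increasing_path A.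
Hypothesis A0 : A 0 = 0.
Hypothesis mphi : forall B, measurable B -> measurable_fun `[0, T] (phi ^~ B : R -> \bar R).
Hypothesis nE : forall B, measurable B ->
  n (B `&` (`]0%R, T] `*` setT)) = (\int[dS A]_(t in `]0%R, T]) phi t [set x | B (t, x)])%E.
Local Notation strip := (`]0%R, T]%classic `*` (setT : set E)).

Let l (t : measurableTypeR R) : {measure set E -> \bar R} := 
  if 0 < t <= T then (phi t : {measure set E -> \bar R}) else mzero.

Let int_l (f : R * E -> \bar R) :
  (\int[dS A]_t \int[l t]_x f (t, x) = \int[dS A]_(t in `]0%R, T]) \int[phi t]_x f (t, x))%E.
Proof.
rewrite [RHS]integral_mkcond; apply: eq_integral => t _; rewrite patchE /l.
by rewrite mem_setE in_itv/=; case: ifPn => // _; rewrite integral_measure_zero.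
Qed.

Let mid : measurable_fun setT (id : measurableTypeR R -> R). Proof. by []. Qed.

Let lfin t : (l t setT < +oo)%E.
Proof. by rewrite /l; case: ifPn => _; [apply: (le_lt_trans _ (ltry 1)); exact: probability_le1|rewrite ltry]. Qed.

Let ml B : measurable B -> measurable_fun setT (l ^~ B : measurableTypeR R -> \bar R).
Proof.
move=> mB; rewrite (_ : l ^~ B = (phi ^~ B : R -> \bar R) \_ `]0, T]).
  apply/(measurable_restrictT _ (measurable_itv _)).
  apply: (measurable_funS (measurable_itv _) _ (mphi mB)) => t /=; rewrite !in_itv/= => /andP[t0 ->].
  by rewrite ltW.
by apply/funext => t; rewrite patchE /l mem_setE in_itv/=; case: ifPn.
Qed.

Let mE B : measurable B -> strip_measure T n B = (\int[dS A]_t l t (xsection B t))%E.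
Proof.
move=> mB; rewrite /strip_measure /= /mrestr nE// integral_mkcond; apply: eq_integral => t _.
rewrite patchE /l mem_setE in_itv/=; case: ifPn => // _; congr (phi t _).
by apply/seteqP; split => x /=; rewrite /xsection /= inE.
Qed.

Lemma strip_times D : measurable D -> n ((D `*` setT) `&` strip) = dS A (D `&` `]0, T]).
Proof.
move=> mD; rewrite nE; last exact: measurableX.
have mI : measurable (`]0%R, T]%classic : set (measurableTypeR R)) by exact: measurable_itv.
rewrite -(@integral_indic _ (measurableTypeR R) R (dS A) _ mI D mD).
apply: eq_integral => t _; rewrite indicE; case: (boolP (t \in D)) => tD.
  by rewrite (_ : [set x | _] = setT) ?probability_setT//; apply/seteqP; split => //; move/set_mem : tD.
by rewrite (_ : [set x | _] = set0) ?measure0//; apply/seteqP; split => // x [/= /mem_set h]; move: tD; rewrite h.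
Qed.

Lemma strip_mass t : 0 <= t <= T -> n (`]0%R, t] `*` setT) = (A t)%:E.
Proof.
move=> /andP[t0 tT]; have e : `]0%R, t]%classic `&` `]0%R, T]%classic = `]0%R, t]%classic.
  by apply/seteqP; split => s /=; rewrite !in_itv/=; [case|move=> /andP[-> st]; rewrite st (le_trans st)].
have := @strip_times `]0%R, t]%classic (measurable_itv _); rewrite -setXI setIT e => ->.
by rewrite dS_oc// A0 subr0.
Qed.

Lemma ge0_strip_integral (f : R * E -> \bar R) : measurable_fun setT f -> (forall p, 0 <= f p)%E ->
  (\int[n]_(p in strip) f p = \int[dS A]_(t in `]0%R, T]) \int[phi t]_x f (t, x))%E.
Proof.
move=> mf f0; rewrite -int_l -(integral_mrestr _ (measurable_strip 0 T) mf).
exact: (ge0_integral_disintegration (k := dS A) (l := l) mid lfin ml mE).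
Qed.

Let mI : measurable (`]0%R, T]%classic : set (measurableTypeR R)). Proof. exact: measurable_itv. Qed.

Lemma hamiltonian_integral (f : R * E -> R) (lam : R -> R) (K : R) : measurable_fun setT f ->
  (\int[n]_(p in strip) `|f p|%:E < +oo)%E -> measurable_fun setT lam -> (forall t, 0 < t <= T -> `|lam t| <= K) ->
  let ham t := ((lam t)%:E + \int[phi t]_x (f (t, x))%:E)%E in
  (dS A).-integrable `]0, T] ham /\
  (\int[dS A]_(t in `]0%R, T]) ham t =
   (\int[dS A]_(t in `]0%R, T]) lam t + \int[n]_(p in strip) f p)%:E)%E.
Proof.
move=> mf fin mlam lamK ham.
have mfE : measurable_fun setT (fun p => (f p)%:E) by exact/measurable_EFinP.
have mfa : measurable_fun setT (fun p => `|f p|%:E) by apply/measurable_EFinP; exact: measurableT_comp.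
have dfin : (dS A `]0%R, T]%classic < +oo)%E by rewrite dS_oc ?ltry// ltW.
have il : (dS A).-integrable `]0%R, T] (EFin \o lam).
  apply: measurable_bounded_integrable => //; first exact: measurable_funTS.
  exists K; split; first exact: num_real.
  by move=> K' KK' t /=; rewrite in_itv/= => /lamK h; rewrite (le_trans h)// ltW.
have fin' : (\int[strip_measure T n]_p `|f p|%:E < +oo)%E by rewrite integral_mrestr.
have [_ h2 h3] := integral_disintegration (k := dS A) (l := l) mid lfin ml mE mf fin'.
have i2 : (dS A).-integrable `]0%R, T] (fun t => \int[phi t]_x (f (t, x))%:E)%E.
  apply/(integrable_mkcond _ mI); move: h2; congr (_.-integrable _ _); apply/funext => t.
  by rewrite patchE /l mem_setE in_itv/=; case: ifPn => // _; rewrite integral_measure_zero.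
split; first exact: integrableD.
rewrite /ham integralD// EFinD; congr (_ + _)%E.
  by rewrite /Rintegral fineK//; exact: integrable_fin_num.
have h3' := int_l (fun p => (f p)%:E); move: h3; rewrite integral_mrestr// h3' => h3; rewrite -h3 /Rintegral fineK// h3.
exact: integrable_fin_num.
Qed.

(** An atomless integrator does not see the jump times, so that [X] and its left
    limits can be exchanged under the integral. *)
Lemma ae_off_times (tm : nat -> \bar R) : (forall t, 0 < t <= T -> n ([set t] `*` setT) = 0%E) ->
  {ae dS A, forall t, `]0%R, T]%classic t -> forall m, tm m <> t%:E}.
Proof.
move=> n0; suff h m : {ae dS A, forall t, `]0%R, T]%classic t -> tm m <> t%:E}.
  by move: (ae_foralln h); apply: filterS => t ht tT m; exact: ht.
case: (tm m) => [s| |]; [|by apply: aeW|by apply: aeW].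
have [sT|sT] := pselect (0 < s <= T); last first.
  by apply: aeW => t tT [st]; apply: sT; rewrite st.
exists [set s]; split.
- exact: measurable_set1.
- have := @strip_times [set s] (measurable_set1 _); rewrite -setXI setIT.
  rewrite (_ : [set s] `&` _ = [set s]) ?n0//.
  by apply/seteqP; split => [t []|t /= ->]//; split => //=; rewrite in_itv.
- by move=> t /= /not_implyP[_ /contrapT [->]].
Qed.

End path_disintegration.

(** The part of a random measure carried by the marks [(x, 0)], seen on the
    first coordinate of the marks. *)
Section first_part.
Context (R : realType) d (E : measurableType d) (n : {measure set (R * (E * R)) -> \bar R}).

Definition zero_second : set (R * (E * R)) := [set p | p.2.2 = 0].

Lemma measurable_zero_second : measurable zero_second.
Proof.
have -> : zero_second = setT `*` (setT `*` [set 0]).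
  by apply/seteqP; split => [[t [x y]] /= h|[t [x y]] [_ [_ /= ->]]].
by apply: measurableX => //; apply: measurableX => //; exact: measurable_set1.
Qed.

Definition forget_second (p : R * (E * R)) : R * E := (p.1, p.2.1).

Lemma measurable_forget_second : measurable_fun setT forget_second.
Proof.
apply: measurable_fun_pair; first exact: measurable_fst.
exact: (measurableT_comp measurable_fst measurable_snd).
Qed.

Definition first_part : {measure set (R * E) -> \bar R} :=
  measure_function_pushforward__canonical__measure_function_Measure
    (mrestr n measurable_zero_second) measurable_forget_second.

Lemma first_part_integral (D : set R) (f : R * E -> \bar R) : measurable D ->
  measurable_fun setT f -> (forall p, 0 <= f p)%E ->
  (\int[first_part]_(p in D `*` setT) f p =
   \int[n]_(p in D `*` setT) (f (p.1, p.2.1) * (p.2.2 == 0%R)%:R%:E))%E.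
Proof.
move=> mD mf f0; have mDE : measurable (D `*` (setT : set E)) by exact: measurableX.
have mDE2 : measurable (D `*` (setT : set (E * R))) by exact: measurableX.
have mfc : measurable_fun setT (f \o forget_second) by exact: measurableT_comp mf measurable_forget_second.
apply: (etrans (ge0_integral_pushforward measurable_forget_second (mrestr n measurable_zero_second) mDE _ _)).
- exact: measurable_funTS.
- by [].
rewrite (_ : forget_second @^-1` _ = D `*` setT); last first.
  by apply/seteqP; split => p /= [].
rewrite -(integral_mrestr (mrestr n measurable_zero_second) mDE2 mfc).
have -> : (\int[mrestr (mrestr n measurable_zero_second) mDE2]_x (f \o forget_second) x =
    \int[mrestr n (measurableI _ _ mDE2 measurable_zero_second)]_x (f \o forget_second) x)%E.
  apply: eq_measure_integral => B mB _.
  by transitivity (n (B `&` (D `*` setT) `&` zero_second)) => //; rewrite -setIA.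
rewrite (integral_mrestr n _ mfc) integral_mkcond [RHS]integral_mkcond; apply: eq_integral => p _.
rewrite !patchE in_setI; case: ifPn => [/andP[-> /set_mem /= ->]|]; first by rewrite eqxx mule1.
rewrite negb_and => /orP[/negbTE -> //|]; case: ifPn => // _ /negP p2.
by case: eqP => [e|_]; [exfalso; apply: p2; exact: mem_set|rewrite mule0].
Qed.

Lemma first_part_le (D : set R) : measurable D -> (first_part (D `*` setT) <= n (D `*` setT))%E.
Proof.
move=> mD; rewrite /first_part /= /pushforward /mrestr; apply: le_measure; rewrite ?inE//.
- apply: measurableI; last exact: measurable_zero_second.
  by rewrite -[X in measurable X]setTI; apply: measurable_forget_second => //; exact: measurableX.
- exact: measurableX.
Qed.

End first_part.

Section predictable_left_limits.
Context (R : realType) (d0 : measure_display) (Omega : measurableType d0).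
Variables (K : R -> set_system Omega) (d : nat) (X : Omega -> R -> 'rV[R]_d).
Hypothesis fK : filtration K.
Hypothesis aX : adapted K X.
Hypothesis X_left : forall w t, exists c, exists2 e, 0 < e & forall s, t - e <= s < t -> X w s = c.

Lemma predictable_left_limit : predictable_on K (setT `*` [set t | 0 < t]) (fun w t => left_limit (X w) t).
Proof.
move=> B mB; have hS := predictable_salg K.
have p0 : predictable K (setT `*` [set t : R | 0 < t]).
  by apply: predictable_ray => //; apply: salgT; case: fK => h _ _; exact: h.
rewrite (_ : _ `&` _ = \bigcup_N \bigcap_k ((setT `*` [set t : R | 0 < t]) `&`
    ((@all_times R _ Omega) `&` (fun p => X p.1 (grid_left (N + k) p.2)) @^-1` B))); last first.
  apply/seteqP; split => [[w t] [[_ /= t0] Bt]|[w t] [N _ h]].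
    have [c [e e0 hc]] := X_left w t.
    have [N _ hN] := grid_left_near t0 e0.
    exists N => // k _; split => //; split; first by split => //=; rewrite in_itv/= andbT ltW.
    rewrite /= hc ?grid_left_lt ?andbT//; last by apply: hN; rewrite /= leq_addr.
    by move: Bt; rewrite (left_limit_near e0 hc).
  have [[_ /= t0] _] := h 0%N Logic.I; split => //=.
  have [c [e e0 hc]] := X_left w t; rewrite (left_limit_near e0 hc).
  have [M _ hM] := grid_left_near t0 e0.
  have [_ [_ /=]] := h M Logic.I; rewrite hc// grid_left_lt// andbT; apply: hM.
  by rewrite /= leq_addl.
apply: (salg_bigcup hS) => N; apply: (salg_bigcap hS) => k; apply: (salgI hS p0).
exact: (adapted_grid_left (N + k) aX mB).
Qed.

End predictable_left_limits.

(** * Step processes in the enlarged filtration *)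

Section predictable_paths.
Context (R : realType) (d0 : measure_display) (Omega : measurableType d0).
Variable K : R -> set_system Omega.
Hypothesis fK : filtration K.

Variable T : R.
Hypothesis T0 : 0 <= T.

Lemma predictable_path d (V : measurableType d) (Y : Omega -> R -> V) w :
  predictable_on K (@horizon R _ Omega T) Y -> measurable_fun `[0, T] (Y w).
Proof.
move=> pY; have mI : measurable `[0, T]%classic by exact: measurable_itv.
have := predictable_patch point (predictable_horizon fK T0) pY.
move=> /(predictable_fun_measurable fK) m.
apply: (eq_measurable_fun (fun t => if (w, t) \in @horizon R _ Omega T then Y w t else point)).
  by move=> t /set_mem tT; rewrite mem_set.
exact: (measurable_funTS (measurableT_comp m (measurable_pair1 w))).
Qed.

End predictable_paths.

Lemma point_measure_sum (R : realType) d (E : measurableType d) (J : set R) (y : R -> E) (T : R) (s : seq (R * E)) :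
  uniq (map fst s) -> (forall x, x \in s -> [/\ 0 < x.1 <= T, J x.1 & y x.1 = x.2]) ->
  (forall t, J t -> 0 < t <= T -> t \in map fst s) ->
  forall f : R * E -> \bar R, measurable_fun setT f -> (forall p, 0 <= f p)%E ->
  (\int[point_measure J y]_(p in `]0%R, T] `*` setT) f p = \sum_(x <- s) f x)%E.
Proof.
move=> us sJ Js f mf f0.
rewrite -(integral_mrestr _ (measurable_strip 0 T) mf).
pose dm i : {measure set (R * E) -> \bar R} := dirac (nth (0, point) s i).
rewrite (eq_measure_integral (msum dm (size s))).
  rewrite ge0_integral_measure_sum// (big_nth (0, point)) big_mkord.
  by apply: eq_bigr => i _; rewrite integral_dirac// diracT mul1e.
move=> A mA _; change (point_measure J y (A `&` (`]0%R, T] `*` setT)) = \sum_(i < size s) \d_(nth (0%R, point) s i) A)%E.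
have -> : (\sum_(i < size s) (\d_(nth (0%R, point) s i) A : \bar R) = \sum_(x <- s) \d_x A)%E.
  by rewrite (big_nth (0, point)) big_mkord.
rewrite /point_measure.
rewrite (_ : esum _ _ = \esum_(t in [set` map fst s]) \d_(t, y t) (A `&` (`]0%R, T] `*` setT)))%E.
  rewrite esum_fset; [|exact: finite_seq|by move=> t _; exact: measure_ge0].
  rewrite -fsbig_seq// big_map; apply: eq_big_seq => x xs.
  have [xT _ ->] := sJ _ xs; rewrite -surjective_pairing !diracE in_setI.
  by rewrite [X in _ && X]mem_set ?andbT//; split => //=; rewrite in_itv.
rewrite esum_mkcond [RHS]esum_mkcond; apply: eq_esum => t _.
case: ifPn => [|]; case: ifPn => //; rewrite !(inE, notin_setE) /=.
- move=> nt Jt; rewrite diracE memNset// => -[_ [/=]]; rewrite in_itv/= => tT _.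
  exact/nt/Js.
- by move=> /mapP[x xs ->] nJ; exfalso; apply: nJ; have [] := sJ _ xs.
Qed.

Section step_setting.
Context (R : realType) (d0 : measure_display) (Omega : measurableType d0).
Variables (P : probability Omega R) (T : R) (d : nat) (X : Omega -> R -> 'rV[R]_d).
Variables (F : R -> set_system Omega) (tau : Omega -> \bar R) (G : R -> set_system Omega).
Hypothesis T0 : 0 < T.
Hypothesis hF : F = natural_filtration X.
Hypothesis mX : forall t, measurable_fun setT (X ^~ t).
Hypothesis qlc : quasi_left_continuous P F X.
Hypothesis mtau : measurable_fun setT tau.
Hypothesis tau_gt0 : forall w, (0 < tau w)%E.
Hypothesis hG : G = enlarged_filtration F tau.
Hypothesis hab : (avoids_stopping_times P F tau /\ martingales_preserved P F G) \/
         (diffuse_law P tau /\ absolutely_continuous_conditional_laws P F tau).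
Variables (tau_ : nat -> Omega -> \bar R) (xi : nat -> Omega -> 'rV[R]_d).
Hypothesis stopF : forall n, stopping_time F (tau_ n).
Hypothesis tau_lt : forall n w, (tau_ n w < +oo -> tau_ n w < tau_ n.+1 w)%E.
Hypothesis tau_inf : forall w, {homo tau_ ^~ w : m n / (m <= n)%N >-> (m <= n)%E} /\ tau_ ^~ w @ \oo --> +oo%E.
Hypothesis xiP : forall n, measurable_wrt (stopped_salgebra F (tau_ n)) setT (xi n) /\
  (forall w, xi n w != 0 <-> (tau_ n w < +oo)%E).
Hypothesis XE : forall w t, X w t = \sum_(n \in [set n | (tau_ n w <= t%:E)%E]) xi n w.
Let E := ('rV[R]_d * R)%type.

Lemma step_rcF : rc_filtration F /\ adapted F X.
Proof. by rewrite hF; exact: natural_filtrationP. Qed.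

Let rcF : rc_filtration F := proj1 step_rcF.
Let aX : adapted F X := proj2 step_rcF.
Let fF : filtration F := proj1 rcF.

Lemma step_rcG : [/\ rc_filtration G, forall s, 0 <= s -> F s `<=` G s & stopping_time G tau].
Proof. by rewrite hG; apply: enlarged_filtrationP => // w; exact: ltW. Qed.

Let rcG : rc_filtration G. Proof. by have [] := step_rcG. Qed.
Let FG : forall s, 0 <= s -> F s `<=` G s. Proof. by have [] := step_rcG. Qed.
Let sG : stopping_time G tau. Proof. by have [] := step_rcG. Qed.
Let fG : filtration G := proj1 rcG.

(** The jumps of [Z] are those of [X], numbered from 1, and [tau]. *)
Definition all_jumps n := if n is m.+1 then tau_ m else tau.
Local Notation jt := all_jumps.

Let tau_lf w : locally_finite (tau_ ^~ w).
Proof. by have [_ h2] := tau_inf w; exact: step_locally_finite. Qed.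

Let jt_lf w : locally_finite (jt ^~ w).
Proof.
move=> t; have [N hN] := tau_lf w t; exists N.+1 => -[//|n] nN; exact: hN.
Qed.

Let X_const w s t : (forall n, (jt n w <= s%:E)%E = (jt n w <= t%:E)%E) -> X w s = X w t.
Proof. by move=> h; apply: (step_eq (XE w)) => n; exact: (h n.+1). Qed.

Let tau_const w s t : (forall n, (jt n w <= s%:E)%E = (jt n w <= t%:E)%E) ->
  (tau w <= s%:E)%E = (tau w <= t%:E)%E.
Proof. by move=> h; exact: (h 0%N). Qed.

Let Fmin K : rc_filtration K -> adapted K X -> forall t, 0 <= t -> F t `<=` K t.
Proof. by move=> rK aK t t0 A; rewrite hF; exact. Qed.

Let Gmin K : rc_filtration K -> (forall s, 0 <= s -> F s `<=` K s) ->
  stopping_time K tau -> forall t, 0 <= t -> G t `<=` K t.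
Proof. by move=> rK FK sK t t0 A; rewrite hG; exact. Qed.

Lemma step_jump_at w n t : tau_ n w = t%:E -> jump (X w) t = xi n w.
Proof. by have [h1 h2] := tau_inf w; move=> e; apply: (step_jump (fun n => @tau_lt n w) h1 h2 (XE w) e). Qed.

Lemma step_jump_off w t : (forall n, tau_ n w <> t%:E) -> jump (X w) t = 0.
Proof. by have [h1 h2] := tau_inf w; move=> h; exact: (step_nojump h2 (XE w) h). Qed.

Let diffF q S : 0 <= q -> measurable_wrt (F q) setT S ->
  (forall w, q < S w) -> forall m, {ae P, forall w, tau_ m w <> (S w)%:E}.
Proof.
move=> q0 mS qS m.
have pS : predictable F [set p | S p.1 <= p.2].
  have hS : sigma_algebra setT (F q) by case: fF => h _ _; exact: h.
  have E1 : prod_salgebra (F q) (@measurable _ R) [set p | S p.1 <= p.2].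
    rewrite prod_salgebraE//.
    have mb : measurable_fun setT (fun p : (g_sigma_algebraType (F q) * R)%type => S p.1 <= p.2).
      apply: measurable_fun_ler => //; move/(measurable_wrtT S hS) : mS => mS.
      exact: (measurableT_comp mS measurable_fst).
    rewrite (_ : [set p | _] = setT `&` (fun p : (g_sigma_algebraType (F q) * R)%type => S p.1 <= p.2) @^-1` [set true]).
      exact: mb.
    by apply/seteqP; split => p /=; [move=> ->|move=> []].
  have := predictable_future fF q0 E1; congr (predictable F _).
  by apply/seteqP; split => p /= => [[]//|h]; split => //; exact: lt_le_trans (qS _) h.
have := qlc (fun w => ltW (le_lt_trans q0 (qS w))) pS.
apply: filterS => w h e; have [_ /(_ w)[_]] := xiP m; rewrite e ltry => /(_ isT).
by rewrite -(step_jump_at e) h eqxx.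
Qed.

Let pre := pre_tau_trace rcF rcG sG Gmin.
Let post := post_tau_section rcF rcG sG Gmin.

(** Condition (b) implies the avoidance that is assumed in (a). *)
Lemma step_avoids : avoids_stopping_times P F tau.
Proof.
have [[]//|[dl ac]] := hab.
by apply: (avoids_of_absolutely_continuous rcF mtau).
Qed.

Let jt_inaccessible n q S : 0 <= q -> measurable_wrt (G q) setT S ->
  (forall w, q < S w) -> {ae P, forall w, jt n w <> (S w)%:E}.
Proof.
move=> q0 mS qS; case: n => [|m] /=.
  by apply: (default_inaccessible rcF mtau pre step_avoids q0 mS qS).
have [[_ mp]|[_ ac]] := hab.
  by apply: (jump_inaccessible_immersion rcF rcG FG stopF diffF mp q0 mS qS).
by apply: (jump_inaccessible_density rcF mtau stopF diffF post ac q0 mS qS).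
Qed.

(** The constant time [0] is predictable, so quasi-left-continuity rules out a
    jump of [X] at [0]. *)
Lemma step_initial : {ae P, forall w, X w 0 = 0}.
Proof.
have pS : predictable F [set p : Omega * R | 0 <= p.2].
  have := predictable_all_times fF; congr (predictable F _).
  by apply/seteqP; split => -[w t]; rewrite /all_times /= in_itv/= andbT => // -[].
have := qlc (fun _ => lexx 0) pS; apply: filterS => w; rewrite /jump.
rewrite (@left_limit_near _ _ (X w) 0 0 1) ?subr0// => s /andP[_ s0].
by apply: (step_neg _ (XE w) s0) => n; have [h _] := stopF n.
Qed.

(** At time 0 the path carries only [X 0], which is a.s. 0. *)
Lemma initial_trivial A w w' : G 0 A -> X w 0 = 0 -> X w' 0 = 0 -> A w -> A w'.
Proof.
move=> GA h h'; apply: (initial_sets rcF aX Fmin rcG sG Gmin jt_lf X_const tau_const tau_gt0 GA).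
by rewrite h h'.
Qed.

Let mtau_ m : measurable_fun setT (tau_ m).
Proof. exact: (stop_measurable rcF stopF). Qed.

(** The jump times of [X] are [F]-stopping times, which [tau] avoids; the two
    coordinates of [Z] thus never jump together. *)
Lemma no_common_jump : {ae P, forall w, forall m t, tau_ m w = t%:E -> tau w <> t%:E}.
Proof.
apply: ae_foralln => m; exists [set w | tau w = tau_ m w /\ (tau_ m w < +oo)%E]; split.
- apply: measurableI.
    by rewrite -[X in measurable X]setTI; exact: emeasurable_fun_eq.
  by rewrite -[X in measurable X]setTI; exact: emeasurable_fun_infty_o.
- exact: step_avoids (stopF m).
- move=> w /= /existsNP[t /not_implyP[e /contrapT e']].
  by rewrite e e' ltry.
Qed.

Lemma all_jumps_predictable_hit W n : predictable G W ->
  {ae P, forall w, forall k : {measure set R -> \bar R}, (k setT < +oo)%E ->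
     (forall x, 0 < x -> k [set x] = 0%E) -> k ([set t | W (w, t)] `&` `]0, T]) = 0%E} ->
  {ae P, forall w, forall t, jt n w = t%:E -> 0 < t <= T -> ~ W (w, t)}.
Proof.
have mjt k : measurable_fun setT (jt k) by case: k.
have nj q V : 0 <= q -> predictable G V -> _ :=
  @nojump_predictable _ _ _ _ _ _ _ _ _ _ aX Fmin rcG FG sG Gmin jt_lf X_const tau_const q V.
exact: (no_predictable_hit rcG mjt jt_lf jt_inaccessible nj n T0).
Qed.

(** Integrals start after time 0: a jump at 0 is discarded, by moving it to
    infinity. *)
Definition positive_jumps n w := if (jt n w <= 0)%E then +oo%E else jt n w.
Local Notation theta := positive_jumps.
Definition jump_marks n w : E := if n is m.+1 then (xi m w, 0) else (0, 1).
Local Notation zeta := jump_marks.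

Let thetaE n w t : 0 <= t -> (theta n w <= t%:E)%E = (0 < jt n w <= t%:E)%E.
Proof. by move=> t0; rewrite /theta ltNge; case: ifPn => // _; rewrite leye_eq. Qed.

Let jt_stop n : stopping_time G (jt n).
Proof.
case: n => [|m] //=; have [h0 h] := stopF m; split => // t t0; exact/FG/h.
Qed.

Lemma positive_jumps_gt0 n w : (0 < theta n w)%E.
Proof. by rewrite /theta; case: ifPn => [_|]; rewrite ?ltry// -ltNge. Qed.

Let theta_set n t (A : set Omega) : 0 <= t -> G t (A `&` [set w | (jt n w <= t%:E)%E]) ->
  G t (A `&` [set w | (theta n w <= t%:E)%E]).
Proof.
move=> t0 GA; have Gst : sigma_algebra setT (G t) by case: fG => h _ _; exact: h.
rewrite (_ : _ `&` _ = (A `&` [set w | (jt n w <= t%:E)%E]) `\` [set w | (jt n w <= 0)%E]).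
  apply: salgD => //; case: fG => _ _ h; apply: (h 0 t) => //.
  by have [_] := jt_stop n; exact.
apply/seteqP; split => w /=; rewrite thetaE// ltNge.
  by move=> [Aw /andP[/negP h1 h2]].
by move=> [[Aw h2] /negP h1]; rewrite h1 h2.
Qed.

Lemma positive_jumps_stop n : stopping_time G (theta n).
Proof.
split=> [w|t t0]; first exact/ltW/positive_jumps_gt0.
by have := @theta_set n t setT t0; rewrite !setTI; apply; have [_] := jt_stop n; exact.
Qed.

Lemma jump_marks_stop n t B : 0 <= t -> measurable B ->
  G t ([set w | (theta n w <= t%:E)%E] `&` zeta n @^-1` B).
Proof.
move=> t0 mB; rewrite setIC; apply: theta_set => //.
have Gst : sigma_algebra setT (G t) by case: fG => h _ _; exact: h.
case: n => [|m] /=.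
  apply: salgI => //; last by have [_] := sG; exact.
  have [B1|B0] := pselect (B (0, 1)).
    by rewrite (_ : _ @^-1` _ = setT); [exact: salgT|apply/seteqP; split].
  by rewrite (_ : _ @^-1` _ = set0); [case: Gst|apply/seteqP; split].
have [mxi _] := xiP m; have mB' : measurable [set x : 'rV[R]_d | B (x, 0)].
  have : measurable_fun setT (fun x : 'rV[R]_d => (x, 0 : R)) by exact: measurable_fun_pair.
  by move=> /(_ measurableT B mB); rewrite setTI.
by have [_ h] := mxi _ mB'; apply: FG => //; have := h t t0; rewrite setTI.
Qed.

Lemma positive_jumps_lf w : locally_finite (theta ^~ w).
Proof.
move=> t; have [N hN] := jt_lf w t; exists N => n nN; rewrite /theta; case: ifPn => // _.
  by rewrite ltry.
exact: hN.
Qed.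

Lemma positive_jumps_distinct : {ae P, forall w, distinct_points theta w}.
Proof.
move: no_common_jump; apply: filterS => w h n m t.
have e k : theta k w = t%:E -> jt k w = t%:E by rewrite /theta; case: ifPn.
move=> /e en /e em; case: n m en em => [|n] [|m] //= en em.
- by have := h m t em.
- by have := h n t en.
- have [h1 h2] := tau_inf w; congr S.
  by apply: (step_inj (fun n => @tau_lt n w) h1); rewrite /= en ?ltry.
Qed.

Local Notation points := (points T zeta positive_jumps_lf).
Let Z w t : E := (X w t, default_process tau w t).

Lemma jump_pairE w s : jump (Z w) s = (jump (X w) s, (tau w == s%:E)%:R).
Proof.
have [e e0 he] := times_left (jt_lf w) s.
have lt_se : s - e < s by rewrite ltrBlDr ltrDl.
have con u : s - e <= u < s -> forall n, (jt n w <= u%:E)%E = (jt n w <= (s - e)%:E)%E.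
  by move=> hu n; rewrite !he ?lexx ?lt_se.
have lX : left_limit (X w) s = X w (s - e).
  by apply: (left_limit_near e0) => u hu; apply: X_const; exact: con.
have lZ : left_limit (Z w) s = Z w (s - e).
  apply: (left_limit_near e0) => u hu; rewrite /Z (X_const (con u hu)) /default_process.
  by rewrite (tau_const (con u hu)).
rewrite /jump lX lZ; congr (_, _); rewrite /= /default_process.
have := he 0%N (s - e); rewrite lexx lt_se => /(_ isT) /= ->.
by rewrite le_eqVlt; case: eqVneq => [->|]; rewrite ?ltxx ?subr0// subrr.
Qed.

Let theta_fin n w : (theta n w <= T%:E)%E -> exists2 t, jt n w = t%:E & theta n w = t%:E /\ 0 < t <= T.
Proof.
have := positive_jumps_gt0 n w; rewrite /theta; case: ifPn => //.
by case: (jt n w) => [t| |]// _; rewrite lte_fin lee_fin => t0 tT; exists t; rewrite // t0.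
Qed.

Let good_path w := forall m t, tau_ m w = t%:E -> tau w <> t%:E.

Let points_jump w x : good_path w -> x \in points w ->
  [/\ 0 < x.1 <= T, jump (Z w) x.1 = x.2 &
     if x.2.2 == 0 then (exists2 m, tau_ m w = (x.1)%:E & x.2.1 = xi m w /\ xi m w != 0) else x.2 = (0, 1)].
Proof.
move=> gw /pointsP[n /theta_fin[t jE [-> tT]] ->] /=; split => //.
  rewrite jump_pairE; case: n jE => [|m] /= jE.
    by rewrite jE eqxx step_jump_off// => k kt; exact: gw kt jE.
  by rewrite (step_jump_at jE); case: eqP => // /(gw _ _ jE).
case: n jE => [|m] /= jE; first by rewrite oner_eq0.
rewrite eqxx; exists m => //; split => //; have [_ /(_ w)[_]] := xiP m.
by apply; rewrite jE ltry.
Qed.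

Let jump_point w t n : jt n w = t%:E -> 0 < t <= T -> (t, zeta n w) \in points w.
Proof.
move=> jE /andP[t0 tT]; have tE : theta n w = t%:E by rewrite /theta jE leNgt lte_fin t0.
by apply/pointsP; exists n; rewrite tE.
Qed.

Lemma pair_jump_measure : {ae P, forall w, forall f : R * E -> \bar R, measurable_fun setT f -> (forall p, 0 <= f p)%E ->
  (\int[point_measure (jump_times (Z w)) (jump (Z w))]_(p in `]0%R, T] `*` setT) f p = \sum_(x <- points w) f x)%E}.
Proof.
move: no_common_jump positive_jumps_distinct; apply: filterS2 => w gw dw; apply: point_measure_sum.
- exact: points_uniq positive_jumps_gt0 _ _ dw.
- move=> x xs; have [xT jx xx] := points_jump gw xs; split=> //; split; first by case/andP: xT.
  rewrite jx; move: xx; case: ifPn => [_ [m _ [e xi0]]|x2 _].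
    by apply: contraNN xi0 => /eqP h; rewrite -e h.
  by apply: contraNN x2 => /eqP ->.
- move=> t [t0]; rewrite jump_pairE => jt0 tT; apply/mapP.
  have [tt|tt] := eqVneq (tau w) t%:E; first by exists (t, zeta 0 w) => //; exact: jump_point.
  have : exists m, tau_ m w = t%:E.
    apply: contrapT => h; move/negP : jt0; apply; rewrite step_jump_off ?(negbTE tt)// => m mt.
    by apply: h; exists m.
  by move=> [m mt]; exists (t, zeta m.+1 w) => //; exact: jump_point.
Qed.

Lemma first_jump_measure : {ae P, forall w, forall f : R * 'rV[R]_d -> \bar R, measurable_fun setT f -> (forall p, 0 <= f p)%E ->
  (\int[point_measure (jump_times (X w)) (jump (X w))]_(p in `]0%R, T] `*` setT) f p =
   \sum_(x <- points w | x.2.2 == 0%R) f (x.1, x.2.1))%E}.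
Proof.
move: no_common_jump positive_jumps_distinct; apply: filterS2 => w gw dw f mf f0.
pose s := [seq (x.1, x.2.1) | x <- points w & x.2.2 == 0].
rewrite (@point_measure_sum _ _ _ _ _ _ s)//.
- by rewrite /s big_map big_filter.
- rewrite /s -map_comp; apply: (subseq_uniq _ (points_uniq T zeta positive_jumps_gt0 positive_jumps_lf dw)).
  by apply: map_subseq; exact: filter_subseq.
- move=> z /mapP[x]; rewrite mem_filter => /andP[x2 xs] -> /=.
  have [xT jx] := points_jump gw xs; rewrite x2 => -[m mt [e xi0]].
  have j : jump (X w) x.1 = x.2.1 by rewrite (step_jump_at mt).
  by split=> //; split; [case/andP: xT|rewrite j e].
- move=> t [t0 jt0] tT; rewrite /s -map_comp; apply/mapP.
  have : exists m, tau_ m w = t%:E.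
    apply: contrapT => h; move/negP : jt0; apply; rewrite step_jump_off// => m mt.
    by apply: h; exists m.
  by move=> [m mt]; exists (t, zeta m.+1 w) => //; rewrite mem_filter eqxx; exact: (jump_point (n := m.+1) mt tT).
Qed.

Lemma jump_measure_off_times (V : normedModType R) d1 (E1 : measurableType d1) (y : R -> V) (z : R -> E1) w (A : set R) :
  (forall t, (forall n, jt n w <> t%:E) -> jump y t = 0) ->
  (forall n t, jt n w = t%:E -> ~ A t) -> point_measure (jump_times y) z (A `*` setT) = 0%E.
Proof.
move=> yj hA; rewrite /point_measure esum1// => t [t0 jn].
have : exists n, jt n w = t%:E.
  by apply: contrapT => h; move/negP : jn; apply; rewrite yj// => n nt; apply: h; exists n.
by move=> [n nt]; rewrite diracE memNset// => -[/= At _]; exact: hA nt At.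
Qed.

Lemma step_compensator_atomless d1 (E1 : measurableType d1) (mu nu : Omega -> {measure set (R * E1) -> \bar R}) :
  compensator P G mu nu ->
  (forall w (A : set R), measurable A -> (forall n t, jt n w = t%:E -> ~ A t) -> mu w (A `*` setT) = 0%E) ->
  {ae P, forall w, (nu w (`]0%R, T] `*` setT) < +oo)%E} ->
  {ae P, forall w, forall t, 0 < t <= T -> nu w ([set t] `*` setT) = 0%E}.
Proof.
move=> comp off fin; apply: (compensator_atomless fG comp T0 fin off) => W n.
exact: all_jumps_predictable_hit.
Qed.

Lemma first_jump_off w t : (forall n, jt n w <> t%:E) -> jump (X w) t = 0.
Proof. by move=> h; apply: step_jump_off => m; exact: (h m.+1). Qed.

Lemma pair_jump_off w t : (forall n, jt n w <> t%:E) -> jump (Z w) t = 0.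
Proof.
by move=> h; rewrite jump_pairE first_jump_off//; case: eqP => // /(h 0%N).
Qed.

(** * The optimal control *)
Let E1 := 'rV[R]_d.
Variables (muX nuX : Omega -> {measure set (R * 'rV[R]_d) -> \bar R}).
Variables (muZ nuZ : Omega -> {measure set (R * ('rV[R]_d * R)) -> \bar R}).
Hypothesis hmuX : forall w, muX w = point_measure (jump_times (X w)) (jump (X w)).
Hypothesis hmuZ : forall w, muZ w = point_measure (jump_times (Z w)) (jump (Z w)).
Hypothesis hnuX : compensator P G muX nuX.
Hypothesis hnuZ : compensator P G muZ nuZ.
Variables (C CX : Omega -> R -> R) (phiX : Omega -> R -> probability 'rV[R]_d R)
  (phi : Omega -> R -> probability ('rV[R]_d * R)%type R).
Hypothesis C_adapted : adapted G C.
Hypothesis C_path : {ae P, forall w, C w 0 = 0 /\ increasing_path (C w)}.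
Hypothesis CX_path : {ae P, forall w, CX w 0 = 0 /\ increasing_path (CX w)}.
Hypothesis CX_le : {ae P, forall w, CX w T <= C w T}.
Hypothesis hphiX : transition_probability G T phiX.
Hypothesis hphi : transition_probability G T phi.
Hypothesis hnuXdis : disintegration P T nuX phiX CX.
Hypothesis hnuZdis : disintegration P T nuZ phi C.

Local Notation PrT := (predictableType G).
Local Notation strip := (`]0%R, T]%classic `*` setT).
Let T0' : 0 <= T := ltW T0.

Let mG A : G T A -> measurable A. Proof. by case: fG => _ h _; exact: h. Qed.

Let aXG : adapted G X.
Proof. by move=> t t0 B mB; apply: FG => //; exact: aX. Qed.

Let muZ_points : {ae P, forall w, forall f : R * E -> \bar R, measurable_fun setT f -> (forall p, 0 <= f p)%E ->
  (\int[muZ w]_(p in strip) f p = \sum_(x <- points w) f x)%E}.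
Proof.
move: pair_jump_measure.
by apply: filterS => w h f mf f0; rewrite hmuZ; exact: h.
Qed.

Let muX_points : {ae P, forall w, forall f : R * E1 -> \bar R, measurable_fun setT f -> (forall p, 0 <= f p)%E ->
  (\int[muX w]_(p in strip) f p = \sum_(x <- points w | x.2.2 == 0%R) f (x.1, x.2.1))%E}.
Proof.
move: first_jump_measure.
by apply: filterS => w h f mf f0; rewrite hmuX; exact: h.
Qed.

Let mphi w B : measurable B -> measurable_fun `[0, T] (phi w ^~ B : R -> \bar R).
Proof. by move=> mB; apply: (predictable_path fG T0' (Y := fun w t => phi w t B)); exact: hphi. Qed.

Let mphiX w B : measurable B -> measurable_fun `[0, T] (phiX w ^~ B : R -> \bar R).
Proof. by move=> mB; apply: (predictable_path fG T0' (Y := fun w t => phiX w t B)); exact: hphiX. Qed.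

Let massZ : {ae P, forall w, forall t, 0 <= t <= T -> nuZ w (`]0%R, t] `*` setT) = (C w t)%:E}.
Proof.
by move: C_path hnuZdis; apply: filterS2 => w [h0 h1] h2 t tT; exact: (strip_mass h1 h0 h2).
Qed.

Let massX : {ae P, forall w, forall t, 0 <= t <= T -> nuX w (`]0%R, t] `*` setT) = (CX w t)%:E}.
Proof.
by move: CX_path hnuXdis; apply: filterS2 => w [h0 h1] h2 t tT; exact: (strip_mass h1 h0 h2).
Qed.

Let TT : 0 <= T <= T. Proof. by rewrite T0' lexx. Qed.

Let finZ : {ae P, forall w, (nuZ w strip < +oo)%E}.
Proof. by move: massZ; apply: filterS => w h; rewrite h ?ltry. Qed.

Let finX : {ae P, forall w, (nuX w strip < +oo)%E}.
Proof. by move: massX; apply: filterS => w h; rewrite h ?ltry. Qed.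

Let atomZ : {ae P, forall w, forall t, 0 < t <= T -> nuZ w ([set t] `*` setT) = 0%E}.
Proof.
apply: (step_compensator_atomless hnuZ) => // w A mA hA.
rewrite hmuZ; apply: (jump_measure_off_times _ _ hA) => t ht.
exact: pair_jump_off.
Qed.

Let atomX : {ae P, forall w, forall t, 0 < t <= T -> nuX w ([set t] `*` setT) = 0%E}.
Proof.
apply: (step_compensator_atomless hnuX) => // w A mA hA.
rewrite hmuX; apply: (jump_measure_off_times _ _ hA) => t ht.
exact: first_jump_off.
Qed.

Variable Mr : R.
Hypothesis hMr : 1 < Mr.
Local Notation kappa := (3 + Mr ^+ 4).
Hypothesis hexp : (\int[P]_w (expR (kappa * C w T))%:E < +oo)%E.

Let kappa1 : 1 <= kappa.
Proof. by apply: ler_wpDr; [apply: exprn_ge0; exact: ltW (lt_trans ltr01 hMr)|rewrite ler1n]. Qed.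

Let mCT : measurable_fun setT (fun w => C w T).
Proof. by move=> _ B mB; apply: mG; exact: (C_adapted T0' mB). Qed.

Let CT_ge0 : {ae P, forall w, 0 <= C w T}.
Proof. by move: massZ; apply: filterS => w h; rewrite -lee_fin -h. Qed.

Let CT_square : (\int[P]_w (C w T ^+ 2)%:E < +oo)%E.
Proof.
have mexp : measurable_fun setT (fun w => expR (kappa * C w T)).
  by apply: measurableT_comp => //; apply: measurable_funM.
apply: (@le_lt_trans _ _ (\int[P]_w (4%:E * (expR (kappa * C w T))%:E)))%E; last first.
  by rewrite ge0_integralZl//; [apply: lte_mul_pinfty|exact/measurable_EFinP].
apply: ae_ge0_le_integral => //.
- by move=> w _; rewrite lee_fin sqr_ge0.
- by apply/measurable_EFinP; exact: measurable_funX.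
- by apply/measurable_EFinP; exact: measurable_funM.
move: CT_ge0; apply: filterS => w c0 _; rewrite -EFinM lee_fin.
by rewrite (le_trans (exponential_dominates c0))// ler_pM2l// ler_expR ler_peMl.
Qed.

(** The two measures that [compensator_unique] identifies: the restriction of
    [mu^Z] to the marks [(x, 0)] is [mu^X], since [X] and [H] do not jump
    together, so both compensate [mu^X]. *)
Let nu12 (b : bool) w : {measure set (R * E1) -> \bar R} := if b then first_part (nuZ w) else nuX w.

Let D_meas (t : R) : measurable (`]0%R, t]%classic : set R). Proof. exact: measurable_itv. Qed.

Let first_field (V : (PrT * E1)%type -> R) : measurable_fun setT V ->
  measurable_fun setT ((fun q => V (q.1, q.2.1) * (q.2.2 == 0)%:R) : (PrT * E)%type -> R).
Proof.
move=> mV; apply: measurable_funM.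
  apply: (measurableT_comp mV); apply: measurable_fun_pair; first exact: measurable_fst.
  exact: (measurableT_comp measurable_fst measurable_snd).
rewrite (_ : (fun q => _) = \1_(setT `*` (setT `*` [set 0]))).
  apply: measurable_indic; apply: measurableX => //; apply: measurableX => //; exact: measurable_set1.
apply/funext => q; rewrite indicE; congr (nat_of_bool _)%:R; apply/eqP/idP.
  by move=> e; apply: mem_set; split => //; split.
by move=> /set_mem[_ []].
Qed.

Let first_partE (V : (PrT * E1)%type -> R) w t : measurable_fun setT V -> (forall q, 0 <= V q) ->
  (\int[first_part (nuZ w)]_(p in `]0%R, t] `*` setT) (V (w, p.1, p.2))%:E =
   \int[nuZ w]_(p in `]0%R, t] `*` setT) (V ((w, p.1), p.2.1) * (p.2.2 == 0)%:R)%:E)%E.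
Proof.
move=> mV V0; apply: (first_part_integral (nuZ w) (D_meas t)) => [|p]; last by rewrite lee_fin.
by apply/measurable_EFinP; exact: (field_section fG).
Qed.

Let first_unique_ge0 (V : (PrT * E1)%type -> R) : measurable_fun setT V -> (forall q, 0 <= V q) ->
  {ae P, forall w, \int[nuZ w]_(p in strip) (V ((w, p.1), p.2.1) * (p.2.2 == 0)%:R)%:E =
    \int[nuX w]_(p in strip) (V (w, p.1, p.2))%:E}%E.
Proof.
move=> mV V0; suff : {ae P, forall w, \int[nu12 true w]_(p in strip) (V (w, p.1, p.2))%:E =
    \int[nu12 false w]_(p in strip) (V (w, p.1, p.2))%:E}%E.
  by apply: filterS => w; rewrite /nu12 first_partE.
apply: (compensator_unique (nu := nu12) (k := fun w => C w T) T0 fG) => //.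
- case; last by case: hnuX.
  split => [w|W pW W0].
    apply/eqP; rewrite eq_le measure_ge0 andbT; have [[h _] _] := hnuZ; rewrite -(h w).
    by apply: first_part_le; exact: measurable_itv.
  have KA := predictable_all_times fG; have := field_patch (0 : R) KA pW; set V' := (X in measurable_fun _ X) => mV'.
  have V'0 q : 0 <= V' q by rewrite /V'; case: ifPn.
  have [[_ h] _] := hnuZ; have := h (fun w t x => V' ((w, t), x.1) * (x.2 == 0)%:R).
  have hf : predictable_field_on G (@all_times R _ Omega) (fun w t (x : E) => V' ((w, t), x.1) * (x.2 == 0)%:R).
    apply: (field_onT KA).
    rewrite (_ : (fun q => _) = (fun q : (PrT * E)%type => V' (q.1, q.2.1) * (q.2.2 == 0)%:R)).
      exact: first_field.
    by apply/funext => -[[w t] x].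
  move=> /(_ hf (fun w t x => mulr_ge0 (V'0 _) (ler0n _ _))).
  rewrite /predictable_on; congr measurable_wrt; apply/funext => -[w t] /=.
  rewrite -(first_partE w t mV' V'0); apply: eq_integral => -[s x] /set_mem[/=]; rewrite in_itv/= => /andP[s0 _] _.
  by rewrite /V' /= mem_set//; split => //=; rewrite in_itv/= andbT ltW.
- move=> W mW W0; have mW' := first_field mW.
  have W'0 (q : (PrT * E)%type) : 0 <= W (q.1, q.2.1) * (q.2.2 == 0)%:R by rewrite mulr_ge0.
  rewrite /= (_ : integral _ _ _ = \int[P]_w \int[nuZ w]_(p in strip) (W ((w, p.1), p.2.1) * (p.2.2 == 0)%:R)%:E)%E; last first.
    by apply: eq_integral => w _; rewrite first_partE.
  have <- := compensator_mean T0 fG hnuZ muZ_points mW' W'0; rewrite -(compensator_strip T0 fG hnuX mW W0).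
  apply: ae_eq_integral_nomeas; move: muX_points; apply: filterS => w h _.
  rewrite h; last 2 first.
  + by apply/measurable_EFinP; exact: (field_section fG).
  + by move=> p; rewrite lee_fin.
  rewrite -sumEFin big_mkcond [RHS]big_mkcond; apply: eq_bigr => x _ /=.
  by case: ifPn => _; rewrite ?mulr1 ?mulr0.
- move: massZ massX CX_le; apply: filterS3 => w hZ hX cx [] /=.
  + by rewrite (le_trans (first_part_le _ (D_meas T)))// hZ.
  + by rewrite hX// lee_fin.
- move: atomZ atomX; apply: filterS2 => w hZ hX [] t tT; last exact: hX.
  apply/eqP; rewrite -[X in X == _]/(first_part (nuZ w) ([set t] `*` setT)) -measure_le0 -(hZ t tT).
  by apply: first_part_le; exact: measurable_set1.
Qed.

Let first_unique (V : (PrT * E1)%type -> R) : measurable_fun setT V ->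
  {ae P, forall w, \int[nuZ w]_(p in strip) (V ((w, p.1), p.2.1) * (p.2.2 == 0)%:R)%:E =
    \int[nuX w]_(p in strip) (V (w, p.1, p.2))%:E}%E.
Proof.
move=> mV; have mp : measurable_fun setT (fun q => Num.max (V q) 0) by exact: measurable_maxr.
have mn : measurable_fun setT (fun q => Num.max (- V q) 0) by apply: measurable_maxr => //; exact: measurable_funN.
move: (first_unique_ge0 mp (fun q => ltac:(by rewrite le_max lexx orbT)))
  (first_unique_ge0 mn (fun q => ltac:(by rewrite le_max lexx orbT))); apply: filterS2 => w hp hn.
rewrite integralE [RHS]integralE; congr (_ - _)%E.
- rewrite [LHS](_ : _ = \int[nuZ w]_(p in strip) (Num.max (V ((w, p.1), p.2.1)) 0 * (p.2.2 == 0)%:R)%:E)%E.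
    rewrite hp; apply: eq_integral => p _; by rewrite funeposE -EFin_max.
  apply: eq_integral => p _; rewrite funeposE -EFin_max; congr _%:E.
  by case: eqP; rewrite ?mulr1 ?mulr0 ?maxxx.
- rewrite [LHS](_ : _ = \int[nuZ w]_(p in strip) (Num.max (- V ((w, p.1), p.2.1)) 0 * (p.2.2 == 0)%:R)%:E)%E.
    rewrite hn; apply: eq_integral => p _; by rewrite funenegE -EFin_max.
  apply: eq_integral => p _; rewrite funenegE -EFin_max; congr _%:E.
  by case: eqP; rewrite ?mulr1 ?mulr0 ?oppr0 ?maxxx.
Qed.

Let mtime : measurable_fun setT ((fun q => Num.max 0 q.1.2) : (PrT * E1)%type -> R).
Proof.
have m1 : measurable_fun setT (fst : (PrT * E1)%type -> PrT) by exact: measurable_fst.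
have := measurableT_comp (predictable_time fG) m1.
exact.
Qed.

(** The continuous parts: [d_1 dC = dC^X]. *)
Let first_times : {ae P, forall w, forall D : set R, measurable D ->
  nuZ w ((D `*` [set x : E | x.2 = 0]) `&` strip) = nuX w ((D `*` setT) `&` strip)}.
Proof.
pose V i : (PrT * E1)%type -> R := fun q => \1_(`]-oo, nratr R i]%classic : set R) (Num.max 0 q.1.2).
have mV i : measurable_fun setT (V i).
  apply: measurableT_comp; first by apply: measurable_indic; exact: measurable_itv.
  exact: mtime.
have : {ae P, forall w, forall i, \int[nuZ w]_(p in strip) (V i ((w, p.1), p.2.1) * (p.2.2 == 0)%:R)%:E =
    \int[nuX w]_(p in strip) (V i (w, p.1, p.2))%:E}%E.
  by apply: ae_foralln => i; exact: first_unique.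
move: finZ; apply: filterS2 => w hZ h.
have mz : measurable (setT `*` (setT `*` [set 0]) : set (R * E)).
  by apply: measurableX => //; apply: measurableX => //; exact: measurable_set1.
pose k (mD : measurable_fun setT (fst : R * E -> R)) : {measure set R -> \bar R} := measure_function_pushforward__canonical__measure_function_Measure
  (mrestr (strip_measure T (nuZ w)) mz) mD.
pose k' (mD : measurable_fun setT (fst : R * E1 -> R)) : {measure set R -> \bar R} := measure_function_pushforward__canonical__measure_function_Measure
  (strip_measure T (nuX w)) mD.
have kE D : k measurable_fst D = nuZ w ((D `*` [set x : E | x.2 = 0]) `&` strip).
  congr (nuZ w _); apply/seteqP; split => -[t [x y]] /=.
    by move=> [[Dt [_ [_ y0]]] s].
  by move=> [[Dt y0] s].
have k'E D : k' measurable_fst D = nuX w ((D `*` setT) `&` strip).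
  by congr (nuX w _); apply/seteqP; split => -[t x] /= [] // [].
move=> D mD; rewrite -kE -k'E; apply: measure_eq_rational_rays => //.
  rewrite kE; apply: le_lt_trans hZ; apply: le_measure; rewrite ?inE.
  - apply: measurableI; last exact: measurable_strip.
    rewrite (_ : _ `*` _ = setT `*` (setT `*` [set 0])) //.
    by apply/seteqP; split => -[t [x y]] /= []// _ [].
  - exact: measurable_strip.
  - exact: subIsetr.
move=> i; rewrite kE k'E; have mi : measurable (`]-oo, nratr R i]%classic : set R) by exact: measurable_itv.
have := h i.
rewrite (_ : (\int[nuZ w]_(p in strip) _)%E = nuZ w ((`]-oo, nratr R i] `*` [set x : E | x.2 = 0]) `&` strip)).
  rewrite (_ : (\int[nuX w]_(p in strip) _)%E = nuX w ((`]-oo, nratr R i] `*` setT) `&` strip))//.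
  rewrite -(@integral_indic _ _ _ (nuX w)); [|exact: measurable_strip|exact: measurableX].
  apply: eq_integral => -[t x] /set_mem[/=]; rewrite in_itv/= => /andP[t0 _] _.
  by rewrite /V/= max_r ?(ltW t0)// !indicE; congr (nat_of_bool _)%:R%:E; apply/idP/idP => /set_mem; [move=> ?; apply: mem_set|case=> ? _; apply: mem_set].
rewrite -(@integral_indic _ _ _ (nuZ w)); [|exact: measurable_strip|].
  apply: eq_integral => -[t x] /set_mem[/=]; rewrite in_itv/= => /andP[t0 _] _.
  rewrite /V/= max_r ?(ltW t0)// !indicE -natrM mulnb; congr (nat_of_bool _)%:R%:E; apply/andP/idP.
    by move=> [/set_mem ? /eqP ?]; apply: mem_set.
  by move=> /set_mem[/= ? ?]; split; [exact: mem_set|exact/eqP].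
rewrite (_ : _ `*` _ = `]-oo, nratr R i] `*` (setT `*` [set 0])).
  by apply: measurableX => //; apply: measurableX => //; exact: measurable_set1.
by apply/seteqP; split => -[t [x y]] /= []// ? [].
Qed.

Let nuX_kernel B : measurable B -> measurable_fun setT (fun w => nuX w (B `&` strip)).
Proof.
move=> mB; pose V : (PrT * E1)%type -> R := fun q => \1_B (Num.max 0 q.1.2, q.2).
have mV : measurable_fun setT V.
  apply: measurableT_comp; first exact: measurable_indic.
  apply: measurable_fun_pair; last exact: measurable_snd.
  exact: mtime.
have V0 q : 0 <= V q by rewrite /V indicE.
have := measurable_nu_integral fG hnuX T0' mV V0.
congr measurable_fun; apply/funext => w.
rewrite -(@integral_indic _ _ _ (nuX w)); [|exact: measurable_strip|by []].
apply: eq_integral => -[t x] /set_mem[/=]; rewrite in_itv/= => /andP[t0 _] _.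
by rewrite /V/= max_r// ltW.
Qed.

(** A set that is null for [d_1 dC dP], as in the selection of [ustar], is null
    for [dC^X] on almost every path. *)
Let dCX_null (N : set (Omega * R)) : measurable N ->
  (\int[P]_w \int[dS (C w)]_(t in `]0%R, T])
     ((\int[phi w t]_x (\1_[set x : E | x.2 = 0] x)%:E) * (\1_N (w, t))%:E) = 0)%E ->
  {ae P, forall w, {ae dS (CX w), forall t, `]0%R, T]%classic t -> ~ N (w, t)}}.
Proof.
move=> mN I0; pose Nw w : set R := [set t | N (w, t)].
have mNw w : measurable (Nw w).
  by have := measurable_xsection w mN; congr measurable; apply/seteqP; split => t; rewrite /xsection /= inE.
have m0 : measurable [set x : E | x.2 = 0].
  have := @measurableX _ _ E1 R setT [set 0] measurableT (measurable_set1 _); congr measurable.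
  by apply/seteqP; split => -[x y] /=; [case|].
have e : {ae P, forall w, (\int[dS (C w)]_(t in `]0%R, T])
     ((\int[phi w t]_x (\1_[set x : E | x.2 = 0] x)%:E) * (\1_N (w, t))%:E) = nuX w ((Nw w `*` setT) `&` strip))%E}.
  move: hnuZdis first_times; apply: filterS2 => w h1 h2; rewrite -(h2 _ (mNw w)) h1; last exact: measurableX.
  apply: eq_integral => t _; rewrite integral_indic// setIT indicE; case: (boolP ((w, t) \in N)) => Nt.
    rewrite mule1; congr (phi w t _); apply/seteqP; split => x /=; last by case.
    by move=> x0; split => //; exact: set_mem.
  rewrite mule0 (_ : [set x | _] = set0) ?measure0//.
  by apply/seteqP; split => // x [/= h _]; move: Nt; rewrite (mem_set (h : N (w, t))).
pose l w : {measure set (R * E1) -> \bar R} :=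
  if (nuX w strip < +oo)%E then strip_measure T (nuX w) else mzero.
have mf : measurable_fun setT (fun w => nuX w strip).
  by have := nuX_kernel measurableT; congr measurable_fun; apply/funext => w; rewrite setTI.
have lfin w : (l w setT < +oo)%E.
  by rewrite /l; case: ifPn => h; [exact: strip_measure_fin|rewrite /= /mzero ltry].
have ml B : measurable B -> measurable_fun setT (l ^~ B).
  move=> mB; rewrite (_ : l ^~ B = fun w => if (nuX w strip < +oo)%E then nuX w (B `&` strip) else 0%E).
    apply: measurable_fun_if => //; first by apply: measurable_fun_lte.
    by apply: measurable_funTS; exact: nuX_kernel.
  by apply/funext => w; rewrite /l; case: ifPn.
pose f (q : Omega * (R * E1)) : \bar R := (\1_N (q.1, q.2.1))%:E.
have mfN : measurable_fun setT f.
  apply/measurable_EFinP; apply: measurableT_comp; first exact: measurable_indic.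
  apply: measurable_fun_pair; first exact: measurable_fst.
  exact: (measurableT_comp measurable_fst measurable_snd).
have mI := measurable_fun_integral_fam lfin ml mfN (fun q => ltac:(by rewrite lee_fin indicE)).
have eI : {ae P, forall w, (\int[l w]_p f (w, p) = nuX w ((Nw w `*` setT) `&` strip))%E}.
  move: finX; apply: filterS => w hw; rewrite /l hw.
  rewrite (_ : (fun p => f (w, p)) = (fun p => (\1_(Nw w `*` (setT : set E1)) p)%:E)).
    by rewrite integral_indic ?setIT//; exact: measurableX.
  apply/funext => -[t x]; rewrite /f /= !indicE; congr (nat_of_bool _)%:R%:E.
  by apply/idP/idP => /set_mem; [move=> ?; apply: mem_set|case=> ? _; apply: mem_set].
have I0' : (\int[P]_w `|\int[l w]_p f (w, p)| = 0)%E.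
  rewrite -I0; apply: ae_eq_integral_nomeas; move: e eI; apply: filterS2 => w -> -> _.
  by rewrite gee0_abs.
have /(ae_eq_integral_abs P measurableT mI) := I0'.
move=> h2; have : {ae P, forall w, nuX w ((Nw w `*` setT) `&` strip) = 0%E}.
  by move: eI h2; apply: filterS2 => w -> /(_ Logic.I).
move: CX_path hnuXdis; apply: filterS3 => w [_ h3] h5 {}h2.
exists (Nw w `&` `]0%R, T]); split.
- exact: (measurableI _ _ (mNw w) (measurable_itv `]0, T])).
- by rewrite -(strip_times h5).
- by move=> t /= /not_implyP[tT /contrapT Nt].
Qed.

Let left_equal : {ae P, forall w, {ae dS (CX w), forall t, `]0%R, T]%classic t -> left_limit (X w) t = X w t}}.
Proof.
move: atomX CX_path hnuXdis; apply: filterS3 => w h1 [h2 h3] h4.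
have h := ae_off_times h4 (tau_ ^~ w) h1.
apply: (@filterS _ _ (ae_filter_ringOfSetsType (dS (CX w))) _ _ _ h) => t ht tT.
have := step_jump_off (ht tT); rewrite /jump => /eqP; rewrite subr_eq0 => /eqP ->.
by [].
Qed.

Context (dU : measure_display) (U : measurableType dU).
Variables (r l : Omega -> R -> 'rV[R]_d -> U -> R) (Ml : R).
Hypothesis hr : predictable_field_on G (@horizon R d0 Omega T) (fun w t (z : 'rV[R]_d * U) => r w t z.1 z.2).
Hypothesis hl : predictable_field_on G (@horizon R d0 Omega T) (fun w t (z : 'rV[R]_d * U) => l w t z.1 z.2).
Hypothesis hrb : {ae P, forall w, forall t x v, 0 <= t <= T -> 0 <= r w t x v <= Mr}.
Hypothesis hlb : {ae P, forall w, forall t x v, 0 <= t <= T -> `|l w t x v| <= Ml}.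
Variables (beta : R) (Theta : Omega -> R -> 'rV[R]_d * R -> R).
Hypothesis beta0 : 0 < beta.
Hypothesis hTheta : L2_field P G T C phi beta Theta.
Local Notation hor := (@horizon R d0 Omega T).

Let KH : predictable G hor := predictable_horizon fG T0'.

Let in_hor w t : 0 <= t <= T -> (w, t) \in hor.
Proof. by move=> tT; apply: mem_set; split => //=; rewrite in_itv. Qed.

Let Th (q : (PrT * E)%type) : R := if q.1 \in hor then Theta q.1.1 q.1.2 q.2 else 0.

Let mTh : measurable_fun setT Th. Proof. exact: (field_patch (0 : R) KH hTheta.1). Qed.

Let ThE w t x : 0 <= t <= T -> Th ((w, t), x) = Theta w t x.
Proof. by move=> tT; rewrite /Th in_hor. Qed.

Let mass w := fine (strip_measure T (nuZ w) setT).

Let massE : {ae P, forall w, mass w = C w T}.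
Proof.
by move: massZ; apply: filterS => w h; rewrite /mass /strip_measure /= /mrestr setTI h.
Qed.

Let expint : (\int[P]_w (expR (kappa * mass w))%:E < +oo)%E.
Proof.
apply: le_lt_trans hexp; rewrite le_eqVlt; apply/predU1P; left; apply: ae_eq_integral_nomeas.
by move: massE; apply: filterS => w ->.
Qed.

Let Th_square : (\int[P]_w \int[nuZ w]_(p in strip) (Th (w, p.1, p.2) ^+ 2 * expR (beta * C w p.1))%:E < +oo)%E.
Proof.
apply: le_lt_trans hTheta.2; rewrite le_eqVlt; apply/predU1P; left; apply: ae_eq_integral_nomeas.
move: C_path hnuZdis; apply: filterS2 => w [c0 cinc] hd _.
pose f (p : R * E) : \bar R := (Th (w, p.1, p.2) ^+ 2 * expR (beta * nonneg_time (C w) p.1))%:E.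
have mf : measurable_fun setT f.
  apply/measurable_EFinP; apply: measurable_funM; first by apply: measurable_funX; exact: (field_section fG).
  apply: measurableT_comp => //; apply: measurable_funM => //.
  have mC : measurable_fun setT (nonneg_time (C w)) by case: cinc => nd _; exact: nondecreasing_measurable.
  exact: (measurableT_comp mC measurable_fst).
have f0 p : (0 <= f p)%E by rewrite lee_fin mulr_ge0// ?sqr_ge0 ?expR_ge0.
have CE t : 0 < t -> nonneg_time (C w) t = C w t by move=> t0; rewrite /nonneg_time max_r// ltW.
transitivity (\int[nuZ w]_(p in strip) f p)%E.
  apply: eq_integral => -[t x] /set_mem[/=]; rewrite in_itv/= => /andP[t0 _] _.
  by rewrite /f /= CE.
rewrite (ge0_strip_integral (fun B => @mphi w B) hd mf f0); apply: eq_integral => t /set_mem/=; rewrite in_itv/= => /andP[t0 tT].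
apply: eq_integral => x _; rewrite /f /= CE// ThE ?(ltW t0)//.
by rewrite real_normK ?num_real// mulrC.
Qed.

Let weight w := Mr ^+ size (points w) * expR (mass w).

Let Th_weighted : (\int[P]_w ((weight w)%:E * \int[nuZ w]_(p in strip) `|Th (w, p.1, p.2)|%:E) < +oo)%E.
Proof.
apply: (weighted_integrable T0 fG positive_jumps_stop positive_jumps_gt0 jump_marks_stop hnuZ muZ_points positive_jumps_distinct finZ atomZ hMr expint beta0 mTh _ Th_square).
by move: massZ; apply: filterS => w h t /andP[t0 tT]; rewrite h ?(ltW t0).
Qed.

Let Th_fin : {ae P, forall w, (\int[nuZ w]_(p in strip) `|Th (w, p.1, p.2)|%:E < +oo)%E}.
Proof.
pose I w := (\int[nuZ w]_(p in strip) `|Th (w, p.1, p.2)|%:E)%E.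
have I0 w : (0 <= I w)%E by apply: integral_ge0 => p _; rewrite lee_fin.
have mI : measurable_fun setT I.
  apply: (measurable_nu_integral fG hnuZ (W := fun q => `|Th q|)) => //.
  exact: measurableT_comp.
have w1 w : 1 <= weight w.
  rewrite -[1]mulr1 ler_pM ?ler01//; first by rewrite exprn_ege1// ltW.
  by rewrite -expR0 ler_expR fine_ge0.
have wI0 w : (0 <= (weight w)%:E * I w)%E by rewrite mule_ge0// lee_fin (le_trans ler01).
have /(integrable_ae measurableT) : P.-integrable setT I.
  apply/integrableP; split => //; apply: le_lt_trans Th_weighted.
  under eq_integral do rewrite gee0_abs//.
  rewrite !ge0_integralTE//; apply: ereal_sup_le => _ [h hI <-]; exists h => // w.
  by rewrite (le_trans (hI w))// -[leLHS]mul1e lee_wpmul2r// lee_fin.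
apply: filterS => w /(_ Logic.I); rewrite ge0_fin_numE//; exact: I0.
Qed.

(** The fields of a control [u], extended from the horizon to all times. *)
Let ut (u : Omega -> R -> U) (p : PrT) : U := if p \in hor then u p.1 p.2 else point.
Let rt (q : (PrT * (E1 * U))%type) : R := if q.1 \in hor then r q.1.1 q.1.2 q.2.1 q.2.2 else 0.
Let lt_ (q : (PrT * (E1 * U))%type) : R := if q.1 \in hor then l q.1.1 q.1.2 q.2.1 q.2.2 else 0.
Let Xm (p : PrT) : E1 := if p \in (setT `*` [set t : R | 0 < t] : set (Omega * R)) then left_limit (X p.1) p.2 else point.
Let oc : set (PrT * E) := (setT `*` `]0, T]) `*` (setT `*` [set 0]).
Let H u (q : (PrT * E)%type) : R := (Num.min Mr (Num.max 0 (rt (q.1, (q.2.1, ut u q.1)))) - 1) * \1_oc q.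
Let lam u (p : PrT) : R := lt_ (p, (Xm p, ut u p)).
Let V u (q : (PrT * E1)%type) : R := Th (q.1, (q.2, 0)) * H u (q.1, (q.2, 0)).

Let mut u : admissible G T u -> measurable_fun setT (ut u).
Proof. by move=> hu; exact: (predictable_patch point KH hu). Qed.

Let mrt : measurable_fun setT rt. Proof. exact: (field_patch (0 : R) KH hr). Qed.
Let mlt : measurable_fun setT lt_. Proof. exact: (field_patch (0 : R) KH hl). Qed.

Let mXm : measurable_fun setT Xm.
Proof.
have K0 : predictable G (setT `*` [set t : R | 0 < t]).
  by apply: predictable_ray => //; apply: salgT; case: fG => h _ _; exact: h.
have left_const : forall w t, exists c, exists2 e, 0 < e & forall s, t - e <= s < t -> X w s = c.
  move=> w t; have [e e0 he] := times_left (tau_lf w) t.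
  exists (X w (t - e)); exists e => // s hs; apply: (step_eq (XE w)) => n.
  by rewrite !(he n)// lexx ltrBlDr ltrDl.
have m := predictable_patch point K0 (predictable_left_limit fG aXG left_const).
exact: m.
Qed.

Let moc : measurable oc.
Proof.
apply: measurableX; last by apply: measurableX => //; exact: measurable_set1.
by rewrite measurable_g_salgebraE; [exact: (predictable_oc fG)|exact: predictable_salg].
Qed.

Let mH u : admissible G T u -> measurable_fun setT (H u).
Proof.
move=> hu; apply: measurable_funM; last exact: measurable_indic.
apply: measurable_funB => //; apply: measurable_minr => //; apply: measurable_maxr => //.
apply: (measurableT_comp mrt); apply: measurable_fun_pair; first exact: measurable_fst.
apply: measurable_fun_pair; first exact: (measurableT_comp measurable_fst measurable_snd).
exact: (measurableT_comp (mut hu) measurable_fst).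
Qed.

Let H_bound u q : 0 <= 1 + H u q <= Mr.
Proof.
rewrite /H indicE; case: (q \in oc); rewrite ?mulr1 ?mulr0; last by rewrite addr0 ler01 ltW.
have M0 : 0 <= Mr by rewrite (le_trans ler01)// ltW.
by rewrite addrC subrK le_min M0 ge_min lexx /= le_max lexx.
Qed.

Let H_supp u (q : Omega * R * E) : ~~ (0 < q.1.2 <= T) -> H u q = 0.
Proof.
move=> nq; rewrite /H indicE memNset ?mulr0// => -[[_ /=]]; rewrite in_itv/= => h.
by move: nq; rewrite h.
Qed.

Let HE u w : (forall t x v, 0 <= t <= T -> 0 <= r w t x v <= Mr) ->
  forall t x, 0 < t <= T -> H u ((w, t), x) = jump_density r w t x (u w t) - 1.
Proof.
move=> rb t x tT; have tT' : 0 <= t <= T by case/andP: tT => t0 ->; rewrite ltW.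
rewrite /H /jump_density indicE /rt /ut /= in_hor//.
have [x0|x0] := eqVneq x.2 0.
  rewrite mem_set; last by split; split.
  rewrite !mulr1 addr0; have /andP[r0 rM] := rb t x.1 (u w t) tT'.
  by rewrite max_r// min_r.
by rewrite memNset ?mulr0 ?add0r ?subrr// => -[_ [_ /= e]]; rewrite e eqxx in x0.
Qed.

Let mlam u : admissible G T u -> measurable_fun setT (lam u).
Proof.
move=> hu; have m2 := measurable_fun_pair_in mXm (mut hu).
have m1 : measurable_fun setT (id : PrT -> PrT) by exact: measurable_id.
exact: (measurableT_comp mlt (measurable_fun_pair_in m1 m2)).
Qed.

Let lamE u w t : 0 < t <= T -> lam u (w, t) = l w t (left_limit (X w) t) (u w t).
Proof.
move=> tT; have tT' : 0 <= t <= T by case/andP: tT => t0 ->; rewrite ltW.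
rewrite /lam /lt_ /ut /= in_hor// /Xm /= mem_set//; split => //=; by case/andP: tT.
Qed.

Let mV u : admissible G T u -> measurable_fun setT (V u).
Proof.
move=> hu; have mm : measurable_fun setT ((fun q => (q.1, (q.2, 0))) : (PrT * E1)%type -> (PrT * E)%type).
  by apply: measurable_fun_pair; [exact: measurable_fst|apply: measurable_fun_pair => //; exact: measurable_snd].
by apply: measurable_funM; [exact: (measurableT_comp mTh mm)|exact: (measurableT_comp (mH hu) mm)].
Qed.

Let H_first u (q : (PrT * E)%type) : H u q = H u (q.1, (q.2.1, 0)) * (q.2.2 == 0)%:R.
Proof.
rewrite /H /= -mulrA; congr (_ * _); rewrite !indicE -natrM mulnb; congr (nat_of_bool _)%:R.
apply/idP/andP => [/set_mem[h1 [_ /= h2]]|[/set_mem[h1 _] /eqP h2]].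
  by split; [apply: mem_set; split => //; split|exact/eqP].
by apply: mem_set; split => //; split.
Qed.

Let nuZ_V u : admissible G T u ->
  {ae P, forall w, (\int[nuZ w]_(p in strip) (Th (w, p.1, p.2) * H u (w, p.1, p.2)))%R =
    \int[nuX w]_(p in strip) V u (w, p.1, p.2)}.
Proof.
move=> hu; move: (first_unique (mV hu)); apply: filterS => w h; rewrite /Rintegral -h.
congr fine; apply: eq_integral => -[t [x y]] _; rewrite /V /= H_first /= mulrA; congr _%:E.
by case: eqP => [->|_]; rewrite ?mulr1 ?mulr0.
Qed.

Let H_le u q : `|H u q| <= Mr.
Proof. by have /andP[h1 h2] := H_bound u q; have := hMr; rewrite ler_norml; lra. Qed.

Let V_fin u : admissible G T u -> {ae P, forall w, (\int[nuX w]_(p in strip) `|V u (w, p.1, p.2)|%:E < +oo)%E}.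
Proof.
move=> hu; have mVa : measurable_fun setT (fun q => `|V u q|) by apply: measurableT_comp => //; exact: mV.
have mTha : measurable_fun setT (fun q => `|Th q|) by exact: measurableT_comp.
move: (first_unique mVa) Th_fin; apply: filterS2 => w <- hT.
have M0 : 0 <= Mr by rewrite (le_trans ler01)// ltW.
apply: (@le_lt_trans _ _ (\int[nuZ w]_(p in strip) (Mr%:E * `|Th (w, p.1, p.2)|%:E))%E); last first.
  rewrite ge0_integralZl//; [exact: lte_mul_pinfty|exact: measurable_strip|].
  by apply/measurable_EFinP/measurable_funTS; exact: (field_section fG w mTha).
apply: ge0_le_integral => //; first exact: measurable_strip.
- by apply/measurable_EFinP/measurable_funTS; exact: (field_section fG w (first_field mVa)).
- apply: emeasurable_funM => //; apply/measurable_EFinP/measurable_funTS; exact: (field_section fG w mTha).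
move=> -[t [x y]] _; rewrite -EFinM lee_fin /V /= normrM; case: eqP => [->|_]; last by rewrite mulr0 mulr_ge0.
by rewrite mulr1 mulrC ler_wpM2r.
Qed.

Let lam_bound u : {ae P, forall w, forall t, 0 < t <= T -> `|lam u (w, t)| <= Ml}.
Proof.
move: hlb; apply: filterS => w h t tT; rewrite lamE//; apply: h.
by case/andP: tT => t0 ->; rewrite ltW.
Qed.

Let ham u w t := hamiltonian phiX l r w t (left_limit (X w) t) (Theta w t) (u w t).

Let ham_integral u : admissible G T u -> {ae P, forall w, (dS (CX w)).-integrable `]0, T] (ham u w) /\
  (\int[dS (CX w)]_(t in `]0%R, T]) ham u w t =
   (\int[dS (CX w)]_(t in `]0%R, T]) lam u (w, t) + \int[nuX w]_(p in strip) V u (w, p.1, p.2))%:E)%E}.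
Proof.
move=> hu; move: CX_path hnuXdis (V_fin hu) => c1 c2; apply: filterS3 (filterI c1 c2) (filterI hrb (lam_bound u)).
move=> w [[c0 cinc] hd] [rb lb] vf.
have mVw := field_section fG w (mV hu); have mlw : measurable_fun setT (fun t => lam u (w, t)).
  exact: (measurableT_comp (predictable_fun_measurable fG (mlam hu)) (measurable_pair1 w)).
have [h1 h2] := hamiltonian_integral T0 cinc (fun B => @mphiX w B) hd mVw vf mlw lb.
have e t : `]0%R, T]%classic t -> ham u w t = ((lam u (w, t))%:E + \int[phiX w t]_x (V u ((w, t), x))%:E)%E.
  rewrite /= in_itv/= => tT; rewrite /ham /hamiltonian lamE//; congr (_ + _)%E; apply: eq_integral => x _.
  have tT' : 0 <= t <= T by case/andP: tT => t0 ->; rewrite ltW.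
  rewrite /V /= (HE u rb)// ThE// /jump_density /= eqxx mulr1 addr0.
  by [].
split; last by rewrite -h2; apply: eq_integral => t /set_mem; exact: e.
by move: h1; apply: eq_integrable; [exact: measurable_itv|move=> t /set_mem tT; rewrite e].
Qed.

Let lam_integral u : admissible G T u -> {ae P, forall w,
  \int[dS (CX w)]_(t in `]0%R, T]) lam u (w, t) = \int[nuX w]_(p in strip) lam u (w, p.1)}.
Proof.
move=> hu; move: CX_path hnuXdis finX => c1 c2 c3; apply: filterS3 (filterI c1 c2) c3 (lam_bound u).
move=> w [[c0 cinc] hd] fx lb.
have mlw : measurable_fun setT (fun t => lam u (w, t)).
  exact: (measurableT_comp (predictable_fun_measurable fG (mlam hu)) (measurable_pair1 w)).
have mf : measurable_fun setT (fun p : R * E1 => lam u (w, p.1)) by exact: measurableT_comp mlw measurable_fst.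
have ff : (\int[nuX w]_(p in strip) `|lam u (w, p.1)|%:E < +oo)%E.
  apply: (@le_lt_trans _ _ (\int[nuX w]_(p in strip) (cst Ml%:E p))%E).
    apply: ge0_le_integral => //; first exact: measurable_strip.
    - by apply/measurable_EFinP/measurable_funTS; exact: measurableT_comp.
    - by move=> p [/=]; rewrite in_itv/= => /lb; rewrite lee_fin.
  apply: (@le_lt_trans _ _ (Ml%:E * nuX w strip))%E; first by rewrite integral_cst//; exact: measurable_strip.
  have Ml0 : 0 <= Ml by apply: le_trans (normr_ge0 _) (lb T _); rewrite T0 lexx.
  exact: lte_mul_pinfty.
have [_] := hamiltonian_integral T0 cinc (fun B => @mphiX w B) hd mf ff (measurable_cst (0 : R)) (fun t _ => ltac:(by rewrite normr0)).
have z : \int[dS (CX w)]_(t in `]0%R, T]) (cst 0 t : R) = 0.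
  by rewrite /Rintegral (_ : integral _ _ _ = 0%E)//; exact: integral0_eq.
rewrite z add0r => h.
transitivity (fine (\int[nuX w]_(p in strip) lam u (w, p.1))%:E) => //; rewrite -h; congr fine; apply: eq_integral => t _.
rewrite add0e; apply/esym; apply: (etrans (integral_cst (phiX w t) measurableT (lam u (w, t))%:E)).
transitivity ((lam u (w, t))%:E * 1)%E; last exact: mule1.
by congr (_ * _)%E; exact: probability_setT.
Qed.

Variables (g : Omega -> 'rV[R]_d -> R) (L : (Omega -> R -> U) -> Omega -> R -> R).
Hypothesis hg : measurable_wrt (prod_salgebra (G T) measurable) setT (fun p : Omega * 'rV[R]_d => g p.1 p.2).
Hypothesis hL : forall u : Omega -> R -> U, admissible G T u -> doleans_dade P G T muZ nuZ r u (L u).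
Variables (Y : Omega -> R -> R) (ustar : Omega -> R -> U).
Hypothesis hY : progressive G T Y.
Hypothesis hbsde : bsde P T muZ nuZ CX X g (driver phiX l r) Y Theta.
Hypothesis hustar : admissible G T ustar.
Hypothesis hstar : minimizing_control P T C phi phiX l r X Theta ustar.

Let gain u w := \int[nuX w]_(p in strip) lam u (w, p.1) + g w (X w T).

Let Gs t : 0 <= t -> sigma_algebra setT (G t). Proof. by case: fG => h _ _; exact: h. Qed.

Let mgX : measurable_fun setT (fun w => g w (X w T)).
Proof.
move=> _ B mB; have := hg mB; rewrite prod_salgebraE; last exact: Gs.
rewrite setTI => hB.
have mid : measurable_fun setT (id : Omega -> g_sigma_algebraType (G T)).
  by move=> _ A mA; rewrite setTI; apply: mG; move: mA; rewrite measurable_g_salgebraE//; exact: Gs.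
by have := measurable_fun_pair_in mid (mX T) measurableT hB; rewrite setTI.
Qed.

Let mgain u : admissible G T u -> measurable_fun setT (gain u).
Proof.
move=> hu; apply: measurable_funD => //; apply: (measurable_nu_Rintegral fG hnuX T0' (W := fun q => lam u q.1)).
by apply: (measurableT_comp (mlam hu)); exact: measurable_fst.
Qed.

Let gainE u : admissible G T u ->
  {ae P, forall w, (\int[dS (CX w)]_(t in `]0%R, T]) l w t (X w t) (u w t)) + g w (X w T) = gain u w}.
Proof.
move=> hu; move: (lam_integral hu) left_equal; apply: filterS2 => w h1 h2; rewrite /gain -h1; congr (_ + _).
congr fine; apply: ae_eq_integral_nomeas.
apply: (@filterS _ _ (ae_filter_ringOfSetsType (dS (CX w))) _ _ _ h2) => t ht tT.
by rewrite lamE ?ht//; move: tT; rewrite /= in_itv.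
Qed.

Let star_ae : {ae P, forall w, {ae dS (CX w), forall t, `]0%R, T]%classic t ->
  driver phiX l r w t (left_limit (X w) t) (Theta w t) = ham ustar w t}}.
Proof.
case: hstar => N [mN I0 hN]; move: (dCX_null mN I0); apply: filterS => w h.
apply: (@filterS _ _ (ae_filter_ringOfSetsType (dS (CX w))) _ _ _ h) => t ht tT; apply: hN; last exact: ht.
by move: tT; rewrite /= in_itv/= => /andP[t0 ->]; rewrite ltW.
Qed.

Let hamI u w := \int[dS (CX w)]_(t in `]0%R, T]) lam u (w, t) + \int[nuX w]_(p in strip) V u (w, p.1, p.2).

Let hamI_le u : admissible G T u -> {ae P, forall w, hamI ustar w <= hamI u w}.
Proof.
move=> hu; move: star_ae (ham_integral hustar) (ham_integral hu); apply: filterS3 => w h [i1 e1] [i2 e2].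
rewrite -lee_fin -[leLHS]e1 -[leRHS]e2.
apply: (integral_mono_integrable (m := dS (CX w)) (measurable_itv `]0, T]) i1 (measurable_int _ i2)).
apply: (@filterS _ _ (ae_filter_ringOfSetsType (dS (CX w))) _ _ _ h) => t ht tT.
by rewrite -ht//; apply: ereal_inf_lbound; exists (u w t).
Qed.

Let sumTh w := \sum_(x <- points w) Th (w, x.1, x.2).
Let intTh w := \int[nuZ w]_(p in strip) Th (w, p.1, p.2).

Let strip_Theta (m : {measure set (R * E) -> \bar R}) w :
  \int[m]_(p in strip) Theta w p.1 p.2 = \int[m]_(p in strip) Th (w, p.1, p.2).
Proof.
congr fine; apply: eq_integral => -[t x] /set_mem[/=]; rewrite in_itv/= => /andP[t0 tT] _.
by rewrite ThE// ltW.
Qed.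

Let bsde0 : {ae P, forall w, Y w 0 + (sumTh w - intTh w) = g w (X w T) + hamI ustar w}.
Proof.
have hb' : {ae P, forall w, forall t, 0 <= t <= T -> _} := hbsde.
move: (ham_integral hustar); apply: filterS3 (filterI muZ_points hb') (filterI star_ae left_equal).
move=> w [hp /(_ 0) hb] [hs hl'] [_ e]; apply: EFin_inj; rewrite EFinD.
have {hb} := hb (ltac:(by rewrite lexx T0')).
rewrite /compensated_integral !strip_Theta (Rint_points hp (lexx T)); last exact: (field_section fG w mTh).
rewrite (_ : \sum_(x <- points w) _ = sumTh w); last first.
  apply: eq_big_seq => x /(points_in positive_jumps_gt0) /andP[_ ->]; rewrite mulr1.
  by [].
rewrite -EFinD => ->; rewrite EFinD -e; congr (_ + _)%E; apply: ae_eq_integral_nomeas.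
apply: (@filterS2 _ _ (ae_filter_ringOfSetsType (dS (CX w))) _ _ _ _ hs hl') => t h1 h2 tT.
by rewrite -(h2 tT) h1.
Qed.

Let mart u w := sumTh w - \int[nuZ w]_(p in strip) (Th (w, p.1, p.2) * (1 + H u (w, p.1, p.2))).

Let martE u : admissible G T u ->
  {ae P, forall w, mart u w = sumTh w - intTh w - \int[nuX w]_(p in strip) V u (w, p.1, p.2)}.
Proof.
move=> hu; move: Th_fin (nuZ_V hu); apply: filterS2 => w hf <-; rewrite /mart -addrA -opprD; congr (_ - _).
have mI := @measurable_strip R _ E 0 T; have mThw := field_section fG w mTh; have mHw := field_section fG w (mH hu).
have i1 : (nuZ w).-integrable strip (fun p => (Th (w, p.1, p.2))%:E).
  by apply/integrableP; split; [exact/measurable_EFinP/measurable_funTS|].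
have i2 : (nuZ w).-integrable strip (fun p => (Th (w, p.1, p.2) * H u (w, p.1, p.2))%:E).
  apply: (le_integrable mI _ _ (integrableZl mI Mr i1)).
    by apply/measurable_EFinP/measurable_funTS; exact: measurable_funM.
  move=> p _; rewrite -EFinM !abse_EFin lee_fin (normrM (Th _)) (normrM Mr) mulrC; apply: ler_wpM2r => //.
  exact: le_trans (H_le _ _) (ler_norm _).
rewrite -RintegralD//; congr fine; apply: eq_integral => p _.
by rewrite mulrDr mulr1.
Qed.

(** The BSDE at time 0 eliminates [g (X_T)]; the integral of [Theta (1 + H u)]
    brings in the part of the hamiltonian that depends on [Theta]. *)
Let gain_decomposition u : admissible G T u ->
  {ae P, forall w, gain u w = Y w 0 + mart u w + (hamI u w - hamI ustar w)}.
Proof.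
move=> hu; move: bsde0 (martE hu) (lam_integral hu); apply: filterS3 => w h1 -> h3.
rewrite /gain -h3 {1}/hamI; move: h1; set a := \int[dS (CX w)]_(_ in _) _; lra.
Qed.

Let Y0_constant : exists y0, {ae P, forall w, Y w 0 = y0}.
Proof.
have hX0 := step_initial.
have [w0 h0] : exists w0, X w0 0 = 0.
  apply: contrapT => h; have : P setT = 0%E.
    have [N [mN N0 hN]] := hX0; apply: (subset_measure0 (A := setT) (B := N)) => // w _.
    by apply: hN => /= e; apply: h; exists w.
  by rewrite probability_setT => /eqP; rewrite onee_eq0.
exists (Y w0 0); move: hX0; apply: filterS => w hw.
have G0 : G 0 [set w' | Y w' 0 = Y w0 0].
  have := hY (t := 0) (ltac:(by rewrite lexx T0')) (measurable_set1 (Y w0 0)).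
  rewrite prod_salgebraE; last exact: Gs.
  move=> /(measurable_ysection (0 : R)); rewrite measurable_g_salgebraE; last exact: Gs.
  congr (G 0); apply/seteqP; split => w' /=; rewrite /ysection /= inE /=; first by case.
  by move=> e; split => //; split => //=; rewrite in_itv/= lexx.
exact: (initial_trivial G0 h0 hw).
Qed.

Let L_adapted u : admissible G T u -> adapted G (L u). Proof. by move=> /hL[]. Qed.

Let L_eq u : admissible G T u -> {ae P, forall w, cadlag_on T (L u w) /\
  forall t, 0 <= t <= T -> L u w t = 1 + compensated_integral (muZ w) (nuZ w) `]0, t]
    (fun s x => left_limit (L u w) s * H u ((w, s), x))}.
Proof.
move=> hu; have [_ h] := hL hu; move: h hrb; apply: filterS2 => w [h1 h2] rb; split => // t tT; rewrite h2//.
have e (m : {measure set (R * E) -> \bar R}) : \int[m]_(p in `]0, t] `*` setT) (left_limit (L u w) p.1 * (jump_density r w p.1 p.2 (u w p.1) - 1))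
   = \int[m]_(p in `]0, t] `*` setT) (left_limit (L u w) p.1 * H u (w, p.1, p.2)).
  congr fine; apply: eq_integral => -[s x] /set_mem[/=]; rewrite in_itv/= => /andP[s0 st] _.
  by rewrite (HE u rb)// s0 (le_trans st)//; case/andP: tT.
by rewrite /compensated_integral !e.
Qed.

Let L_pos u : admissible G T u -> {ae P, forall w, 0 <= L u w T}.
Proof.
move=> hu; have := doleans_bound T0 fG positive_jumps_gt0 muZ_points positive_jumps_distinct finZ atomZ hMr (mH hu) (H_bound u) (H_supp u) (L_adapted hu) (L_eq hu).
by apply: filterS => w /andP[].
Qed.

Let L_mean u : admissible G T u -> P.-integrable setT (fun w => (L u w T)%:E) /\ (\int[P]_w (L u w T)%:E = 1)%E.
Proof.
move=> hu; exact: (doleans_mean T0 fG positive_jumps_stop positive_jumps_gt0 jump_marks_stop hnuZ muZ_points positive_jumps_distinct finZ atomZ hMr (mH hu) (H_bound u) (H_supp u) (L_adapted hu) (L_eq hu) expint).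
Qed.

Let mart_mean u : admissible G T u ->
  P.-integrable setT (fun w => (L u w T * mart u w)%:E) /\ (\int[P]_w (L u w T * mart u w)%:E = 0)%E.
Proof.
move=> hu; exact: (girsanov_mean T0 fG positive_jumps_stop positive_jumps_gt0 jump_marks_stop hnuZ muZ_points positive_jumps_distinct finZ atomZ hMr (mH hu) (H_bound u) (H_supp u) (L_adapted hu) (L_eq hu) expint mTh Th_weighted).
Qed.

Let costE u : admissible G T u -> (cost P T CX X l g (L u) u = \int[P]_w (L u w T * gain u w)%:E)%E.
Proof.
move=> hu; apply: (integral_density_measure (L_mean hu).1 (L_pos hu) _ (mgain hu)); exact: gainE.
Qed.

Let value_integral u y0 : admissible G T u ->
  P.-integrable setT (fun w => (L u w T * (y0 + mart u w))%:E) /\ (\int[P]_w (L u w T * (y0 + mart u w))%:E = y0%:E)%E.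
Proof.
move=> hu; have [i1 e1] := L_mean hu; have [i2 e2] := mart_mean hu; have i3 := integrableZl measurableT y0 i1.
have e w : ((L u w T * (y0 + mart u w))%:E = y0%:E * (L u w T)%:E + (L u w T * mart u w)%:E)%E.
  by rewrite mulrDr EFinD mulrC EFinM.
split; first by rewrite (_ : (fun w => _) = (fun w => y0%:E * (L u w T)%:E + (L u w T * mart u w)%:E)%E); [exact: integrableD|apply/funext].
rewrite (eq_integral (fun w => y0%:E * (L u w T)%:E + (L u w T * mart u w)%:E)%E); last by move=> w _.
apply: (etrans (integralD measurableT i3 i2)); rewrite e2 adde0.
by apply: (etrans (integralZl measurableT i1 y0)); rewrite e1 mule1.
Qed.

(** Integrating the gain against [L^u] gives [Y_0] plus the mean of a nonnegative
    excess, which vanishes for [ustar]. *)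
Lemma optimal_control : {ae P, forall w, (Y w 0)%:E = cost P T CX X l g (L ustar) ustar} /\
  cost P T CX X l g (L ustar) ustar = ereal_inf [set cost P T CX X l g (L u) u | u in admissible G T].
Proof.
have [y0 hy0] := Y0_constant.
have star : cost P T CX X l g (L ustar) ustar = y0%:E.
  rewrite costE// -(value_integral y0 hustar).2; apply: ae_eq_integral_nomeas.
  move: hy0 (gain_decomposition hustar); apply: filterS2 => w -> ->; rewrite subrr addr0.
  by [].
split; first by move: hy0; apply: filterS => w ->.
apply/eqP; rewrite eq_le; apply/andP; split; last by apply: ereal_inf_lbound; exists ustar.
apply: le_ereal_inf_tmp => _ [u hu <-]; rewrite star costE//.
have [i e] := value_integral y0 hu; rewrite -e; apply: integral_mono_integrable => //.
  apply/measurable_EFinP; apply: measurable_funM; last exact: mgain.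
  by apply/measurable_EFinP; exact: (measurable_int P (L_mean hu).1).
move: (L_pos hu); apply: filterS3 (filterI hy0 (gain_decomposition hu)) (hamI_le hu).
move=> w [-> ->] h1 h2 _.
by rewrite lee_fin ler_wpM2l// lerDl subr_ge0.
Qed.

End step_setting.

Unset Implicit Arguments.
Set Printing Implicit Defensive.

Theorem theorem5p16 (R : realType) (d0 : measure_display)
  (Omega : measurableType d0) (P : probability Omega R)
  (T : R) (hT : 0 < T)
  (* the step process X and its filtration F *)
  (d : nat) (X : Omega -> R -> 'rV[R]_d) (F : R -> set_system Omega)
  (hF : F = natural_filtration X)
  (hX : step_process F X)
  (hXqlc : quasi_left_continuous P F X)
  (* the random time tau, its indicator process H, and the filtration G *)
  (tau : Omega -> \bar R) (htau : measurable_fun setT tau)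
  (htau_gt0 : forall w, (0 < tau w)%E)
  (H : Omega -> R -> R) (hH : H = default_process tau)
  (G : R -> set_system Omega) (hG : G = enlarged_filtration F tau)
  (hab : (avoids_stopping_times P F tau /\ martingales_preserved P F G) \/
         (diffuse_law P tau /\
          absolutely_continuous_conditional_laws P F tau))
  (* jump measures of X and Z = (X, H), and G-compensators *)
  (muX : Omega -> {measure set (R * 'rV[R]_d) -> \bar R})
  (hmuX : forall w, muX w = point_measure (jump_times (X w)) (jump (X w)))
  (Z : Omega -> R -> 'rV[R]_d * R) (hZ : Z = fun w t => (X w t, H w t))
  (muZ : Omega -> {measure set (R * ('rV[R]_d * R)) -> \bar R})
  (hmuZ : forall w, muZ w = point_measure (jump_times (Z w)) (jump (Z w)))
  (nuX : Omega -> {measure set (R * 'rV[R]_d) -> \bar R})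
  (hnuX : compensator P G muX nuX)
  (nuZ : Omega -> {measure set (R * ('rV[R]_d * R)) -> \bar R})
  (hnuZ : compensator P G muZ nuZ)
  (Lambda : Omega -> R -> R)
  (hLambda : dual_predictable_projection P G H Lambda)
  (* nuX = phiX dCX, C = CX + Lambda, nuZ = phi dC *)
  (CX : Omega -> R -> R) (hCX : increasing_process P G CX)
  (phiX : Omega -> R -> probability 'rV[R]_d R)
  (hphiX : transition_probability G T phiX)
  (hnuXdis : disintegration P T nuX phiX CX)
  (C : Omega -> R -> R) (hC : C = fun w t => CX w t + Lambda w t)
  (phi : Omega -> R -> probability ('rV[R]_d * R)%type R)
  (hphi : transition_probability G T phi)
  (hnuZdis : disintegration P T nuZ phi C)
  (* coefficients of the control problem *)
  (dU : measure_display) (U : measurableType dU)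
  (r l : Omega -> R -> 'rV[R]_d -> U -> R)
  (hr : predictable_field_on G (@horizon R d0 Omega T)
          (fun w t (z : 'rV[R]_d * U) => r w t z.1 z.2))
  (hl : predictable_field_on G (@horizon R d0 Omega T)
          (fun w t (z : 'rV[R]_d * U) => l w t z.1 z.2))
  (Mr Ml : R) (hMr : 1 < Mr) (hMl : 0 < Ml)
  (hrb : {ae P, forall w, forall t x v, 0 <= t <= T -> 0 <= r w t x v <= Mr})
  (hlb : {ae P, forall w, forall t x v, 0 <= t <= T -> `|l w t x v| <= Ml})
  (hexp : (\int[P]_w (expR ((3 + Mr ^+ 4) * C w T))%:E < +oo)%E)
  (g : Omega -> 'rV[R]_d -> R)
  (hg : measurable_wrt (prod_salgebra (G T) measurable) setT
          (fun p : Omega * 'rV[R]_d => g p.1 p.2))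
  (beta : R)
  (hbeta : (density_deviation P T r * density_deviation P T r < beta%:E)%E)
  (hexpbeta : (\int[P]_w (expR (beta * C w T))%:E < +oo)%E)
  (hgL2 : (\int[P]_w (`|g w (X w T)| ^+ 2 * expR (beta * C w T))%:E < +oo)%E)
  (hmin : forall Theta : Omega -> R -> 'rV[R]_d * R -> R,
     L1_field P G T C phi Theta ->
     exists u : Omega -> R -> U, admissible G T u /\
       minimizing_control P T C phi phiX l r X Theta u)
  (* the Doleans-Dade exponentials L^u *)
  (L : (Omega -> R -> U) -> Omega -> R -> R)
  (hL : forall u : Omega -> R -> U, admissible G T u ->
     doleans_dade P G T muZ nuZ r u (L u))
  (* the solution of the BSDE and the corresponding control *)
  (Y : Omega -> R -> R) (Theta : Omega -> R -> 'rV[R]_d * R -> R)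
  (hY : L2_prog P G T C beta Y)
  (hTheta : L2_field P G T C phi beta Theta)
  (hbsde : bsde P T muZ nuZ CX X g (driver phiX l r) Y Theta)
  (ustar : Omega -> R -> U) (hustar : admissible G T ustar)
  (hstar : minimizing_control P T C phi phiX l r X Theta ustar) :
  {ae P, forall w, (Y w 0)%:E = cost P T CX X l g (L ustar) ustar} /\
  cost P T CX X l g (L ustar) ustar =
    ereal_inf [set cost P T CX X l g (L u) u | u in admissible G T].
Proof.
subst H C Z; case: hX => mX [tau_ [xi [stopF tau_lt tau_inf xiP XE]]].
have T0' : 0 <= T := ltW hT.
have [[fG _] _ _] := step_rcG hF mX htau htau_gt0 hG.
have Gs t : 0 <= t -> sigma_algebra setT (G t) by case: fG => h _ _; exact: h.
case: hLambda => [[aLam pLam] _ _]; case: (hCX) => aCX pCX.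
have aC : adapted G (fun w t => CX w t + Lambda w t).
  move=> t t0; apply/(measurable_wrtT _ (Gs t t0)); apply: measurable_funD.
    by apply/(measurable_wrtT (CX ^~ t) (Gs t t0)); exact: aCX.
  by apply/(measurable_wrtT (Lambda ^~ t) (Gs t t0)); exact: aLam.
have pC : {ae P, forall w, CX w 0 + Lambda w 0 = 0 /\ increasing_path (fun t => CX w t + Lambda w t)}.
  move: pCX pLam; apply: filterS2 => w [c0 [c1 c2]] [l0 [l1 l2]]; rewrite c0 l0 addr0; split => //; split.
    by move=> s t st; apply: lerD; [exact: c1|exact: l1].
  by move=> t; apply: cvgD; [exact: c2|exact: l2].
have CX_le : {ae P, forall w, CX w T <= CX w T + Lambda w T}.
  move: pLam; apply: filterS => w [l0 [l1 _]]; rewrite lerDl -l0.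
  by have := l1 0 T T0'; rewrite /nonneg_time maxxx max_r.
have beta0 : 0 < beta.
  rewrite -lte_fin; apply: le_lt_trans hbeta; case: (density_deviation P T r) => [x| |] //.
  - by rewrite -EFinM lee_fin -expr2 sqr_ge0.
  - by rewrite mulyy leey.
  - by rewrite mulNyNy leey.
exact: (optimal_control hT hF mX hXqlc htau htau_gt0 hG hab stopF tau_lt tau_inf xiP XE
  hmuX hmuZ hnuX hnuZ aC pC pCX CX_le hphiX hphi hnuXdis hnuZdis hMr hexp hr hl hrb hlb beta0 hTheta hg hL hY.1
  hbsde hustar hstar).
Qed.
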